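(* Let $K$ be an algebraically closed field of arbitrary characteristic, let $Z=m_1P_1+\cdots+m_nP_n$ for nonnegative integers $m_i$ and general points $P_i\in\mathbf{P}^2=\mathbf{P}^2_K$, and let $t>\alpha(Z)$. For $s\in\{t-1,t,t+1\}$ let $\gamma_s$ be the product (with multiplicity) of all irreducible factors of the greatest common divisor of $I(Z)_s$ that define plane curves negative for the points $P_1,\ldots,P_n$. Let $\gamma_{t-1}=f_1^{c_1}\cdots f_r^{c_r}$ be the factorization into non-associate irreducible factors, let $d_j=\deg(f_j)$, and write (up to scalar multiples) $\gamma_t=f_1^{c_1'}\cdots f_r^{c_r'}$ and $\gamma_{t+1}=f_1^{c_1''}\cdots f_r^{c_r''}$, where $c_j''\le c_j'\le c_j$ for all $j$. Let $C_j$ be the normalization of the plane curve defined by $f_j$, and let $(a_{C_j},b_{C_j})$ be its splitting type. Let $\mu_t:I(Z)_t\otimes_K R_1\to I(Z)_{t+1}$ be the multiplication map $f\otimes g\mapsto fg$. If the SHGH Conjecture holds, then $$\dim_K \operatorname{cok}\mu_t\ \le\ \sum_j d_j(c_j'-c_j'')-\sum_j\binom{c_j'-c_j''}{2}+\sum_j\left(\binom{c_j-c_j'-a_{C_j}}{2}+\binom{c_j-c_j'-b_{C_j}}{2}\right).$$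
   Context: Notation. $R=K[\mathbf{P}^2]$ is the homogeneous coordinate ring of $\mathbf{P}^2$ (a polynomial ring in three variables with the standard grading). For points $P_i\in\mathbf{P}^2$ and integers $m_i\ge0$, $Z=m_1P_1+\cdots+m_nP_n$ is the fat point subscheme defined by the homogeneous ideal $I(Z)=\bigcap_i I(P_i)^{m_i}\subset R$, where $I(P_i)$ is the ideal generated by all forms vanishing at $P_i$. $I(Z)_t$ is the degree $t$ homogeneous component of $I(Z)$, and $\alpha(Z)$ is the least $t$ with $I(Z)_t\neq0$. The greatest common divisor of $I(Z)_s$ means the gcd of all its elements (defined up to scalar). ''General points'' means that $(P_1,\ldots,P_n)$ lies in a suitable nonempty Zariski open subset of $(\mathbf{P}^2)^n$, where the open condition is allowed to depend on the numerical data ($m_1,\ldots,m_n$ and $t$) under consideration. ''Generic points'' means that $(P_1,\ldots,P_n)$ is generic, i.e., satisfies all such open conditions simultaneously (after extending the ground field if necessary). Negative and contributory curves. A plane curve $C$ defined by an irreducible form of degree $d$ is negative for $P_1,\ldots,P_n$ if $(\operatorname{mult}_{P_1}(C))^2+\cdots+(\operatorname{mult}_{P_n}(C))^2>d^2$. It is contributory for $P_1,\ldots,P_n$ if $C$ is a rational curve, smooth except possibly at the points $P_i$, with $\operatorname{mult}_{P_1}(C)+\cdots+\operatorname{mult}_{P_n}(C)=3d-1$. (Under the SHGH Conjecture the curves defined by the $f_j$ are contributory, hence rational, so their splitting types are defined.) Splitting type. For a rational plane curve $C'\subset\mathbf{P}^2$ with normalization $C\to C'$, let $f:C\to\mathbf{P}^2$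 be the composition of the normalization with the inclusion. Then $C\cong\mathbf{P}^1$ and $f^*(\Omega_{\mathbf{P}^2}(1))\cong\mathcal{O}_C(-a_C)\oplus\mathcal{O}_C(-b_C)$ for unique integers $a_C\le b_C$, where $\Omega_{\mathbf{P}^2}$ is the cotangent bundle; $(a_C,b_C)$ is called the splitting type of $C$. SHGH Conjecture. Let $X$ be a surface obtained by blowing up $n$ generic points of $\mathbf{P}^2$. Then every reduced irreducible curve $C\subset X$ with $C^2<0$ is an exceptional curve (i.e., $C$ is smooth and rational with $C^2=-1$), and for every nef divisor $F$ on $X$ either $h^0(X,\mathcal{O}_X(F))=0$ or $h^1(X,\mathcal{O}_X(F))=0$. (A divisor $F$ is nef if $F\cdot D\ge0$ for every effective divisor $D$.) Convention: $\binom{k}{2}=k(k-1)/2$ for integers $k\ge2$, and $\binom{k}{2}=0$ for all integers $k<2$ (including negative $k$). *)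

(* Defs.v *)
(* MathComp + multinomials.  Forms on P^k are homogeneous elements of         *)
(* {mpoly K[k.+1]}; subspaces and ideals are Prop-valued predicates.          *)
From HB Require Import structures.
From mathcomp Require Import all_boot all_order all_algebra.
From mathcomp Require Import mpoly.

Set Implicit Arguments.
Unset Strict Implicit.
Unset Printing Implicit Defensive.

Import GRing.Theory.
Local Open Scope ring_scope.

Definition divides (R : comNzRingType) (a b : R) : Prop := exists c, b = c * a.

Definition associate (R : comNzRingType) (a b : R) : Prop :=
  divides a b /\ divides b a.

Definition irreducible_elt (R : idomainType) (p : R) : Prop :=
  [/\ p != 0, p \isn't a GRing.unit &
      forall a b, p = a * b -> a \is a GRing.unit \/ b \is a GRing.unit].

Definition is_gcd (R : comNzRingType) (S : R -> Prop) (g : R) : Prop :=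
  (forall f, S f -> divides g f) /\
  (forall h, (forall f, S f -> divides h f) -> divides h g).

Definition ideal_gen (R : comNzRingType) (S : R -> Prop) (f : R) : Prop :=
  exists (k : nat) (a g : 'I_k -> R),
    (forall i, S (g i)) /\ f = \sum_i a i * g i.

Fixpoint ideal_pow (R : comNzRingType) (I : R -> Prop) (m : nat) : R -> Prop :=
  if m is m'.+1 then
    ideal_gen (fun f => exists a b, [/\ I a, ideal_pow I m' b & f = a * b])
  else fun _ => True.

(* N is the dimension of V / W, for subspaces W of V *)
Definition dim_quot (K : fieldType) (E : lmodType K) (V W : E -> Prop)
    (N : nat) : Prop :=
  exists e : 'I_N -> E,
    [/\ forall i, V (e i),
        forall c : 'I_N -> K, W (\sum_i c i *: e i) -> forall i, c i = 0 &
        forall v, V v -> exists c : 'I_N -> K, W (v - \sum_i c i *: e i)].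

(* A point of P^k, through a nonzero vector of homogeneous coordinates; every *)
(* notion below is invariant under rescaling that vector.                     *)
Record proj (k : nat) (K : fieldType) := Proj {
  coords :> 'I_k.+1 -> K;
  coords_neq0 : exists i, coords i != 0 }.

Definition mdegree (n : nat) (K : fieldType) (f : {mpoly K[n]}) : nat :=
  (msize f).-1.

(* f(phi_0, ..., phi_{n-1}) *)
Definition psubst (n k : nat) (K : fieldType) (phi : 'I_n -> {mpoly K[k]})
    (f : {mpoly K[n]}) : {mpoly K[k]} :=
  mmap (@mpolyC k K) phi f.

(* Zariski topology on (P^2)^n: the j-th homogeneous coordinate of the i-th   *)
(* point is the variable of index mxvec_index i j.                            *)

Definition multihomog (n : nat) (K : fieldType) (G : {mpoly K[n * 3]}) : Prop :=
  exists e : 'I_n -> nat, forall u, u \in msupp G ->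
    forall i, (\sum_(j < 3) u (mxvec_index i j))%N = e i.

Definition eval_points (n : nat) (K : fieldType) (G : {mpoly K[n * 3]})
    (P : 'I_n -> proj 2 K) : K :=
  G.@[fun k => mxvec (\matrix_(i < n, j < 3) P i j) 0 k].

Definition zariski_open (n : nat) (K : fieldType)
    (U : ('I_n -> proj 2 K) -> Prop) : Prop :=
  exists S : {mpoly K[n * 3]} -> Prop,
    (forall G, S G -> multihomog G) /\
    (forall P, U P <-> exists2 G, S G & eval_points G P != 0).

(* P, with coordinates in the extension L of K, lies in every nonempty open   *)
(* subset of (P^2)^n defined over K.                                          *)
Definition generic_points (n : nat) (K L : fieldType) (iota : {rmorphism K -> L})
    (P : 'I_n -> proj 2 L) : Prop :=
  forall G : {mpoly K[n * 3]}, multihomog G ->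
    (exists Q : 'I_n -> proj 2 K, eval_points G Q != 0) ->
    eval_points (map_mpoly iota G) P != 0.

Definition point_ideal (K : fieldType) (p : proj 2 K) : {mpoly K[3]} -> Prop :=
  ideal_gen (fun f => (exists d : nat, f \is d.-homog) /\ f.@[p] = 0).

Definition fat_ideal (n : nat) (K : fieldType) (P : 'I_n -> proj 2 K)
    (m : 'I_n -> nat) (f : {mpoly K[3]}) : Prop :=
  forall i, ideal_pow (point_ideal (P i)) (m i) f.

Definition fat_ideal_deg (n : nat) (K : fieldType) (P : 'I_n -> proj 2 K)
    (m : 'I_n -> nat) (t : nat) (f : {mpoly K[3]}) : Prop :=
  fat_ideal P m f /\ f \is t.-homog.

Definition is_alpha (n : nat) (K : fieldType) (P : 'I_n -> proj 2 K)
    (m : 'I_n -> nat) (a : nat) : Prop :=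
  (exists f, fat_ideal_deg P m a f /\ f != 0) /\
  (forall s, (s < a)%N -> forall f, fat_ideal_deg P m s f -> f = 0).

Definition im_mu (n : nat) (K : fieldType) (P : 'I_n -> proj 2 K)
    (m : 'I_n -> nat) (t : nat) (h : {mpoly K[3]}) : Prop :=
  exists (k : nat) (f g : 'I_k -> {mpoly K[3]}),
    [/\ forall i, fat_ideal_deg P m t (f i), forall i, g i \is 1%N.-homog &
        h = \sum_i f i * g i].

Definition dim_cok_mu (n : nat) (K : fieldType) (P : 'I_n -> proj 2 K)
    (m : 'I_n -> nat) (t N : nat) : Prop :=
  dim_quot (fat_ideal_deg P m t.+1) (im_mu P m t) N.

Definition mult_at (K : fieldType) (p : proj 2 K) (f : {mpoly K[3]})
    (k : nat) : Prop :=
  ideal_pow (point_ideal p) k f /\ ~ ideal_pow (point_ideal p) k.+1 f.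

Definition negative (n : nat) (K : fieldType) (P : 'I_n -> proj 2 K)
    (f : {mpoly K[3]}) : Prop :=
  exists2 k : 'I_n -> nat, (forall i, mult_at (P i) f (k i)) &
    (mdegree f ^ 2 < \sum_i k i ^ 2)%N.

(* gamma is the product of the negative irreducible factors, listed in s, of  *)
(* a gcd g of I(Z)_t; both are determined up to nonzero scalars u, v.         *)
Definition is_gamma (n : nat) (K : fieldType) (P : 'I_n -> proj 2 K)
    (m : 'I_n -> nat) (t : nat) (gamma : {mpoly K[3]}) : Prop :=
  exists (g : {mpoly K[3]}) (u v : K) (s s' : seq {mpoly K[3]}),
    [/\ is_gcd (fat_ideal_deg P m t) g,
        u != 0 /\ v != 0,
        g = u *: ((\prod_(p <- s) p) * (\prod_(p <- s') p)),
        (forall p, p \in s -> irreducible_elt p /\ negative P p) /\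
        (forall p, p \in s' -> irreducible_elt p /\ ~ negative P p) &
        gamma = v *: \prod_(p <- s) p].

(* (X_0 : X_1) |-> (phi_0 : phi_1 : phi_2) is a birational morphism from P^1  *)
(* to the curve f = 0, i.e. the normalization of that curve composed with its *)
(* inclusion in P^2; (A0 : A1) is the rational inverse.                       *)
Definition normalization_P1 (K : fieldType) (f : {mpoly K[3]})
    (phi : 'I_3 -> {mpoly K[2]}) : Prop :=
  [/\ exists e : nat, forall j, phi j \is e.-homog,
      forall w : proj 1 K, exists j, (phi j).@[w] != 0,
      psubst phi f = 0 &
      exists (e : nat) (A0 A1 : {mpoly K[3]}),
        [/\ A0 \is e.-homog, A1 \is e.-homog,
            psubst phi A0 != 0 \/ psubst phi A1 != 0 &
            psubst phi A0 * 'X_ord_max = psubst phi A1 * 'X_ord0]].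

Definition rational_curve (K : fieldType) (f : {mpoly K[3]}) : Prop :=
  exists phi, normalization_P1 f phi.

(* The fibre of Omega(1) at the point [v] of P^2 is the space of linear forms *)
(* vanishing at v (Euler sequence), so phi^*Omega(1) is the subbundle of the  *)
(* trivial bundle of rank 3 on P^1 whose fibre at w is the plane              *)
(* {l | \sum_j phi_j(w) l_j = 0}.  A homomorphism O(-a) -> O^3 is a triple q  *)
(* of forms of degree a; thus (q1, q2) is an isomorphism of                   *)
(* O(-a) (+) O(-b) onto phi^*Omega(1) when q1(w), q2(w) is a basis of that    *)
(* plane for all w.  As O(-a) with a < 0 has no nonzero map to O^3, natural   *)
(* numbers a, b suffice.                                                      *)
Definition splitting_type (K : fieldType) (f : {mpoly K[3]}) (a b : nat) : Prop :=
  (a <= b)%N /\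
  exists phi : 'I_3 -> {mpoly K[2]}, normalization_P1 f phi /\
  exists q1 q2 : 'I_3 -> {mpoly K[2]},
    [/\ forall j, q1 j \is (a).-homog, forall j, q2 j \is b.-homog &
        forall w : proj 1 K,
        [/\ \sum_j (phi j).@[w] * (q1 j).@[w] = 0,
            \sum_j (phi j).@[w] * (q2 j).@[w] = 0 &
            row_free (\matrix_(i < 2, j < 3)
              (if i == ord0 then q1 j else q2 j).@[w])]].

(* The blow-up X of P^2 at distinct points P_i.  A blowup_frame is a point of *)
(* X together with local coordinates (s, u) = ('X_0, 'X_1) centred at it.     *)
(* With p, q, r the rows of frame_mx, (s, u) is mapped to                     *)
(*   [p + s q + u r]    at a point [p] outside the P_i (frame_on = None),     *)
(*   [p + s (q + u r)]  at the tangent direction q at P_i, viewed as a point  *)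
(*                      of the exceptional curve E_i (frame_on = Some i);     *)
(*                      there E_i is s = 0.                                   *)
Record blowup_frame (n : nat) (K : fieldType) (P : 'I_n -> proj 2 K) :=
  BlowupFrame {
    frame_mx : 'M[K]_3;
    frame_on : option 'I_n;
    frame_unit : frame_mx \in unitmx;
    frame_base : match frame_on with
      | Some i => forall j, frame_mx ord0 j = P i j
      | None => forall (i : 'I_n) (c : K),
          exists j, frame_mx ord0 j <> c * P i j
      end }.

Definition frame_chart (n : nat) (K : fieldType) (P : 'I_n -> proj 2 K)
    (x : blowup_frame P) (j : 'I_3) : {mpoly K[2]} :=
  let s := 'X_ord0 in let u := 'X_ord_max in
  (frame_mx x ord0 j)%:MP + frame_mx x 1 j *: s
    + frame_mx x ord_max j *: (if frame_on x is Some _ then s * u else u).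

Definition pullback (n : nat) (K : fieldType) (P : 'I_n -> proj 2 K)
    (x : blowup_frame P) (A : {mpoly K[3]}) : {mpoly K[2]} :=
  psubst (frame_chart x) A.

(* (d, m) is the class of d L - m_1 E_1 - ... - m_n E_n in Pic X, the free    *)
(* abelian group on the pullback L of a line and on the E_i.                  *)
Definition divisor (n : nat) : Type := (int * ('I_n -> int))%type.

Definition intersection (n : nat) (F D : divisor n) : int :=
  F.1 * D.1 - \sum_i F.2 i * D.2 i.

Definition order_at (n : nat) (K : fieldType) (P : 'I_n -> proj 2 K)
    (x : blowup_frame P) (F : divisor n) : int :=
  if frame_on x is Some i then F.2 i else 0.

(* Rational sections of O_X(d L - \sum_i m_i E_i) are the quotients g = A / B *)
(* of forms with deg A - deg B = d.  Such a g is represented at x by the      *)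
(* rational function G / H, regular at the origin, when its pullback to the   *)
(* chart of x is s ^ m_i * G / H, with m_i = 0 outside the E_i.               *)
Definition local_rep (n : nat) (K : fieldType) (P : 'I_n -> proj 2 K)
    (F : divisor n) (x : blowup_frame P) (g : {fraction {mpoly K[3]}})
    (G H : {mpoly K[2]}) : Prop :=
  H@_0%MM != 0 /\
  exists (a b : nat) (A B : {mpoly K[3]}),
    [/\ A \is (a).-homog, B \is b.-homog, B != 0, a%:Z - b%:Z = F.1 &
        g = tofrac A / tofrac B /\
        tofrac (pullback x A) / tofrac (pullback x B)
          = tofrac 'X_ord0 ^ order_at x F * (tofrac G / tofrac H)].

(* g belongs to the stalk of O_X(F) at x *)
Definition regular_at (n : nat) (K : fieldType) (P : 'I_n -> proj 2 K)
    (F : divisor n) (x : blowup_frame P) (g : {fraction {mpoly K[3]}}) : Prop :=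
  exists G H, local_rep F x g G H.

Definition generates_at (n : nat) (K : fieldType) (P : 'I_n -> proj 2 K)
    (F : divisor n) (x : blowup_frame P) (g : {fraction {mpoly K[3]}}) : Prop :=
  exists G H, local_rep F x g G H /\ G@_0%MM != 0.

(* X being projective, the nonvanishing loci of global sections of line       *)
(* bundles form a basis of its Zariski topology.                              *)
Definition blowup_open (n : nat) (K : fieldType) (P : 'I_n -> proj 2 K)
    (U : blowup_frame P -> Prop) : Prop :=
  forall x, U x -> exists (D : divisor n) (g : {fraction {mpoly K[3]}}),
    [/\ forall y : blowup_frame P, regular_at D y g,
        generates_at D x g &
        forall y, generates_at D y g -> U y].

Definition h0_vanishes (n : nat) (K : fieldType) (P : 'I_n -> proj 2 K)
    (F : divisor n) : Prop :=
  forall g, (forall x : blowup_frame P, regular_at F x g) -> g = 0.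

(* Every Cech 1-cocycle of O_X(F) on every open cover is a coboundary.  X is  *)
(* irreducible, so restriction maps between nonempty opens are injective and  *)
(* (co)cycle identities may be written between rational sections.             *)
Definition h1_vanishes (n : nat) (K : fieldType) (P : 'I_n -> proj 2 K)
    (F : divisor n) : Prop :=
  forall (J : Type) (U : J -> blowup_frame P -> Prop),
    (forall j, blowup_open (U j)) ->
    (forall j, exists x, U j x) ->
    (forall x, exists j, U j x) ->
  forall g : J -> J -> {fraction {mpoly K[3]}},
    (forall i j x, U i x -> U j x -> regular_at F x (g i j)) ->
    (forall i j k, g i j + g j k = g i k) ->
  exists h : J -> {fraction {mpoly K[3]}},
    (forall j x, U j x -> regular_at F x (h j)) /\
    (forall i j, g i j = h j - h i).

Definition effective (n : nat) (K : fieldType) (P : 'I_n -> proj 2 K)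
    (D : divisor n) : Prop :=
  exists2 g, g != 0 & forall x : blowup_frame P, regular_at D x g.

Definition nef (n : nat) (K : fieldType) (P : 'I_n -> proj 2 K)
    (F : divisor n) : Prop :=
  forall D, effective P D -> 0 <= intersection F D.

Definition proper_transform (n : nat) (K : fieldType) (f : {mpoly K[3]})
    (k : 'I_n -> nat) : divisor n :=
  ((mdegree f)%:Z, fun i => (k i)%:Z).

(* f has multiplicity k_i at P_i.  The local equation G of the proper         *)
(* transform, at each point of X, is not in the square of the maximal ideal.  *)
Definition smooth_transform (n : nat) (K : fieldType) (P : 'I_n -> proj 2 K)
    (f : {mpoly K[3]}) (k : 'I_n -> nat) : Prop :=
  forall (x : blowup_frame P) (G : {mpoly K[2]}),
    pullback x f = 'X_ord0 ^+ (if frame_on x is Some i then k i else 0%N) * G ->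
    G@_0%MM = 0 -> exists v : 'I_2, G@_U_(v)%MM != 0.

(* The reduced irreducible curves on X are the E_i, which are exceptional, and*)
(* the proper transforms of irreducible plane curves.  The generic points     *)
(* have coordinates in an algebraically closed extension L of K.              *)
Definition SHGH (K : closedFieldType) : Prop :=
  forall (L : closedFieldType) (iota : {rmorphism K -> L}) (n : nat)
         (P : 'I_n -> proj 2 L),
    generic_points iota P ->
    (forall (f : {mpoly L[3]}) (k : 'I_n -> nat),
       irreducible_elt f -> f \is (mdegree f).-homog ->
       (forall i, mult_at (P i) f (k i)) ->
       let C := proper_transform f k in
       intersection C C < 0 ->
       [/\ smooth_transform P f k, rational_curve f &
           intersection C C = -1]) /\
    (forall F : divisor n, nef P F -> h0_vanishes P F \/ h1_vanishes P F).

Definition binom2 (k : int) : int :=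
  if k is Posz j then 'C(j, 2)%:Z else 0.

(* Main.v *)
(* Split the forms of degree t - 1 into their negative fixed part, made of the
   curves C_j, and a moving part A. Under SHGH the class A is nef with
   h^0(A) = chi(A); comparing A with A + C_j, A + C_i + C_j and A + C_j + E_i,
   which have no more sections than the original class, gives A . C_j = 0 and
   C_i . C_j = 0, and bounds the multiplicities. The multiplication map of the
   class A + L is surjective. Adding the curves C_j to it one at a time and
   restricting to C_j = P^1, a step raises the dimension of the cokernel by at
   most (a_j - e)^+ + (b_j - e)^+, where e - 1 is the degree of the class on C_j;
   these terms add up to the binomial coefficients. The jump d_j s - binom(s, 2),
   s = c'_j - c''_j, comes from the fixed part of degree t + 1.

   SHGH enters in three ways. Vanishing of H^1 gives interpolation at the fat
   points, through an explicit Cech cocycle. A smooth rational C with C^2 = -1 has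
   K . C = -1: chi bounds K . C from both sides, as sections of multiples of an
   ample class cut out all but few of the forms on C = P^1. Finally, if the bound
   failed on a set of configurations meeting every nonempty open set, this set and
   the open sets would lie in an ultrafilter; the tautological configuration over
   the ultrapower of K is then generic, so that SHGH applies to it, and by Los's
   theorem it violates the bound as well. *)

Require Import Defs.
From HB Require Import structures.
From mathcomp Require Import all_boot all_order all_algebra.
From mathcomp Require Import mpoly ring_quotient generic_quotient.
From mathcomp Require boolp classical_sets filter.
From mathcomp Require Import ring zify.
From Stdlib Require Import Classical ClassicalEpsilon FunctionalExtensionality PropExtensionality.

Set Implicit Arguments.
Unset Strict Implicit.
Unset Printing Implicit Defensive.

Import GRing.Theory.
Local Open Scope ring_scope.

(** * Dimensions of subspaces *)

Section FiniteDimension.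
Variables (K : fieldType) (E : lmodType K).
Implicit Types V W : E -> Prop.

(** No cohomology is developed. Vanishing of H^1 is expressed as [h0 <= chi], where [chi] is a
    number and the opposite inequality always holds by counting conditions; exact sequences become
    rank-nullity for the substitution of a parametrization. Bezout's inequality and the invariants
    of a rational curve also come from comparing dimensions of spaces of forms, in place of a local
    intersection theory. The hypothesis shapes the rest. It gives C^2 = -1 but not K . C: parity and
    the two bounds leave -K . C = 1 or -1, and the second value would make the parametrization
    ramify or identify two points, against smoothness. It concerns generic points, while one open
    set is wanted; this works because only curves and classes of degree at most t occur, so that a
    counterexample has one of finitely many numerical types. The binomials arise from a_j + b_j =
    d_j: the copy number l + 1 of C_j costs (l - a_j)^+ + (l - b_j)^+, and the sum of (l - a)^+ over
    l < x is binom(x - a, 2). *)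

Definition subspace V := V 0 /\ forall (a : K) x y, V x -> V y -> V (a *: x + y).

Definition zero_sub (x : E) : Prop := x = 0.

Definition is_dim V N := dim_quot V zero_sub N.

Definition fin_dim V := exists (N : nat) (e : 'I_N -> E),
  forall v, V v -> exists c : 'I_N -> K, v = \sum_i c i *: e i.

(** A total function, so that dimensions can enter arithmetic; it has its meaning only when [hdimP]
    or [is_dimE] applies. *)
Definition hdim V : nat := epsilon (inhabits 0%N) (is_dim V).

Lemma subspace0 V : subspace V -> V 0. Proof. by case. Qed.

Lemma subspaceZ V a x : subspace V -> V x -> V (a *: x).
Proof. by move=> [V0 VL] Vx; rewrite -[a *: x]addr0; apply: VL. Qed.

Lemma subspaceD V x y : subspace V -> V x -> V y -> V (x + y).
Proof. by move=> [V0 VL] Vx Vy; rewrite -[x]scale1r; apply: VL. Qed.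

Lemma subspaceN V x : subspace V -> V x -> V (- x).
Proof. by move=> sV Vx; rewrite -scaleN1r; apply: subspaceZ. Qed.

Lemma subspaceB V x y : subspace V -> V x -> V y -> V (x - y).
Proof. by move=> sV Vx Vy; apply: subspaceD => //; apply: subspaceN. Qed.

Lemma subspace_sum V (I : finType) (F : I -> E) :
  subspace V -> (forall i, V (F i)) -> V (\sum_i F i).
Proof.
move=> sV VF; elim/big_rec: _ => [|i x _ Vx]; first exact: subspace0.
exact: subspaceD.
Qed.

Lemma subspace_zero : subspace zero_sub.
Proof. by split=> // a x y -> ->; rewrite scaler0 addr0. Qed.

Lemma subspaceI V W : subspace V -> subspace W -> subspace (fun x => V x /\ W x).
Proof.
move=> [V0 VL] [W0 WL]; split=> // a x y [Vx Wx] [Vy Wy]; split; [exact: VL|exact: WL].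
Qed.

(** Expressing each [g i] through the [e j] modulo [W] gives an M by N matrix; for N < M it has a
    nonzero left kernel vector, which is a forbidden relation between the [g i]. *)
Lemma indep_le_span V W N M (e : 'I_N -> E) (g : 'I_M -> E) :
  subspace W ->
  (forall v, V v -> exists c : 'I_N -> K, W (v - \sum_i c i *: e i)) ->
  (forall i, V (g i)) ->
  (forall c : 'I_M -> K, W (\sum_i c i *: g i) -> forall i, c i = 0) ->
  (M <= N)%N.
Proof.
move=> sW span Vg indep.
pose A i := projT1 (constructive_indefinite_description _ (span _ (Vg i))).
have AP i : W (g i - \sum_j A i j *: e j).
  exact: projT2 (constructive_indefinite_description _ (span _ (Vg i))).
pose B := \matrix_(i < M, j < N) A i j.
rewrite leqNgt; apply/negP=> ltNM.
have: kermx B != 0.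
  rewrite kermx_eq0 /row_free; apply/negP=> /eqP rB.
  by have := rank_leq_col B; rewrite rB leqNgt ltNM.
case/rowV0Pn=> u /sub_kermxP uB /eqP; apply; apply/rowP=> i; rewrite mxE.
apply: (indep (u 0)) => {i}.
have ->: \sum_i u 0 i *: g i = \sum_i u 0 i *: (g i - \sum_j A i j *: e j).
  rewrite [RHS](eq_bigr (fun i => u 0 i *: g i - u 0 i *: \sum_j A i j *: e j));
    last by move=> i _; rewrite scalerBr.
  rewrite big_split /= sumrN.
  have -> : \sum_i u 0 i *: (\sum_j A i j *: e j) = \sum_j (u *m B) 0 j *: e j.
    under eq_bigr do rewrite scaler_sumr.
    rewrite exchange_big; apply: eq_bigr => j _; rewrite mxE scaler_suml.
    by apply: eq_bigr => i _; rewrite mxE scalerA.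
  rewrite uB [X in _ - X]big1 ?subr0 // => j _; by rewrite mxE scale0r.
by apply: subspace_sum => // i; apply: subspaceZ.
Qed.

Lemma dim_quot_uniq V W N M : subspace W -> dim_quot V W N -> dim_quot V W M -> N = M.
Proof.
move=> sW [e [Ve ie se]] [g [Vg ig sg]]; apply/eqP; rewrite eqn_leq.
by rewrite (indep_le_span sW sg Ve ie) (indep_le_span sW se Vg ig).
Qed.

(** A family independent modulo [W] is independent in [V], hence of bounded length; one of maximal
    length must span, since any vector outside its span would extend it. *)
Lemma dim_quot_exists V W : subspace V -> subspace W -> fin_dim V ->
  exists N, dim_quot V W N.
Proof.
move=> sV sW [B [b bP]].
pose good M := exists g : 'I_M -> E, (forall i, V (g i)) /\
  forall c : 'I_M -> K, W (\sum_i c i *: g i) -> forall i, c i = 0.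
have bnd M : good M -> (M <= B)%N.
  move=> [g [Vg ig]]; apply: (indep_le_span (W := zero_sub) (V := V) (e := b) (g := g)) => //.
  - exact: subspace_zero.
  - by move=> v /bP[c ->]; exists c; rewrite /zero_sub subrr.
  - by move=> c c0; apply: ig; rewrite c0; apply: subspace0.
pose good' M := if excluded_middle_informative (good M) then true else false.
have goodP M : reflect (good M) (good' M).
  by rewrite /good'; case: excluded_middle_informative => h; constructor.
have ex : exists M, good' M.
  exists 0%N; apply/goodP; exists (fun=> 0); split=> [[]//|c _ []//].
have ub M : good' M -> (M <= B)%N by move/goodP/bnd.
case: (ex_maxnP ex ub) => N /goodP[g [Vg ig]] maxN; exists N, g; split=> // v Vv.
apply: NNPP => nv.
suff /goodP/maxN : good N.+1 by rewrite ltnn.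
exists (fun i => if unlift ord0 i is Some j then g j else v); split.
  by move=> i; case: unliftP => [j _|_].
move=> c; rewrite big_ord_recl unlift_none.
under eq_bigr do rewrite liftK.
move=> cW; have c0 : c ord0 = 0.
  apply/eqP/negPn/negP=> cn0; apply: nv.
  exists (fun i => - (c ord0)^-1 * c (lift ord0 i)).
  have := subspaceZ (c ord0)^-1 sW cW; congr W.
  rewrite scalerDr scalerA mulVf // scale1r; congr (_ + _).
  rewrite scaler_sumr -sumrN; apply: eq_bigr => i _.
  by rewrite scalerA mulNr scaleNr opprK.
move: cW; rewrite c0 scale0r add0r => cW i.
by case: (unliftP ord0 i) => [j ->|->//]; apply: (ig (fun j => c (lift ord0 j))).
Qed.

Lemma hdimP V : subspace V -> fin_dim V -> is_dim V (hdim V).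
Proof.
move=> sV fV; apply: (epsilon_spec (inhabits 0%N) (is_dim V)).
exact: dim_quot_exists subspace_zero fV.
Qed.

Lemma is_dimE V N : is_dim V N -> hdim V = N.
Proof.
move=> dV; apply: (dim_quot_uniq subspace_zero _ dV).
by apply: (epsilon_spec (inhabits 0%N) (is_dim V)); exists N.
Qed.

Lemma is_dim_fin V N : is_dim V N -> fin_dim V.
Proof.
move=> [e [_ _ se]]; exists N, e => v /se[c]; rewrite /zero_sub => /subr0_eq ->.
by exists c.
Qed.

Lemma fin_dimS V W : (forall x, V x -> W x) -> fin_dim W -> fin_dim V.
Proof. by move=> sub [N [e h]]; exists N, e => v /sub/h. Qed.

Lemma hdim_ge V M (g : 'I_M -> E) : subspace V -> fin_dim V ->
  (forall i, V (g i)) ->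
  (forall c : 'I_M -> K, \sum_i c i *: g i = 0 -> forall i, c i = 0) ->
  (M <= hdim V)%N.
Proof.
move=> sV fV Vg ig; have [e [Ve ie se]] := hdimP sV fV.
exact: (indep_le_span subspace_zero se Vg ig).
Qed.

Lemma hdim_le V M (g : 'I_M -> E) : subspace V ->
  (forall v, V v -> exists c : 'I_M -> K, v = \sum_i c i *: g i) ->
  (hdim V <= M)%N.
Proof.
move=> sV sg; have fV : fin_dim V by exists M, g.
have [e [Ve ie se]] := hdimP sV fV.
apply: (indep_le_span (W := zero_sub) (V := V) (e := g) _ _ Ve ie); first exact: subspace_zero.
by move=> v /sg[c ->]; exists c; rewrite /zero_sub subrr.
Qed.

Lemma eq_hdim V W : (forall x, V x <-> W x) -> hdim V = hdim W.
Proof.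
move=> VW; suff -> : V = W by [].
by apply: functional_extensionality => x; apply: propositional_extensionality.
Qed.

Lemma dim_quot_hdim V W N : subspace V -> subspace W -> (forall x, W x -> V x) ->
  fin_dim V -> dim_quot V W N -> hdim V = (N + hdim W)%N.
Proof.
move=> sV sW WV fV [e [Ve ie se]].
have [b [Wb ib sb]] := hdimP sW (fin_dimS WV fV).
apply: is_dimE; exists (fun i => match split i with inl j => e j | inr k => b k end).
have sumE (c : 'I_(N + hdim W) -> K) :
    \sum_i c i *: (match split i with inl j => e j | inr k => b k end)
    = \sum_j c (lshift _ j) *: e j + \sum_k c (rshift _ k) *: b k.
  rewrite big_split_ord; congr (_ + _); apply: eq_bigr => i _.
    by rewrite (unsplitK (inl i)).
  by rewrite (unsplitK (inr i)).
split.
- by move=> i; case: splitP => j _ //; apply: WV.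
- move=> c; rewrite sumE => c0.
  have c1 : forall j, c (lshift _ j) = 0.
    apply: (ie (fun j => c (lshift _ j))).
    rewrite -[\sum_i _](addrK (\sum_k c (rshift N k) *: b k)) c0 sub0r.
    by apply: subspaceN => //; apply: subspace_sum => // i; apply: subspaceZ.
  move: c0; rewrite big1 ?add0r => [c2 i|j _]; last by rewrite c1 scale0r.
  by rewrite -(splitK i); case: split => j /=; [exact: c1|exact: (ib (fun k => c (rshift N k)))].
- move=> v /se[c1 /sb[c2]]; rewrite /zero_sub => /subr0_eq c2E.
  exists (fun i => match split i with inl j => c1 j | inr k => c2 k end).
  rewrite sumE; apply/eqP; rewrite subr_eq0; apply/eqP.
  under eq_bigr do rewrite (unsplitK (inl _)).
  under [X in _ + X]eq_bigr do rewrite (unsplitK (inr _)).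
  by rewrite -c2E addrC subrK.
Qed.

Lemma hdim_quot V W : subspace V -> subspace W -> (forall x, W x -> V x) ->
  fin_dim V -> dim_quot V W (hdim V - hdim W).
Proof.
move=> sV sW WV fV; have [N dN] := dim_quot_exists sV sW fV.
by rewrite (dim_quot_hdim sV sW WV fV dN) addnK.
Qed.

Lemma hdimS V W : subspace V -> subspace W -> (forall x, W x -> V x) ->
  fin_dim V -> (hdim W <= hdim V)%N.
Proof.
move=> sV sW WV fV; have [N dN] := dim_quot_exists sV sW fV.
by rewrite (dim_quot_hdim sV sW WV fV dN) leq_addl.
Qed.

Lemma hdim_eq V W : subspace V -> subspace W -> (forall x, W x -> V x) ->
  fin_dim V -> (hdim V <= hdim W)%N -> forall x, V x -> W x.
Proof.
move=> sV sW WV fV le x Vx; have [e [Ve ie se]] := hdim_quot sV sW WV fV.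
have [c] := se _ Vx; rewrite big1 ?subr0 // => i _.
by case: i => i lti; exfalso; move: lti le; rewrite -subn_eq0 => lti /eqP le; rewrite le in lti.
Qed.

Lemma hdim0 V : (forall x, V x -> x = 0) -> hdim V = 0%N.
Proof.
move=> V0; apply: is_dimE; exists (fun=> 0); split=> [[]//|c _ []//|v /V0 ->].
by exists (fun=> 0); rewrite /zero_sub big_ord0 subrr.
Qed.

End FiniteDimension.

Arguments zero_sub {K E}.

Section LinearImage.
Variables (K : fieldType) (E E' : lmodType K).

Definition lin (phi : E -> E') := forall (a : K) x y, phi (a *: x + y) = a *: phi x + phi y.

Definition image (phi : E -> E') (V : E -> Prop) (y : E') := exists2 x, V x & y = phi x.

Variable phi : E -> E'.
Hypothesis lphi : lin phi.

Lemma lin0 : phi 0 = 0.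
Proof.
by have := lphi 1 0 0; rewrite !scale1r addr0 => /eqP; rewrite -subr_eq0 opprD addrA subrr sub0r oppr_eq0 => /eqP.
Qed.

Lemma linZ a x : phi (a *: x) = a *: phi x.
Proof. by have := lphi a x 0; rewrite lin0 !addr0. Qed.

Lemma linD x y : phi (x + y) = phi x + phi y.
Proof. by have := lphi 1 x y; rewrite !scale1r. Qed.

Lemma linB x y : phi (x - y) = phi x - phi y.
Proof. by rewrite linD -scaleN1r linZ scaleN1r. Qed.

Lemma lin_sum (I : Type) (r : seq I) (F : I -> E) :
  phi (\sum_(i <- r) F i) = \sum_(i <- r) phi (F i).
Proof.
elim: r => [|i r IH]; first by rewrite !big_nil lin0.
by rewrite !big_cons linD IH.
Qed.

Lemma subspace_image V : subspace V -> subspace (image phi V).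
Proof.
move=> sV; split; first by exists 0; rewrite ?lin0 //; apply: subspace0.
move=> a _ _ [x Vx ->] [y Vy ->]; exists (a *: x + y); last by rewrite lphi.
by case: sV => _; apply.
Qed.

Lemma subspace_preim W : subspace W -> subspace (fun x => W (phi x)).
Proof.
move=> sW; split=> [|a x y Wx Wy]; first by rewrite lin0; apply: subspace0.
by rewrite lphi; case: sW => _; apply.
Qed.

Lemma fin_dim_image V : fin_dim V -> fin_dim (image phi V).
Proof.
move=> [N [e se]]; exists N, (fun i => phi (e i)) => _ [x /se[c ->] ->].
by exists c; rewrite lin_sum; apply: eq_bigr => i _; rewrite linZ.
Qed.

(** A basis of [V] modulo the kernel maps to a basis of the image. *)
Lemma hdim_image V : subspace V -> fin_dim V ->
  hdim V = (hdim (image phi V) + hdim (fun x => V x /\ phi x = 0%R))%N.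
Proof.
move=> sV fV; set W := (fun x => _ /\ _).
have sW : subspace W.
  by apply: (subspaceI sV); apply: (subspace_preim (W := zero_sub)); apply: subspace_zero.
have [N dN] := dim_quot_exists sV sW fV.
rewrite (dim_quot_hdim sV sW _ fV dN) => [|x []//]; congr (_ + _)%N.
case: dN => e [Ve ie se]; apply/esym/is_dimE; exists (fun i => phi (e i)).
have sumE (c : 'I_N -> K) : \sum_i c i *: phi (e i) = phi (\sum_i c i *: e i).
  by rewrite lin_sum; apply: eq_bigr => i _; rewrite linZ.
split=> [i|c|_ [x Vx ->]]; first by exists (e i).
  rewrite sumE => c0; apply: ie; split=> //.
  by apply: subspace_sum => // i; apply: subspaceZ.
by have [c [_ c0]] := se _ Vx; exists c; rewrite sumE /zero_sub -linB.
Qed.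

Lemma hdim_image_inj V : subspace V -> fin_dim V -> (forall x, V x -> phi x = 0 -> x = 0) ->
  hdim (image phi V) = hdim V.
Proof.
move=> sV fV inj; rewrite (hdim_image sV fV) (hdim0 (V := fun x => _ /\ _)) ?addn0 //.
by move=> x [/inj].
Qed.

Lemma hdim_image_le V : subspace V -> fin_dim V -> (hdim (image phi V) <= hdim V)%N.
Proof. by move=> sV fV; rewrite (hdim_image sV fV) leq_addr. Qed.

End LinearImage.

Section Sum.
Variables (K : fieldType) (E : lmodType K).
Implicit Types V W : E -> Prop.

Definition sum_sub V W (x : E) := exists y z, [/\ V y, W z & x = y + z].

Lemma subspace_sum_sub V W : subspace V -> subspace W -> subspace (sum_sub V W).
Proof.
move=> sV sW; split; first by exists 0, 0; split; rewrite ?addr0 //; apply: subspace0.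
move=> a _ _ [x [y [Vx Wy ->]]] [x' [y' [Vx' Wy' ->]]].
exists (a *: x + x'), (a *: y + y'); split; first by case: sV => _; apply.
  by case: sW => _; apply.
by rewrite scalerDr addrACA.
Qed.

Lemma fin_dim_sum_sub V W : fin_dim V -> fin_dim W -> fin_dim (sum_sub V W).
Proof.
move=> [N [e se]] [M [f sf]].
exists (N + M)%N, (fun i => match split i with inl j => e j | inr k => f k end).
move=> _ [y [z [/se[c ->] /sf[d ->] ->]]].
exists (fun i => match split i with inl j => c j | inr k => d k end).
rewrite big_split_ord; congr (_ + _); apply: eq_bigr => i _.
  by rewrite (unsplitK (inl i)).
by rewrite (unsplitK (inr i)).
Qed.

(** One and the same family is a basis of [V] modulo the intersection and of the sum modulo [W]. *)
Lemma hdim_sum_sub V W : subspace V -> subspace W -> fin_dim V -> fin_dim W ->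
  (hdim (sum_sub V W) + hdim (fun x => V x /\ W x))%N = (hdim V + hdim W)%N.
Proof.
move=> sV sW fV fW; set S := sum_sub V W; set I := fun x => _ /\ _.
have sS : subspace S by apply: subspace_sum_sub.
have fS : fin_dim S by apply: fin_dim_sum_sub.
have sI : subspace I by apply: subspaceI.
have WS x : W x -> S x by move=> Wx; exists 0, x; split; rewrite ?add0r //; apply: subspace0.
have [N dN] := dim_quot_exists sV sI fV.
have VE := dim_quot_hdim sV sI (fun x => @proj1 _ _) fV dN.
have dS : dim_quot S W N.
  case: dN => e [Ve ie se]; exists e; split.
  - by move=> i; exists (e i), 0; split; rewrite ?addr0 //; apply: subspace0.
  - move=> c Wc; apply: ie; split=> //.
    by apply: subspace_sum => // i; apply: subspaceZ.
  - move=> _ [y [z [/se[c [_ cW]] Wz ->]]]; exists c.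
    by rewrite addrAC; apply: subspaceD.
by rewrite VE (dim_quot_hdim sS sW WS fS dS); lia.
Qed.

End Sum.

(** * Unique factorization *)

Section Divisibility.
Variable R : idomainType.
Implicit Types a b c p q : R.

Definition prime_elt p :=
  forall a b, divides p (a * b) -> divides p a \/ divides p b.

Definition has_factorizations (A : idomainType) := forall x : A, x != 0 ->
  exists (u : A) (s : seq A), [/\ u \is a GRing.unit,
    forall q : A, q \in s -> irreducible_elt q & x = u * \prod_(q <- s) q].

Lemma divides_refl a : divides a a.
Proof. by exists 1; rewrite mul1r. Qed.

Lemma divides_trans b a c : divides a b -> divides b c -> divides a c.
Proof. by move=> [x ->] [y ->]; exists (y * x); rewrite mulrA. Qed.

Lemma divides_mulr a b c : divides a b -> divides a (b * c).
Proof. by move=> [x ->]; exists (x * c); rewrite mulrAC. Qed.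

Lemma divides_mull a b c : divides a b -> divides a (c * b).
Proof. by rewrite mulrC; apply: divides_mulr. Qed.

Lemma dividesD a b c : divides a b -> divides a c -> divides a (b + c).
Proof. by move=> [x ->] [y ->]; exists (x + y); rewrite mulrDl. Qed.

Lemma dividesB a b c : divides a b -> divides a c -> divides a (b - c).
Proof. by move=> [x ->] [y ->]; exists (x - y); rewrite mulrBl. Qed.

Lemma divides0 a : divides a 0.
Proof. by exists 0; rewrite mul0r. Qed.

Lemma divides_subM a x x' y y' :
  divides a (x - x') -> divides a (y - y') -> divides a (x * y - x' * y').
Proof.
move=> hx hy; have -> : x * y - x' * y' = x * (y - y') + (x - x') * y' by ring.
by apply: dividesD; [apply: divides_mull|apply: divides_mulr].
Qed.

Lemma divides_subX a x x' k : divides a (x - x') -> divides a (x ^+ k - x' ^+ k).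
Proof.
move=> h; elim: k => [|k IH]; first by rewrite subrr; apply: divides0.
by rewrite !exprS; apply: divides_subM.
Qed.

Lemma divides_unitr a b u : u \is a GRing.unit -> divides a (u * b) -> divides a b.
Proof. by move=> uu [x h]; exists (u^-1 * x); rewrite -mulrA -h mulKr. Qed.

Lemma divides_unitl a u : u \is a GRing.unit -> divides u a.
Proof. by move=> uu; exists (a * u^-1); rewrite divrK. Qed.

Lemma divides_mul2l c a b : c != 0 -> divides (c * a) (c * b) <-> divides a b.
Proof.
move=> c0; split=> [[x h]|[x ->]]; last by exists x; rewrite mulrCA.
by exists x; apply: (mulfI c0); rewrite h mulrCA.
Qed.

End Divisibility.

(** * Gauss's lemma: irreducible polynomials over a factorial domain are prime *)

Section Gauss.
Variable R : idomainType.
Implicit Types (f g h : {poly R}) (c p : R).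

Lemma divides_polyC p f : divides p%:P f <-> forall i, divides p f`_i.
Proof.
split=> [[q ->] i|h]; first by exists q`_i; rewrite coefMC.
pose q i := projT1 (constructive_indefinite_description _ (h i)).
have qP i : f`_i = q i * p.
  exact: projT2 (constructive_indefinite_description _ (h i)).
exists (\poly_(i < size f) q i); apply/polyP=> i; rewrite coefMC coef_poly.
by case: ltnP => hi; [exact: qP | rewrite mul0r nth_default].
Qed.

(** The induction peels off constant terms. As p divides ab, it divides one of them, say a; then it
    divides f X (g X + b), the factor X can be cancelled, and the pair f, g X + b is smaller. *)
Lemma Gauss_lemma p : prime_elt p -> prime_elt p%:P.
Proof.
move=> pp f g; elim: {f g}_.+1 {-2}f {-2}g (ltnSn (size f + size g)) => // n IH f g.
elim/poly_ind: f => [|f a _]; first by left; apply: divides0.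
elim/poly_ind: g => [|g b _]; first by right; apply: divides0.
rewrite ltnS => szn /divides_polyC pfg.
(* Removing the constant term lowers the size only if h is nonzero; non-divisibility of some
   coefficient by p guarantees this. *)
have szX (h : {poly R}) c : divides p c -> (exists i, ~ divides p h`_i) ->
    (size h < size (h * 'X + c%:P)%R)%N.
  move=> _ [i hi]; rewrite size_MXaddC; case: eqP => [h0|//].
  by case: hi; rewrite h0 coef0; apply: divides0.
have divX (h : {poly R}) c : divides p c -> divides p%:P h -> divides p%:P (h * 'X + c%:P).
  move=> [x ->] [y ->]; apply: dividesD; first by exists (y * 'X); rewrite mulrAC.
  by exists x%:P; rewrite polyCM.
have XK (h : {poly R}) : divides p%:P (h * 'X) -> divides p%:P h.
  by move/divides_polyC => hX; apply/divides_polyC => i; have := hX i.+1; rewrite coefMX.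
have /pp pab : divides p (a * b).
  by have := pfg 0; rewrite coef0M !coefD !coefMX !coefC /= !add0r.
move: pfg => /divides_polyC pfg; case: pab => [pa|pb].
- case: (classic (divides p%:P f)) => [pf|npf]; first by left; apply: divX.
  have ex : exists i, ~ divides p f`_i.
    by apply: not_all_ex_not => h; apply: npf; apply/divides_polyC.
  have : divides p%:P (f * (g * 'X + b%:P)).
    apply: XK; rewrite mulrAC.
    have -> : f * 'X * (g * 'X + b%:P) = (f * 'X + a%:P) * (g * 'X + b%:P)
        - (g * 'X + b%:P) * a%:P by ring.
    apply: dividesB => //; apply: divides_mull; case: pa => x ->.
    by exists x%:P; rewrite polyCM.
  case/IH => [|//|]; last by right.
  by apply: leq_trans szn; rewrite ltn_add2r szX.
- case: (classic (divides p%:P g)) => [pg|npg]; first by right; apply: divX.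
  have ex : exists i, ~ divides p g`_i.
    by apply: not_all_ex_not => h; apply: npg; apply/divides_polyC.
  have : divides p%:P ((f * 'X + a%:P) * g).
    apply: XK; rewrite -mulrA.
    have -> : (f * 'X + a%:P) * (g * 'X) = (f * 'X + a%:P) * (g * 'X + b%:P)
        - (f * 'X + a%:P) * b%:P by ring.
    apply: dividesB => //; apply: divides_mull; case: pb => x ->.
    by exists x%:P; rewrite polyCM.
  case/IH => [|| //]; last by left.
  by apply: leq_trans szn; rewrite ltn_add2l szX.
Qed.

Hypothesis Rfact : has_factorizations R.
Hypothesis Rprime : forall p : R, irreducible_elt p -> prime_elt p.

(** Clears denominators: by Gauss's lemma each prime factor of c divides g or h, and is taken out of
    that factor. *)
Lemma cancel_const c f g h : c != 0 -> c%:P * f = g * h ->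
  exists g' h' c1 c2, [/\ f = g' * h', g = c1%:P * g' & h = c2%:P * h'].
Proof.
move=> c0; have [u [s [uu sP ->]]] := Rfact c0.
elim: s f g h sP => [|p s IH] f g h sP.
  rewrite big_nil mulr1 => E; exists (u^-1%:P * g), h, u, 1; split.
  - by rewrite -mulrA -E mulrA -polyCM mulVr // mul1r.
  - by rewrite mulrA -polyCM divrr // mul1r.
  - by rewrite mul1r.
have pi : irreducible_elt p by apply: sP; rewrite mem_head.
have p0 : p%:P != 0 by case: pi => pn0 _ _; rewrite polyC_eq0.
have sP' q : q \in s -> irreducible_elt q by move=> qs; apply: sP; rewrite inE qs orbT.
rewrite big_cons mulrCA polyCM -mulrA => E.
have /(Gauss_lemma (Rprime pi)) : divides p%:P (g * h) by exists ((u * \prod_(j <- s) j)%:P * f); rewrite -E mulrC.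
case=> [[g1 gE]|[h1 hE]].
  have /(IH _ _ _ sP')[g' [h' [c1 [c2 [-> g1E ->]]]]] : (u * \prod_(j <- s) j)%:P * f = g1 * h.
    by apply: (mulfI p0); rewrite E gE; ring.
  exists g', h', (c1 * p), c2; split=> //; rewrite gE g1E polyCM; ring.
have /(IH _ _ _ sP')[g' [h' [c1 [c2 [-> -> h1E]]]]] : (u * \prod_(j <- s) j)%:P * f = g * h1.
  by apply: (mulfI p0); rewrite E hE; ring.
exists g', h', c1, (c2 * p); split=> //; rewrite hE h1E polyCM; ring.
Qed.

(** For nonconstant f, take the gcd h of f and g over the fraction field. After clearing
    denominators f = w' h', so one of the two is a unit. If w' is, f divides a constant multiple of
    g, hence g itself, as constant factors of f are units. If h' is, then h is constant, and a
    Bezout relation times b shows that f divides b. *)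
Lemma poly_irreducible_prime f : irreducible_elt f -> prime_elt f.
Proof.
move=> [f0 fu fi] g b.
have unitC (c : R) : c%:P \is a GRing.unit = (c \is a GRing.unit).
  by rewrite poly_unitE size_polyC coefC /=; have [->|] := eqVneq c 0; rewrite ?unitr0.
have [sz1|sz1] := eqVneq (size f) 1.
  have /size_poly1P[c c0 fE] : size f == 1 by rewrite sz1.
  rewrite fE; apply: Gauss_lemma; apply: Rprime; split=> //.
    by rewrite -unitC -fE.
  by move=> x y cE; rewrite -!unitC; apply: fi; rewrite fE cE polyCM.
have fconst (x : {poly R}) c : f = c%:P * x -> c \is a GRing.unit.
  move=> E; case: (fi _ _ E) => [|ux]; first by rewrite unitC.
  case/eqP: sz1; rewrite E mul_polyC size_scale.
    by move: ux; rewrite poly_unitE => /andP[/eqP].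
  by apply/negP=> /eqP c0; move: f0; rewrite E c0 mul0r eqxx.
have fcancel (x y : {poly R}) c : c != 0 -> c%:P * x = y * f -> divides f x.
  move=> c0 /(cancel_const c0)[y' [f' [c1 [c2 [-> _ E]]]]].
  have uc := fconst _ _ E; exists (y' * c2^-1%:P).
  by rewrite E -mulrA [c2^-1%:P * _]mulrA -polyCM mulVr // mul1r.
set h := gcdp f g.
have h0 : h != 0 by rewrite gcdp_eq0 (negPf f0).
have /Pdiv.Idomain.dvdpP[[c w] /= c0 cE] : h %| f by apply: dvdp_gcdl.
have /Pdiv.Idomain.dvdpP[[d v] /= d0 dE] : h %| g by apply: dvdp_gcdr.
move: cE dE; rewrite -!mul_polyC => cE dE.
have [w' [h' [c1 [c2 [fE wE hE]]]]] := cancel_const c0 cE.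
case: (fi _ _ fE) => [uw|uh] [y gb].
- left; apply: (fcancel _ (v * c2%:P * w'^-1)); first exact: d0.
  by rewrite dE hE fE -!mulrA mulKr.
- right; have [[u1 u2] /= /eqpP[[e1 e2] /= /andP[e10 e20] eE]] := Bezoutp f g.
  have [r r0 hr] : exists2 r, r != 0 & h = r%:P.
    move: uh; rewrite poly_unitE => /andP[/size_poly1P[r r0 rE] _].
    exists (c2 * r); last by rewrite hE rE polyCM.
    by apply: contraNneq h0; rewrite hE rE -polyCM => ->.
  apply: (fcancel _ (e1%:P * (u1 * b + u2 * y)) (e2 * r)); first by rewrite mulf_neq0.
  rewrite polyCM -hr mul_polyC -/h -eE -mul_polyC.
  have -> : e1%:P * (u1 * f + u2 * g) * b = e1%:P * (u1 * f * b + u2 * (g * b)) by ring.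
  by rewrite gb; ring.
Qed.

End Gauss.

Section MpolyRmorph.
Variables (n : nat) (R : comNzRingType) (S : comNzRingType).

Lemma mpoly_rmorph_ext (F G : {rmorphism {mpoly R[n]} -> S}) :
  (forall c, F c%:MP = G c%:MP) -> (forall i, F 'X_i = G 'X_i) -> F =1 G.
Proof.
move=> hC hX p; rewrite (mpolyE p) !rmorph_sum; apply: eq_bigr => m _.
rewrite -mul_mpolyC !rmorphM hC; congr (_ * _).
rewrite mpolyXE_id !rmorph_prod; apply: eq_bigr => i _.
by rewrite !rmorphXn hX.
Qed.

End MpolyRmorph.

(** * Unique factorization in several variables *)

Section MpolyFactor.
Variable K : fieldType.

Lemma mpoly_unitE n (p : {mpoly K[n]}) : (p \is a GRing.unit) = (msize p == 1%N).
Proof.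
apply/idP/idP => [/andP[/eqP pE]|].
  by rewrite pE msizeC mcoeffC eqxx mulr1 unitfE => ->.
move=> /eqP s1; have pE : p = (p@_0%MM)%:MP by apply: msize1_polyC; rewrite s1.
have [p0|p0] := eqVneq p 0; first by rewrite p0 msize0 in s1.
by apply/andP; rewrite {1}pE eqxx unitfE; split=> //; apply: contraNneq p0 => c0; rewrite pE c0.
Qed.

Lemma mpoly_factorizations n : has_factorizations {mpoly K[n]}.
Proof.
move=> x; elim: {x}_.+1 {-2}x (ltnSn (msize x)) => // k IH x szx x0.
have [ux|ux] := boolP (x \is a GRing.unit).
  by exists x, [::]; split=> //; rewrite big_nil mulr1.
case: (classic (irreducible_elt x)) => [xi|nxi].
  exists 1, [:: x]; split; first exact: unitr1.
    by move=> p; rewrite inE => /eqP ->.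
  by rewrite big_seq1 mul1r.
have [a [b [xE ua ub]]] : exists a b, [/\ x = a * b, a \isn't a GRing.unit & b \isn't a GRing.unit].
  apply: NNPP => no; apply: nxi; split=> // a b xE.
  apply: NNPP => /not_or_and[/negP na /negP nb]; apply: no.
  by exists a, b.
move: (x0); rewrite xE mulf_eq0 negb_or => /andP[a0 b0].
have := szx; rewrite xE msizeM // => szab.
have := ua; have := ub; rewrite !mpoly_unitE => ub1 ua1.
have := a0; have := b0; rewrite -!msize_poly_eq0 => sb0 sa0.
have [lta ltb] : (msize a < k)%N /\ (msize b < k)%N.
  move: szab ub1 ua1 sb0 sa0; rewrite -!/(msize _).
  by move: (msize a) (msize b) => i j; lia.
have [u [s [uu sP ->]]] := IH a lta a0.
have [v [r [uv rP ->]]] := IH b ltb b0.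
exists (u * v), (s ++ r); split; first by rewrite unitrM uu.
  by move=> p; rewrite mem_cat => /orP[/sP|/rP].
by rewrite big_cat /=; ring.
Qed.

(** The inverse of [muni]: it identifies polynomials in the last variable over {mpoly K[n]} with
    {mpoly K[n.+1]}, so that Gauss's lemma can be iterated over the number of variables. *)
Definition mmerge n (q : {poly {mpoly K[n]}}) : {mpoly K[n.+1]} :=
  (map_poly (@mwiden n K) q).['X_ord_max].

Fact mmerge_is_additive n : additive (@mmerge n).
Proof. by move=> p q; rewrite /mmerge rmorphB hornerD hornerN. Qed.

HB.instance Definition _ n := GRing.isAdditive.Build _ _ (@mmerge n) (@mmerge_is_additive n).

Fact mmerge_is_multiplicative n : multiplicative (@mmerge n).
Proof. by split=> [p q|]; rewrite /mmerge ?rmorphM ?hornerM // rmorph1 hornerC. Qed.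

HB.instance Definition _ n := GRing.isMultiplicative.Build _ _ (@mmerge n) (@mmerge_is_multiplicative n).

Lemma muniXmax n : muni ('X_ord_max : {mpoly K[n.+1]}) = 'X.
Proof.
rewrite muniE msuppX big_seq1 mcoeffX eqxx scale1r mnm1E eqxx expr1.
rewrite (_ : [multinom _ | _ < n] = 0%MM) ?mpolyX0 ?scale1r //.
apply/mnmP=> i; rewrite mnmE mnm1E mnm0E; case: eqP => // /(congr1 val) /=.
by have := ltn_ord i; lia.
Qed.

Lemma muniXwiden n (i : 'I_n) : muni ('X_(widen_ord (leqnSn n) i) : {mpoly K[n.+1]}) = ('X_i)%:P.
Proof.
rewrite muniE msuppX big_seq1 mcoeffX eqxx scale1r mnm1E.
have -> : (widen_ord (leqnSn n) i == ord_max) = false.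
  by apply/eqP => /(congr1 val) /=; have := ltn_ord i; lia.
rewrite expr0 alg_polyC; congr (_%:P); congr 'X_[_].
by apply/mnmP=> j; rewrite mnmE !mnm1E; congr nat_of_bool; apply/eqP/eqP => [/(congr1 val)|->//] /= /val_inj.
Qed.

Lemma mwidenXU n (i : 'I_n) : mwiden ('X_i : {mpoly K[n]}) = 'X_(widen_ord (leqnSn n) i).
Proof. by rewrite mwidenX mnmwiden1. Qed.

Lemma muniK n : cancel (@muni n K) (@mmerge n).
Proof.
move=> p; apply: (@mpoly_rmorph_ext _ _ _ (@mmerge n \o @muni n K) idfun) => [c|i] /=.
  by rewrite muniC /mmerge map_polyC /= hornerC mwidenC.
have [[j ->]|->] : (exists j, i = widen_ord (leqnSn n) j) \/ i = ord_max.
- case: (ltnP i n) => hi; [left; exists (Ordinal hi)|right]; apply: val_inj => //=.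
  by have := ltn_ord i; lia.
- by rewrite muniXwiden /mmerge map_polyC /= hornerC mwidenXU.
- by rewrite muniXmax /mmerge map_polyX hornerX.
Qed.

Lemma mmergeK n : cancel (@mmerge n) (@muni n K).
Proof.
have hC (c : {mpoly K[n]}) : muni (mmerge c%:P) = c%:P.
  rewrite /mmerge map_polyC /= hornerC.
  apply: (@mpoly_rmorph_ext _ _ _ (@muni n K \o @mwiden n K) (polyC \o idfun)) => [a|i] /=.
    by rewrite mwidenC muniC.
  by rewrite mwidenXU muniXwiden.
elim/poly_ind => [|p c IH]; first by rewrite !rmorph0.
have -> : mmerge (p * 'X + c%:P) = mmerge p * mmerge 'X + mmerge c%:P.
  by rewrite -[_ * mmerge _]rmorphM -rmorphD.
rewrite muniD muniM IH hC; congr (_ * _ + _).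
by rewrite /mmerge map_polyX hornerX muniXmax.
Qed.

Lemma irreducible_iso (A B : idomainType) (F : {rmorphism A -> B}) (G : {rmorphism B -> A}) x :
  cancel F G -> cancel G F -> irreducible_elt x -> irreducible_elt (F x).
Proof.
move=> FG GF [x0 xu xi].
have unitF y : (F y \is a GRing.unit) = (y \is a GRing.unit).
  by apply/idP/idP => [u|]; [rewrite -(FG y) rmorph_unit|apply: rmorph_unit].
split; first by apply: contraNneq x0 => h; rewrite -(FG x) h rmorph0.
  by rewrite unitF.
move=> a b E; rewrite -(GF a) -(GF b) !unitF; apply: xi.
by rewrite -rmorphM -E FG.
Qed.

Theorem mpoly_irreducible_prime n (p : {mpoly K[n]}) : irreducible_elt p -> prime_elt p.
Proof.
elim: n p => [|n IH] p pi.
  case: pi => p0 /negP[]; rewrite mpoly_unitE; apply/eqP.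
  have pE := nvar0_mpolyC p; rewrite pE msizeC.
  by case: eqP => // h; move: p0; rewrite pE h mpolyC0 eqxx.
have pm := irreducible_iso (@muniK n) (@mmergeK n) pi.
move=> a b [x E].
have /(_ (muni a) (muni b)) [|[y yE]|[y yE]] : prime_elt (muni p) := poly_irreducible_prime (@mpoly_factorizations n) IH pm.
- by exists (muni x); exact: etrans (esym (muniM a b)) (etrans (congr1 (@muni n K) E) (muniM x p)).
- by left; exists (mmerge y); apply: (can_inj (@muniK n)); rewrite yE muniM mmergeK.
- by right; exists (mmerge y); apply: (can_inj (@muniK n)); rewrite yE muniM mmergeK.
Qed.

End MpolyFactor.

(** * Orders of vanishing *)

(** Substituting X_i T^(w_i) for X_i makes the coefficient of T^j the part of weight j. Homogeneity
    (all weights 1) and order of vanishing at a point (weight 0 on the first coordinate) are both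
    read off this ring morphism. *)
HB.lock Definition grw n (R : comNzRingType) (w : 'I_n -> nat) (f : {mpoly R[n]}) :
  {poly {mpoly R[n]}} :=
  mmap (polyC \o @mpolyC n R) (fun i => ('X_i)%:P * 'X^(w i)) f.

Section WeightGrading.
Variables (n : nat) (R : comNzRingType) (w : 'I_n -> nat).

Definition mwt (m : 'X_{1..n}) : nat := \sum_i w i * m i.

Local Notation grw := (@grw n R w).

Lemma mwtD m1 m2 : mwt (m1 + m2)%MM = (mwt m1 + mwt m2)%N.
Proof. by rewrite /mwt -big_split; apply: eq_bigr => i _; rewrite mnmDE mulnDr. Qed.

Lemma grwE f : grw f = \sum_(m <- msupp f) (f@_m *: 'X_[m])%:P * 'X^(mwt m).
Proof.
rewrite grw.unlock /mmap; apply: eq_bigr => m _.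
rewrite -mul_mpolyC polyCM -mulrA; congr (_ * _).
rewrite /mmap1 mpolyXE_id rmorph_prod /mwt -prodrXr -big_split /=.
by apply: eq_bigr => i _; rewrite exprMn -exprM rmorphXn.
Qed.

Lemma coef_grw f j m : (grw f)`_j@_m = if mwt m == j then f@_m else 0.
Proof.
rewrite grwE coef_sum raddf_sum /=.
under eq_bigr do rewrite coefCM coefXn mulr_natr mcoeffMn mcoeffZ mcoeffX.
have [mf|mf] := boolP (m \in msupp f).
  rewrite (bigD1_seq m) ?msupp_uniq //= eqxx mulr1 big1 ?addr0 => [|m' /negPf ->].
    by rewrite eq_sym; case: eqP.
  by rewrite mulr0 mul0rn.
rewrite (memN_msupp_eq0 mf) if_same big_seq big1 // => m' m'f.
by case: eqP => [E|]; [rewrite -E m'f in mf|rewrite mulr0 mul0rn].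
Qed.

Lemma grwM f g : grw (f * g) = grw f * grw g. Proof. by rewrite grw.unlock; exact: rmorphM. Qed.

Definition ordw k (f : {mpoly R[n]}) := forall m, m \in msupp f -> (k <= mwt m)%N.

Lemma ordwP k f : ordw k f <-> forall j, (j < k)%N -> (grw f)`_j = 0.
Proof.
split=> [h j jk|h m mf].
  apply/mpolyP => m; rewrite coef_grw mcoeff0; case: eqP => // E.
  apply: memN_msupp_eq0; apply/negP => /h; lia.
rewrite leqNgt; apply/negP => /h /(congr1 (mcoeff m)).
by rewrite coef_grw eqxx mcoeff0; apply/eqP; rewrite -mcoeff_msupp.
Qed.

Lemma ordw0 f : ordw 0 f. Proof. by []. Qed.

Lemma ordw_zero k : ordw k 0. Proof. by move=> m; rewrite msupp0. Qed.

Lemma ordwD k f g : ordw k f -> ordw k g -> ordw k (f + g).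
Proof. by move=> hf hg m /msuppD_le; rewrite mem_cat => /orP[/hf|/hg]. Qed.

Lemma ordwM k l f g : ordw k f -> ordw l g -> ordw (k + l) (f * g).
Proof.
move=> hf hg m /msuppM_le /allpairsP[[m1 m2] /= [/hf h1 /hg h2 ->]].
by rewrite mwtD leq_add.
Qed.

Lemma ordw_sum k (I : Type) (r : seq I) (F : I -> {mpoly R[n]}) :
  (forall i, ordw k (F i)) -> ordw k (\sum_(i <- r) F i).
Proof. by move=> h; elim/big_rec: _ => [|i x _]; [apply: ordw_zero|apply: ordwD]. Qed.

End WeightGrading.

Lemma mwt1 n (m : 'X_{1..n}) : mwt (fun=> 1%N) m = mdeg m.
Proof. by rewrite /mwt mdegE; apply: eq_bigr => i _; rewrite mul1n. Qed.

Lemma coefM_low (D : nzRingType) (p q : {poly D}) k l :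
  (forall j, (j < k)%N -> p`_j = 0) -> (forall j, (j < l)%N -> q`_j = 0) ->
  (p * q)`_(k + l) = p`_k * q`_l.
Proof.
move=> pk ql; rewrite coefM (bigD1 (inord k)) //= inordK ?ltnS ?leq_addr // addKn.
rewrite big1 ?addr0 // => i ik; have [lik|lki] := ltnP i k; first by rewrite pk // mul0r.
rewrite ql ?mulr0 //.
have : i != k :> nat.
  by apply: contraNneq ik => E; apply/eqP/val_inj; rewrite /= inordK // ltnS leq_addr.
by have := ltn_ord i; lia.
Qed.

Section WeightOrder.
Variables (n : nat) (R : idomainType) (w : 'I_n -> nat).
Implicit Types f g : {mpoly R[n]}.

Lemma ordw_exact f : f != 0 -> exists k, ordw w k f /\ ~ ordw w k.+1 f.
Proof.
move=> f0; pose good k := [exists m : 'I_(size (msupp f)), mwt w (nth 0%MM (msupp f) m) == k].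
have ex : exists k, good k.
  have : (0 < size (msupp f))%N by rewrite lt0n size_eq0 msupp_eq0.
  by move=> s0; exists (mwt w (nth 0%MM (msupp f) 0)); apply/existsP; exists (Ordinal s0).
case: (ex_minnP ex) => k /existsP[i /eqP ik] mink; exists k; split.
  move=> m mf; apply: mink; apply/existsP.
  have lti : (index m (msupp f) < size (msupp f))%N by rewrite index_mem.
  by exists (Ordinal lti); rewrite /= nth_index.
by move=> /(_ _ (mem_nth 0%MM (ltn_ord i))); rewrite ik ltnn.
Qed.

(** The parts of lowest weight are nonzero and their product is nonzero in a domain; hence
    multiplicities add. *)
Lemma ordwM_exact k l f g : ordw w k f -> ~ ordw w k.+1 f -> ordw w l g -> ~ ordw w l.+1 g ->
  ~ ordw w (k + l).+1 (f * g).
Proof.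
move=> fk nfk gl ngl /ordwP /(_ (k + l)%N (ltnSn _)).
have next (h : {mpoly R[n]}) j : ordw w j h -> ~ ordw w j.+1 h -> (grw w h)`_j <> 0.
  move=> hj nhj z; apply: nhj; apply/ordwP => i; rewrite ltnS leq_eqVlt => /orP[/eqP ->//|].
  exact: (ordwP _ _ _).1 hj i.
rewrite grwM (coefM_low ((ordwP _ _ _).1 fk) ((ordwP _ _ _).1 gl)).
by move/eqP; rewrite mulf_eq0 => /orP[/eqP /(next _ _ fk nfk)|/eqP /(next _ _ gl ngl)].
Qed.

End WeightOrder.

(** * Homogeneous forms, their factors and coprimality *)

Section Forms.
Variable K : fieldType.

Lemma poly_factor_monomial (D : idomainType) (p q : {poly D}) c N :
  c != 0 -> p * q = c%:P * 'X^N -> exists c' i, p = c'%:P * 'X^i.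
Proof.
move=> c0; have X0 : 'X != 0 :> {poly D} by rewrite polyX_eq0.
elim: N p q => [|N IH] p q E.
  have : size (p * q) = 1 by rewrite E expr0 mulr1 size_polyC c0.
  have [->|p0] := eqVneq p 0; first by rewrite mul0r size_poly0.
  have [->|q0] := eqVneq q 0; first by rewrite mulr0 size_poly0.
  rewrite size_mul // => sz.
  have /size_poly1P[c' _ ->] : size p == 1.
    have := p0; have := q0; rewrite -!size_poly_eq0; move: sz.
    by move: (size p) (size q) => i j; lia.
  by exists c', 0; rewrite expr0 mulr1.
have /eqP := congr1 (fun r : {poly D} => r`_0) E.
rewrite coef0M coefCM coefXn mulr0 mulf_eq0 => /orP[|] z.
  have pE : p = (\poly_(i < (size p).-1) p`_i.+1) * 'X.
    apply/polyP => i; rewrite coefMX coef_poly; case: i => [|i] /=; first exact/eqP.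
    by case: ltnP => // h; rewrite nth_default //; lia.
  have [|c' [i pE']] := IH (\poly_(i < (size p).-1) p`_i.+1) q.
    apply: (mulIf X0); rewrite mulrAC -pE E exprSr mulrA; by [].
  by exists c', i.+1; rewrite pE pE' exprSr mulrA.
have qE : q = (\poly_(i < (size q).-1) q`_i.+1) * 'X.
  apply/polyP => i; rewrite coefMX coef_poly; case: i => [|i] /=; first exact/eqP.
  by case: ltnP => // h; rewrite nth_default //; lia.
apply: (IH p (\poly_(i < (size q).-1) q`_i.+1)).
by apply: (mulIf X0); rewrite -mulrA -qE E exprSr mulrA.
Qed.

Lemma mdegree_homog n d (f : {mpoly K[n]}) : f != 0 -> f \is d.-homog -> mdegree f = d.
Proof. by move=> f0 hf; apply: (dhomog_uniq f0 _ hf); apply: dhomog_msize hf. Qed.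

Lemma homog_grw n d (f : {mpoly K[n]}) : f \is d.-homog -> grw (fun=> 1%N) f = f%:P * 'X^d.
Proof.
move=> hf; apply/polyP => j; rewrite coefCM coefXn; apply/mpolyP => m.
rewrite coef_grw mwt1 mulr_natr mcoeffMn.
case: (eqVneq (mdeg m) d) => [->|ne]; first by rewrite eq_sym; case: eqP.
by rewrite (dhomog_nemf_coeff hf) // if_same mul0rn.
Qed.

Lemma grw_homog n d (f g : {mpoly K[n]}) : grw (fun=> 1%N) f = g%:P * 'X^d -> f \is d.-homog.
Proof.
move=> E; apply/dhomogP => m mf; apply/eqP/negPn/negP => ne.
have := coef_grw (fun=> 1%N) f (mdeg m) m; rewrite E mwt1 eqxx coefCM coefXn (negPf ne).
by rewrite mulr0 mcoeff0 => /esym/eqP; rewrite mcoeff_eq0 mf.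
Qed.

(** For a form, [grw] is a monomial in T, and every factor of a nonzero monomial over a domain is
    again a monomial. *)
Lemma homog_factorl n d (f g : {mpoly K[n]}) :
  f * g \is d.-homog -> f * g != 0 -> f \is (mdegree f).-homog.
Proof.
move=> h fg0; have := homog_grw h; rewrite grwM.
case/(poly_factor_monomial fg0) => c [i /grw_homog hi].
rewrite (mdegree_homog _ hi) //.
by apply: contraNneq fg0 => ->; rewrite mul0r.
Qed.

Lemma homog_divides n d (f g : {mpoly K[n]}) :
  f \is d.-homog -> f != 0 -> divides g f -> g \is (mdegree g).-homog.
Proof.
move=> hf f0 [x E]; apply: (homog_factorl (g := x) (d := d)); rewrite mulrC -E //.
Qed.

Lemma homog_quotient n d e (f g x : {mpoly K[n]}) :
  f \is d.-homog -> f != 0 -> g \is e.-homog -> f = x * g ->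
  (e <= d)%N /\ x \is (d - e).-homog.
Proof.
move=> hf f0 hg E; have x0 : x != 0 by apply: contraNneq f0 => z; rewrite E z mul0r.
have hx : x \is (mdegree x).-homog by apply: (homog_factorl (g := g) (d := d)); rewrite -E.
have := dhomogM hx hg; rewrite -E => h.
by rewrite (dhomog_uniq f0 hf h) leq_addl addnK.
Qed.

Lemma unit_homog n d (f : {mpoly K[n]}) : f \is d.-homog -> f \is a GRing.unit -> d = 0%N.
Proof.
move=> hf uf; have f0 : f != 0 by apply: contraTneq uf => ->; rewrite unitr0.
by rewrite -(mdegree_homog f0 hf) /mdegree; move: uf; rewrite mpoly_unitE => /eqP ->.
Qed.

Lemma homog0_unit n (f : {mpoly K[n]}) : f != 0 -> f \is 0.-homog -> f \is a GRing.unit.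
Proof.
move=> f0 hf; rewrite mpoly_unitE; have := mdegree_homog f0 hf.
by rewrite /mdegree (mpolySpred _ f0) /= => ->.
Qed.

Lemma homog0_const n (f : {mpoly K[n]}) : f \is 0.-homog -> f = (f@_0%MM)%:MP.
Proof.
move=> hf; have [->|f0] := eqVneq f 0; first by rewrite mcoeff0 mpolyC0.
apply: msize1_polyC; have := mdegree_homog f0 hf.
by rewrite /mdegree (mpolySpred _ f0) /= => ->.
Qed.

(** Says that b is a nonzerodivisor modulo a; [coprime_sym] gives symmetry for nonzero a. *)
Definition coprime_elt (R : comNzRingType) (a b : R) := forall x, divides a (b * x) -> divides a x.

Lemma coprime_sym (R : idomainType) (a b : R) : a != 0 -> coprime_elt a b -> coprime_elt b a.
Proof.
move=> a0 h x [y E]; have /h[z yE] : divides a (b * y) by exists x; rewrite mulrC -E mulrC.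
by exists z; apply: (mulfI a0); rewrite E yE; ring.
Qed.

Lemma coprime_mulr (R : comNzRingType) (a b c : R) :
  coprime_elt a b -> coprime_elt a c -> coprime_elt a (b * c).
Proof. by move=> hb hc x; rewrite -mulrA => /hb/hc. Qed.

Lemma coprime1 (R : comNzRingType) (a : R) : coprime_elt a 1.
Proof. by move=> x; rewrite mul1r. Qed.

Lemma coprime_expr (R : comNzRingType) (a b : R) k : coprime_elt a b -> coprime_elt a (b ^+ k).
Proof.
by move=> h; elim: k => [|k IH]; [exact: coprime1|rewrite exprS; apply: coprime_mulr].
Qed.

Lemma coprime_mull (R : idomainType) (a b c : R) : a != 0 ->
  coprime_elt a c -> coprime_elt b c -> coprime_elt (a * b) c.
Proof.
move=> a0 ha hb x [y E].
have /ha[z xE] : divides a (c * x) by exists (y * b); rewrite E; ring.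
have /hb[v zE] : divides b (c * z).
  exists y; apply: (mulfI a0); have -> : a * (c * z) = c * x by rewrite xE; ring.
  by rewrite E; ring.
by exists v; rewrite xE zE; ring.
Qed.

Lemma coprime_dvd_mul (R : idomainType) (a b x : R) :
  coprime_elt a b -> divides a x -> divides b x -> divides (a * b) x.
Proof. by move=> h ax [y E]; move: ax; rewrite E mulrC => /h[z ->]; exists z; ring. Qed.

Lemma coprime_dvd_prod (R : idomainType) (I : eqType) (r : seq I) (F : I -> R) x :
  uniq r -> (forall i, i \in r -> F i != 0) ->
  (forall i j, i \in r -> j \in r -> i != j -> coprime_elt (F i) (F j)) ->
  (forall i, i \in r -> divides (F i) x) -> divides (\prod_(i <- r) F i) x.
Proof.
elim: r => [|i r IH] /=; first by move=> *; rewrite big_nil; exists x; rewrite mulr1.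
move=> /andP[ir ur] F0 cop dv; rewrite big_cons; apply: coprime_dvd_mul.
- have : {subset r <= r} by [].
  elim: {1 3}r => [|j s IHs] sub; first by rewrite big_nil; apply: coprime1.
  rewrite big_cons; apply: coprime_mulr; last by apply: IHs => k ks; apply: sub; rewrite inE ks orbT.
  have jr : j \in r by apply: sub; rewrite mem_head.
  by apply: cop; rewrite ?mem_head // ?inE ?jr ?orbT //; apply: contraNneq ir => ->.
- by apply: dv; rewrite mem_head.
- apply: IH => // [j jr|j k jr kr|j jr]; [apply: F0|apply: cop|apply: dv];
    by rewrite inE ?jr ?kr orbT.
Qed.

Lemma irreducible_coprime n (p q : {mpoly K[n]}) :
  irreducible_elt p -> ~ divides p q -> coprime_elt p q.
Proof. by move=> ip nd x /(mpoly_irreducible_prime ip)[]. Qed.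

Lemma exists_irreducible_factor n (f : {mpoly K[n]}) : f != 0 -> f \isn't a GRing.unit ->
  exists2 p, irreducible_elt p & divides p f.
Proof.
move=> f0 uf; have [u [[|p s] [uu sP fE]]] := mpoly_factorizations f0.
  by move: uf; rewrite fE big_nil mulr1 uu.
exists p; first by apply: sP; rewrite mem_head.
by rewrite fE big_cons; exists (u * \prod_(q <- s) q); ring.
Qed.

Lemma coprime_of_no_common n (f g : {mpoly K[n]}) : f != 0 ->
  (forall p, irreducible_elt p -> divides p f -> divides p g -> False) -> coprime_elt f g.
Proof.
move=> f0 no; have [u [s [uu sP fE]]] := mpoly_factorizations f0.
have {no} no p : p \in s -> ~ divides p g.
  move=> ps; apply: no; first exact: sP.
  by rewrite fE (big_rem p) //=; exists (u * \prod_(q <- rem p s) q); ring.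
have u0 : u != 0 by apply: contraTneq uu => ->; rewrite unitr0.
rewrite fE; apply: coprime_mull => //; first by move=> x _; apply: divides_unitl.
elim: s sP no {fE} => [|p s IH] sP no; first by rewrite big_nil => x _; exists x; rewrite mulr1.
rewrite big_cons; apply: coprime_mull.
- by have [|] := sP p; rewrite ?mem_head.
- by apply: irreducible_coprime; [apply: sP|apply: no]; rewrite mem_head.
- by apply: IH => q qs; [apply: sP|apply: no]; rewrite inE qs orbT.
Qed.

Definition form n d (f : {mpoly K[n]}) : Prop := f \is d.-homog.

Lemma subspace_form n d : subspace (@form n d).
Proof. by split=> [|a x y hx hy]; [exact: dhomog0|apply: rpredD => //; apply: rpredZ]. Qed.

Lemma is_dim_form n d : is_dim (@form n.+1 d) 'C(d + n, d).
Proof.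
pose b : seq 'X_{1..n.+1} := [seq s2m t | t : d.-tuple 'I_n.+1 <- enum (basis n.+1 d)].
have szb : size b = 'C(d + n, d) by apply: size_basis.
have ub : uniq b by apply: uniq_basis.
have memb m : (m \in b) = (mdeg m == d) by rewrite -basis_cover.
exists (fun i => 'X_[nth 0%MM b i]); split.
- by move=> i; rewrite /form dhomogX -memb mem_nth // szb.
- move=> c; rewrite /zero_sub => c0 i.
  have := congr1 (mcoeff (nth 0%MM b i)) c0; rewrite mcoeff0 raddf_sum (bigD1 i) //=.
  rewrite mcoeffZ mcoeffX eqxx mulr1 big1 ?addr0 // => j ji.
  by rewrite mcoeffZ mcoeffX nth_uniq ?szb // (inj_eq val_inj) (negPf ji) mulr0.
- move=> f hf; exists (fun i => f@_(nth 0%MM b i)); apply/eqP; rewrite subr_eq0; apply/eqP.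
  rewrite (_ : \sum_i _ = \sum_(m <- b) f@_m *: 'X_[m]); last by rewrite (big_nth 0%MM) big_mkord szb.
  apply/mpolyP => m; rewrite raddf_sum /=.
  have [mb|mb] := boolP (m \in b).
    rewrite (bigD1_seq m) //= mcoeffZ mcoeffX eqxx mulr1 big1 ?addr0 // => m' /negPf ne.
    by rewrite mcoeffZ mcoeffX ne mulr0.
  rewrite (dhomog_nemf_coeff hf) -?memb // big_seq big1 // => m' m'b.
  by rewrite mcoeffZ mcoeffX; case: eqP => [E|_]; [rewrite -E m'b in mb|rewrite mulr0].
Qed.

Lemma fin_dim_form n d : fin_dim (@form n.+1 d).
Proof. exact: is_dim_fin (@is_dim_form n d). Qed.

Lemma hdim_form n d : hdim (@form n.+1 d) = 'C(d + n, n).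
Proof. by rewrite (is_dimE (@is_dim_form n d)) -[RHS]bin_sub ?leq_addl // addnK. Qed.

End Forms.

(** * Linear substitutions and powers of a point ideal *)

HB.lock Definition msub (R : comNzRingType) n k (phi : 'I_n -> {mpoly R[k]}) (f : {mpoly R[n]}) :
  {mpoly R[k]} := mmap (@mpolyC k R) phi f.

(** The substitution x -> x M on row vectors: the value of [lsub M f] at (1,0,0) is the value of f
    at the first row of M, so a matrix whose first row is a point moves this point to (1:0:0). *)
HB.lock Definition lsub (R : comNzRingType) n (M : 'M[R]_n) (f : {mpoly R[n]}) : {mpoly R[n]} :=
  msub (fun j => \sum_i M i j *: 'X_i) f.

Section Substitution.
Variable R : comNzRingType.

Section Basics.
Variables (n k : nat) (phi : 'I_n -> {mpoly R[k]}).

Lemma msubD f g : msub phi (f + g) = msub phi f + msub phi g.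
Proof. rewrite msub.unlock; exact: rmorphD. Qed.
Lemma msubB f g : msub phi (f - g) = msub phi f - msub phi g.
Proof. rewrite msub.unlock; exact: rmorphB. Qed.
Lemma msub0 : msub phi 0 = 0. Proof. rewrite msub.unlock; exact: rmorph0. Qed.
Lemma msub1 : msub phi 1 = 1. Proof. rewrite msub.unlock; exact: rmorph1. Qed.
Lemma msubM f g : msub phi (f * g) = msub phi f * msub phi g.
Proof. rewrite msub.unlock; exact: rmorphM. Qed.
Lemma msubXn f d : msub phi (f ^+ d) = msub phi f ^+ d.
Proof. rewrite msub.unlock; exact: rmorphXn. Qed.
Lemma msubZ c f : msub phi (c *: f) = c *: msub phi f.
Proof. by rewrite msub.unlock mmapZ mul_mpolyC. Qed.
Lemma msub_sum (I : Type) (r : seq I) (F : I -> {mpoly R[n]}) :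
  msub phi (\sum_(i <- r) F i) = \sum_(i <- r) msub phi (F i).
Proof. rewrite msub.unlock; exact: rmorph_sum. Qed.
Lemma msub_prod (I : Type) (r : seq I) (F : I -> {mpoly R[n]}) :
  msub phi (\prod_(i <- r) F i) = \prod_(i <- r) msub phi (F i).
Proof. rewrite msub.unlock; exact: rmorph_prod. Qed.
Lemma msubX i : msub phi 'X_i = phi i.
Proof. by rewrite msub.unlock mmapX mmap1U. Qed.
Lemma msubXm m : msub phi 'X_[m] = \prod_i phi i ^+ m i.
Proof. by rewrite msub.unlock mmapX. Qed.
Lemma msubE f : msub phi f = \sum_(m <- msupp f) f@_m *: \prod_i phi i ^+ m i.
Proof. by rewrite {1}(mpolyE f) msub_sum; apply: eq_bigr => m _; rewrite msubZ msubXm. Qed.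

Lemma msub_eval f v : (msub phi f).@[v] = f.@[fun i => (phi i).@[v]].
Proof.
rewrite msubE rmorph_sum [RHS]mevalE; apply: eq_bigr => m _; rewrite /= mevalZ rmorph_prod.
by congr (_ * _); apply: eq_bigr => i _; rewrite rmorphXn.
Qed.
End Basics.

Lemma eq_msub n k (phi psi : 'I_n -> {mpoly R[k]}) f : phi =1 psi -> msub phi f = msub psi f.
Proof.
by move=> E; rewrite !msubE; apply: eq_bigr => m _; congr (_ *: _); apply: eq_bigr => i _; rewrite E.
Qed.

Lemma msub_comp n k l (phi : 'I_n -> {mpoly R[k]}) (psi : 'I_k -> {mpoly R[l]}) f :
  msub psi (msub phi f) = msub (fun i => msub psi (phi i)) f.
Proof.
rewrite [msub phi f]msubE msub_sum msubE; apply: eq_bigr => m _; rewrite msubZ msub_prod.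
by congr (_ *: _); apply: eq_bigr => i _; rewrite msubXn.
Qed.

Lemma msub_id n (f : {mpoly R[n]}) : msub (fun i => 'X_i) f = f.
Proof.
by rewrite msubE [RHS]mpolyE; apply: eq_bigr => m _; rewrite mpolyXE_id.
Qed.

Lemma dhomog_prodE n (I : Type) (r : seq I) (F : I -> {mpoly R[n]}) (d : I -> nat) :
  (forall i, F i \is (d i).-homog) -> \prod_(i <- r) F i \is (\sum_(i <- r) d i)%N.-homog.
Proof.
move=> h; elim: r => [|i r IH]; first by rewrite !big_nil dhomog1.
by rewrite !big_cons dhomogM.
Qed.

Lemma msub_homog n k d e (phi : 'I_n -> {mpoly R[k]}) f :
  (forall i, phi i \is e.-homog) -> f \is d.-homog -> msub phi f \is (d * e)%N.-homog.
Proof.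
move=> hphi hf; rewrite msubE big_seq; apply: rpred_sum => m mf; apply: rpredZ.
have -> : (d * e = \sum_i (e * m i))%N.
  by rewrite -(dhomog_mf hf mf : mdeg m = d) mdegE mulnC -big_distrr.
by apply: dhomog_prodE => i; apply: dhomogMn.
Qed.

Lemma msub_homog1 n k d (phi : 'I_n -> {mpoly R[k]}) f :
  (forall i, phi i \is 1.-homog) -> f \is d.-homog -> msub phi f \is d.-homog.
Proof. by move=> hphi hf; have := msub_homog hphi hf; rewrite muln1. Qed.

Lemma lsubE n (M : 'M[R]_n) f : lsub M f = msub (fun j => \sum_i M i j *: 'X_i) f.
Proof. by rewrite lsub.unlock. Qed.

Lemma lsub_comp n (M N : 'M[R]_n) f : lsub N (lsub M f) = lsub (N *m M) f.
Proof.
rewrite !lsubE msub_comp; apply: eq_msub => j; rewrite msub_sum.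
under eq_bigr => i _ do rewrite msubZ msubX scaler_sumr.
rewrite exchange_big /=; apply: eq_bigr => l _; rewrite mxE scaler_suml.
by apply: eq_bigr => i _; rewrite scalerA mulrC.
Qed.

Lemma lsub_id n (f : {mpoly R[n]}) : lsub 1%:M f = f.
Proof.
rewrite lsubE -[RHS]msub_id; apply: eq_msub => j.
by rewrite (bigD1 j) //= mxE eqxx scale1r big1 ?addr0 // => i /negPf ij; rewrite mxE ij scale0r.
Qed.

Lemma lsub_eval n (M : 'M[R]_n) f x : (lsub M f).@[x] = f.@[fun j => \sum_i M i j * x i].
Proof.
rewrite lsubE msub_eval; apply: meval_eq => j; rewrite rmorph_sum; apply: eq_bigr => i _.
by rewrite /= mevalZ mevalXU.
Qed.

Lemma dhomogX1 n (i : 'I_n) : ('X_i : {mpoly R[n]}) \is 1.-homog.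
Proof. by rewrite dhomogX; apply/eqP/mdeg1. Qed.

Lemma linear_form_homog n k (c : 'I_n -> R) (F : 'I_n -> {mpoly R[k]}) d :
  (forall i, F i \is d.-homog) -> \sum_i c i *: F i \is d.-homog.
Proof. by move=> h; apply: rpred_sum => i _; apply: rpredZ. Qed.

Lemma lsub_homog n (M : 'M[R]_n) d f : f \is d.-homog -> lsub M f \is d.-homog.
Proof.
move=> hf; rewrite lsubE -[d]muln1; apply: msub_homog hf => j.
by apply: linear_form_homog => i; apply: dhomogX1.
Qed.

Section LinearBasics.
Variables (n : nat) (M : 'M[R]_n).
Implicit Types f g : {mpoly R[n]}.

Lemma lsubD f g : lsub M (f + g) = lsub M f + lsub M g. Proof. rewrite lsub.unlock; exact: msubD. Qed.
Lemma lsub0 : lsub M 0 = 0. Proof. rewrite lsub.unlock; exact: msub0. Qed.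
Lemma lsub1 : lsub M 1 = 1. Proof. rewrite lsub.unlock; exact: msub1. Qed.
Lemma lsubM f g : lsub M (f * g) = lsub M f * lsub M g. Proof. rewrite lsub.unlock; exact: msubM. Qed.
Lemma lsubXn f d : lsub M (f ^+ d) = lsub M f ^+ d. Proof. rewrite lsub.unlock; exact: msubXn. Qed.
Lemma lsubZ c f : lsub M (c *: f) = c *: lsub M f. Proof. rewrite lsub.unlock; exact: msubZ. Qed.
Lemma lsub_sum (I : Type) (r : seq I) (F : I -> {mpoly R[n]}) :
  lsub M (\sum_(i <- r) F i) = \sum_(i <- r) lsub M (F i).
Proof. rewrite lsub.unlock; exact: msub_sum. Qed.
End LinearBasics.

End Substitution.

Lemma map_msub (R S : comNzRingType) (h : {rmorphism R -> S}) n k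
  (phi : 'I_n -> {mpoly R[k]}) f :
  map_mpoly h (msub phi f) = msub (fun i => map_mpoly h (phi i)) (map_mpoly h f).
Proof.
rewrite msubE rmorph_sum /=; under eq_bigr => m _ do rewrite map_mpolyZ rmorph_prod /=.
pose F : {rmorphism {mpoly R[n]} -> {mpoly S[k]}} :=
  mmap (@mpolyC k S \o h) (fun i => map_mpoly h (phi i)).
transitivity (F f).
  rewrite /F /= /mmap; apply: eq_bigr => m _; rewrite mul_mpolyC; congr (_ *: _).
  by apply: eq_bigr => i _; rewrite rmorphXn.
pose G : {rmorphism {mpoly R[n]} -> {mpoly S[k]}} :=
  mmap (@mpolyC k S) (fun i => map_mpoly h (phi i)) \o map_mpoly h.
rewrite msub.unlock; apply: (mpoly_rmorph_ext (F := F) (G := G)) => [c|i].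
  by rewrite /F /G /= map_mpolyC !mmapC.
by rewrite /F /G /= map_mpolyX !mmapX !mmap1U.
Qed.

(** * Frames at a point and powers of its ideal *)

Section Frames.
Variable K : fieldType.

Lemma msub_psubst n k (phi : 'I_n -> {mpoly K[k]}) f : psubst phi f = msub phi f.
Proof. by rewrite msub.unlock. Qed.

(** The rank one normal form of the row vector v exhibits it as a nonzero multiple of the first row
    of an invertible matrix. *)
Lemma exists_frame n (v : 'I_n.+1 -> K) : (exists i, v i != 0) ->
  exists2 M : 'M[K]_n.+1, M \in unitmx & forall j, M ord0 j = v j.
Proof.
move=> [i vi]; pose x := \row_j v j.
have x0 : x != 0 by apply/eqP => /rowP/(_ i)/eqP; rewrite !mxE (negPf vi).
have rx : \rank x = 1%N by rewrite rank_rV x0.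
pose c := col_ebase x 0 0.
have xE : x = c *: row 0 (row_ebase x).
  rewrite -[LHS]mulmx_ebase rx {1}(mx11_scalar (col_ebase x)) -mulmxA mul_scalar_mx -/c.
  congr (_ *: _); apply/rowP => j; rewrite !mxE big_ord_recl !mxE /= mul1r big1 ?addr0 // => k _.
  by rewrite !mxE /= mul0r.
have c0 : c != 0.
  by have := col_ebase_unit x; rewrite (mx11_scalar (col_ebase x)) unitmxE det_scalar1 unitfE.
exists (c *: row_ebase x); first by rewrite unitmxZ ?unitfE // row_ebase_unit.
by move=> j; have /rowP/(_ j) := xE; rewrite !mxE => ->.
Qed.

Lemma lsubK n (M : 'M[K]_n) : M \in unitmx -> cancel (lsub M) (lsub (invmx M)).
Proof. by move=> uM f; rewrite lsub_comp mulVmx // lsub_id. Qed.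

Lemma lsubVK n (M : 'M[K]_n) : M \in unitmx -> cancel (lsub (invmx M)) (lsub M).
Proof. by move=> uM f; rewrite lsub_comp mulmxV // lsub_id. Qed.

(** With these weights, order at least k means that every monomial has degree at least k in the
    coordinates other than X_0, that is, vanishing to order k at (1:0:0). *)
Definition w01 n (i : 'I_n) : nat := (0 < i)%N.

Definition ordM (M : 'M[K]_3) k f := ordw (@w01 3) k (lsub M f).

Lemma ideal_genD (R : comNzRingType) (S : R -> Prop) f g :
  ideal_gen S f -> ideal_gen S g -> ideal_gen S (f + g).
Proof.
move=> [a [x [y [Sy ->]]]] [b [u [v [Sv ->]]]].
exists (a + b)%N, (fun i => match split i with inl j => x j | inr j => u j end),
  (fun i => match split i with inl j => y j | inr j => v j end); split.
  by move=> i; case: split.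
rewrite big_split_ord; congr (_ + _); apply: eq_bigr => i _.
  by rewrite (unsplitK (inl i)).
by rewrite (unsplitK (inr i)).
Qed.

Lemma ideal_genM (R : comNzRingType) (S : R -> Prop) f g : ideal_gen S f -> ideal_gen S (g * f).
Proof.
move=> [a [x [y [Sy ->]]]]; exists a, (fun i => g * x i), y; split=> //.
by rewrite mulr_sumr; apply: eq_bigr => i _; rewrite mulrA.
Qed.

Lemma ideal_gen0 (R : comNzRingType) (S : R -> Prop) : ideal_gen S 0.
Proof. by exists 0%N, (fun=> 0), (fun=> 0); split=> [[]//|]; rewrite big_ord0. Qed.

Lemma ideal_gen_in (R : comNzRingType) (S : R -> Prop) f : S f -> ideal_gen S f.
Proof. by move=> Sf; exists 1%N, (fun=> 1), (fun=> f); split=> //; rewrite big_ord1 mul1r. Qed.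

Lemma ideal_powD (R : comNzRingType) (I : R -> Prop) k f g :
  ideal_pow I k f -> ideal_pow I k g -> ideal_pow I k (f + g).
Proof. by case: k => // k; apply: ideal_genD. Qed.

Lemma ideal_powM (R : comNzRingType) (I : R -> Prop) k f g :
  ideal_pow I k f -> ideal_pow I k (g * f).
Proof. by case: k => // k; apply: ideal_genM. Qed.

Lemma ideal_pow0 (R : comNzRingType) (I : R -> Prop) k : ideal_pow I k 0.
Proof. by case: k => // k; apply: ideal_gen0. Qed.

Lemma ideal_powS (R : comNzRingType) (I : R -> Prop) k f g :
  I f -> ideal_pow I k g -> ideal_pow I k.+1 (f * g).
Proof. by move=> If Ig; apply: ideal_gen_in; exists f, g. Qed.

Lemma ideal_powW (R : comNzRingType) (I : R -> Prop) k l f :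
  (l <= k)%N -> ideal_pow I k f -> ideal_pow I l f.
Proof.
elim: l k f => // l IH [//|k] f lk [r [a [g [h ->]]]].
exists r, a, g; split=> // i; have [x [y [Ix Iy ->]]] := h i.
by exists x, y; split=> //; apply: IH Iy.
Qed.

Lemma ideal_pow_expr (R : comNzRingType) (I : R -> Prop) a b k f :
  I f -> ideal_pow I k b -> ideal_pow I (a + k) (f ^+ a * b).
Proof.
move=> If Ib; elim: a => [|a IH]; first by rewrite mul1r.
by rewrite exprS -mulrA; apply: ideal_powS.
Qed.

Lemma eval_base d (f : {mpoly K[3]}) : f \is d.-homog ->
  f.@[fun i => (i == ord0)%:R] = f@_(U_(ord0) *+ d)%MM.
Proof.
move=> hf; rewrite mevalE.
have ev m : m \in msupp f ->
    f@_m * \prod_i ((i == ord0)%:R : K) ^+ m i = if m == (U_(ord0) *+ d)%MM then f@_m else 0.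
  move=> mf; case: eqP => [->|ne].
    rewrite big1 ?mulr1 // => i _; rewrite mulmnE mnm1E.
    by have [_|_] := eqVneq i ord0; rewrite ?expr1n.
  have [i i0 mi] : exists2 i, i != ord0 & m i != 0%N.
    apply: NNPP => no; apply: ne; apply/mnmP => i; rewrite mulmnE mnm1E.
    have mz j : j != ord0 -> m j = 0%N.
      by move=> j0; apply/eqP/negPn/negP => mj; apply: no; exists j.
    have := dhomog_mf hf mf : mdeg m = d; rewrite mdegE (bigD1 ord0) //= big1; last by move=> j /mz.
    rewrite addn0 => m0; have [->|i0] := eqVneq i ord0; first by rewrite mul1n.
    by rewrite (mz _ i0).
  by rewrite (bigD1 i) //= (negPf i0) expr0n (negPf mi) mul0r mulr0.
rewrite big_seq (eq_bigr _ ev) -big_seq -big_mkcond /=.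
have [mf|mf] := boolP ((U_(ord0) *+ d)%MM \in msupp f).
  by rewrite -big_filter filter_pred1_uniq ?msupp_uniq // big_seq1.
rewrite (memN_msupp_eq0 mf) big_seq_cond big1 // => m /andP[m1 /eqP m2].
by rewrite -m2 m1 in mf.
Qed.

(** In a frame at p the ideal of p is generated by the two coordinates of weight 1. This turns
    membership in a power of the ideal into the vanishing of finitely many coefficients, which is
    multiplicative, yields linear conditions and passes to ultraproducts. *)
Theorem ideal_powP (p : proj 2 K) (M : 'M[K]_3) k f : M \in unitmx ->
  (forall j, M ord0 j = p j) -> ideal_pow (point_ideal p) k f <-> ordM M k f.
Proof.
move=> uM pM; split.
  have gen1 g : point_ideal p g -> ordM M 1 g.
    move=> [r [a [h [hP ->]]]]; rewrite /ordM lsub_sum; apply: ordw_sum => i.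
    rewrite lsubM; apply: (@ordwM _ _ _ 0 1) => //.
    have [[d hd] h0] := hP i; have hd' := lsub_homog M hd => m mh.
    rewrite lt0n; apply/negP => /eqP wm.
    (* In degree d the only monomial of weight 0 is X_0^d, and its coefficient is the value at the
       point. *)
    have mE : m = (U_(ord0) *+ d)%MM.
      have mz j : j != ord0 -> m j = 0%N.
        move=> j0; have : (m j <= mwt (@w01 3) m)%N.
          by rewrite /mwt (bigD1 j) //= {1}/w01 lt0n j0 mul1n leq_addr.
        by rewrite wm leqn0 => /eqP.
      apply/mnmP => i'; rewrite mulmnE mnm1E.
      have := dhomog_mf hd' mh : mdeg m = d; rewrite mdegE (bigD1 ord0) //= big1; last by move=> j /mz.
      rewrite addn0 => m0; have [->|i0] := eqVneq i' ord0; first by rewrite mul1n.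
      by rewrite (mz _ i0).
    move: mh; rewrite mcoeff_msupp mE -(eval_base hd') lsub_eval.
    rewrite (meval_eq (v2 := p)) ?h0 ?eqxx // => j.
    by rewrite (bigD1 ord0) //= ?eqxx mulr1 pM big1 ?addr0 // => l /negPf ->; rewrite mulr0.
  elim: k f => [|k IH] f; first by move=> _; apply: ordw0.
  move=> [r [a [g [gP ->]]]]; rewrite /ordM lsub_sum; apply: ordw_sum => i.
  rewrite lsubM; apply: (@ordwM _ _ _ 0 k.+1) => //.
  have [x [y [/gen1 hx /IH hy ->]]] := gP i.
  by rewrite lsubM; exact: ordwM hx hy.
move=> ordf; rewrite -[f](lsubK uM).
set y := fun j : 'I_3 => \sum_i invmx M i j *: 'X_i.
have yP j : j != ord0 -> point_ideal p (y j).
  move=> j0; apply: ideal_gen_in; split.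
    by exists 1%N; apply: linear_form_homog => i; apply: dhomogX1.
  rewrite /y rmorph_sum /=.
  transitivity ((M *m invmx M) ord0 j); last by rewrite mulmxV // mxE eq_sym (negPf j0).
  by rewrite mxE; apply: eq_bigr => i _; rewrite mevalZ mevalXU pM mulrC.
rewrite [lsub (invmx M) _]lsubE -/y; move: y yP => y yP; rewrite msubE big_seq.
elim/big_rec: _ => [|m g mf Ig]; first exact: ideal_pow0.
apply: ideal_powD => //; rewrite -mul_mpolyC; apply: ideal_powM.
rewrite !big_ord_recl big_ord0; apply: ideal_powM.
apply: (ideal_powW (ordf m mf)).
have -> : mwt (@w01 3) m = (m (lift ord0 ord0) + (m (lift ord0 (lift ord0 ord0)) + 0))%N.
  by rewrite /mwt !big_ord_recl big_ord0 /w01 /= mul0n !mul1n.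
apply: ideal_pow_expr; first by apply: yP.
by apply: ideal_pow_expr; first by apply: yP.
Qed.

End Frames.

(* Unfolding any of these makes unification diverge. *)
Global Opaque mmap meval mpoly_mul mpoly_add mpoly_opp mpoly_scale mpolyC mcoeff.

Section Order.
Variable K : fieldType.
Implicit Types (p q : proj 2 K) (f g : {mpoly K[3]}).

Definition vanish p k f := ideal_pow (point_ideal p) k f.

Lemma frameP p : exists2 M : 'M[K]_3, M \in unitmx & forall j, M ord0 j = p j.
Proof. exact: exists_frame (coords_neq0 p). Qed.

Lemma vanish0 p f : vanish p 0 f. Proof. by []. Qed.

Lemma vanishM p k l f g : vanish p k f -> vanish p l g -> vanish p (k + l) (f * g).
Proof.
have [M uM pM] := frameP p; rewrite /vanish !(ideal_powP _ _ uM pM) => hf hg.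
by rewrite /ordM lsubM; exact: ordwM hf hg.
Qed.

Lemma vanish_exp p c f : vanish p 1 f -> vanish p c (f ^+ c).
Proof. by move=> h; elim: c => [//|c IH]; rewrite exprS; exact: vanishM h IH. Qed.

Lemma vanish_mull p k f g : vanish p k f -> vanish p k (g * f).
Proof. exact: ideal_powM. Qed.

Lemma vanishW p k l f : (l <= k)%N -> vanish p k f -> vanish p l f.
Proof. exact: ideal_powW. Qed.

Lemma lsub_neq0 (M : 'M[K]_3) f : M \in unitmx -> f != 0 -> lsub M f != 0.
Proof.
move=> uM; apply: contraNneq => E; rewrite -(lsubK uM f) E.
by apply/eqP; exact: lsub0.
Qed.

Lemma mult_exists p f : f != 0 -> exists k, mult_at p f k.
Proof.
have [M uM pM] := frameP p => f0.
have [k [hk nhk]] := ordw_exact (@w01 3) (lsub_neq0 uM f0).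
by exists k; split; rewrite (ideal_powP _ _ uM pM).
Qed.

Lemma mult_mul p f g k l : mult_at p f k -> mult_at p g l -> mult_at p (f * g) (k + l).
Proof.
have [M uM pM] := frameP p => [[hf nf] [hg ng]]; split; first exact: vanishM.
move: hf nf hg ng; rewrite !(ideal_powP _ _ uM pM) /ordM lsubM => hf nf hg ng.
exact: ordwM_exact hf nf hg ng.
Qed.

Lemma mult_neq0 p f k : mult_at p f k -> f != 0.
Proof. by move=> [_ nf]; apply/eqP => f0; apply: nf; rewrite f0; apply: ideal_pow0. Qed.

Lemma mult_le p f k l : mult_at p f k -> vanish p l f -> (l <= k)%N.
Proof. by move=> [_ nf] h; rewrite leqNgt; apply/negP => lt; apply: nf; exact: (vanishW lt h). Qed.

Lemma mult_uniq p f k l : mult_at p f k -> mult_at p f l -> k = l.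
Proof.
by move=> hk hl; apply/eqP; rewrite eqn_leq (mult_le hl (proj1 hk)) (mult_le hk (proj1 hl)).
Qed.

Lemma vanish_div p f g k l : mult_at p f k -> vanish p l (f * g) -> vanish p (l - k) g.
Proof.
move=> hf h; have [->|g0] := eqVneq g 0; first exact: ideal_pow0.
have [j hg] := mult_exists p g0.
apply: (vanishW _ (proj1 hg)).
by have := mult_le (mult_mul hf hg) h; lia.
Qed.

Lemma mult1 p : mult_at p 1 0.
Proof.
split=> //; have [M uM pM] := frameP p; rewrite (ideal_powP _ _ uM pM) /ordM lsub1 => /(_ 0%MM).
by rewrite msupp1 mem_head /mwt big1 => [/(_ isT)|i _]; rewrite ?mnm0E ?muln0.
Qed.

Lemma mult_expr p f k c : mult_at p f k -> mult_at p (f ^+ c) (c * k).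
Proof. by move=> h; elim: c => [|c IH]; [exact: mult1|rewrite exprS mulSn; apply: mult_mul]. Qed.

Lemma mult_prod p (I : Type) (r : seq I) (F : I -> {mpoly K[3]}) (k : I -> nat) :
  (forall i, mult_at p (F i) (k i)) -> mult_at p (\prod_(i <- r) F i) (\sum_(i <- r) k i).
Proof.
move=> h; elim: r => [|i r IH]; first by rewrite !big_nil; apply: mult1.
by rewrite !big_cons; apply: mult_mul.
Qed.

Lemma mwt_w01_le (m : 'X_{1..3}) : (mwt (@w01 3) m <= mdeg m)%N.
Proof. by rewrite mdegE; apply: leq_sum => i _; rewrite /w01; case: (0 < i)%N; rewrite ?mul1n. Qed.

Lemma vanish_le_deg p f k d : f \is d.-homog -> f != 0 -> vanish p k f -> (k <= d)%N.
Proof.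
have [M uM pM] := frameP p => hf f0; rewrite /vanish (ideal_powP _ _ uM pM) => ordf.
have h0 := lsub_neq0 uM f0; have hf' := lsub_homog M hf.
have ms : mlead (lsub M f) \in msupp (lsub M f) by apply: mlead_supp.
apply: leq_trans (ordf _ ms) _; rewrite -(dhomog_mf hf' ms : mdeg _ = d).
exact: mwt_w01_le.
Qed.

Lemma vanish1_eval p f d : f \is d.-homog -> vanish p 1 f <-> f.@[p] = 0.
Proof.
move=> hf; split=> [h|h].
  have [M uM pM] := frameP p.
  have ev : (lsub M f).@[fun i => (i == ord0)%:R] = f.@[p].
    rewrite lsub_eval; apply: meval_eq => j.
    by rewrite (bigD1 ord0) //= ?eqxx mulr1 pM big1 ?addr0 // => l /negPf ->; rewrite mulr0.
  rewrite -ev (eval_base (lsub_homog M hf)); apply: memN_msupp_eq0; apply/negP.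
  move: h; rewrite /vanish (ideal_powP _ _ uM pM) => h /h.
  by rewrite /mwt big1 // => i _; rewrite mulmnE mnm1E /w01; case: eqP => [<-|_]; rewrite ?mul0n ?muln0.
rewrite -[f]mulr1; apply: ideal_powS; last by [].
by apply: ideal_gen_in; split=> //; exists d.
Qed.

Lemma mult0_eval p f d : f \is d.-homog -> f.@[p] != 0 -> mult_at p f 0.
Proof. by move=> hf fp; split=> // /(vanish1_eval _ hf) E; rewrite E eqxx in fp. Qed.

End Order.

(** * Nonvanishing of polynomials; lines through and off given points *)

Section Nonvanishing.
Variable K : closedFieldType.

Lemma mpoly_nonvanish n (f : {mpoly K[n]}) : f != 0 -> exists v, f.@[v] != 0.
Proof.
elim: n f => [|n IH] f f0.
  exists (fun=> 0); rewrite (nvar0_mpolyC f) mevalC; apply: contraNneq f0 => z.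
  by rewrite (nvar0_mpolyC f) z mpolyC0.
have m0 : muni f != 0 by apply: contraNneq f0 => z; rewrite -(muniK f) z; apply/eqP; exact: rmorph0.
have lc0 : lead_coef (muni f) != 0 by rewrite lead_coef_eq0.
have [v vP] := IH _ lc0.
pose q := map_poly (meval v) (muni f).
have q0 : q != 0.
  by apply/eqP => /(congr1 (fun r : {poly K} => r`_(size (muni f)).-1)); rewrite coef0 coef_map => /eqP; apply/negP.
have [t tP] := closed_nonrootP q q0.
pose w (i : 'I_n.+1) := if unlift ord_max i is Some j then v j else t.
exists w; suff -> : f.@[w] = q.[t] by [].
rewrite /q.
apply: (mpoly_rmorph_ext (F := meval w) (G := horner_eval t \o map_poly (meval v) \o @muni n K)) => [c|i] /=.
  by rewrite mevalC muniC map_polyC /horner_eval hornerC /= mevalC.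
have [[j ->]|->] : (exists j, i = widen_ord (leqnSn n) j) \/ i = ord_max.
- case: (ltnP i n) => hi; [left; exists (Ordinal hi)|right]; apply: val_inj => //=.
  by have := ltn_ord i; lia.
- rewrite mevalXU muniXwiden map_polyC /horner_eval hornerC /= mevalXU /w.
  have -> : widen_ord (leqnSn n) j = lift ord_max j by apply: val_inj; rewrite /= /bump leqNgt ltn_ord.
  by rewrite liftK.
- by rewrite mevalXU muniXmax map_polyX /horner_eval hornerX /w unlift_none.
Qed.

(** The factor c is automatically nonzero, since p has a nonzero coordinate. *)
Definition proportional k (p q : proj k K) := exists c, forall j, p j = c * q j.

Definition lform (c : 'I_3 -> K) : {mpoly K[3]} := \sum_i c i *: 'X_i.

Lemma lform_homog c : lform c \is 1.-homog.
Proof. by apply: linear_form_homog => i; apply: dhomogX1. Qed.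

Lemma lform_eval c (x : 'I_3 -> K) : (lform c).@[x] = \sum_i c i * x i.
Proof. by rewrite rmorph_sum; apply: eq_bigr => i _; rewrite /= mevalZ mevalXU. Qed.

Lemma separating_line (p q : proj 2 K) : ~ proportional p q ->
  exists l : {mpoly K[3]}, [/\ l \is 1.-homog, l.@[q] = 0 & l.@[p] != 0].
Proof.
move=> npq; have [M uM qM] := frameP q.
pose y j := lform (fun i => invmx M i j).
have yE j (x : 'I_3 -> K) : (y j).@[x] = ((\row_i x i) *m invmx M) 0 j.
  by rewrite lform_eval mxE; apply: eq_bigr => i _; rewrite mxE mulrC.
have y0 j : j != ord0 -> (y j).@[q] = 0.
  move=> j0; rewrite yE (_ : \row_i q i = row ord0 M); last by apply/rowP => i; rewrite !mxE qM.
  by rewrite -row_mul mulmxV // !mxE eq_sym (negPf j0).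
apply: NNPP => no; apply: npq; exists ((y ord0).@[p]).
have z j : j != ord0 -> (y j).@[p] = 0.
  move=> j0; apply/eqP/negPn/negP => nz; apply: no; exists (y j); split=> //; last exact: y0.
  exact: lform_homog.
move=> j; have /rowP/(_ j) : \row_i p i = \row_i p i *m invmx M *m M by rewrite mulmxKV.
rewrite !mxE (bigD1 ord0) //= big1 => [|i /z]; first by rewrite addr0 qM yE => ->.
by rewrite yE => ->; rewrite mul0r.
Qed.

(** In the dual plane, the lines through P_i are the zeros of the linear form with coefficients P_i;
    any vector off the product of these forms will do. The extra factor X_0 makes this vector
    nonzero. *)
Lemma common_nonvanishing_line n (P : 'I_n -> proj 2 K) :
  exists2 c : 'I_3 -> K, (exists i, c i != 0) & forall i, (lform c).@[P i] != 0.
Proof.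
have [|c] := @mpoly_nonvanish 3 ('X_ord0 * \prod_i lform (P i)).
  rewrite mulf_neq0 //; first by rewrite -msize_poly_eq0 msizeX.
  apply/prodf_neq0 => i _; have [j Pj] := coords_neq0 (P i).
  apply/eqP => /(congr1 (fun f => f.@[fun k => (k == j)%:R])).
  rewrite lform_eval meval0 (bigD1 j) //= eqxx mulr1 big1 ?addr0 => [/eqP|k /negPf ->]; last by rewrite mulr0.
  by apply/negP.
rewrite rmorphM rmorph_prod /= mulf_eq0 negb_or mevalXU => /andP[c0 /prodf_neq0 h].
exists c; first by exists ord0.
move=> i; have := h i isT; rewrite !lform_eval.
by under eq_bigr do rewrite mulrC.
Qed.

End Nonvanishing.

(** * Forms with multiple points *)

Lemma lin_msub (K : fieldType) n k (phi : 'I_n -> {mpoly K[k]}) : lin (msub phi).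
Proof. by move=> a x y; rewrite msubD msubZ. Qed.

Lemma low_linear (R : comNzRingType) n (w : 'I_n -> nat) (M : 'M[R]_n) k a (x y : {mpoly R[n]}) :
  (grw w (lsub M (a *: x + y)))`_k = a *: (grw w (lsub M x))`_k + (grw w (lsub M y))`_k.
Proof.
apply/mpolyP => u; rewrite mcoeffD mcoeffZ !coef_grw lsubD lsubZ mcoeffD mcoeffZ.
by case: eqP => // _; rewrite mulr0 addr0.
Qed.

Lemma lin_low (K : fieldType) n (w : 'I_n -> nat) (M : 'M[K]_n) k :
  lin (fun f => (grw w (lsub M f))`_k).
Proof. exact: low_linear. Qed.

Section Counting.
Variables (K : closedFieldType) (n : nat) (P : 'I_n -> proj 2 K).
Implicit Types (m k l : 'I_n -> nat) (d e : nat).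

Local Notation I := (fat_ideal_deg P).

Definition h0 m d : nat := hdim (I m d).

(** The expected dimension: each point of multiplicity m imposes binom(m + 1, 2) conditions. It is
    also the Euler characteristic of the class d L - sum m_i E_i. *)
Definition chi m d : int := 'C(d + 2, 2)%:Z - \sum_i 'C(m i + 1, 2)%:Z.

Definition distinct_points := forall i j, i != j -> ~ proportional (P i) (P j).

Lemma subspace_fat m d : subspace (I m d).
Proof.
split=> [|a x y [hx hx'] [hy hy']].
  by split; [move=> i; apply: ideal_pow0|apply: dhomog0].
split; last by apply: rpredD => //; apply: rpredZ.
move=> i; apply: ideal_powD => //; rewrite -mul_mpolyC; exact: ideal_powM.
Qed.

Lemma fin_dim_fat m d : fin_dim (I m d).
Proof. by apply: fin_dimS (@fin_dim_form K 2 d) => f []. Qed.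

Lemma fat_neq0 m d : (0 < h0 m d)%N -> exists2 f, I m d f & f != 0.
Proof.
move=> h; apply: NNPP => no; move: h; rewrite /h0 hdim0 // => f If.
by apply/eqP/negPn/negP => f0; apply: no; exists f.
Qed.

Lemma fatM m k d e f g : I m d f -> I k e g -> I (fun i => m i + k i)%N (d + e) (f * g).
Proof. by move=> [hf df] [hg dg]; split=> [i|]; [apply: vanishM|apply: dhomogM]. Qed.

Lemma fat_mult f k d : f \is d.-homog -> (forall i, mult_at (P i) f (k i)) -> I k d f.
Proof. by move=> hf h; split=> // i; case: (h i). Qed.

Lemma fatW m k d f : (forall i, (k i <= m i)%N) -> I m d f -> I k d f.
Proof. by move=> h [hf df]; split=> // i; apply: ideal_powW (h i) (hf i). Qed.

Definition bump m i := fun j => (m j + (j == i))%N.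

Lemma subspace_bump m i d f : I (bump m i) d f -> I m d f.
Proof. by apply: fatW => j; apply: leq_addr. Qed.

(** Raising the multiplicity at P_i from m to m + 1 kills the part of weight m in a frame at P_i. In
    degree d this part lies in the span of the m + 1 monomials X_0^(d-m) X_1^a X_2^(m-a). *)
Lemma h0_bump_le m i d : (h0 m d <= h0 (bump m i) d + (m i).+1)%N.
Proof.
have [M uM pM] := frameP (P i).
pose phi (f : {mpoly K[3]}) := (grw (@w01 3) (lsub M f))`_(m i).
have lphi : lin phi by exact: lin_low.
rewrite {1}/h0 (hdim_image lphi (subspace_fat m d) (fin_dim_fat m d)) addnC leq_add //.
  apply: hdimS (fin_dim_fat _ _); [exact: subspace_fat| |].
    apply: subspaceI; first exact: subspace_fat.
    by apply: (subspace_preim lphi (W := zero_sub)); apply: subspace_zero.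
  move=> f [If f0]; split; last by case: If.
  move=> j; rewrite /bump; case: eqP => [->|_]; last by rewrite addn0; case: If.
  rewrite addn1 (ideal_powP _ _ uM pM); apply/ordwP => l.
  rewrite ltnS leq_eqVlt => /orP[/eqP -> //|]; move: l; apply/ordwP.
  by apply/(ideal_powP _ _ uM pM); case: If.
pose i1 := lift ord0 ord0 : 'I_3; pose i2 := lift ord0 (lift ord0 ord0) : 'I_3.
pose mon (a : 'I_(m i).+1) : 'X_{1..3} :=
  (U_(ord0) *+ (d - m i) + U_(i1) *+ a + U_(i2) *+ (m i - a))%MM.
apply: (hdim_le (g := fun a => 'X_[mon a])).
  by apply: subspace_image => //; apply: subspace_fat.
move=> _ [f [If df] ->]; exists (fun a => (phi f)@_(mon a)).
have mE (u : 'X_{1..3}) : mdeg u = (u ord0 + u i1 + u i2)%N.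
  by rewrite mdegE !big_ord_recl big_ord0 addn0 addnA.
have wE (u : 'X_{1..3}) : mwt (@w01 3) u = (u i1 + u i2)%N.
  by rewrite /mwt !big_ord_recl big_ord0 /w01 /= mul0n !mul1n add0n addn0.
have monE a : [/\ mon a ord0 = (d - m i)%N, mon a i1 = a & mon a i2 = (m i - a)%N].
  by split; rewrite !mnmDE !mulmnE !mnm1E /= ?mul0n ?mul1n ?addn0 ?add0n.
apply/mpolyP => u; rewrite raddf_sum /=.
have coefsum (b : 'I_(m i).+1 -> K) : (exists2 a, u = mon a & True) \/ (forall a, u <> mon a).
  by case: (classic (exists a, u = mon a)) => [[a ->]|no]; [left; exists a|right=> a E; apply: no; exists a].
case: (coefsum (fun=> 0)) => [[a uE _]|no].
  rewrite (bigD1 a) //= mcoeffZ mcoeffX uE eqxx mulr1 big1 ?addr0 // => b ba.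
  rewrite mcoeffZ mcoeffX; case: eqP => [E|]; last by rewrite mulr0.
  have [_ h1 _] := monE a; have [_ h2 _] := monE b.
  by move: ba; rewrite -(inj_eq val_inj) /= -h1 -h2 E eqxx.
rewrite big1 => [|b _]; last first.
  by rewrite mcoeffZ mcoeffX; case: eqP => [/esym/no|]; rewrite ?mulr0.
rewrite /phi coef_grw; case: eqP => // wu.
apply: memN_msupp_eq0; apply/negP => uf.
have du : mdeg u = d := dhomog_mf (lsub_homog M df) uf.
have ltu : (u i1 < (m i).+1)%N by rewrite ltnS -wu wE leq_addr.
apply: (no (Ordinal ltu)); have [h0' h1 h2] := monE (Ordinal ltu).
move: du wu; rewrite mE wE => du wu.
apply/mnmP => j; have : j \in [:: ord0; i1; i2].
  by case: j => [[|[|[|j]]] lj] //; rewrite !inE -!val_eqE.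
rewrite !inE => /or3P[] /eqP ->; rewrite ?h0' ?h1 ?h2 /=; move: du wu;
  by move: (u ord0) (u i1) (u i2) (m i) => x y z t; lia.
Qed.

Lemma sum_bump m i : (\sum_j bump m i j = (\sum_j m j).+1)%N.
Proof.
rewrite /bump big_split /= -addn1; congr (_ + _)%N.
by rewrite (bigD1 i) //= eqxx big1 // => j /negPf ->.
Qed.

Lemma chi_bump m i d : chi (bump m i) d = chi m d - (m i).+1%:Z.
Proof.
rewrite /chi (bigD1 i) //= [in RHS](bigD1 i) //= {1}/bump eqxx.
rewrite (eq_bigr (fun j => 'C(m j + 1, 2)%:Z)) => [|j /negPf ji]; last by rewrite /bump ji addn0.
by rewrite !addn1 binS bin1; lia.
Qed.

Lemma chi0 d : chi (fun=> 0%N) d = 'C(d + 2, 2)%:Z.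
Proof. by rewrite /chi big1 ?subr0 // => i _; rewrite bin_small. Qed.

Lemma h0_0 d : h0 (fun=> 0%N) d = 'C(d + 2, 2).
Proof.
by rewrite -(hdim_form K 2 d); apply: eq_hdim => f; split=> [[]|hf].
Qed.

Lemma mult_ind (Q : ('I_n -> nat) -> Prop) :
  Q (fun=> 0%N) -> (forall m i, Q m -> Q (bump m i)) -> forall m, Q m.
Proof.
move=> Q0 QS m; have [N] := ubnP (\sum_i m i); elim: N m => // N IH m ltN.
case: (classic (exists i, (0 < m i)%N)) => [[i mi]|no]; last first.
  suff -> : m = fun=> 0%N by [].
  apply: functional_extensionality => i; apply/eqP; rewrite -leqn0 leqNgt.
  by apply/negP => mi; apply: no; exists i.
pose m' j := (m j - (j == i))%N.
have mE : m = bump m' i.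
  apply: functional_extensionality => j; rewrite /bump /m' subnK //.
  by case: eqP => [->|].
by rewrite mE; apply/QS/IH; move: ltN; rewrite mE sum_bump.
Qed.

Lemma chi_le_h0 m d : chi m d <= (h0 m d)%:Z.
Proof.
elim/mult_ind: m => [|m i IH]; first by rewrite chi0 h0_0.
by rewrite chi_bump; have := h0_bump_le m i d; lia.
Qed.

Hypothesis distP : distinct_points.

(** The m_i + 1 conditions are independent: multiply the monomials of degree m_i in the two
    coordinates vanishing at P_i by a form Q of degree d - m_i that has multiplicity at least m_j at
    the other points and is nonzero at P_i. Such a Q is a product of lines through the P_j missing
    P_i, padded by a line through none of the points. *)
Lemma h0_bump_ge m i d : (\sum_j m j <= d)%N -> (h0 (bump m i) d + (m i).+1 <= h0 m d)%N.
Proof.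
move=> md; have [M uM pM] := frameP (P i).
have line j : exists l : {mpoly K[3]}, l \is 1.-homog /\ l.@[P i] != 0 /\ (j != i -> l.@[P j] = 0).
  have [->|ji] := eqVneq j i.
    have [c _ h] := common_nonvanishing_line P.
    by exists (lform c); split; [exact: lform_homog|split].
  have [|l [h1 h2 h3]] := @separating_line _ (P i) (P j); first by apply: distP; rewrite eq_sym.
  by exists l.
pose L j := projT1 (constructive_indefinite_description _ (line j)).
have LP j : L j \is 1.-homog /\ (L j).@[P i] != 0 /\ (j != i -> (L j).@[P j] = 0).
  exact: projT2 (constructive_indefinite_description _ (line j)).
pose Q := L i ^+ (d - \sum_j m j) * \prod_(j | j != i) L j ^+ m j.
have Qhom : Q \is (d - m i).-homog.
  have -> : (d - m i = (d - \sum_j m j) + \sum_(j | j != i) m j)%N.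
    by move: md; rewrite (bigD1 i) //=; lia.
  apply: dhomogM.
    by rewrite -[X in X.-homog]mul1n; apply: dhomogMn; case: (LP i).
  elim/big_rec2: _ => [|j x y _ h]; first exact: dhomog1.
  by apply: dhomogM => //; rewrite -[x in x.-homog]mul1n; apply: dhomogMn; case: (LP j).
have Q0 : mult_at (P i) Q 0.
  apply: (mult0_eval Qhom); rewrite rmorphM rmorphXn rmorph_prod /=.
  rewrite mulf_neq0 ?expf_neq0 //; first by case: (LP i) => _ [].
  by apply/prodf_neq0 => j _; rewrite rmorphXn expf_neq0 //; case: (LP j) => _ [].
have Qv j : j != i -> vanish (P j) (m j) Q.
  move=> ji; apply: ideal_powM; rewrite (bigD1 j) //= mulrC; apply: ideal_powM.
  have [h1 [_ h2]] := LP j; have /(vanish1_eval _ h1) v1 := h2 ji.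
  exact: vanish_exp.
pose i1 := lift ord0 ord0 : 'I_3; pose i2 := lift ord0 (lift ord0 ord0) : 'I_3.
pose y j := lsub (invmx M) ('X_j : {mpoly K[3]}).
have y1 j : j != ord0 -> vanish (P i) 1 (y j).
  move=> j0; rewrite /vanish (ideal_powP _ _ uM pM) /ordM lsubVK // => u.
  have j1 : w01 j = 1%N by rewrite /w01 lt0n; move: j0; rewrite -(inj_eq val_inj) => ->.
  by rewrite msuppX inE => /eqP ->; rewrite /mwt (bigD1 j) // j1 mul1n mnm1E eqxx.
have yhom j : y j \is 1.-homog by apply: lsub_homog; apply: dhomogX1.
pose B (a : 'I_(m i).+1) := y i1 ^+ a * y i2 ^+ (m i - a).
have BP a : I m d (B a * Q).
  have aE : (a + (m i - a) = m i)%N by have := ltn_ord a; lia.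
  have hB : B a \is (m i).-homog.
    rewrite -aE; apply: dhomogM; rewrite -[X in X.-homog]mul1n; apply: dhomogMn; exact: yhom.
  split=> [j|]; last first.
    have -> : d = (m i + (d - m i))%N by move: md; rewrite (bigD1 i) //=; lia.
    exact: dhomogM.
  have [->|ji] := eqVneq j i; last by apply: ideal_powM; apply: Qv.
  rewrite mulrC; apply: ideal_powM; rewrite -{1}aE.
  by apply: vanishM; apply: vanish_exp; apply: y1.
have [N [e [Ie ie se]]] := dim_quot_exists (subspace_fat m d) (subspace_fat (bump m i) d) (fin_dim_fat m d).
rewrite {2}/h0 (dim_quot_hdim _ _ (@subspace_bump m i d) (fin_dim_fat m d) (ex_intro _ e (And3 Ie ie se)));
  try exact: subspace_fat.
rewrite addnC leq_add2r.
apply: (indep_le_span (subspace_fat (bump m i) d) se BP) => c [/(_ i)].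
rewrite /bump eqxx addn1.
under eq_bigr => a _ do rewrite scalerAl; rewrite -mulr_suml mulrC.
move/(vanish_div Q0); rewrite subn0 /vanish (ideal_powP _ _ uM pM) /ordM => hB _ a.
have BE : lsub M (\sum_a c a *: B a) = \sum_a c a *: 'X_[(U_(i1) *+ a + U_(i2) *+ (m i - a))%MM].
  rewrite lsub_sum; apply: eq_bigr => b _; rewrite lsubZ lsubM !lsubXn.
  by rewrite !lsubVK // mpolyXD !mpolyXn.
pose mon b := (U_(i1) *+ b + U_(i2) *+ (m i - b))%MM : 'X_{1..3}.
have mon1 b : mon b i1 = b by rewrite mnmDE !mulmnE !mnm1E /= mul0n mul1n addn0.
have cE : (lsub M (\sum_a c a *: B a))@_(mon a) = c a.
  rewrite BE raddf_sum (bigD1 a) //= mcoeffZ mcoeffX eqxx mulr1 big1 ?addr0 // => b ba.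
  rewrite mcoeffZ mcoeffX; case: eqP => [E|]; last by rewrite mulr0.
  by move: ba; rewrite -(inj_eq val_inj) /= -(mon1 b) -[val a]/(nat_of_ord a) -(mon1 a) /mon E eqxx.
rewrite -cE; apply: memN_msupp_eq0; apply/negP => /hB.
rewrite /mwt !big_ord_recl big_ord0 /w01 /= mul0n !mul1n add0n addn0.
rewrite -/i1 -/i2 mon1 mnmDE !mulmnE !mnm1E /= mul0n mul1n add0n.
by have := ltn_ord a; lia.
Qed.

(** Independence is needed only before the last increase of a multiplicity, where the sum is one
    less; hence d + 1 and not d in the hypothesis. *)
Lemma h0_eq_chi m d : (\sum_i m i <= d.+1)%N -> (h0 m d)%:Z = chi m d.
Proof.
elim/mult_ind: m => [|m i IH]; first by rewrite chi0 h0_0.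
rewrite sum_bump ltnS => md; have := h0_bump_ge i md; have := h0_bump_le m i d.
by rewrite chi_bump -IH; [lia|apply: leq_trans md _].
Qed.

End Counting.

Lemma bin2Z (d : nat) : 2 * 'C(d + 2, 2)%:Z = (d%:Z + 2) * (d%:Z + 1) :> int.
Proof.
have := bin_ffact (d + 2) 2; rewrite addn2 ffactnS ffactn1 /= (_ : 2`! = 2)%N //.
by move: 'C(d.+2, 2) => c h; nia.
Qed.

Lemma bin2Z' (m : nat) : 2 * 'C(m + 1, 2)%:Z = (m%:Z + 1) * m%:Z :> int.
Proof. by case: m => [|m]; [rewrite bin_small|rewrite addSnnS bin2Z; lia]. Qed.

Lemma sumZ (I : Type) (r : seq I) (F : I -> nat) :
  (\sum_(i <- r) F i)%N%:Z = \sum_(i <- r) (F i)%:Z :> int.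
Proof. exact: (big_morph Posz PoszD (erefl _)). Qed.

Lemma chi2 n (m : 'I_n -> nat) d :
  2 * chi m d = (d%:Z + 2) * (d%:Z + 1) - \sum_i ((m i)%:Z + 1) * (m i)%:Z.
Proof.
rewrite /chi mulrBr bin2Z mulr_sumr; congr (_ - _).
by apply: eq_bigr => i _; rewrite bin2Z'.
Qed.

Section MulMap.
Variables (K : fieldType) (n : nat).
Implicit Types f g : {mpoly K[n]}.

Lemma lin_mul f : lin (fun x : {mpoly K[n]} => f * x).
Proof. by move=> a x y; rewrite mulrDr scalerAr. Qed.

Lemma mul_inj f x : f != 0 -> f * x = 0 -> x = 0.
Proof. by move=> f0 /eqP; rewrite mulf_eq0 (negPf f0) => /eqP. Qed.

Lemma hdim_mul f (V : {mpoly K[n]} -> Prop) : f != 0 -> subspace V -> fin_dim V ->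
  hdim (image (fun x => f * x) V) = hdim V.
Proof. by move=> f0 sV fV; apply: hdim_image_inj => //; [exact: lin_mul|move=> x _; exact: mul_inj]. Qed.

Lemma divides_sub_msub (a : {mpoly K[n]}) (psi : 'I_n -> {mpoly K[n]}) h :
  (forall i, divides a ('X_i - psi i)) -> divides a (h - msub psi h).
Proof.
move=> H.
have HX m : divides a ('X_[m] - msub psi 'X_[m]).
  rewrite mpolyXE_id msub_prod; elim/big_rec2: _ => [|i x y _ hx].
    by rewrite subrr; apply: divides0.
  by apply: divides_subM => //; rewrite msubXn msubX; apply: divides_subX.
rewrite (mpolyE h) msub_sum -sumrB.
elim/big_rec: _ => [|m x _ hx]; first exact: divides0.
apply: dividesD => //; rewrite msubZ -scalerBr -mul_mpolyC; exact: divides_mull.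
Qed.
End MulMap.

(** * Bezout's inequality with multiplicities *)

Section BezoutInequality.
Variables (K : closedFieldType) (n : nat) (P : 'I_n -> proj 2 K).
Hypothesis distP : distinct_points P.

(* The products of f with the forms vanishing l at the points, and of g with
   those vanishing k, are among the forms vanishing k + l, of known dimension. *)
Theorem bezout_inequality f g d e (k l : 'I_n -> nat) :
  irreducible_elt f -> f \is d.-homog -> g \is e.-homog ->
  (forall i, vanish (P i) (k i) f) -> (forall i, vanish (P i) (l i) g) ->
  ~ divides f g -> (\sum_i k i * l i <= d * e)%N.
Proof.
move=> fi hf hg kf lg nfg.
have f0 : f != 0 by case: fi.
have g0 : g != 0 by apply/eqP => g0; apply: nfg; rewrite g0; apply: divides0.
pose S := (\sum_i (k i + l i))%N; pose kl i := (k i + l i)%N.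
pose V := image (fun x => f * x) (fat_ideal_deg P l (S + e)).
pose W := image (fun x => g * x) (fat_ideal_deg P k (S + d)).
pose T := image (fun x => f * g * x) (@form K 3 S).
have sV : subspace V by apply: subspace_image; [exact: lin_mul|exact: subspace_fat].
have sW : subspace W by apply: subspace_image; [exact: lin_mul|exact: subspace_fat].
have sT : subspace T by apply: subspace_image; [exact: lin_mul|exact: subspace_form].
have fV : fin_dim V by apply: fin_dim_image; [exact: lin_mul|exact: fin_dim_fat].
have fW : fin_dim W by apply: fin_dim_image; [exact: lin_mul|exact: fin_dim_fat].
have fT : fin_dim T by apply: fin_dim_image; [exact: lin_mul|exact: fin_dim_form].
have hV : hdim V = h0 P l (S + e) by apply: hdim_mul => //; [exact: subspace_fat|exact: fin_dim_fat].
have hW : hdim W = h0 P k (S + d) by apply: hdim_mul => //; [exact: subspace_fat|exact: fin_dim_fat].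
have hT : hdim T = 'C(S + 2, 2).
  rewrite -(hdim_form K 2 S); apply: hdim_mul; first by rewrite mulf_neq0.
    exact: subspace_form.
  exact: fin_dim_form.
have VW : (hdim (fun x => V x /\ W x) <= hdim T)%N.
  apply: hdimS => //; first exact: subspaceI.
  move=> _ [[a [va ha] ->] [b [vb hb] E]].
  have [b0|b0] := eqVneq b 0.
    by exists 0; [exact: subspace0 (subspace_form _ _ _)|rewrite E b0 !mulr0].
  have /(mpoly_irreducible_prime fi) [|[c bc]] : divides f (g * b) by exists a; rewrite -E mulrC.
    by move/nfg.
  have [_] := homog_quotient hb b0 hf bc; rewrite addnK => hc.
  by exists c => //; rewrite E bc; ring.
have sub x : sum_sub V W x -> fat_ideal_deg P kl (S + d + e) x.
  move=> [_ [_ [[a Ia ->] [b Ib ->] ->]]]; apply: subspaceD; first exact: subspace_fat.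
    have := fatM (conj kf hf : fat_ideal_deg P k d f) Ia.
    by rewrite [X in fat_ideal_deg _ _ X](_ : _ = S + d + e)%N //; lia.
  have := fatM (conj lg hg : fat_ideal_deg P l e g) Ib.
  rewrite [X in fat_ideal_deg _ _ X](_ : _ = S + d + e)%N; last by lia.
  by apply: fatW => i; rewrite /kl addnC.
have le1 : (hdim (sum_sub V W) <= h0 P kl (S + d + e))%N.
  by apply: hdimS sub _; [exact: subspace_fat|exact: subspace_sum_sub|exact: fin_dim_fat].
have sumE := hdim_sum_sub sV sW fV fW.
have chiE : (h0 P kl (S + d + e))%:Z = chi kl (S + d + e).
  by apply: h0_eq_chi => //; rewrite -addnA -addnS leq_addr.
have c1 := chi_le_h0 P l (S + e); have c2 := chi_le_h0 P k (S + d).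
(* The two summands are bounded below by [chi], their intersection above by the multiples of fg, and
   the ambient dimension is exact because S is the sum of all multiplicities. In the resulting
   inequality everything depending on S cancels and de - sum k_i l_i >= 0 remains. *)
have big : 2 * chi l (S + e) + 2 * chi k (S + d) <= 2 * chi kl (S + d + e) + 2 * 'C(S + 2, 2)%:Z.
  by rewrite -chiE; lia.
move: big; rewrite !chi2 bin2Z !PoszD.
have -> : \sum_i ((kl i)%:Z + 1) * (kl i)%:Z = \sum_i ((k i)%:Z + 1) * (k i)%:Z
    + \sum_i ((l i)%:Z + 1) * (l i)%:Z + 2 * \sum_i (k i)%:Z * (l i)%:Z.
  rewrite mulr_sumr -!big_split; apply: eq_bigr => i _; rewrite /kl PoszD /=; ring.
have -> : \sum_i (k i)%:Z * (l i)%:Z = (\sum_i k i * l i)%N%:Z.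
  by rewrite sumZ; apply: eq_bigr => i _; rewrite PoszM.
move: (\sum_i ((k i)%:Z + 1) * (k i)%:Z) (\sum_i ((l i)%:Z + 1) * (l i)%:Z) (\sum_i k i * l i)%N.
by move=> A B C h; nia.
Qed.

End BezoutInequality.

(** * Restriction to a line missing the points *)

Section LineRestriction.
Variables (K : closedFieldType) (n : nat) (P : 'I_n -> proj 2 K).

(** In coordinates where the line is X_0 = 0, restriction sets X_0 to zero; its kernel consists of
    the multiples of the line, and both coordinates of P^1 lift to linear forms. *)
Lemma line_restriction : exists (phi : 'I_3 -> {mpoly K[2]}) (l : {mpoly K[3]}),
  [/\ forall j, phi j \is 1.-homog, [/\ l \is 1.-homog, l != 0 & forall i, l.@[P i] != 0],
    msub phi l = 0, (forall f, msub phi f = 0 -> divides l f)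
    & forall j, exists2 y, y \is 1.-homog & msub phi y = 'X_j].
Proof.
have [c c0 lc] := common_nonvanishing_line P.
have [N uN Nc] := exists_frame c0.
pose rest (i : 'I_3) : {mpoly K[2]} := if unlift ord0 i is Some j then 'X_j else 0.
pose M := invmx N^T.
have uN' : N^T \in unitmx by rewrite unitmx_tr.
have uM : M \in unitmx by rewrite unitmx_inv.
pose phi j := msub rest (lsub M 'X_j).
have phiE f : msub phi f = msub rest (lsub M f).
  by rewrite lsubE msub_comp; apply: eq_msub => j; rewrite /phi lsubE msubX.
have resthom j : rest j \is 1.-homog.
  by rewrite /rest; case: unliftP => [i _|_]; [apply: dhomogX1|apply: dhomog0].
have lE : lform c = lsub N^T 'X_ord0.
  by rewrite lsubE msubX /lform; apply: eq_bigr => i _; rewrite mxE Nc.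
have N_M f : lsub M (lsub N^T f) = f by rewrite -[M]/(invmx _) lsubK.
have M_N f : lsub N^T (lsub M f) = f by rewrite -[M]/(invmx _) lsubVK.
exists phi, (lform c); split.
- by move=> j; apply: msub_homog1 => //; apply: lsub_homog; apply: dhomogX1.
- split=> //; first exact: lform_homog.
  rewrite lE; apply: lsub_neq0 => //; by rewrite -msize_poly_eq0 msizeX.
- by rewrite phiE lE N_M msubX /rest unlift_none.
- move=> f; rewrite phiE => f0.
  pose back (i : 'I_2) : {mpoly K[3]} := 'X_(lift ord0 i).
  pose psi i := msub back (rest i).
  have : divides 'X_ord0 (lsub M f - msub psi (lsub M f)).
    apply: divides_sub_msub => i; rewrite /psi /rest; case: unliftP => [j ->|->].
      by rewrite msubX subrr; apply: divides0.
    by rewrite msub0 subr0; apply: divides_refl.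
  rewrite -msub_comp f0 msub0 subr0 => [[x E]].
  by exists (lsub N^T x); rewrite lE -lsubM -E M_N.
- move=> j; exists (lsub N^T 'X_(lift ord0 j)); first by apply: lsub_homog; apply: dhomogX1.
  by rewrite phiE N_M msubX /rest liftK.
Qed.

Lemma im_muM m t f g : fat_ideal_deg P m t f -> g \is 1.-homog -> im_mu P m t (f * g).
Proof. by move=> hf hg; exists 1%N, (fun=> f), (fun=> g); split=> //; rewrite big_ord1. Qed.

Lemma im_muD m t x y : im_mu P m t x -> im_mu P m t y -> im_mu P m t (x + y).
Proof.
move=> [a [f [g [hf hg ->]]]] [b [f' [g' [hf' hg' ->]]]].
exists (a + b)%N, (fun i => match split i with inl j => f j | inr j => f' j end),
  (fun i => match split i with inl j => g j | inr j => g' j end); split.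
- by move=> i; case: split.
- by move=> i; case: split.
rewrite big_split_ord; congr (_ + _); apply: eq_bigr => i _.
  by rewrite (unsplitK (inl i)).
by rewrite (unsplitK (inr i)).
Qed.

Lemma im_mu0 m t : im_mu P m t 0.
Proof. by exists 0%N, (fun=> 0), (fun=> 0); split=> [[]//|[]//|]; rewrite big_ord0. Qed.

Lemma subspace_im_mu m t : subspace (im_mu P m t).
Proof.
split=> [|a x y [k [f [g [hf hg ->]]]] hy]; first exact: im_mu0.
apply: im_muD => //; rewrite scaler_sumr.
exists k, (fun i => a *: f i), g; split=> // [i|].
  by apply: subspaceZ => //; apply: subspace_fat.
by apply: eq_bigr => i _; rewrite scalerAl.
Qed.

Lemma im_mu_sub m t x : im_mu P m t x -> fat_ideal_deg P m t.+1 x.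
Proof.
move=> [k [f [g [hf hg ->]]]]; apply: subspace_sum; first exact: subspace_fat.
move=> i; have [v h] := hf i; split; last by have := dhomogM h (hg i); rewrite addn1.
by move=> j; rewrite mulrC; apply: ideal_powM.
Qed.

Lemma fin_dim_im_mu m t : fin_dim (im_mu P m t).
Proof. by apply: fin_dimS (fin_dim_fat P m t.+1) => x; apply: im_mu_sub. Qed.

Lemma chiS (m : 'I_n -> nat) d : chi m d.+1 = chi m d + (d + 2)%N%:Z :> int.
Proof. by rewrite /chi addSn binS bin1; lia. Qed.

Lemma fat_div_line l (m : 'I_n -> nat) d f : l \is 1.-homog -> l != 0 ->
  (forall i, l.@[P i] != 0) ->
  fat_ideal_deg P m d.+1 (l * f) -> fat_ideal_deg P m d f.
Proof.
move=> hl l0 lP [v h].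
have [->|f0] := eqVneq f 0; first exact: subspace0 (subspace_fat _ _ _).
have [_] := homog_quotient (f := l * f) (g := l) (x := f) h (mulf_neq0 l0 f0) hl (mulrC _ _).
rewrite subn1 => hf; split=> // i.
by have := vanish_div (mult0_eval hl (lP i)) (v i); rewrite subn0.
Qed.

(** Castelnuovo-Mumford regularity. If H^1 vanishes in degree d, then it does in degree d + 1, and
    restriction to the line is onto in degree d + 1. A form h of degree d + 2 restricts to a U + b
    V; lifting a and b changes h by elements of the image of the multiplication map until it is a
    multiple of the line, and the quotient is again in the system of degree d + 1. *)
Lemma line_step (m : 'I_n -> nat) d : (h0 P m d)%:Z <= chi m d ->
  (h0 P m d.+1)%:Z <= chi m d.+1 /\
  forall h, fat_ideal_deg P m d.+2 h -> im_mu P m d.+1 h.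
Proof.
move=> hd; have [phi [l [phi1 [l1 l0 lP] phil kerl lift_line]]] := line_restriction.
have lphi : lin (msub phi) := @lin_msub _ _ _ phi.
have ker_le e : (hdim (fun x => fat_ideal_deg P m e.+1 x /\ msub phi x = 0%R) <= h0 P m e)%N.
  rewrite /h0 -(hdim_mul (f := l) l0 (subspace_fat P m e) (fin_dim_fat P m e)).
  apply: hdimS.
  - by apply: subspace_image; [exact: lin_mul|exact: subspace_fat].
  - apply: subspaceI; first exact: subspace_fat.
    exact: (subspace_preim lphi (W := zero_sub) (@subspace_zero _ _)).
  - move=> f [hf /kerl [x fE]]; exists x; last by rewrite fE mulrC.
    by apply: (fat_div_line l1 l0 lP); rewrite mulrC -fE.
  - by apply: fin_dim_image; [exact: lin_mul|exact: fin_dim_fat].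
have im_sub e x : image (msub phi) (fat_ideal_deg P m e) x -> @form K 2 e x.
  move=> [f [_ hf] ->]; exact: msub_homog1.
have form2 e : hdim (@form K 2 e) = e.+1 by rewrite hdim_form addn1 bin1.
have im_le e : (hdim (image (msub phi) (fat_ideal_deg P m e)) <= e.+1)%N.
  rewrite -(form2 e); apply: hdimS (@im_sub e) _; first exact: subspace_form.
    by apply: subspace_image => //; apply: subspace_fat.
  exact: fin_dim_form.
have rn e : (h0 P m e.+1 <= hdim (image (msub phi) (fat_ideal_deg P m e.+1)) + h0 P m e)%N.
  rewrite {1}/h0 (hdim_image lphi (subspace_fat P m e.+1) (fin_dim_fat P m e.+1)).
  by rewrite leq_add2l; exact: ker_le.
split.
  by have := rn d; have := im_le d.+1; rewrite chiS; move: hd; lia.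
have onto g : g \is d.+1.-homog -> image (msub phi) (fat_ideal_deg P m d.+1) g.
  apply: (hdim_eq (subspace_form _ _ _) _ (@im_sub d.+1) (fin_dim_form _ _ _)).
    by apply: subspace_image => //; apply: subspace_fat.
  rewrite form2; have := rn d; have := chi_le_h0 P m d.+1.
  by rewrite chiS; move: hd; lia.
move=> h hh; have [y0 hy0 y0E] := lift_line ord0; have [y1 hy1 y1E] := lift_line ord_max.
have hphi : msub phi h \is d.+2.-homog by apply: im_sub; exists h.
have [a [b [ha hb abE]]] : exists a b : {mpoly K[2]}, [/\ a \is d.+1.-homog, b \is d.+1.-homog
    & msub phi h = a * 'X_ord0 + b * 'X_ord_max].
  pose G (g : {mpoly K[2]}) := exists a b : {mpoly K[2]}, [/\ a \is d.+1.-homog, b \is d.+1.-homog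
    & g = a * 'X_ord0 + b * 'X_ord_max].
  rewrite (mpolyE (msub phi h)) big_seq.
  apply: (big_ind G) => [|_ _ [a [b [ha hb ->]]] [a' [b' [ha' hb' ->]]]|u uf].
  - by exists 0, 0; split; rewrite ?dhomog0 // !mul0r addr0.
  - by exists (a + a'), (b + b'); split; rewrite ?rpredD // !mulrDl addrACA.
  have du : mdeg u = d.+2 := dhomog_mf hphi uf.
  have uE (i : 'I_2) : (0 < u i)%N -> exists2 v : {mpoly K[2]}, v \is d.+1.-homog & 'X_[u] = v * 'X_i.
    move=> ui; have le : (U_(i) <= u)%MM by rewrite lep1mP -lt0n.
    exists 'X_[u - U_(i)]; last by rewrite -mpolyXD submK.
    rewrite dhomogX; apply/eqP; change (mdeg (u - U_(i))%MM = d.+1).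
    by have := mdegD (u - U_(i)) U_(i); rewrite submK // du mdeg1 addn1 => -[].
  have : (0 < u ord0)%N || (0 < u ord_max)%N.
    rewrite -addn_gt0; move: du; rewrite mdegE !big_ord_recl big_ord0 addn0 => du.
    by rewrite (_ : ord_max = lift ord0 ord0) ?du //; apply: val_inj.
  case/orP => /uE[v hv ->].
    by exists ((msub phi h)@_u *: v), 0; split; rewrite ?dhomog0 ?rpredZ // mul0r addr0 scalerAl.
  by exists 0, ((msub phi h)@_u *: v); split; rewrite ?dhomog0 ?rpredZ // mul0r add0r scalerAl.
have [f hf fE] := onto _ ha; have [g hg gE] := onto _ hb.
pose r := h - (f * y0 + g * y1).
have r0 : msub phi r = 0.
  by rewrite /r msubB msubD !msubM y0E y1E -fE -gE abE subrr.
have muE : im_mu P m d.+1 (f * y0 + g * y1) by apply: im_muD; apply: im_muM.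
have [x rE] := kerl _ r0.
have hx : fat_ideal_deg P m d.+1 x.
  apply: (fat_div_line l1 l0 lP); rewrite mulrC -rE.
  by apply: subspaceB hh _; [exact: subspace_fat|exact: im_mu_sub].
have -> : h = x * l + (f * y0 + g * y1) by rewrite -rE /r subrK.
by apply: im_muD => //; apply: im_muM.
Qed.

End LineRestriction.

(** * Binary forms *)

Lemma homog_scale (R : comNzRingType) n d (f : {mpoly R[n]}) c x :
  f \is d.-homog -> f.@[fun i => c * x i] = c ^+ d * f.@[x].
Proof.
move=> hf; rewrite !mevalE mulr_sumr big_seq [RHS]big_seq; apply: eq_bigr => m mf.
rewrite mulrCA; congr (_ * _); have <- : mdeg m = d := dhomog_mf hf mf.
rewrite mdegE -prodrXr -big_split /=; apply: eq_bigr => i _; exact: exprMn.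
Qed.

Lemma ord2P (i : 'I_2) : i = ord0 \/ i = ord_max.
Proof. by case: i => [[|[|i]] li] //; [left|right]; apply: val_inj. Qed.

Section BinaryForms.
Variable K : closedFieldType.
Local Notation B := {mpoly K[2]}.
Implicit Types (a b h : B) (w : proj 1 K).
Local Notation U := ('X_ord0 : B).
Local Notation V := ('X_ord_max : B).

Definition pt2 (s t : K) : 'I_2 -> K := fun i => if i == ord0 then s else t.

Lemma mpoly_eq0 n (f : {mpoly K[n]}) : (forall v, f.@[v] = 0) -> f = 0.
Proof.
move=> h; apply/eqP/negPn/negP => /mpoly_nonvanish[v]; by rewrite h eqxx.
Qed.

Lemma eval_pt2 h w : h.@[w] = h.@[pt2 (w ord0) (w ord_max)].
Proof. by apply: meval_eq => i; rewrite /pt2; case: (ord2P i) => ->. Qed.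

Definition root_line w : B := w ord_max *: U - w ord0 *: V.

Lemma root_line_homog w : root_line w \is 1.-homog.
Proof. by rewrite rpredB // rpredZ // dhomogX1. Qed.

Lemma root_line_eval w (v : 'I_2 -> K) : (root_line w).@[v] = w ord_max * v ord0 - w ord0 * v ord_max.
Proof. by rewrite mevalB !mevalZ !mevalXU. Qed.

Lemma proj1_neq0 w : w ord0 != 0 \/ w ord_max != 0.
Proof. by have [i] := coords_neq0 w; case: (ord2P i) => -> h; [left|right]. Qed.

Lemma root_line_neq0 w : root_line w != 0.
Proof.
apply/eqP => E; have e1 := root_line_eval w (pt2 1 0); have e2 := root_line_eval w (pt2 0 1).
move: e1 e2; rewrite E !meval0 /pt2 /= !mulr1 !mulr0 subr0 sub0r => /esym h1 /esym /eqP.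
by rewrite oppr_eq0; case: (proj1_neq0 w) => /negPf; rewrite ?h1 ?eqxx // => ->.
Qed.

Lemma root_line_divides h d w : h \is d.-homog -> h.@[w] = 0 -> divides (root_line w) h.
Proof.
move=> hh hw; case: (proj1_neq0 w) => w0.
- pose psi i : B := (w i / w ord0) *: U.
  have : divides (root_line w) (h - msub psi h).
    apply: divides_sub_msub => i; rewrite /psi; case: (ord2P i) => ->.
      by rewrite divff // scale1r subrr; apply: divides0.
    exists (- (w ord0)^-1)%:MP; rewrite mul_mpolyC /root_line scalerBr !scalerA !mulNr mulVf //.
    by rewrite scaleN1r opprK scaleNr addrC mulrC.
  suff -> : msub psi h = 0 by rewrite subr0.
  apply: mpoly_eq0 => v; rewrite msub_eval (meval_eq (v2 := fun i => (v ord0 / w ord0) * w i)).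
    by rewrite (homog_scale _ _ hh) hw mulr0.
  by move=> i; rewrite /psi mevalZ mevalXU; ring.
- pose psi i : B := (w i / w ord_max) *: V.
  have : divides (root_line w) (h - msub psi h).
    apply: divides_sub_msub => i; rewrite /psi; case: (ord2P i) => ->; last first.
      by rewrite divff // scale1r subrr; apply: divides0.
    exists ((w ord_max)^-1)%:MP; rewrite mul_mpolyC /root_line scalerBr !scalerA mulVf //.
    by rewrite scale1r mulrC.
  suff -> : msub psi h = 0 by rewrite subr0.
  apply: mpoly_eq0 => v; rewrite msub_eval (meval_eq (v2 := fun i => (v ord_max / w ord_max) * w i)).
    by rewrite (homog_scale _ _ hh) hw mulr0.
  by move=> i; rewrite /psi mevalZ mevalXU; ring.
Qed.

Lemma proj1_exists s t : s != 0 \/ t != 0 -> exists w : proj 1 K, w ord0 = s /\ w ord_max = t.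
Proof.
move=> st; have ex : exists i, pt2 s t i != 0 by case: st => h; [exists ord0|exists ord_max].
by exists (Proj ex).
Qed.

Lemma binary_root h d : (0 < d)%N -> h \is d.-homog -> exists w, h.@[w] = 0.
Proof.
move=> d0 hh; pose q := mmap (@polyC K) (fun i => if i == ord0 then 'X else 1) h.
have qE x : q.[x] = h.@[pt2 x 1].
  pose G : {rmorphism B -> K} := horner_eval x \o mmap (@polyC K) (fun i => if i == ord0 then 'X else 1).
  apply: (mpoly_rmorph_ext (F := G) (G := meval (pt2 x 1))) => [c|i]; rewrite /G /=.
    by rewrite mmapC mevalC /horner_eval hornerC.
  by rewrite mmapX mmap1U mevalXU /horner_eval /pt2; case: eqP => _; rewrite ?hornerX ?hornerC.
(* A nonzero constant dehomogenization means that h = c V^d, whose root (1:0) lies at infinity. *)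
have [/size_poly1P[c _ qc]|/closed_rootP[x /eqP qx]] := boolP (size q == 1); last first.
  have [|w [w0 w1]] := @proj1_exists x 1; first by right; rewrite oner_eq0.
  by exists w; rewrite eval_pt2 w0 w1 -qE.
have [|w [w0 w1]] := @proj1_exists 1 0; first by left; rewrite oner_eq0.
exists w; suff -> : h = c *: V ^+ d.
  by rewrite mevalZ rmorphXn /= mevalXU w1 expr0n (gtn_eqF d0) mulr0.
have V0 : V != 0 by rewrite -msize_poly_eq0 msizeX.
apply: (mulfI V0); apply/eqP; rewrite -subr_eq0; apply/eqP; apply: mpoly_eq0 => v.
rewrite mevalB !mevalM mevalZ rmorphXn /= mevalXU.
have [->|v1] := eqVneq (v ord_max) 0; first by rewrite !mul0r subrr.
have -> : h.@[v] = v ord_max ^+ d * h.@[pt2 (v ord0 / v ord_max) 1].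
  rewrite -(homog_scale _ _ hh); apply: meval_eq => i; rewrite /pt2.
  by case: (ord2P i) => ->; rewrite ?mulr1 // mulrC divfK.
by rewrite -qE qc hornerC; ring.
Qed.

Lemma no_common_zero_coprime a b d e : a != 0 -> a \is d.-homog -> b \is e.-homog ->
  (forall w, a.@[w] = 0 -> b.@[w] = 0 -> False) -> coprime_elt a b.
Proof.
move=> a0 ha hb no; apply: coprime_of_no_common => // p ip pa [y by_].
have hp := homog_divides ha a0 pa; have [p0 pu _] := ip.
have dp : (0 < mdegree p)%N.
  rewrite lt0n; apply/negP => /eqP z; case/negP: pu; apply: homog0_unit => //.
  by rewrite -[X in X.-homog]z.
have [w pw] := binary_root dp hp; case: pa => x ax.
by apply: (no w); rewrite ?ax ?by_ mevalM pw mulr0.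
Qed.

(** Multiples of a and of b meet only in multiples of ab, so the span has dimension 2(N + 1) - (N -
    c + 1) = c + N + 1, that of all forms of degree c + N. *)
Lemma coprime_span a b c N : a != 0 -> b != 0 -> a \is c.-homog -> b \is c.-homog ->
  coprime_elt a b -> (c <= N)%N -> forall h, h \is (c + N).-homog ->
  exists x y, [/\ x \is N.-homog, y \is N.-homog & h = a * x + b * y].
Proof.
move=> a0 b0 ha hb cop cN.
pose A := image (fun x => a * x) (@form K 2 N); pose C := image (fun x => b * x) (@form K 2 N).
have sA : subspace A by apply: subspace_image; [exact: lin_mul|exact: subspace_form].
have sC : subspace C by apply: subspace_image; [exact: lin_mul|exact: subspace_form].
have fA : fin_dim A by apply: fin_dim_image; [exact: lin_mul|exact: fin_dim_form].
have fC : fin_dim C by apply: fin_dim_image; [exact: lin_mul|exact: fin_dim_form].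
have hform e : hdim (@form K 2 e) = e.+1 by rewrite hdim_form addn1 bin1.
have hA : hdim A = N.+1 by rewrite -(hform N); apply: hdim_mul => //; [exact: subspace_form|exact: fin_dim_form].
have hC : hdim C = N.+1 by rewrite -(hform N); apply: hdim_mul => //; [exact: subspace_form|exact: fin_dim_form].
pose T := image (fun x => a * b * x) (@form K 2 (N - c)).
have hT : hdim T = (N - c).+1.
  rewrite -(hform (N - c)%N); apply: hdim_mul; first by rewrite mulf_neq0.
    exact: subspace_form.
  exact: fin_dim_form.
have AC : (hdim (fun x => A x /\ C x) <= hdim T)%N.
  apply: hdimS; [| |move=> _ [[x hx ->] [y hy E]]|].
  - by apply: subspace_image; [exact: lin_mul|exact: subspace_form].
  - exact: subspaceI.
  - have [y0|y0] := eqVneq y 0.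
      by exists 0; [exact: dhomog0|rewrite E y0 !mulr0].
    have /cop[z yz] : divides a (b * y) by exists x; rewrite -E mulrC.
    have [_ hz] := homog_quotient hy y0 ha yz.
    by exists z => //; rewrite E yz; ring.
  - by apply: fin_dim_image; [exact: lin_mul|exact: fin_dim_form].
have sub x : sum_sub A C x -> @form K 2 (c + N) x.
  move=> [_ [_ [[y hy ->] [z hz ->] ->]]]; apply: rpredD; exact: dhomogM.
have sumE := hdim_sum_sub sA sC fA fC.
move=> h hh; have [|_ [_ [[x hx ->] [y hy ->] ->]]] := hdim_eq (subspace_form _ _ _) (subspace_sum_sub sA sC) sub
  (fin_dim_form _ _ _) _ hh; last by exists x, y.
by rewrite hform; lia.
Qed.

Lemma binary_gcd (x y : B) e : x \is e.-homog -> y \is e.-homog -> x != 0 \/ y != 0 ->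
  exists (r : nat) (th a b : B), [/\ (r <= e)%N, th \is r.-homog,
    a \is (e - r).-homog /\ b \is (e - r).-homog,
    (forall w, a.@[w] = 0 -> b.@[w] = 0 -> False) & x = a * th /\ y = b * th].
Proof.
elim: e x y => [|e IH] x y hx hy xy.
  exists 0%N, 1, x, y; split; rewrite ?dhomog1 ?mulr1 ?subn0 //.
  move=> w xw yw; case: xy => /negP[]; apply/eqP.
    by rewrite (homog0_const hx); move: xw; rewrite {1}(homog0_const hx) mevalC => ->; rewrite mpolyC0.
  by rewrite (homog0_const hy); move: yw; rewrite {1}(homog0_const hy) mevalC => ->; rewrite mpolyC0.
case: (classic (exists w, x.@[w] = 0 /\ y.@[w] = 0)) => [[w [xw yw]]|no]; last first.
  exists 0%N, 1, x, y; split; rewrite ?dhomog1 ?mulr1 ?subn0 //.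
  by move=> w xw yw; apply: no; exists w.
have [x' xE] := root_line_divides hx xw; have [y' yE] := root_line_divides hy yw.
have quot h h' : h \is e.+1.-homog -> h = h' * root_line w -> h' \is e.-homog.
  move=> hh hE; have [z|h0] := eqVneq h 0.
    have /eqP : h' * root_line w = 0 by rewrite -hE.
    by rewrite mulf_eq0 (negPf (root_line_neq0 w)) orbF => /eqP ->; apply: dhomog0.
  by have [_] := homog_quotient hh h0 (root_line_homog w) hE; rewrite subn1.
have [||| r [th [a [b [re hth [ha hb] no [aE bE]]]]]] := IH x' y'.
- exact: quot hx xE.
- exact: quot hy yE.
- by case: xy => h; [left|right]; apply: contraNneq h => z; rewrite ?xE ?yE z mul0r.
exists r.+1, (th * root_line w), a, b; split=> //.
- by have := dhomogM hth (root_line_homog w); rewrite addn1.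
- by rewrite xE yE aE bE !mulrA.
Qed.

End BinaryForms.

(** * Parametrized rational curves *)

Lemma conditions_bound (r0 s d k : nat) : (d <= r0 + s)%N -> (d <= r0)%N -> (s - k <= (r0 + s - d).+1)%N.
Proof. lia. Qed.

(** Here a is a rank and b the dimension of the kernel, for forms of degree r0 + s vanishing to
    order s at a point of multiplicity k on a curve of degree d. The quadratic terms in s cancel:
    the rank is linear in s with slope d - k. *)
Lemma hilbert_arith (r0 s d k a b : nat) : (d <= r0 + s)%N -> (k <= s)%N ->
  2 * (a + b)%N%:Z = ((r0 + s)%N%:Z + 2) * ((r0 + s)%N%:Z + 1) - (s%:Z + 1) * s%:Z :> int ->
  2 * b%:Z = ((r0 + s - d)%N%:Z + 2) * ((r0 + s - d)%N%:Z + 1) - ((s - k)%N%:Z + 1) * (s - k)%N%:Z :> int ->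
  2 * a%:Z = 2 * s%:Z * (d%:Z - k%:Z) + d%:Z * (2 * r0%:Z + 3 - d%:Z) - k%:Z + k%:Z * k%:Z :> int.
Proof.
move=> dr ks; rewrite -!subzn // !PoszD => h1 h2.
have -> : 2 * a%:Z = 2 * (a%:Z + b%:Z) - 2 * b%:Z :> int by ring.
by rewrite h1 h2; ring.
Qed.

(** A comparison of slopes: I grows like s (d - k) and dominates a function of slope e - r. The
    explicit s is large enough for a slope exceeding d - k to beat the constant terms. [upper_arith]
    is the reverse comparison. *)
Lemma lower_arith (e r d k r0 N : nat) (I : nat -> nat) : (r <= e)%N -> (k <= d)%N ->
  (forall s, (k <= s)%N -> 2 * (I s)%:Z = 2 * s%:Z * (d%:Z - k%:Z) + d%:Z * (2 * r0%:Z + 3 - d%:Z)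
     - k%:Z + k%:Z * k%:Z :> int) ->
  (forall s, (k <= s)%N -> ((N + s * (e - r)).+1 <= I s)%N) -> (e + k <= d + r)%N.
Proof.
move=> re kd IE lo; rewrite leqNgt; apply/negP => lt.
pose s := (k + (d * (2 * r0 + 3) + k * k))%N.
have ks : (k <= s)%N by apply: leq_addr.
have le : (s * (d - k).+1 <= s * (e - r))%N by rewrite leq_mul2l; apply/orP; right; lia.
have := IE s ks; have := lo s ks.
have : (s * (d - k).+1)%N%:Z = s%:Z * (d%:Z - k%:Z) + s%:Z :> int.
  by rewrite PoszM -addn1 PoszD -subzn //; ring.
have : s%:Z = k%:Z + (d%:Z * (2 * r0%:Z + 3) + k%:Z * k%:Z) :> int.
  by rewrite /s !PoszD !PoszM PoszD PoszM.
have : 0 <= d%:Z * d%:Z :> int by rewrite Num.Theory.mulr_ge0.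
have : 0 <= k%:Z * k%:Z :> int by rewrite Num.Theory.mulr_ge0.
move: (s * (e - r))%N (s * (d - k).+1)%N le (I s) => u v le i k2 d2 sE vE lo' IE'.
have : 2 * i%:Z = 2 * (v%:Z - s%:Z) + (s%:Z - k%:Z - k%:Z * k%:Z) - d%:Z * d%:Z - k%:Z + k%:Z * k%:Z :> int.
  by rewrite IE' vE [X in _ + (X - _ - _)]sE; ring.
by move: lo' le d2 k2; clear; move: (d%:Z * d%:Z) (k%:Z * k%:Z) => D2 K2; lia.
Qed.

Lemma upper_arith (e r d k r0 : nat) (I : nat -> nat) : (r <= e)%N -> (k <= d)%N ->
  (forall s, (k <= s)%N -> 2 * (I s)%:Z = 2 * s%:Z * (d%:Z - k%:Z) + d%:Z * (2 * r0%:Z + 3 - d%:Z)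
     - k%:Z + k%:Z * k%:Z :> int) ->
  (forall s, (k <= s)%N -> (I s <= ((r0 + s) * e - s * r).+1)%N) -> (d + r <= e + k)%N.
Proof.
move=> re kd IE up; rewrite leqNgt; apply/negP => lt.
pose s := (k + (e * r0 + 2 + d * d))%N.
have ks : (k <= s)%N by apply: leq_addr.
have le : (s * (e - r).+1 <= s * (d - k))%N by rewrite leq_mul2l; apply/orP; right; lia.
have := IE s ks; have := up s ks.
have -> : ((r0 + s) * e - s * r = r0 * e + s * (e - r))%N.
  by rewrite mulnDl mulnBr addnBA // leq_mul2l re orbT.
have : (s * (d - k))%N%:Z = s%:Z * (d%:Z - k%:Z) :> int by rewrite PoszM -subzn.
have : s%:Z = k%:Z + (e%:Z * r0%:Z + 2 + d%:Z * d%:Z) :> int.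
  by rewrite /s !PoszD !PoszM.
have : 0 <= d%:Z * (2 * r0%:Z + 3) :> int by rewrite Num.Theory.mulr_ge0 // Num.Theory.addr_ge0 // Num.Theory.mulr_ge0.
have : 0 <= k%:Z * k%:Z :> int by rewrite Num.Theory.mulr_ge0.
have dd : 0 <= d%:Z * d%:Z :> int by rewrite Num.Theory.mulr_ge0.
have : (r0 * e)%N%:Z = e%:Z * r0%:Z :> int by rewrite PoszM mulrC.
rewrite mulnS in le.
move: (r0 * e)%N (s * (e - r))%N (s * (d - k))%N le (I s) => t u v le i tE k2 d2 sE vE up' IE'.
have : 2 * i%:Z = 2 * v%:Z + d%:Z * (2 * r0%:Z + 3) - d%:Z * d%:Z - k%:Z + k%:Z * k%:Z :> int.
  by rewrite IE' vE; ring.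
move: up' le d2 k2 tE sE dd; clear.
by move: (d%:Z * d%:Z) (k%:Z * k%:Z) (d%:Z * _) (e%:Z * _) => D2 K2 X Y; lia.
Qed.

Section ParametrizedCurve.
Variable K : closedFieldType.
Local Notation R := {mpoly K[3]}.
Local Notation B := {mpoly K[2]}.
Local Notation U := ('X_ord0 : B).
Local Notation V := ('X_ord_max : B).

Lemma var_neq0 n (i : 'I_n) : 'X_i != 0 :> {mpoly K[n]}.
Proof. by rewrite -msize_poly_eq0 msizeX. Qed.

Lemma hdim_binary e : hdim (@form K 2 e) = e.+1.
Proof. by rewrite hdim_form addn1 bin1. Qed.

Lemma span_no_common_zero (a b : B) c N : a \is c.-homog -> b \is c.-homog ->
  (forall w : proj 1 K, a.@[w] = 0 -> b.@[w] = 0 -> False) -> (c <= N)%N ->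
  forall h : B, h \is (c + N).-homog ->
  exists x y : B, [/\ x \is N.-homog, y \is N.-homog & h = a * x + b * y].
Proof.
move=> ha hb no cN h hh.
have one (b' : B) : b' \is c.-homog -> (forall w : proj 1 K, b'.@[w] = 0 -> False) ->
    exists2 y : B, y \is N.-homog & h = b' * y.
  move=> hb' nob; have c0 : c = 0%N.
    by apply/eqP; rewrite -leqn0 leqNgt; apply/negP => /binary_root/(_ hb')[w /nob].
  move: hb' hh; rewrite c0 add0n => hb' hh.
  have bu : b' \is a GRing.unit.
    apply: homog0_unit => //; apply/eqP => b0.
    have [|w _] := @proj1_exists K 1 1; first by left; rewrite oner_eq0.
    by apply: (nob w); rewrite b0 meval0.
  exists (b'^-1 * h); last by rewrite mulVKr.
  have [->|h0] := eqVneq h 0; first by rewrite mulr0 dhomog0.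
  have hE : h = (b'^-1 * h) * b' by rewrite mulrAC mulVr // mul1r.
  by have [_] := homog_quotient hh h0 hb' hE; rewrite subn0.
have [a0|a0] := eqVneq a 0.
  have [y hy hE] : exists2 y : B, y \is N.-homog & h = b * y.
    by apply: one => // w; apply: no; rewrite a0 meval0.
  by exists 0, y; split; rewrite ?dhomog0 // mulr0 add0r.
have [b0|b0] := eqVneq b 0.
  have [y hy hE] : exists2 y : B, y \is N.-homog & h = a * y.
    by apply: one => // w aw; apply: (no w aw); rewrite b0 meval0.
  by exists y, 0; split; rewrite ?dhomog0 // mulr0 addr0.
exact: coprime_span a0 b0 ha hb (no_common_zero_coprime a0 ha hb no) cN h hh.
Qed.

Lemma msub_scale n k N (g : {mpoly K[k]}) (x : 'I_n -> {mpoly K[k]}) (h : {mpoly K[n]}) :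
  h \is N.-homog -> msub (fun i => g * x i) h = g ^+ N * msub x h.
Proof.
move=> hh; rewrite !msubE mulr_sumr big_seq [RHS]big_seq; apply: eq_bigr => m mf.
rewrite -scalerAr; congr (_ *: _); have <- : mdeg m = N := dhomog_mf hh mf.
by rewrite mdegE -prodrXr -big_split /=; apply: eq_bigr => i _; exact: exprMn.
Qed.

(** The coordinates dual to the rows of M. If the first row is the point p, then [coord M j1] and
    [coord M j2] span the pencil of lines through p. *)
Definition coord (M : 'M[K]_3) j : R := lsub (invmx M) 'X_j.

Lemma coord_homog M j : coord M j \is 1.-homog.
Proof. by apply: lsub_homog; apply: dhomogX1. Qed.

Lemma coord_eval (M : 'M[K]_3) i j : M \in unitmx -> (coord M j).@[M i] = (i == j)%:R.
Proof.
move=> uM; rewrite lsub_eval mevalXU.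
transitivity ((M *m invmx M) i j); last by rewrite mulmxV // mxE.
by rewrite mxE; apply: eq_bigr => l _; rewrite mulrC.
Qed.

Lemma coord_vanish (p : proj 2 K) (M : 'M[K]_3) j : M \in unitmx ->
  (forall i, M ord0 i = p i) -> j != ord0 -> vanish p 1 (coord M j).
Proof.
move=> uM pM j0; apply/(vanish1_eval _ (coord_homog M j)).
by rewrite -(meval_eq (v1 := M ord0)) // coord_eval // eq_sym (negPf j0).
Qed.

Definition j1 : 'I_3 := lift ord0 ord0.
Definition j2 : 'I_3 := lift ord0 (lift ord0 ord0).

Lemma ord3P (i : 'I_3) : [\/ i = ord0, i = j1 | i = j2].
Proof.
by case: i => [[|[|[|i]]] li] //; [constructor 1|constructor 2|constructor 3]; apply: val_inj.
Qed.

Lemma msub3E (y : 'I_3 -> R) h : msub y h = \sum_(m <- msupp h) h@_m *: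
  (y ord0 ^+ m ord0 * (y j1 ^+ m j1 * y j2 ^+ m j2)).
Proof. by rewrite msubE; apply: eq_bigr => m _; rewrite !big_ord_recl big_ord0 mulr1. Qed.

Lemma coord_expansion (M : 'M[K]_3) (f : R) : M \in unitmx ->
  f = \sum_(m <- msupp (lsub M f)) (lsub M f)@_m *:
        (coord M ord0 ^+ m ord0 * (coord M j1 ^+ m j1 * coord M j2 ^+ m j2)).
Proof.
move=> uM; rewrite -{1}(lsubK uM f) {1}lsubE msub3E; apply: eq_bigr => m _.
by rewrite /coord !lsubE !msubX.
Qed.

Variables (f : R) (d : nat) (phi : 'I_3 -> B) (e : nat) (A0 A1 : R) (E : nat).
Hypotheses (fi : irreducible_elt f) (hf : f \is d.-homog).
Hypothesis hphi : forall j, phi j \is e.-homog.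
Hypothesis nz : forall w : proj 1 K, exists j, (phi j).@[w] != 0.
Hypothesis phif : msub phi f = 0.
Hypotheses (hA0 : A0 \is E.-homog) (hA1 : A1 \is E.-homog).
Hypothesis nzA : msub phi A0 != 0 \/ msub phi A1 != 0.
Hypothesis birat : msub phi A0 * V = msub phi A1 * U.

Let f_neq0 : f != 0. Proof. by case: fi. Qed.

Let d_gt0 : (0 < d)%N.
Proof.
rewrite lt0n; apply/negP => /eqP d0; case: fi => _ /negP fu _; apply: fu.
by have := hf; rewrite d0; apply: homog0_unit.
Qed.

(** The relation between the pullbacks of A0 and A1 says that (A0 : A1) inverts phi up to a common
    factor g, extracted by coprimality of U and V. *)
Lemma birational_factor : exists g : B, [/\ g != 0, msub phi A0 = g * U & msub phi A1 = g * V].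
Proof.
have cop : coprime_elt U V.
  apply: (no_common_zero_coprime (d := 1) (e := 1)); rewrite ?var_neq0 ?dhomogX1 // => w.
  by rewrite !mevalXU; case: (proj1_neq0 w) => /eqP.
have [g gE] : divides U (msub phi A0).
  by apply: cop; exists (msub phi A1); rewrite mulrC.
have g1 : msub phi A1 = g * V.
  by apply: (mulIf (var_neq0 ord0)); rewrite -birat gE; ring.
exists g; split=> //; apply/eqP => g0; case: nzA => /negP[]; rewrite ?gE ?g1 g0 mul0r //.
Qed.

Let E_gt0 : (0 < E)%N.
Proof.
have [g [g0 gE _]] := birational_factor.
have h := msub_homog hphi hA0; rewrite lt0n; apply/negP => /eqP E0.
have n0 : msub phi A0 != 0 by rewrite gE mulf_neq0 // var_neq0.
have [] := homog_quotient h n0 (dhomogX1 _ ord0) gE; by rewrite E0 mul0n.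
Qed.

(** A ternary form that pulls back to g^N h: through the rational inverse the image of the
    restriction map contains g^N times every binary form of degree N. *)
Definition lift_form (h : B) : R := msub (fun i : 'I_2 => if i == ord0 then A0 else A1) h.

Lemma lift_form_homog h N : h \is N.-homog -> lift_form h \is (N * E).-homog.
Proof. by move=> hh; apply: msub_homog => // i; case: eqP. Qed.

Lemma lift_formE g h N : msub phi A0 = g * U -> msub phi A1 = g * V -> h \is N.-homog ->
  msub phi (lift_form h) = g ^+ N * h.
Proof.
move=> g0 g1 hh; rewrite /lift_form msub_comp -[in RHS](msub_id h) -(msub_scale g _ hh).
by apply: eq_msub => i; case: (ord2P i) => ->.
Qed.

Let lphi : lin (msub phi). Proof. exact: lin_msub. Qed.

Let Im s := image (msub phi) (@form K 3 s).
Let Ker s (h : R) := @form K 3 s h /\ msub phi h = 0.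

Let rank_nullity s : 'C(s + 2, 2) = (hdim (Im s) + hdim (Ker s))%N.
Proof. by rewrite -(hdim_form K 2 s); exact: (hdim_image lphi (subspace_form _ _ _) (fin_dim_form _ _ _)). Qed.

Let subKer s : subspace (Ker s).
Proof.
apply: subspaceI; first exact: subspace_form.
exact: (subspace_preim lphi (W := zero_sub) (@subspace_zero _ _)).
Qed.

Let finKer s : fin_dim (Ker s).
Proof. by apply: fin_dimS (fin_dim_form K 2 s) => h []. Qed.

Let Im_ge N : (N.+1 <= hdim (Im (N * E)))%N.
Proof.
have [g [g0 gE0 gE1]] := birational_factor.
have gN0 : g ^+ N != 0 by apply: expf_neq0.
rewrite -(hdim_binary N) -(hdim_mul gN0 (subspace_form _ _ _) (fin_dim_form _ _ _)).
apply: hdimS.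
- by apply: subspace_image => //; apply: subspace_form.
- by apply: subspace_image; [exact: lin_mul|exact: subspace_form].
- move=> _ [h hh ->]; exists (lift_form h); first exact: lift_form_homog.
  by rewrite (lift_formE gE0 gE1 hh).
- by apply: fin_dim_image => //; apply: fin_dim_form.
Qed.

(* Otherwise the ideal of the image would contain two coprime forms, so that
   the images of the spaces of forms would have bounded dimension. *)
Theorem kernel_principal k h : h \is k.-homog -> msub phi h = 0 -> divides f h.
Proof.
move=> hh phih; apply: NNPP => nfh.
have h_neq0 : h != 0 by apply/eqP => z; apply: nfh; rewrite z; apply: divides0.
(* Two coprime forms of degrees d and k in the kernel would bound the rank in degree s by dk, while
   the rank is at least N + 1. The summand d + k only ensures that s >= d + k. *)
pose N := (d * k + d + k)%N; pose s := (N * E)%N.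
have [S sE] : exists S, s = (S + d + k)%N.
  exists (s - (d + k))%N; rewrite -addnA subnK //.
  by apply: leq_trans (leq_pmulr N E_gt0); rewrite /N -addnA leq_addl.
pose W1 := image (fun x => f * x) (@form K 3 (S + k)); pose W2 := image (fun x => h * x) (@form K 3 (S + d)).
pose T := image (fun x => f * h * x) (@form K 3 S).
have s1 : subspace W1 by apply: subspace_image; [exact: lin_mul|exact: subspace_form].
have s2 : subspace W2 by apply: subspace_image; [exact: lin_mul|exact: subspace_form].
have sT : subspace T by apply: subspace_image; [exact: lin_mul|exact: subspace_form].
have f1 : fin_dim W1 by apply: fin_dim_image; [exact: lin_mul|exact: fin_dim_form].
have f2 : fin_dim W2 by apply: fin_dim_image; [exact: lin_mul|exact: fin_dim_form].
have fT : fin_dim T by apply: fin_dim_image; [exact: lin_mul|exact: fin_dim_form].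
have hd (x : R) t : x != 0 -> hdim (image (fun y => x * y) (@form K 3 t)) = 'C(t + 2, 2).
  by move=> x0; rewrite hdim_mul ?hdim_form //; [exact: subspace_form|exact: fin_dim_form].
have inter : (hdim (fun x => W1 x /\ W2 x) <= hdim T)%N.
  apply: hdimS => //; first exact: subspaceI.
  move=> _ [[a ha ->] [b hb ab]].
  have [b0|b0] := eqVneq b 0.
    by exists 0; [exact: dhomog0|rewrite ab b0 !mulr0].
  have /(mpoly_irreducible_prime fi) [//|[c bc]] : divides f (h * b) by exists a; rewrite -ab mulrC.
  have [_] := homog_quotient hb b0 hf bc; rewrite addnK => hc.
  by exists c => //; rewrite ab bc; ring.
have sub x : sum_sub W1 W2 x -> Ker s x.
  move=> [_ [_ [[a ha ->] [b hb ->] ->]]]; split.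
    have e1 : s = (d + (S + k))%N by rewrite sE addnCA addnA.
    have e2 : s = (k + (S + d))%N by rewrite sE addnC.
    by apply: rpredD; [rewrite e1|rewrite e2]; apply: dhomogM.
  by rewrite msubD !msubM phif phih !mul0r addr0.
have le := hdimS (subKer s) (subspace_sum_sub s1 s2) sub (finKer s).
have sumE := hdim_sum_sub s1 s2 f1 f2.
move: sumE inter; rewrite (hd f) // (hd h) // (hd (f * h)); last by rewrite mulf_neq0.
have rn := rank_nullity s; have imN : (N.+1 <= hdim (Im s))%N := Im_ge N.
have b1 := bin2Z s; have b2 := bin2Z (S + k); have b3 := bin2Z (S + d); have b4 := bin2Z S.
have idE : (s%:Z + 2) * (s%:Z + 1) - ((S + k)%:Z + 2) * ((S + k)%:Z + 1)
    - ((S + d)%:Z + 2) * ((S + d)%:Z + 1) + (S%:Z + 2) * (S%:Z + 1) = 2 * (d%:Z * k%:Z) :> int.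
  by rewrite sE !PoszD; ring.
move: imN le b1 b2 b3 b4 idE; rewrite rn /N -[(d%:Z * k%:Z)%R]PoszM.
move: (hdim _) (hdim _) (hdim _) (hdim _) => i1 i2 i3 i4 imN le b1 b2 b3 b4 idE sumE inter.
move: idE; rewrite -b1 -b2 -b3 -b4; move: (d * k)%N imN => dk imN idE.
by move: imN le sumE inter idE; clear; lia.
Qed.

Let Ker_mul s t (V0 : R -> Prop) (V1 : R -> Prop) : s = (d + t)%N -> subspace V1 -> fin_dim V1 ->
  (forall x, V0 x -> @form K 3 s x) -> (forall x, V1 x -> @form K 3 t x) ->
  (forall x, @form K 3 t x -> V0 (f * x) <-> V1 x) ->
  hdim (fun x => V0 x /\ msub phi x = 0%R) = hdim V1.
Proof.
move=> sE sV1 fV1 V0s V1t eqv; rewrite -(hdim_mul f_neq0 sV1 fV1); apply: eq_hdim => x; split.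
  move=> [vx px]; have hx : x \is s.-homog := V0s _ vx.
  have [z xE] := kernel_principal hx px.
  exists z; last by rewrite xE mulrC.
  have hz : z \is t.-homog.
    have [x0|x0] := eqVneq x 0.
      have /eqP : z * f = 0 by rewrite -xE.
      by rewrite mulf_eq0 (negPf f_neq0) orbF => /eqP ->; apply: dhomog0.
    by have [_] := homog_quotient hx x0 hf xE; rewrite sE addKn.
  by apply/eqv => //; rewrite mulrC -xE.
move=> [z vz ->]; split; last by rewrite msubM phif mul0r.
by apply/eqv => //; apply: V1t.
Qed.

(** * Branches of a parametrized curve over a point *)

Section AtPoint.
Variables (p : proj 2 K) (M : 'M[K]_3) (k : nat).
Hypotheses (uM : M \in unitmx) (pM : forall j, M ord0 j = p j) (fk : mult_at p f k).

Let l1 := coord M j1.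
Let l2 := coord M j2.

Let not_both_zero : msub phi l1 = 0 -> msub phi l2 = 0 -> False.
Proof.
move=> z1 z2.
have [x1 E1] := kernel_principal (coord_homog M j1) z1.
have [x2 E2] := kernel_principal (coord_homog M j2) z2.
have e11 := coord_eval j1 j1 uM; have e12 := coord_eval j1 j2 uM.
have e22 := coord_eval j2 j2 uM.
have l1n : coord M j1 != 0 by apply/eqP => z; move: e11; rewrite z meval0 => /esym/eqP; rewrite oner_eq0.
have l2n : coord M j2 != 0 by apply/eqP => z; move: e22; rewrite z meval0 => /esym/eqP; rewrite oner_eq0.
have [_ h1] := homog_quotient (coord_homog M j1) l1n hf E1.
have [_ h2] := homog_quotient (coord_homog M j2) l2n hf E2.
have d1 : (1 - d = 0)%N by apply/eqP; rewrite subn_eq0 d_gt0.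
move: h1 h2; rewrite d1 => /homog0_const h1 /homog0_const h2.
move: e11 e12 e22; rewrite E1 E2 h1 h2 !mevalM !mevalC /=.
move: (x1@_0%MM) (x2@_0%MM) => c1 c2 e11 /eqP; rewrite mulf_eq0 => /orP[/eqP ->|/eqP fz].
  by rewrite mul0r => /esym/eqP; rewrite oner_eq0.
by move: e11; rewrite fz mulr0 => /esym/eqP; rewrite oner_eq0.
Qed.

Let gcd_data : exists (r : nat) (th a b : B), [/\ (r <= e)%N, th \is r.-homog,
  a \is (e - r).-homog /\ b \is (e - r).-homog,
  (forall w : proj 1 K, a.@[w] = 0 -> b.@[w] = 0 -> False)
  & msub phi l1 = a * th /\ msub phi l2 = b * th].
Proof.
have hl j : msub phi (coord M j) \is e.-homog.
  by have := msub_homog hphi (coord_homog M j); rewrite mul1n.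
apply: binary_gcd; try exact: hl.
apply: NNPP => /not_or_and[/negP/negPn/eqP z1 /negP/negPn/eqP z2].
exact: not_both_zero z1 z2.
Qed.

Let P1 : 'I_1 -> proj 2 K := fun=> p.

Let dist1 : distinct_points P1.
Proof. by move=> i j; rewrite !ord1 eqxx. Qed.

Let Vs D s (x : R) := fat_ideal_deg P1 (fun=> s) D x.

Let VsE D s x : Vs D s x <-> vanish p s x /\ x \is D.-homog.
Proof. by split=> [[v h]|[v h]]; [split=> //; exact: (v ord0)|split]. Qed.

Let hdim_Vs D s : (s <= D.+1)%N -> 2 * (hdim (Vs D s))%:Z = (D%:Z + 2) * (D%:Z + 1) - (s%:Z + 1) * s%:Z :> int.
Proof.
move=> sD; have := h0_eq_chi dist1 (m := fun=> s) (d := D).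
by rewrite big_ord1 => /(_ sD); rewrite /h0 -/(Vs D s) => ->; rewrite chi2 big_ord1.
Qed.

Let k_le_d : (k <= d)%N.
Proof. by apply: vanish_le_deg hf f_neq0 (proj1 fk). Qed.

(** The kernel of restriction consists of f times forms vanishing to order s - k in degree r0 + s -
    d; both dimensions are known exactly. *)
Let hdim_Im_Vs r0 s : (d <= r0)%N -> (k <= s)%N ->
  2 * (hdim (image (msub phi) (Vs (r0 + s) s)))%:Z
    = 2 * s%:Z * (d%:Z - k%:Z) + d%:Z * (2 * r0%:Z + 3 - d%:Z) - k%:Z + k%:Z * k%:Z :> int.
Proof.
move=> dr ks; have sV := subspace_fat P1 (fun=> s) (r0 + s).
have rn := hdim_image lphi sV (fin_dim_fat _ _ _).
have drs : (d <= r0 + s)%N by apply: leq_trans dr (leq_addr _ _).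
have kerE : hdim (fun x => Vs (r0 + s) s x /\ msub phi x = 0%R) = hdim (Vs (r0 + s - d) (s - k)).
  apply: (Ker_mul (s := (r0 + s)%N) (t := (r0 + s - d)%N)).
  - by rewrite subnKC.
  - exact: subspace_fat.
  - exact: fin_dim_fat.
  - by move=> x [].
  - by move=> x [].
  move=> x hx; split=> [[v h]|[v h]]; apply/VsE; split=> //.
  - by apply: (vanish_div fk); exact: (v ord0).
  - by rewrite -(subnKC ks); apply: vanishM; [case: fk|exact: (v ord0)].
  - by have := dhomogM hf hx; rewrite subnKC.
have h1 : 2 * (hdim (Vs (r0 + s) s))%:Z = _ := hdim_Vs (leq_trans (leq_addl r0 s) (leqnSn _)).
have h2 : 2 * (hdim (Vs (r0 + s - d) (s - k)))%:Z = _ := hdim_Vs (conditions_bound k drs dr).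
move: rn h1 h2; rewrite -/(Vs _ _) kerE => ->.
exact: hilbert_arith drs ks.
Qed.

Let theta_divides (th a b : B) m x : msub phi l1 = a * th -> msub phi l2 = b * th ->
  vanish p m x -> divides (th ^+ m) (msub phi x).
Proof.
move=> E1 E2; rewrite /vanish (ideal_powP _ _ uM pM) => ordx.
rewrite (coord_expansion x uM) msub_sum big_seq.
elim/big_rec: _ => [|u y ux hy]; first exact: divides0.
apply: dividesD => //; rewrite msubZ -mul_mpolyC; apply: divides_mull.
rewrite !msubM !msubXn; apply: divides_mull.
have -> : msub phi (coord M j1) ^+ u j1 * msub phi (coord M j2) ^+ u j2
    = (a ^+ u j1 * b ^+ u j2) * th ^+ (u j1 + u j2).
  by rewrite -/l1 -/l2 E1 E2 !exprMn exprD mulrACA.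
apply: divides_mull.
have le : (m <= u j1 + u j2)%N.
  by apply: leq_trans (ordx u ux) _; rewrite /mwt !big_ord_recl big_ord0 /w01 /= mul0n !mul1n addn0.
by rewrite -(subnKC le) exprD; apply: divides_mulr; apply: divides_refl.
Qed.

(** Forms vanishing to order s + 1 include both coordinates through p times those of order s; since
    a and b have no common zero, all binary forms of the next degree are reached. *)
Let image_ge (r N : nat) (th a b g : B) : (e - r <= N)%N ->
  a \is (e - r).-homog -> b \is (e - r).-homog ->
  (forall w : proj 1 K, a.@[w] = 0 -> b.@[w] = 0 -> False) ->
  msub phi l1 = a * th -> msub phi l2 = b * th ->
  msub phi A0 = g * U -> msub phi A1 = g * V ->
  forall s H, H \is (N + s * (e - r)).-homog ->
  image (msub phi) (Vs (N * E + s) s) (g ^+ N * th ^+ s * H).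
Proof.
move=> cN ha hb no E1 E2 g0 g1; elim=> [|s IH] H hH.
  exists (lift_form H).
    by apply/VsE; split=> //; rewrite addn0; apply: lift_form_homog; rewrite mul0n addn0 in hH.
  by rewrite expr0 mulr1 (lift_formE g0 g1 (N := N)) //; rewrite mul0n addn0 in hH.
have hH' : H \is ((e - r) + (N + s * (e - r))).-homog by rewrite addnCA -mulSn.
have [x [y [hx hy HE]]] := span_no_common_zero ha hb no (leq_trans cN (leq_addr _ _)) hH'.
have [X /VsE[vX hX] XE] := IH x hx; have [Y /VsE[vY hY] YE] := IH y hy.
have step (l Z : R) : l \is 1.-homog -> vanish p 1 l -> vanish p s Z -> Z \is (N * E + s).-homog ->
    Vs (N * E + s.+1) s.+1 (l * Z).
  move=> hl vl vZ hZ; apply/VsE; split; first exact: vanishM vl vZ.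
  by have := dhomogM hl hZ; rewrite add1n addnS.
exists (l1 * X + l2 * Y).
  apply: subspaceD; first exact: subspace_fat.
    by apply: step => //; [exact: coord_homog|exact: (coord_vanish uM pM)].
  by apply: step => //; [exact: coord_homog|exact: (coord_vanish uM pM)].
rewrite msubD !msubM E1 E2 -XE -YE HE exprS.
by move: (g ^+ N) (th ^+ s) => G T; ring.
Qed.

(** Let [th] be the common factor, of degree r, of the pencil of lines through p pulled back to P^1.
    Forms vanishing to order s at p pull back to multiples of th^s, and in fixed codegree these
    images grow with s at rate e - r; counting forms gives the rate d - k. Equating the two rates
    replaces any local study of the branches. *)
Lemma curve_at_point : exists (r : nat) (th a b : B),
  [/\ (e + k = d + r)%N, th \is r.-homog /\ th != 0,
    a \is (e - r).-homog /\ b \is (e - r).-homog,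
    (forall w : proj 1 K, a.@[w] = 0 -> b.@[w] = 0 -> False)
    & [/\ msub phi (coord M j1) = a * th, msub phi (coord M j2) = b * th
       & forall m x, vanish p m x -> divides (th ^+ m) (msub phi x)]].
Proof.
have [r [th [a [b [re hth [ha hb] no [E1 E2]]]]]] := gcd_data.
exists r, th, a, b.
have [g [g0 gE0 gE1]] := birational_factor.
have thd m x := @theta_divides th a b m x E1 E2.
pose N := ((e - r) + d)%N.
have dr0 : (d <= N * E)%N by apply: leq_trans (leq_pmulr _ E_gt0); rewrite leq_addl.
have IE s ks := @hdim_Im_Vs (N * E)%N s dr0 ks.
have th0 : th != 0.
  apply/eqP => z.
  have z1 : msub phi l1 = 0 by rewrite E1 z mulr0.
  have z2 : msub phi l2 = 0 by rewrite E2 z mulr0.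
  exact: not_both_zero z1 z2.
have lower s : (k <= s)%N -> ((N + s * (e - r)).+1 <= hdim (image (msub phi) (Vs (N * E + s) s)))%N.
  move=> ks; have n0 : g ^+ N * th ^+ s != 0 by rewrite mulf_neq0 // expf_neq0.
  rewrite -(hdim_binary (N + s * (e - r))) -(hdim_mul n0 (subspace_form _ _ _) (fin_dim_form _ _ _)).
  apply: hdimS.
  - by apply: subspace_image => //; apply: subspace_fat.
  - by apply: subspace_image; [exact: lin_mul|exact: subspace_form].
  - by move=> _ [H hH ->]; exact: (image_ge (leq_addr _ _) ha hb no E1 E2 gE0 gE1).
  - by apply: fin_dim_image => //; apply: fin_dim_fat.
have upper s : (k <= s)%N ->
    (hdim (image (msub phi) (Vs (N * E + s) s)) <= ((N * E + s) * e - s * r).+1)%N.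
  move=> ks; have n0 : th ^+ s != 0 by apply: expf_neq0.
  rewrite -(hdim_binary ((N * E + s) * e - s * r)).
  rewrite -(hdim_mul n0 (subspace_form _ _ _) (fin_dim_form _ _ _)).
  apply: hdimS.
  - by apply: subspace_image; [exact: lin_mul|exact: subspace_form].
  - by apply: subspace_image => //; apply: subspace_fat.
  - move=> _ [x /VsE[vx hx] ->]; have [q qE] := thd _ _ vx.
    exists q; last by rewrite mulrC.
    have hx' := msub_homog hphi hx.
    have [z|x0] := eqVneq (msub phi x) 0.
      have /eqP : q * th ^+ s = 0 by rewrite -qE.
      by rewrite mulf_eq0 (negPf n0) orbF => /eqP ->; apply: dhomog0.
    by have [_] := homog_quotient hx' x0 (dhomogMn s hth) qE; rewrite [(r * s)%N]mulnC.
  - by apply: fin_dim_image; [exact: lin_mul|exact: fin_dim_form].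
split=> //; apply/eqP; rewrite eqn_leq; apply/andP; split.
  exact: (lower_arith re k_le_d IE lower).
exact: (upper_arith re k_le_d IE upper).
Qed.

End AtPoint.

End ParametrizedCurve.

Section Normalization.
Variable K : closedFieldType.
Local Notation R := {mpoly K[3]}.
Local Notation B := {mpoly K[2]}.

Lemma coord_decomposition (M : 'M[K]_3) (x : 'I_3 -> K) j : M \in unitmx ->
  x j = \sum_i (coord M i).@[x] * M i j.
Proof.
move=> uM; have /rowP/(_ j) : \row_i x i = \row_i x i *m invmx M *m M by rewrite mulmxKV.
rewrite !mxE => ->; apply: eq_bigr => i _; congr (_ * _).
rewrite lsub_eval mevalXU mxE; apply: eq_bigr => l _; by rewrite mxE mulrC.
Qed.

Lemma on_point (p : proj 2 K) (M : 'M[K]_3) (x : 'I_3 -> K) : M \in unitmx ->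
  (forall j, M ord0 j = p j) -> (coord M j1).@[x] = 0 -> (coord M j2).@[x] = 0 ->
  forall j, x j = (coord M ord0).@[x] * p j.
Proof.
move=> uM pM z1 z2 j; rewrite (coord_decomposition x j uM) !big_ord_recl big_ord0.
by rewrite -/j1 -/j2 z1 z2 !mul0r !addr0 pM.
Qed.

(** At a point off the curve k = 0, and [th] has no root, since a root would be mapped to that
    point; so r = 0 and the parametrization has degree e = d. At every other point the relation e +
    k = d + r then says that [th] has degree exactly the multiplicity k. *)
Theorem normalization_curve (f : R) (phi : 'I_3 -> B) d : irreducible_elt f -> f \is d.-homog ->
  normalization_P1 f phi ->
  [/\ forall j, phi j \is d.-homog, (forall w : proj 1 K, exists j, (phi j).@[w] != 0),
    msub phi f = 0, (forall k h, h \is k.-homog -> msub phi h = 0 -> divides f h)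
    & forall (p : proj 2 K) (M : 'M[K]_3) k, M \in unitmx -> (forall j, M ord0 j = p j) ->
      mult_at p f k -> exists (th a b : B),
      [/\ th \is k.-homog /\ th != 0, a \is (d - k).-homog /\ b \is (d - k).-homog,
        (forall w : proj 1 K, a.@[w] = 0 -> b.@[w] = 0 -> False)
        & [/\ msub phi (coord M j1) = a * th, msub phi (coord M j2) = b * th
          & forall m x, vanish p m x -> divides (th ^+ m) (msub phi x)]]].
Proof.
move=> fi hf [[e hphi] nz]; rewrite !msub_psubst => phif [E [A0 [A1 []]]].
rewrite !msub_psubst => hA0 hA1 nzA birat.
have atp p M k uM pM fk := @curve_at_point K f d phi e A0 A1 E fi hf hphi phif hA0 hA1 nzA birat p M k uM pM fk.
have ker k h hh hz := @kernel_principal K f d phi e A0 A1 E fi hf hphi phif hA0 hA1 nzA birat k h hh hz.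
have ed : e = d.
  have f0 : f != 0 by case: fi.
  have d0 : (0 < d)%N.
    rewrite lt0n; apply/negP => /eqP z; case: fi => _ /negP fu _; apply: fu.
    by have := hf; rewrite z; apply: homog0_unit.
  have [v fv] := mpoly_nonvanish f0.
  have [p pv] : exists p : proj 2 K, forall j, p j = v j.
    have ex : exists i, v i != 0.
      apply: NNPP => no; case/negP: fv; apply/eqP.
      rewrite -(meval_eq (v1 := fun i => 0 * v i)).
        by rewrite (homog_scale _ _ hf) expr0n (gtn_eqF d0) mul0r.
      move=> i; rewrite mul0r; apply/esym/eqP/negPn/negP => vi; apply: no; by exists i.
    by exists (Proj ex).
  have fp : f.@[p] != 0 by rewrite (meval_eq (v2 := v)).
  have [M uM pM] := frameP p.
  have [r [th [a [b [er [hth th0] _ _ [E1 E2 _]]]]]] := atp p M 0%N uM pM (mult0_eval hf fp).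
  have r0 : r = 0%N.
    apply/eqP; rewrite -leqn0 leqNgt; apply/negP => /binary_root/(_ hth)[w thw].
    pose x j := (phi j).@[w].
    have z j : j != ord0 -> (coord M j).@[x] = 0.
      by case: (ord3P j) => -> // _; rewrite -msub_eval ?E1 ?E2 mevalM thw mulr0.
    have xE := on_point uM pM (z j1 isT) (z j2 isT).
    have : f.@[x] = 0 by rewrite -msub_eval phif meval0.
    rewrite (meval_eq _ xE) (homog_scale _ _ hf) => /eqP; rewrite mulf_eq0 (negPf fp) orbF.
    rewrite expf_eq0 d0 /= => /eqP c0; have [j /eqP[]] := nz w.
    by rewrite -/(x j) xE c0 mul0r.
  by move: er; rewrite r0 !addn0.
rewrite ed in hphi atp; split=> // p M k uM pM fk.
have [r [th [a [b [er [hth th0] [ha hb] no [E1 E2 thd]]]]]] := atp p M k uM pM fk.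
move: er => /addnI kr; rewrite -kr in hth ha hb.
by exists th, a, b.
Qed.

End Normalization.

(** * Splitting types *)

Section Pairs.
Variables (K : fieldType) (E E' : lmodType K).

Lemma hdim_pair (V : E -> Prop) (W : E' -> Prop) : subspace V -> subspace W -> fin_dim V -> fin_dim W ->
  let VW (z : E * E') := V z.1 /\ W z.2 in
  [/\ subspace VW, fin_dim VW & hdim VW = (hdim V + hdim W)%N].
Proof.
move=> sV sW fV fW VW.
have [e [Ve ie se]] := hdimP sV fV; have [g [Wg ig sg]] := hdimP sW fW.
have sVW : subspace VW.
  split=> [|a x y [vx wx] [vy wy]]; first by split; apply: subspace0.
  by split; [case: sV => _; apply|case: sW => _; apply].
pose b (i : 'I_(hdim V + hdim W)) : E * E' := match split i with inl j => (e j, 0) | inr k => (0, g k) end.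
have bE (c : 'I_(hdim V + hdim W) -> K) : \sum_i c i *: b i
    = (\sum_j c (lshift _ j) *: e j, \sum_k c (rshift _ k) *: g k).
  rewrite big_split_ord /= /b.
  under eq_bigr => j _ do rewrite (unsplitK (inl j)).
  under [X in _ + X]eq_bigr => j _ do rewrite (unsplitK (inr j)).
  have h1 (I : Type) (r : seq I) (F : I -> E) : \sum_(i <- r) ((F i, 0) : E * E') = (\sum_(i <- r) F i, 0).
    elim: r => [|i r IH]; first by rewrite !big_nil.
    by rewrite !big_cons IH; congr pair; rewrite /= addr0.
  have h2 (I : Type) (r : seq I) (F : I -> E') : \sum_(i <- r) ((0, F i) : E * E') = (0, \sum_(i <- r) F i).
    elim: r => [|i r IH]; first by rewrite !big_nil.
    by rewrite !big_cons IH; congr pair; rewrite /= addr0.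
  transitivity (\sum_j ((c (lshift _ j) *: e j, 0) : E * E') + \sum_k ((0, c (rshift _ k) *: g k) : E * E')).
    by congr (_ + _); apply: eq_bigr => j _; congr pair; rewrite /= scaler0.
  by rewrite h1 h2; congr pair; rewrite /= ?addr0 ?add0r.
have dVW : is_dim VW (hdim V + hdim W).
  exists b; split.
  - by move=> i; rewrite /b; case: split => j; split; by [exact: Ve|exact: Wg|exact: subspace0].
  - move=> c; rewrite /zero_sub bE => -[c1 c2] i.
    rewrite -(splitK i); case: split => j /=.
      exact: (ie (fun j => c (lshift _ j)) c1).
    exact: (ig (fun j => c (rshift _ j)) c2).
  - move=> [x y] [/se[c1] /subr0_eq /= ->] /sg[c2] /subr0_eq /= ->.
    exists (fun i => match split i with inl j => c1 j | inr k => c2 k end).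
    apply/eqP; rewrite subr_eq0 bE; apply/eqP; congr pair; apply: eq_bigr => j _.
      by rewrite (unsplitK (inl j)).
    by rewrite (unsplitK (inr j)).
split=> //; [exact: is_dim_fin dVW|exact: is_dimE dVW].
Qed.
End Pairs.

Section Syzygies.
Variable K : closedFieldType.
Local Notation B := {mpoly K[2]}.
Local Notation U := ('X_ord0 : B).
Local Notation V := ('X_ord_max : B).
Implicit Types (x y q : 'I_3 -> B) (w : proj 1 K).

Lemma binary_eq0 (F : B) : (forall w, F.@[w] = 0) -> F = 0.
Proof.
move=> h; apply: (mulfI (var_neq0 K (ord0 : 'I_2))); rewrite mulr0; apply: mpoly_eq0 => v.
rewrite mevalM mevalXU; have [->|v0] := eqVneq (v ord0) 0; first by rewrite mul0r.
have ex : exists i, v i != 0 by exists ord0.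
by rewrite [F.@[v]](h (Proj ex)) mulr0.
Qed.

Definition no_common_zero x := forall w, exists j, (x j).@[w] != 0.

Definition parallel x y := forall i j, x i * y j = x j * y i.

(** Every divisor m of x_i divides y_i, by induction on its degree: at a root of m some other x_j is
    nonzero, and parallelism forces y_i to vanish there once more. For m = x_i this gives the
    factor. *)
Lemma parallel_multiple x y c c' : (forall i, x i \is c.-homog) -> (forall i, y i \is c'.-homog) ->
  no_common_zero x -> parallel x y ->
  exists al : B, [/\ forall i, y i = al * x i, al \is (c' - c).-homog & (c' < c)%N -> al = 0].
Proof.
move=> hx hy nzx par.
have [w0 _] := @proj1_exists K 1 1 (or_introl (oner_neq0 K)).
have [i xiw] := nzx w0.
have xi0 : x i != 0 by apply: contraNneq xiw => ->; rewrite meval0.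
have div n : forall (m s : B), m \is n.-homog -> m != 0 -> x i = s * m -> divides m (y i).
  elim: n => [|n IH] m s hm m0 E; first by apply: divides_unitl; exact: homog0_unit.
  have [w mw] := binary_root (ltn0Sn n) hm.
  have [m' mE] := root_line_divides hm mw.
  have m'0 : m' != 0 by apply: contraNneq m0 => z; rewrite mE z mul0r.
  have [_] := homog_quotient hm m0 (root_line_homog w) mE; rewrite subn1 => hm'.
  have [z yE] : divides m' (y i).
    by apply: (IH m' (s * root_line w)) => //; rewrite E mE; ring.
  have [j xj] := nzx w.
  have zE : x j * z = root_line w * s * y j.
    apply: (mulfI m'0); have -> : m' * (x j * z) = x j * y i by rewrite yE; ring.
    by rewrite -par E mE; ring.
  have rw : (root_line w).@[w] = 0 by rewrite root_line_eval mulrC subrr.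
  have zw : z.@[w] = 0.
    have /eqP := congr1 (meval w) zE; rewrite !mevalM rw !mul0r mulf_eq0 (negPf xj) /=.
    by move/eqP.
  have hz : z \is (c' - n).-homog.
    have [z0|y0] := eqVneq (y i) 0.
      have /eqP : z * m' = 0 by rewrite -yE.
      by rewrite mulf_eq0 (negPf m'0) orbF => /eqP ->; apply: dhomog0.
    by have [_] := homog_quotient (hy i) y0 hm' yE.
  have [z' zzE] := root_line_divides hz zw.
  by exists z'; rewrite yE zzE mE; ring.
have [al yE] : divides (x i) (y i).
  by apply: (div c (x i) 1) => //; rewrite mul1r.
have allE j : y j = al * x j.
  by apply: (mulfI xi0); rewrite par yE; ring.
have [y0|y0] := eqVneq (y i) 0.
  have al0 : al = 0.
    have /eqP : al * x i = 0 by rewrite -yE.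
    by rewrite mulf_eq0 (negPf xi0) orbF => /eqP.
  by exists al; split=> //; rewrite al0 dhomog0.
have [le hal] := homog_quotient (hy i) y0 (hx i) yE.
by exists al; split=> //; rewrite ltnNge le.
Qed.

Definition cross x y : 'I_3 -> B := fun i =>
  if i == ord0 then x j1 * y j2 - x j2 * y j1
  else if i == j1 then x j2 * y ord0 - x ord0 * y j2
  else x ord0 * y j1 - x j1 * y ord0.

Definition dot x y : B := x ord0 * y ord0 + x j1 * y j1 + x j2 * y j2.

Lemma dotE x y : \sum_j x j * y j = dot x y.
Proof. by rewrite !big_ord_recl big_ord0 addr0 addrA. Qed.

Lemma cross_homog x y a b : (forall i, x i \is (a).-homog) -> (forall i, y i \is b.-homog) ->
  forall i, cross x y i \is (a + b).-homog.
Proof. by move=> hx hy i; rewrite /cross; do 2?case: ifP => _; rewrite rpredB // dhomogM. Qed.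

Lemma cross_parallel x y phi : dot phi x = 0 -> dot phi y = 0 -> parallel (cross x y) phi.
Proof.
move=> hx hy.
have E01 : cross x y ord0 * phi j1 = cross x y j1 * phi ord0.
  apply/eqP; rewrite -subr_eq0 /cross /=; apply/eqP.
  transitivity (y j2 * dot phi x - x j2 * dot phi y); first by rewrite /dot; ring.
  by rewrite hx hy !mulr0 subrr.
have E02 : cross x y ord0 * phi j2 = cross x y j2 * phi ord0.
  apply/eqP; rewrite -subr_eq0 /cross /=; apply/eqP.
  transitivity (x j1 * dot phi y - y j1 * dot phi x); first by rewrite /dot; ring.
  by rewrite hx hy !mulr0 subrr.
have E12 : cross x y j1 * phi j2 = cross x y j2 * phi j1.
  apply/eqP; rewrite -subr_eq0 /cross /=; apply/eqP.
  transitivity (y ord0 * dot phi x - x ord0 * dot phi y); first by rewrite /dot; ring.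
  by rewrite hx hy !mulr0 subrr.
by move=> i j; case: (ord3P i) => ->; case: (ord3P j) => ->.
Qed.

Lemma parallel_sym x y : parallel x y -> parallel y x.
Proof. by move=> h i j; rewrite mulrC -h mulrC. Qed.

Lemma cross0_parallel x y : (forall i, cross x y i = 0) -> parallel x y.
Proof.
move=> h.
have E12 : x j1 * y j2 = x j2 * y j1 by apply/eqP; rewrite -subr_eq0; have := h ord0; rewrite /cross /= => ->.
have E20 : x j2 * y ord0 = x ord0 * y j2 by apply/eqP; rewrite -subr_eq0; have := h j1; rewrite /cross /= => ->.
have E01 : x ord0 * y j1 = x j1 * y ord0 by apply/eqP; rewrite -subr_eq0; have := h j2; rewrite /cross /= => ->.
by move=> i j; case: (ord3P i) => ->; case: (ord3P j) => ->.
Qed.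

Lemma parallel_both_eq0 q1 q2 y : parallel y q1 -> parallel y q2 -> (exists i, cross q1 q2 i != 0) ->
  forall i, y i = 0.
Proof.
move=> p1 p2 [l cl] i.
have E j k : y i * (q1 j * q2 k - q1 k * q2 j) = 0.
  have -> : y i * (q1 j * q2 k - q1 k * q2 j) = (y i * q1 j) * q2 k - (y i * q1 k) * q2 j by ring.
  rewrite p1 (p1 i k).
  have -> : y j * q1 i * q2 k - y k * q1 i * q2 j = q1 i * (y j * q2 k - y k * q2 j) by ring.
  by rewrite p2 subrr mulr0.
have /eqP : y i * cross q1 q2 l = 0 by rewrite /cross; do 2?case: ifP => _; apply: E.
by rewrite mulf_eq0 (negPf cl) orbF => /eqP.
Qed.

Section Given.
Variables (phi q1 q2 : 'I_3 -> B) (d a b : nat).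
Hypotheses (hphi : forall j, phi j \is d.-homog) (nzphi : no_common_zero phi).
Hypotheses (hq1 : forall j, q1 j \is (a).-homog) (hq2 : forall j, q2 j \is b.-homog).
Hypothesis basis : forall w : proj 1 K,
  [/\ \sum_j (phi j).@[w] * (q1 j).@[w] = 0, \sum_j (phi j).@[w] * (q2 j).@[w] = 0
    & row_free (\matrix_(i < 2, j < 3) (if i == ord0 then q1 j else q2 j).@[w])].

Let N := cross q1 q2.

Let dot1 : dot phi q1 = 0.
Proof.
apply: binary_eq0 => w; have [E _ _] := basis w; rewrite -dotE rmorph_sum /= -[RHS]E.
by apply: eq_bigr => j _; rewrite mevalM.
Qed.

Let dot2 : dot phi q2 = 0.
Proof.
apply: binary_eq0 => w; have [_ E _] := basis w; rewrite -dotE rmorph_sum /= -[RHS]E.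
by apply: eq_bigr => j _; rewrite mevalM.
Qed.

Let nzN : no_common_zero N.
Proof.
move=> w; have [_ _] := basis w; set A := \matrix_(i, j) _ => fA.
have rowsA (u v : K) : (forall j, u * (q1 j).@[w] + v * (q2 j).@[w] = 0) -> u = 0 /\ v = 0.
  move=> h; pose r : 'rV[K]_2 := \row_i (if i == ord0 then u else v).
  have rA : r *m A = 0 *m A.
    rewrite mul0mx; apply/rowP => j; rewrite !mxE !big_ord_recl big_ord0 !mxE /= addr0.
    exact: h.
  have /rowP rE := row_free_inj fA rA.
  by have := rE ord0; have := rE ord_max; rewrite !mxE /=.
apply: NNPP => no; have {no} z j : (N j).@[w] = 0.
  by apply/eqP/negPn/negP => h; apply: no; exists j.
have := z ord0; have := z j1; have := z j2; rewrite /N /cross /= !mevalB !mevalM.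
move=> /subr0_eq e01 /subr0_eq e20 /subr0_eq e12.
have par i j : (q1 i).@[w] * (q2 j).@[w] = (q1 j).@[w] * (q2 i).@[w].
  by case: (ord3P i) => ->; case: (ord3P j) => ->.
have [i q1i] : exists i, (q1 i).@[w] != 0.
  apply: NNPP => no; have [|h _] := @rowsA 1 0.
    by move=> j; rewrite mul0r addr0 mul1r; apply/eqP/negPn/negP => h; apply: no; exists j.
  by move/eqP: h; rewrite oner_eq0.
have [|h1 h2] := @rowsA ((q2 i).@[w]) (- (q1 i).@[w]).
  by move=> j; rewrite mulNr (par i j) mulrC subrr.
by move/eqP: h2; rewrite oppr_eq0 (negPf q1i).
Qed.

Let parN : parallel N phi. Proof. exact: cross_parallel dot1 dot2. Qed.

Let hN i : N i \is (a + b).-homog. Proof. exact: cross_homog. Qed.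

(** The cross product of q1 and q2 has no common zero and is parallel to phi; each is then a
    multiple of the other, and the degrees a + b and d agree. *)
Lemma splitting_sum : (a + b = d)%N.
Proof.
have [al [alE hal _]] := parallel_multiple hN hphi nzN parN.
have [be [beE hbe _]] := parallel_multiple hphi hN nzphi (parallel_sym parN).
have [w0 _] := @proj1_exists K 1 1 (or_introl (oner_neq0 K)).
have [i pi] := nzphi w0; have [j Nj] := nzN w0.
have p0 : phi i != 0 by apply: contraNneq pi => ->; rewrite meval0.
have N0 : N j != 0 by apply: contraNneq Nj => ->; rewrite meval0.
have [le1 _] := homog_quotient (hphi i) p0 (hN i) (alE i).
have [le2 _] := homog_quotient (hN j) N0 (hphi j) (beE j).
by apply/eqP; rewrite eqn_leq le1 le2.
Qed.

(** Cramer's rule: the cross products of x with q2 and of q1 with x are multiples of phi, and these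
    multiples, divided by the nonzero constant relating the cross product of q1, q2 to phi, are the
    coefficients. *)
Lemma syzygy_decomposition dl x : (forall j, x j \is dl.-homog) -> dot phi x = 0 ->
  exists al be : B, [/\ al \is (dl - a).-homog, be \is (dl - b).-homog,
    (dl < a)%N -> al = 0, (dl < b)%N -> be = 0 & forall j, x j = al * q1 j + be * q2 j].
Proof.
move=> hx dx; have abd := splitting_sum.
have [be [beE hbe _]] := parallel_multiple hphi hN nzphi (parallel_sym parN).
have [al1 [al1E hal1 al10]] := parallel_multiple hphi (cross_homog hx hq2) nzphi
  (parallel_sym (cross_parallel dx dot2)).
have [be1 [be1E hbe1 be10]] := parallel_multiple hphi (cross_homog hq1 hx) nzphi
  (parallel_sym (cross_parallel dot1 dx)).
move: hbe hal1 hbe1 al10 be10; rewrite -abd subnn subnDr subnDl ltn_add2r ltn_add2l.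
move=> hbe hal1 hbe1 al10 be10.
have be0 : be != 0.
  have [w0 _] := @proj1_exists K 1 1 (or_introl (oner_neq0 K)).
  have [j Nj] := nzN w0; apply: contraNneq Nj => z; by rewrite beE z mul0r meval0.
have ube := homog0_unit be0 hbe.
have bE := homog0_const hbe; set c := be@_0%MM in bE.
pose y j := be * x j - al1 * q1 j - be1 * q2 j.
have y1 : parallel y q2.
  apply: cross0_parallel => i.
  have -> : cross y q2 i = be * cross x q2 i - al1 * cross q1 q2 i.
    by rewrite /cross /y; do 2?case: ifP => _; ring.
  by rewrite al1E -/N beE; ring.
have y2 : parallel y q1.
  apply: cross0_parallel => i.
  have -> : cross y q1 i = - (be * cross q1 x i) + be1 * cross q1 q2 i.
    by rewrite /cross /y; do 2?case: ifP => _; ring.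
  by rewrite be1E -/N beE; ring.
have exN : exists i, N i != 0.
  have [w0 _] := @proj1_exists K 1 1 (or_introl (oner_neq0 K)).
  by have [j Nj] := nzN w0; exists j; apply: contraNneq Nj => ->; rewrite meval0.
have y0 := parallel_both_eq0 y2 y1 exN.
have hbeV : be^-1 \is 0.-homog.
  have c0 : c != 0 by apply: contraNneq be0 => z; rewrite bE z mpolyC0.
  have -> : be^-1 = c^-1%:MP.
    apply: (mulfI be0); rewrite mulrV // {1}bE -mpolyCM divff //.
  by rewrite -[_%:MP]mulr1 mul_mpolyC rpredZ // dhomog1.
exists (be^-1 * al1), (be^-1 * be1); split.
- exact: dhomogM hbeV hal1.
- exact: dhomogM hbeV hbe1.
- by move=> lt; rewrite al10 ?mulr0.
- by move=> lt; rewrite be10 ?mulr0.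
- move=> j; have := y0 j; rewrite /y => /eqP; rewrite subr_eq0 subr_eq => /eqP E.
  by apply: (mulfI be0); rewrite E mulrDr !mulrA mulrV // !mul1r addrC.
Qed.

(** The [phi j] are the coordinates restricted to the curve; this is the image of multiplication by
    linear forms on binary forms of degree dl. *)
Definition span_phi dl (h : B) := exists x : 'I_3 -> B, (forall j, x j \is dl.-homog) /\ h = dot phi x.

Lemma subspace_span_phi dl : subspace (span_phi dl).
Proof.
split=> [|s h h' [x [hx ->]] [y [hy ->]]].
  by exists (fun=> 0); split=> [j|]; [exact: dhomog0|rewrite /dot !mulr0 !addr0].
exists (fun j => s *: x j + y j); split=> [j|]; first by rewrite rpredD // rpredZ.
by rewrite /dot -!mul_mpolyC; ring.
Qed.

Lemma span_phi_homog dl h : span_phi dl h -> h \is (dl + d).-homog.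
Proof.
by move=> [x [hx ->]]; rewrite /dot addnC !rpredD // dhomogM.
Qed.

(** The kernel of the map from triples of forms of degree dl is the space of syzygies, of dimension
    at most (dl + 1 - a)^+ + (dl + 1 - b)^+. Since a + b = d, the defect from dl + d + 1 is at most
    (a - dl - 1)^+ + (b - dl - 1)^+, the h^1 of the twisted pullback of Omega(1). *)
Lemma hdim_span_phi dl : (dl + d + 1 <= hdim (span_phi dl) + ((a - dl.+1) + (b - dl.+1)))%N.
Proof.
pose F := @form K 2 dl.
have sF : subspace F by exact: subspace_form.
have fF : fin_dim F by exact: fin_dim_form.
have [s2 f2 h2] := hdim_pair sF sF fF fF.
have [s3 f3 h3] := hdim_pair s2 sF f2 fF.
set T := (fun z : B * B * B => _) in s3 f3 h3.
pose vec (z : B * B * B) : 'I_3 -> B := fun i => if i == ord0 then z.1.1 else if i == j1 then z.1.2 else z.2.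
pose D (z : B * B * B) := dot phi (vec z).
have lD : lin D by move=> s z z'; rewrite /D /dot /vec /= -!mul_mpolyC; ring.
have hT : hdim T = (3 * dl.+1)%N by rewrite h3 h2 hdim_binary; lia.
have rn := hdim_image lD s3 f3.
have imE : hdim (image D T) = hdim (span_phi dl).
  apply: eq_hdim => h; split=> [[z [[z0 z1] z2] ->]|[x [hx ->]]].
    by exists (vec z); split=> // j; rewrite /vec; do 2?case: ifP.
  by exists (x ord0, x j1, x j2); first by split; [split; exact: hx|exact: hx].
pose I1 := image (fun al : B => ((al * q1 ord0, al * q1 j1, al * q1 j2) : B * B * B))
  (fun al => al \is (dl - a).-homog /\ ((dl < a)%N -> al = 0)).
pose I2 := image (fun al : B => ((al * q2 ord0, al * q2 j1, al * q2 j2) : B * B * B))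
  (fun al => al \is (dl - b).-homog /\ ((dl < b)%N -> al = 0)).
have lq (q : 'I_3 -> B) : lin (fun al : B => ((al * q ord0, al * q j1, al * q j2) : B * B * B)).
  by move=> s u v; congr (_, _, _); rewrite mulrDl -scalerAl.
have sG t : subspace (fun al : B => al \is (dl - t).-homog /\ ((dl < t)%N -> al = 0)).
  split=> [|s u v [hu u0] [hv v0]]; first by split=> //; exact: dhomog0.
  split; first by rewrite rpredD // rpredZ.
  by move=> lt; rewrite u0 // v0 // scaler0 addr0.
have fG t : fin_dim (fun al : B => al \is (dl - t).-homog /\ ((dl < t)%N -> al = 0)).
  by apply: fin_dimS (fin_dim_form K 1 (dl - t)) => u [].
have dG t : (hdim (fun al : B => al \is (dl - t).-homog /\ ((dl < t)%N -> al = 0%R)) <= dl.+1 - t)%N.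
  have [lt|le] : (dl < t)%N \/ (t <= dl)%N by case: (ltnP dl t); [left|right].
    by rewrite hdim0 // => u [_ u0]; exact: u0 lt.
  apply: (@leq_trans (hdim (@form K 2 (dl - t)))); last by rewrite hdim_binary subSn.
  by apply: hdimS; [exact: subspace_form|exact: sG|move=> u []|exact: fin_dim_form].
have d1 : (hdim I1 <= dl.+1 - a)%N.
  by apply: leq_trans (hdim_image_le (lq q1) (sG a) (fG a)) (dG a).
have d2 : (hdim I2 <= dl.+1 - b)%N.
  by apply: leq_trans (hdim_image_le (lq q2) (sG b) (fG b)) (dG b).
have s1 : subspace I1 by apply: subspace_image.
have s2' : subspace I2 by apply: subspace_image.
have f1 : fin_dim I1 by apply: fin_dim_image.
have f2' : fin_dim I2 by apply: fin_dim_image.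
have kerle : (hdim (fun z => T z /\ D z = 0%R) <= hdim (sum_sub I1 I2))%N.
  apply: hdimS.
  - exact: subspace_sum_sub.
  - apply: subspaceI => //.
    exact: (subspace_preim lD (W := zero_sub) (@subspace_zero _ _)).
  - move=> [[x0 x1] x2] [[[/= h0 h1] /= h2'] Dz].
    have [|al [be [hal hbe al0 be0 xE]]] := syzygy_decomposition (dl := dl) (x := vec (x0, x1, x2)) _ Dz.
      by move=> j; rewrite /vec; do 2?case: ifP.
    exists (al * q1 ord0, al * q1 j1, al * q1 j2), (be * q2 ord0, be * q2 j1, be * q2 j2).
    split; [by exists al|by exists be|].
    by congr (_, _, _); [rewrite -(xE ord0)|rewrite -(xE j1)|rewrite -(xE j2)].
  - exact: fin_dim_sum_sub.
have sumle := hdim_sum_sub s1 s2' f1 f2'.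
move: rn kerle sumle d1 d2; rewrite hT imE -splitting_sum.
by move: (hdim _) (hdim _) (hdim _) (hdim _) (hdim _) (hdim _); clear; lia.
Qed.

End Given.
End Syzygies.

Lemma nat_min (Q : nat -> Prop) : (exists n, Q n) -> exists n, Q n /\ forall k, (k < n)%N -> ~ Q k.
Proof.
move=> [n]; elim/ltn_ind: n => n IH Qn.
case: (classic (exists2 k, (k < n)%N & Q k)) => [[k kn Qk]|no]; first exact: IH kn Qk.
by exists n; split=> // k kn Qk; apply: no; exists k.
Qed.

(** * Existence of the splitting *)

Section SplittingExists.
Variable K : closedFieldType.
Local Notation B := {mpoly K[2]}.
Variables (phi : 'I_3 -> B) (d : nat).
Hypotheses (hphi : forall j, phi j \is d.-homog) (nzphi : no_common_zero phi).

Definition syzygy k (q : 'I_3 -> B) := (forall j, q j \is k.-homog) /\ dot phi q = 0.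

Definition multiple_of (q1 q : 'I_3 -> B) := exists x, forall j, q j = x * q1 j.

Let w0 : exists w : proj 1 K, True.
Proof. by have [w _] := @proj1_exists K 1 1 (or_introl (oner_neq0 K)); exists w. Qed.

Definition koszul (i : 'I_3) : 'I_3 -> B := cross phi (fun j => (j == i)%:R).

Lemma koszul_syzygy i : syzygy d (koszul i).
Proof.
split=> [j|]; last by rewrite /dot /koszul /cross /=; ring.
rewrite -[d]addn0; apply: cross_homog => // l.
by case: eqP => _; [exact: dhomog1|exact: dhomog0].
Qed.

Lemma syzygy_root k q (w : proj 1 K) : syzygy k q -> (forall j, (q j).@[w] = 0) ->
  exists q', (forall j, q j = q' j * root_line w) /\ ((exists j, q j != 0) -> (0 < k)%N) /\ syzygy k.-1 q'.
Proof.
move=> [hq dq] qw.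
have dv j : divides (root_line w) (q j) by exact: root_line_divides (hq j) (qw j).
pose q' j := projT1 (constructive_indefinite_description _ (dv j)).
have qE j : q j = q' j * root_line w.
  exact: projT2 (constructive_indefinite_description _ (dv j)).
have quot j : q j != 0 -> (1 <= k)%N /\ q' j \is (k - 1).-homog.
  by move=> q0; exact: homog_quotient (hq j) q0 (root_line_homog w) (qE j).
exists q'; split=> //; split; first by move=> [j /quot[]].
split=> [j|].
  have [z|q0] := eqVneq (q j) 0; last by rewrite -subn1; case: (quot j q0).
  have /eqP : q' j * root_line w = 0 by rewrite -qE.
  by rewrite mulf_eq0 (negPf (root_line_neq0 w)) orbF => /eqP ->; exact: dhomog0.
apply: (mulIf (root_line_neq0 w)); rewrite mul0r -dq /dot !qE; ring.
Qed.

(** Choose a nonzero syzygy q1 of least degree, then q2 of least degree among those that are not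
    multiples of q1. Were their values dependent at some v, a suitable q2 - h q1 would vanish at v
    and could be divided by the equation of v, contradicting minimality. *)
Theorem splitting_exists : exists (a b : nat) (q1 q2 : 'I_3 -> B),
  [/\ (a <= b)%N, forall j, q1 j \is (a).-homog, forall j, q2 j \is b.-homog &
    forall w : proj 1 K, [/\ \sum_j (phi j).@[w] * (q1 j).@[w] = 0,
      \sum_j (phi j).@[w] * (q2 j).@[w] = 0
      & row_free (\matrix_(i < 2, j < 3) (if i == ord0 then q1 j else q2 j).@[w])]].
Proof.
have [w _] := w0; have [i0 pi0] := nzphi w.
(* At a point where phi_i does not vanish, the values of the Koszul relations
   other than the i-th one are linearly independent. *)
have koszul_indep (q1 : 'I_3 -> B) : exists i, ~ multiple_of q1 (koszul i).
  apply: NNPP => no; have {}no i : multiple_of q1 (koszul i).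
    by apply: NNPP => h; apply: no; exists i.
  have p0 : phi i0 != 0 by apply: contraNneq pi0 => ->; rewrite meval0.
  have [x0 h0] := no ord0; have [x1 h1] := no j1; have [x2 h2] := no j2.
  have sq i j : koszul i j * koszul j i = koszul i i * koszul j j.
    by have [x hx] := no i; have [y hy] := no j; rewrite !hx !hy; ring.
  have e01 := sq ord0 j1; have e02 := sq ord0 j2; have e12 := sq j1 j2.
  move: e01 e02 e12; rewrite /koszul /cross /= !mulr0 !mulr1 !subr0 !sub0r !mul0r.
  rewrite ?subrr ?mul0r => e01 e02 e12; case/negP: p0.
  have sq0 (y : B) : - y * y = 0 \/ y * - y = 0 -> y == 0.
    by case => /eqP; rewrite ?mulNr ?mulrN oppr_eq0 mulf_eq0 orbb.
  by case: (ord3P i0) => ->; apply: sq0; tauto.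
have exa : exists a, exists2 q, syzygy a q & exists j, q j != 0.
  have [i ni] := koszul_indep (fun=> 0).
  exists d, (koszul i); first exact: koszul_syzygy.
  apply: NNPP => no; apply: ni; exists 0 => j; rewrite mul0r.
  by apply/eqP/negPn/negP => h; apply: no; exists j.
have [a [[q1 s1 nz1] mina]] := nat_min exa.
have nzq1 : no_common_zero q1.
  move=> v; apply: NNPP => no.
  have z j : (q1 j).@[v] = 0 by apply/eqP/negPn/negP => h; apply: no; exists j.
  have [q' [qE [a0 s']]] := syzygy_root s1 z.
  apply: (mina a.-1); first by rewrite ltn_predL; exact: a0.
  exists q' => //; have [j qj] := nz1; exists j.
  by apply: contraNneq qj => h; rewrite qE h mul0r.
have exb : exists b, exists2 q, syzygy b q & ~ multiple_of q1 q.
  by have [i ni] := koszul_indep q1; exists d, (koszul i) => //; exact: koszul_syzygy.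
have [b [[q2 s2 nm2] minb]] := nat_min exb.
have nz2 : exists j, q2 j != 0.
  apply: NNPP => no; apply: nm2; exists 0 => j; rewrite mul0r.
  by apply/eqP/negPn/negP => h; apply: no; exists j.
have ab : (a <= b)%N by rewrite leqNgt; apply/negP => /mina[]; exists q2.
have indep (v : proj 1 K) (c : K) : ~ (forall j, (q2 j).@[v] = c * (q1 j).@[v]).
  move=> E.
  have [h hh hv] : exists2 h : B, h \is (b - a).-homog & h.@[v] = 1.
    case: (proj1_neq0 v) => v0.
      exists ((v ord0 ^+ (b - a))^-1 *: 'X_ord0 ^+ (b - a)).
        by rewrite rpredZ //; have := dhomogMn (b - a) (dhomogX1 K (ord0 : 'I_2)); rewrite mul1n.
      by rewrite mevalZ rmorphXn /= mevalXU mulVf // expf_neq0.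
    exists ((v ord_max ^+ (b - a))^-1 *: 'X_ord_max ^+ (b - a)).
      by rewrite rpredZ //; have := dhomogMn (b - a) (dhomogX1 K (ord_max : 'I_2)); rewrite mul1n.
    by rewrite mevalZ rmorphXn /= mevalXU mulVf // expf_neq0.
  pose q3 j := q2 j - (c *: h) * q1 j.
  have s3 : syzygy b q3.
    split=> [j|].
      apply: rpredB; first by case: s2.
      have hq1 : q1 j \is (a).-homog by case: s1.
      by have := dhomogM (rpredZ c hh : c *: h \is (b - a).-homog) hq1; rewrite subnK.
    case: s1 => _ d1; case: s2 => _ d2.
    have -> : dot phi q3 = dot phi q2 - (c *: h) * dot phi q1 by rewrite /dot /q3; ring.
    by rewrite d1 d2 mulr0 subrr.
  have z j : (q3 j).@[v] = 0 by rewrite mevalB mevalM mevalZ hv mulr1 E subrr.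
  have [q' [qE [b0 s']]] := syzygy_root s3 z.
  have nz3 : exists j, q3 j != 0.
    apply: NNPP => no; apply: nm2; exists (c *: h) => j; apply/eqP; rewrite -subr_eq0.
    by apply/negPn/negP => n; apply: no; exists j.
  apply: (minb b.-1); first by rewrite ltn_predL; exact: b0.
  exists q' => // -[x xE]; apply: nm2; exists (x * root_line v + c *: h) => j.
  have := qE j; rewrite /q3 xE => /eqP; rewrite subr_eq => /eqP ->.
  by ring.
exists a, b, q1, q2; split=> //; [by case: s1|by case: s2|move=> v; split].
- have : (dot phi q1).@[v] = 0 by case: s1 => _ ->; rewrite meval0.
  by rewrite -dotE rmorph_sum /= => E; rewrite -[RHS]E; apply: eq_bigr => j _; rewrite mevalM.
- have : (dot phi q2).@[v] = 0 by case: s2 => _ ->; rewrite meval0.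
  by rewrite -dotE rmorph_sum /= => E; rewrite -[RHS]E; apply: eq_bigr => j _; rewrite mevalM.
- rewrite -kermx_eq0; apply/rowV0P => u /sub_kermxP uA.
  have eqn j : u 0 ord0 * (q1 j).@[v] + u 0 ord_max * (q2 j).@[v] = 0.
    have /rowP/(_ j) := uA; rewrite !mxE !big_ord_recl big_ord0 !mxE /= addr0 => E.
    by rewrite -[RHS]E; congr (_ + u 0 _ * _); apply: val_inj.
  have u1 : u 0 ord_max = 0.
    apply/eqP/negPn/negP => n; apply: (indep v (- (u 0 ord_max)^-1 * u 0 ord0)) => j.
    apply: (mulfI n); rewrite !mulrA mulrN divff // mulN1r mulNr.
    by apply/eqP; rewrite -subr_eq0 opprK addrC; apply/eqP; exact: eqn.
  have u0 : u 0 ord0 = 0.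
    have [j qj] := nzq1 v; have := eqn j; rewrite u1 mul0r addr0 => /eqP.
    by rewrite mulf_eq0 (negPf qj) orbF => /eqP.
  by apply/rowP => i; rewrite mxE; case: (ord2P i) => ->.
Qed.

End SplittingExists.

Lemma splitting_type_exists (K : closedFieldType) (f : {mpoly K[3]}) d :
  irreducible_elt f -> f \is d.-homog -> rational_curve f -> exists a b, splitting_type f a b.
Proof.
move=> fi hf [phi nphi]; have [hphi nz _ _ _] := normalization_curve fi hf nphi.
have [a [b [q1 [q2 [ab h1 h2 h]]]]] := splitting_exists hphi nz.
by exists a, b; split=> //; exists phi; split=> //; exists q1, q2.
Qed.

(** * Adding a curve to a class *)

Lemma form_quotient (K : fieldType) n d e (f g x : {mpoly K[n]}) :
  f \is d.-homog -> g != 0 -> g \is e.-homog -> f = x * g -> x \is (d - e).-homog.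
Proof.
move=> hf g0 hg E; have [z|f0] := eqVneq f 0; last by case: (homog_quotient hf f0 hg E).
have /eqP : x * g = 0 by rewrite -E.
by rewrite mulf_eq0 (negPf g0) orbF => /eqP ->; exact: dhomog0.
Qed.

Section CurveStep.
Variables (K : closedFieldType) (n : nat) (P : 'I_n -> proj 2 K).
Hypothesis distP : distinct_points P.
Local Notation B := {mpoly K[2]}.

Definition inter (D : nat) (m : 'I_n -> nat) (d : nat) (k : 'I_n -> nat) : int :=
  D%:Z * d%:Z - \sum_i (m i)%:Z * (k i)%:Z.

Definition addm (m k : 'I_n -> nat) := fun i => (m i + k i)%N.

Lemma interD D D' m m' d k : inter (D + D') (addm m m') d k = inter D m d k + inter D' m' d k.
Proof.
rewrite /inter PoszD mulrDl.
under eq_bigr => i _ do rewrite /addm PoszD mulrDl.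
by rewrite big_split /=; ring.
Qed.

(** Riemann-Roch for a sum of two classes, doubled to stay among the integers; the last bracket is
    -K . C. *)
Lemma chi_addm m k D d : 2 * chi (addm m k) (D + d) = 2 * chi m D + 2 * inter D m d k
  + inter d k d k + (3 * d%:Z - \sum_i (k i)%:Z) :> int.
Proof.
rewrite !chi2 /inter.
have -> : \sum_i ((addm m k i)%:Z + 1) * (addm m k i)%:Z = \sum_i ((m i)%:Z + 1) * (m i)%:Z
   + 2 * \sum_i (m i)%:Z * (k i)%:Z + \sum_i (k i)%:Z * (k i)%:Z + \sum_i (k i)%:Z.
  rewrite mulr_sumr -!big_split; apply: eq_bigr => i _; rewrite /addm PoszD /=; ring.
by rewrite PoszD; ring.
Qed.

(** A common root of [th i] and [th j] would be mapped to both P_i and P_j; so the powers are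
    pairwise coprime and their product divides. *)
Lemma prod_theta_divides (th : 'I_n -> B) (k : 'I_n -> nat) (phi : 'I_3 -> B) :
  (forall i, [/\ th i \is (k i).-homog, th i != 0,
    forall m x, vanish (P i) m x -> divides (th i ^+ m) (msub phi x)
    & forall w : proj 1 K, (th i).@[w] = 0 -> exists2 c, c != 0 & forall j, (phi j).@[w] = c * P i j]) ->
  forall m x, (forall i, vanish (P i) (m i) x) -> divides (\prod_i th i ^+ m i) (msub phi x).
Proof.
move=> thP m x v; apply: coprime_dvd_prod; first exact: index_enum_uniq.
- by move=> i _; apply: expf_neq0; case: (thP i).
- move=> i j _ _ ij; apply: coprime_expr.
  have cop : coprime_elt (th i) (th j).
    have [hi i0 _ ri] := thP i; have [hj _ _ rj] := thP j.
    apply: (no_common_zero_coprime i0 hi hj) => w /ri[c c0 cE] /rj[c' c'0 c'E].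
    apply: (distP ij); exists (c^-1 * c') => l.
    by apply: (mulfI c0); rewrite -cE c'E mulrA mulVKf.
  have [_ j0 _ _] := thP j; have [_ i0 _ _] := thP i.
  apply: coprime_sym => //; apply: coprime_expr; exact: coprime_sym.
- by move=> i _; case: (thP i) => _ _ + _; apply.
Qed.

Variables (f : {mpoly K[3]}) (d : nat) (k : 'I_n -> nat) (phi : 'I_3 -> B).
Hypotheses (fi : irreducible_elt f) (hf : f \is d.-homog) (fk : forall i, mult_at (P i) f (k i)).
Hypothesis nphi : normalization_P1 f phi.

Let hphi j : phi j \is d.-homog. Proof. by case: (normalization_curve fi hf nphi). Qed.
Let nzphi : no_common_zero phi. Proof. by case: (normalization_curve fi hf nphi). Qed.
Let phif : msub phi f = 0. Proof. by case: (normalization_curve fi hf nphi). Qed.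
Let kerphi e h : h \is e.-homog -> msub phi h = 0 -> divides f h.
Proof. by case: (normalization_curve fi hf nphi) => _ _ _ + _ => /(_ e h). Qed.
Let f0 : f != 0. Proof. by case: fi. Qed.
Let lphi : lin (msub phi). Proof. exact: lin_msub. Qed.

Let theta_ex i : exists th : B, [/\ th \is (k i).-homog, th != 0,
  forall m x, vanish (P i) m x -> divides (th ^+ m) (msub phi x)
  & forall w : proj 1 K, th.@[w] = 0 -> exists2 c, c != 0 & forall j, (phi j).@[w] = c * P i j].
Proof.
have [_ _ _ _ atp] := normalization_curve fi hf nphi.
have [M uM pM] := frameP (P i).
have [th [a [b [[hth th0] _ _ [E1 E2 thd]]]]] := atp _ _ _ uM pM (fk i).
exists th; split=> // w tw; pose x j := (phi j).@[w].
have z j : j != ord0 -> (coord M j).@[x] = 0.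
  by case: (ord3P j) => -> // _; rewrite -msub_eval ?E1 ?E2 mevalM tw mulr0.
have xE := on_point uM pM (z j1 isT) (z j2 isT).
exists ((coord M ord0).@[x]) => //; apply/eqP => c0; have [j /eqP[]] := nzphi w.
by rewrite -/(x j) xE c0 mul0r.
Qed.

Let th i := projT1 (constructive_indefinite_description _ (theta_ex i)).
Let thP i : [/\ th i \is (k i).-homog, th i != 0,
  forall m x, vanish (P i) m x -> divides (th i ^+ m) (msub phi x)
  & forall w : proj 1 K, (th i).@[w] = 0 -> exists2 c, c != 0 & forall j, (phi j).@[w] = c * P i j].
Proof. exact: projT2 (constructive_indefinite_description _ (theta_ex i)). Qed.

(** The equation on P^1 of the divisor cut on C by sum m_i E_i. A form of degree D with
    multiplicities m restricts to [Th m] times a form whose degree is the intersection number with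
    C. *)
Let Th (m : 'I_n -> nat) : B := \prod_i th i ^+ m i.

Let Th_homog m : Th m \is (\sum_i m i * k i)%N.-homog.
Proof.
apply: dhomog_prodE => i; rewrite mulnC; apply: dhomogMn; by case: (thP i).
Qed.

Let Th_neq0 m : Th m != 0.
Proof. by apply/prodf_neq0 => i _; apply: expf_neq0; case: (thP i). Qed.

Let Th_divides m D x : fat_ideal_deg P m D x -> divides (Th m) (msub phi x).
Proof. by move=> [v _]; apply: prod_theta_divides thP _ _ v. Qed.

Lemma chi_curve m D : inter d k d k = -1 -> 3 * d%:Z - \sum_i (k i)%:Z = 1 ->
  chi (addm m k) (D + d) = chi m D + inter D m d k :> int.
Proof.
move=> c2 ck; have := chi_addm m k D d; rewrite c2 ck => E.
by move: E; clear; move: (chi _ _) (chi _ _) (inter _ _ _ _) => x y z; lia.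
Qed.

Lemma rho_sub m D x : fat_ideal_deg P m D x ->
  image (fun y => Th m * y) (fun y => y \is (D * d - \sum_i m i * k i)%N.-homog /\
     ((D * d < \sum_i m i * k i)%N -> y = 0)) (msub phi x).
Proof.
move=> Ix; have [y yE] := Th_divides Ix.
have hx : msub phi x \is (D * d)%N.-homog by apply: msub_homog; case: Ix.
exists y; last by rewrite mulrC.
split; first exact: form_quotient hx (Th_neq0 m) (Th_homog m) yE.
move=> lt; have [z|n0] := eqVneq (msub phi x) 0.
  have /eqP : y * Th m = 0 by rewrite -yE.
  by rewrite mulf_eq0 (negPf (Th_neq0 m)) orbF => /eqP.
by have [] := homog_quotient hx n0 (Th_homog m) yE; rewrite leqNgt lt.
Qed.

Let interN D m : inter D m d k = (D * d)%N%:Z - (\sum_i m i * k i)%N%:Z.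
Proof.
rewrite /inter sumZ PoszM; congr (_ - _); apply: eq_bigr => i _; by rewrite PoszM.
Qed.

(** Taking e to be any natural number above the intersection number plus one covers negative degrees
    on C, where the restriction is zero. *)
Let hdim_rho m D (e : nat) : inter D m d k + 1 <= e%:Z ->
  (hdim (image (msub phi) (fat_ideal_deg P m D)) <= e)%N.
Proof.
rewrite interN => le.
pose G (y : B) := y \is (D * d - \sum_i m i * k i)%N.-homog /\ ((D * d < \sum_i m i * k i)%N -> y = 0).
have sG : subspace G.
  split=> [|s u v [hu u0] [hv v0]]; first by split=> //; exact: dhomog0.
  by split; [rewrite rpredD // rpredZ|move=> lt; rewrite u0 // v0 // scaler0 addr0].
have fG : fin_dim G by apply: fin_dimS (fin_dim_form K 1 _) => u [h _]; exact: h.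
have dG : (hdim G <= e)%N.
  have [lt|ge] : (D * d < \sum_i m i * k i)%N \/ (\sum_i m i * k i <= D * d)%N.
    by case: (ltnP (D * d) (\sum_i m i * k i)); [left|right].
    by rewrite hdim0 // => u [_ u0]; exact: u0 lt.
  apply: (@leq_trans (D * d - \sum_i m i * k i).+1); last by move: le ge; clear; lia.
  rewrite -(hdim_binary K (D * d - \sum_i m i * k i)).
  by apply: hdimS; [exact: subspace_form|exact: sG|move=> u []|exact: fin_dim_form].
apply: leq_trans dG; rewrite -(hdim_mul (Th_neq0 m) sG fG).
apply: hdimS.
- by apply: subspace_image => //; exact: lin_mul.
- by apply: subspace_image => //; exact: subspace_fat.
- by move=> _ [x Ix ->]; exact: rho_sub.
- by apply: fin_dim_image => //; exact: lin_mul.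
Qed.

Lemma hdim_ker m D : (hdim (fun x => fat_ideal_deg P (addm m k) (D + d) x /\ msub phi x = 0%R) <= h0 P m D)%N.
Proof.
rewrite /h0 -(hdim_mul f0 (subspace_fat P m D) (fin_dim_fat P m D)).
apply: hdimS.
- by apply: subspace_image; [exact: lin_mul|exact: subspace_fat].
- apply: subspaceI; first exact: subspace_fat.
  exact: (subspace_preim lphi (W := zero_sub) (@subspace_zero _ _)).
- move=> x [[v hx] /(kerphi hx)[y yE]]; exists y; last by rewrite mulrC.
  split=> [i|]; last by have := form_quotient hx f0 hf yE; rewrite addnK.
  have := v i; rewrite yE mulrC => /(vanish_div (fk i)).
  by rewrite /addm addnK.
- by apply: fin_dim_image; [exact: lin_mul|exact: fin_dim_fat].
Qed.

(* Riemann-Roch for the twist of the restriction sequence along the curve. *)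
Lemma h0_add_curve m D (e : nat) : inter (D + d) (addm m k) d k + 1 <= e%:Z ->
  (h0 P (addm m k) (D + d) <= h0 P m D + e)%N.
Proof.
move=> le; rewrite {1}/h0 (hdim_image lphi (subspace_fat _ _ _) (fin_dim_fat _ _ _)) addnC.
by apply: leq_add; [exact: hdim_ker|exact: hdim_rho].
Qed.

(** On P^1 there is no H^1 in degrees at least -1, so vanishing of H^1 is inherited when such a copy
    of C is added. *)
Lemma chi_step m D : inter d k d k = -1 -> 3 * d%:Z - \sum_i (k i)%:Z = 1 ->
  (h0 P m D)%:Z <= chi m D -> 0 <= inter (D + d) (addm m k) d k + 1 ->
  (h0 P (addm m k) (D + d))%:Z <= chi (addm m k) (D + d).
Proof.
move=> c2 ck hm; have := interD D d m k d k; have := chi_curve m D c2 ck; rewrite c2.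
case E : (inter (D + d) (addm m k) d k + 1) => [e|//] chiE iE _.
have le : inter (D + d) (addm m k) d k + 1 <= e%:Z by rewrite E.
have := h0_add_curve le; rewrite chiE; move: hm iE E; clear.
move: (h0 _ _ _) (h0 _ _ _) (chi _ _) (inter _ _ _ _) (inter _ _ _ _) => h0' h0'' c i1 i2.
by lia.
Qed.

Variables (q1 q2 : 'I_3 -> B) (a b : nat).
Hypotheses (hq1 : forall j, q1 j \is (a).-homog) (hq2 : forall j, q2 j \is b.-homog).
Hypothesis basis : forall w : proj 1 K,
  [/\ \sum_j (phi j).@[w] * (q1 j).@[w] = 0, \sum_j (phi j).@[w] * (q2 j).@[w] = 0
    & row_free (\matrix_(i < 2, j < 3) (if i == ord0 then q1 j else q2 j).@[w])].

Lemma splitting_degree : (a + b = d)%N.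
Proof. exact: splitting_sum hphi nzphi hq1 hq2 basis. Qed.

(** Compare the two multiplication maps through restriction to C. The image for the larger class
    contains, in its kernel of restriction, f times the image for the smaller one. On C the larger
    class restricts onto all forms of degree e - 1, so the loss there is the one computed for the
    products with the [phi j]. *)
Theorem cok_step m D (e : nat) : inter d k d k = -1 -> 3 * d%:Z - \sum_i (k i)%:Z = 1 ->
  (h0 P m D)%:Z <= chi m D -> inter (D + d) (addm m k) d k + 1 = e%:Z ->
  (h0 P (addm m k) (D + d).+1 + hdim (im_mu P m D)
    <= hdim (im_mu P (addm m k) (D + d)) + h0 P m D.+1 + ((a - e) + (b - e)))%N.
Proof.
move=> c2 ck hm eE; set m' := addm m k; set D' := (D + d)%N.
pose T := im_mu P m' D'.
have sT : subspace T by exact: subspace_im_mu.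
have fT : fin_dim T by exact: fin_dim_im_mu.
have rnT := hdim_image lphi sT fT.
have kerT : (hdim (im_mu P m D) <= hdim (fun x => T x /\ msub phi x = 0%R))%N.
  rewrite -(hdim_mul f0 (subspace_im_mu P m D) (fin_dim_im_mu P m D)).
  apply: hdimS.
  - apply: subspaceI => //; exact: (subspace_preim lphi (W := zero_sub) (@subspace_zero _ _)).
  - by apply: subspace_image; [exact: lin_mul|exact: subspace_im_mu].
  - move=> _ [_ [r [F [G [hF hG ->]]]] ->]; split; last by rewrite msubM phif mul0r.
    exists r, (fun i => F i * f), G; split=> // [i|].
      by apply: fatM (hF i) (fat_mult hf fk).
    by rewrite mulr_sumr; apply: eq_bigr => i _; ring.
  - exact: fin_dimS (fun x => @proj1 _ _) fT.
have up : (h0 P m' D'.+1 <= h0 P m D.+1 + (e + d))%N.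
  have := @h0_add_curve m D.+1 (e + d)%N; rewrite addSn; apply.
  have : inter (D + d).+1 (addm m k) d k = inter (D + d) (addm m k) d k + d%:Z.
    by rewrite /inter -addn1 PoszD; ring.
  by move=> ->; rewrite PoszD -eE addrAC.
suff imT : (e + d <= hdim (image (msub phi) T) + ((a - e) + (b - e)))%N.
  move: rnT kerT up imT; rewrite -/T; clear.
  move: (h0 _ _ _) (h0 _ _ _) (hdim _) (hdim _) (hdim _) (hdim _) => x1 x2 x3 x4 x5 x6.
  by lia.
(* For e = 0 the class has degree -1 on the curve, and the correction a + b = d already accounts for
   the whole bound e + d. *)
case: e eE {up} => [|dl] eE; first by rewrite add0n !subn0 splitting_degree leq_addl.
(* The sections of G + C restrict onto all forms of degree dl on the curve. *)
have dlE : (D' * d = dl + \sum_i m' i * k i)%N.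
  by have := interN D' m'; rewrite -/D' -/m' in eE *; move: eE; clear; lia.
have onto y : y \is dl.-homog -> image (msub phi) (fat_ideal_deg P m' D') (Th m' * y).
  have n0 := Th_neq0 m'; pose S := image (fun y => Th m' * y) (@form K 2 dl).
  have sS : subspace S by apply: subspace_image; [exact: lin_mul|exact: subspace_form].
  have fS : fin_dim S by apply: fin_dim_image; [exact: lin_mul|exact: fin_dim_form].
  have sI : subspace (image (msub phi) (fat_ideal_deg P m' D')).
    by apply: subspace_image => //; exact: subspace_fat.
  have sub x : image (msub phi) (fat_ideal_deg P m' D') x -> S x.
    move=> [z /rho_sub[u [hu _] ->] ->]; exists u => //.
    by move: hu; rewrite dlE addnK.
  move=> hy; apply: (hdim_eq sS sI sub fS); last by exists y.
  rewrite (hdim_mul n0 (subspace_form _ _ _) (fin_dim_form _ _ _)) hdim_binary.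
  have rn := hdim_image lphi (subspace_fat P m' D') (fin_dim_fat P m' D').
  have kr := hdim_ker m D.
  have := chi_le_h0 P m' D'; rewrite /h0 rn (chi_curve m D c2 ck).
  have := interD D d m k d k; rewrite c2; move: kr hm eE; rewrite -/m' -/D'; clear.
  rewrite /h0; move: (hdim _) (hdim _) (hdim _) (inter _ _ _ _) (inter _ _ _ _) (chi _ _).
  by move=> x1 x2 x3 x4 x5 x6; lia.
have := hdim_span_phi hphi nzphi hq1 hq2 basis dl.
rewrite -(hdim_mul (Th_neq0 m') (subspace_span_phi phi dl)); last first.
  exact: fin_dimS (@span_phi_homog _ phi d hphi dl) (fin_dim_form K 1 (dl + d)).
have le : (hdim (image (fun y : B => (Th m' * y)%R) (span_phi phi dl)) <= hdim (image (msub phi) T))%N.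
  apply: hdimS.
  - by apply: subspace_image.
  - by apply: subspace_image; [exact: lin_mul|exact: subspace_span_phi].
  - move=> _ [_ [x [hx ->]] ->].
    have [z0 I0 E0] := onto _ (hx ord0); have [z1 I1 E1] := onto _ (hx j1); have [z2 I2 E2] := onto _ (hx j2).
    exists (z0 * 'X_ord0 + z1 * 'X_j1 + z2 * 'X_j2).
      by apply: im_muD; [apply: im_muD|]; apply: im_muM => //; exact: dhomogX1.
    by rewrite !msubD !msubM !msubX -E0 -E1 -E2 /dot; ring.
  - exact: fin_dim_image.
move: le; move: (hdim _) (hdim _); clear; lia.
Qed.

End CurveStep.

(** * The bound for good configurations *)

Section Gamma.
Variables (K : closedFieldType) (n : nat) (P : 'I_n -> proj 2 K).
Local Notation R := {mpoly K[3]}.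

Lemma negative_associate (p q x : R) : x \is a GRing.unit -> p = x * q -> negative P q -> negative P p.
Proof.
move=> ux pE [k kq neg].
have x0 : x != 0 by apply: contraTneq ux => ->; rewrite unitr0.
have q0 : q != 0.
  apply/eqP => z; move: neg; rewrite z /mdegree msize0 /= exp0n //.
  apply/negP; rewrite -leqNgt leqn0 sum_nat_eq0; apply/forallP => i; apply/implyP => _.
  by have /negP[] := mult_neq0 (kq i); rewrite z eqxx.
exists k => [i|].
  have [a xa] := mult_exists (P i) x0.
  have v0 : x^-1 != 0 by rewrite invr_eq0.
  have [b vb] := mult_exists (P i) v0.
  have := mult_mul xa vb; rewrite mulrV // => /(mult_uniq (mult1 _)) E.
  have a0 : a = 0%N by move: E; clear; lia.
  by have := mult_mul xa (kq i); rewrite -pE a0.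
suff -> : mdegree p = mdegree q by [].
by rewrite pE /mdegree msizeM //; move: ux; rewrite mpoly_unitE => /eqP ->.
Qed.

(** Recasts the product of negative factors of a gcd as a divisibility property. For the last
    clause: if G q divided everything it would divide the gcd, so q would be associate to one of the
    factors that are not negative. *)
Lemma gammaP m s G : is_gamma P m s G -> (exists2 x, fat_ideal_deg P m s x & x != 0) ->
  [/\ G != 0, forall h, fat_ideal_deg P m s h -> divides G h,
      forall q, irreducible_elt q -> divides q G -> negative P q
    & forall q, irreducible_elt q -> negative P q -> ~ (forall h, fat_ideal_deg P m s h -> divides (G * q) h)].
Proof.
move=> [g [u [v [l [l' [[gd gmax] [u0 v0] gE [ln l'n] GE]]]]]] [x Ix x0].
have g0 : g != 0.
  by apply: contraNneq x0 => z; have [y ->] := gd _ Ix; rewrite z mulr0.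
have G0 : G != 0.
  move: g0; rewrite gE GE -!mul_mpolyC !mulf_eq0 !negb_or => /and3P[_ -> _].
  by rewrite mpolyC_eq0 v0.
have unitC (c : K) : c != 0 -> (c%:MP : R) \is a GRing.unit.
  by move=> c0; rewrite mpoly_unitE msizeC c0.
have dG h : fat_ideal_deg P m s h -> divides G h.
  move=> /gd; apply: divides_trans; rewrite gE GE; exists ((u * v^-1)%:MP * \prod_(p <- l') p).
  rewrite -!mul_mpolyC mpolyCM.
  have : (v^-1)%:MP * v%:MP = 1 :> R by rewrite -mpolyCM mulVf.
  move: (\prod_(p <- l) p) (\prod_(p <- l') p) => X Y E.
  by rewrite -[LHS]mulr1 -E; ring.
have in_prod (q : R) (ll : seq R) : irreducible_elt q -> (forall p, p \in ll -> irreducible_elt p) ->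
    divides q (\prod_(p <- ll) p) -> exists2 p, p \in ll & exists2 x, x \is a GRing.unit & p = x * q.
  move=> qi; elim: ll => [_|p ll IH pi].
    by rewrite big_nil => -[y E]; case: qi => _ + _; rewrite (_ : q \is a GRing.unit) //; apply/unitrPr; exists y; rewrite mulrC.
  rewrite big_cons => dq; have qp := mpoly_irreducible_prime qi.
  case: (qp _ _ dq) => [[y yE]|].
    exists p; first exact: mem_head.
    exists y => //; have [_ _ /(_ _ _ yE)[//|uq]] := pi p (mem_head _ _).
    by case: qi => _ /negP[].
  move=> /IH[p' pl|p' pl E]; first by apply: pi; rewrite inE pl orbT.
  by exists p' => //; rewrite inE pl orbT.
split=> // [q qi|q qi qn all].
  rewrite GE -mul_mpolyC => /(divides_unitr (unitC _ v0)) /in_prod -/(_ qi)[p /ln[]//|p pl [y uy pE]].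
  apply: (negative_associate (x := y^-1) (q := p)); last by case: (ln p pl).
    by rewrite unitrV.
  by rewrite pE mulKr.
have := gmax _ all; rewrite gE GE -!mul_mpolyC.
have -> : u%:MP * (\prod_(p <- l) p * \prod_(p <- l') p) =
   (\prod_(p <- l) p) * (u%:MP * \prod_(p <- l') p) :> R by ring.
have -> : v%:MP * \prod_(p <- l) p * q = (\prod_(p <- l) p) * (v%:MP * q) by ring.
rewrite divides_mul2l; last first.
  by move: G0; rewrite GE -mul_mpolyC mulf_eq0 negb_or => /andP[].
move=> /(divides_trans (divides_mull _ (divides_refl q))) /(divides_unitr (unitC _ u0)).
move=> /in_prod -/(_ qi)[p /l'n[]//|p pl [y uy pE]].
by case: (l'n p pl) => _; apply; exact: (negative_associate uy pE).
Qed.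

End Gamma.

Section Numeric.
Import Order.TTheory Num.Theory.
Variables (K : closedFieldType) (n : nat) (P : 'I_n -> proj 2 K).
Hypothesis distP : distinct_points P.
Local Notation R := {mpoly K[3]}.

(** Together with [good_nef] this is all that is used of the conjecture. The bound t on the degree
    leaves finitely many numerical types and so allows passage from generic to general points. *)
Definition good_curves t := forall (f : R) d k, irreducible_elt f -> f \is d.-homog -> (d <= t)%N ->
  (forall i, mult_at (P i) f (k i)) -> inter d k d k < 0 ->
  [/\ inter d k d k = -1, 3 * d%:Z - \sum_i (k i)%:Z = 1 & rational_curve f].

(** Vanishing of H^1 for effective nef classes, with nefness tested only on irreducible plane
    curves: intersections with the E_i are the multiplicities, which are natural numbers. *)
Definition good_nef t := forall m a, (a <= t)%N ->
  (exists2 x, fat_ideal_deg P m a x & x != 0) ->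
  (forall (g : R) e k, irreducible_elt g -> g \is e.-homog -> (forall i, mult_at (P i) g (k i)) ->
     0 <= inter a m e k) ->
  (h0 P m a)%:Z <= chi m a.

Lemma h0_mul (G : R) dG mu m' m D' : G \is dG.-homog -> (forall i, mult_at (P i) G (mu i)) -> G != 0 ->
  (forall i, (m i <= mu i + m' i)%N) -> (h0 P m' D' <= h0 P m (dG + D'))%N.
Proof.
move=> hG mG G0 le.
rewrite {1}/h0 -(hdim_mul G0 (subspace_fat P m' D') (fin_dim_fat P m' D')).
apply: hdimS; [exact: subspace_fat| | |exact: fin_dim_fat].
  by apply: subspace_image; [exact: lin_mul|exact: subspace_fat].
move=> _ [y Iy ->]; apply: fatW (fatM (fat_mult hG mG) Iy); exact: le.
Qed.

Lemma inter_ge0_of_not_divides a m e k (g x : R) : irreducible_elt g -> g \is e.-homog ->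
  (forall i, mult_at (P i) g (k i)) -> fat_ideal_deg P m a x -> ~ divides g x ->
  0 <= inter a m e k.
Proof.
move=> gi hg kg [vx hx] ndv.
have := bezout_inequality distP gi hg hx (fun i => (kg i).1) vx ndv.
rewrite /inter => le; rewrite -PoszM.
have -> : \sum_i (m i)%:Z * (k i)%:Z = (\sum_i k i * m i)%N%:Z.
  by rewrite sumZ; apply: eq_bigr => i _; rewrite PoszM mulrC.
by move: le; rewrite mulnC; clear; lia.
Qed.

(* A divisor negative on g forces g into the base locus, and then the moving
   part of any section shows g^2 < 0. *)
Lemma negative_of_inter a m e k (g x : R) : irreducible_elt g -> g \is e.-homog ->
  (forall i, mult_at (P i) g (k i)) -> fat_ideal_deg P m a x -> x != 0 ->
  inter a m e k < 0 -> inter e k e k < 0.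
Proof.
move=> gi hg kg; elim: a {-2}a (leqnn a) m x => [|N IH] a aN m x Ix x0 neg.
  have a0 : a = 0%N by move: aN; clear; lia.
  have [d|nd] := classic (divides g x); last first.
    by have := inter_ge0_of_not_divides gi hg kg Ix nd; move: neg; clear; move: (inter _ _ _ _) => z; lia.
  have ux : x \is a GRing.unit by apply: homog0_unit => //; have := Ix.2; rewrite a0.
  have [y E] := d; case: gi => _ /negP[]; move: ux; rewrite E; rewrite unitrM; by case/andP.
have [[y yE]|nd] := classic (divides g x); last first.
  by have := inter_ge0_of_not_divides gi hg kg Ix nd; move: neg; clear; move: (inter _ _ _ _) => z; lia.
have g0 : g != 0 by case: gi.
have [le hy] := homog_quotient Ix.2 x0 hg yE.
have e0 : (0 < e)%N.
  rewrite lt0n; apply/eqP => z; case: gi => _ /negP[].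
  by apply: homog0_unit g0 _; have := hg; rewrite z.
have y0 : y != 0 by apply: contraNneq x0 => z; rewrite yE z mul0r.
have Iy : fat_ideal_deg P (fun i => m i - k i)%N (a - e) y.
  split=> // i; apply: (vanish_div (kg i)); rewrite mulrC -yE; exact: Ix.1.
have [lt|ge] := ltP (inter (a - e)%N (fun i => m i - k i)%N e k) 0.
  by apply: (IH (a - e)%N _ _ y Iy y0 lt); move: aN le e0; clear; lia.
have : inter (a - e)%N (fun i => m i - k i)%N e k + inter e k e k <= inter a m e k.
  rewrite -interD /inter subnK // lerD2l lerN2; apply: ler_sum => i _.
  by rewrite /addm -!PoszM lez_nat leq_mul2r; apply/orP; right; clear; lia.
move: neg ge; clear; move: (inter _ _ _ _) (inter _ _ _ _) (inter _ _ _ _) => x1 x2 x3; lia.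
Qed.

Section Curves.
Variables (r : nat) (f : 'I_r -> R) (d : 'I_r -> nat) (k : 'I_r -> 'I_n -> nat).
Hypotheses (fi : forall j, irreducible_elt (f j)) (hf : forall j, f j \is (d j).-homog).
Hypothesis fk : forall j i, mult_at (P i) (f j) (k j i).
Hypothesis nassoc : forall i j, i != j -> ~ associate (f i) (f j).
Hypotheses (sq : forall j, inter (d j) (k j) (d j) (k j) = -1)
  (adj : forall j, 3 * (d j)%:Z - \sum_i (k j i)%:Z = 1)
  (rat : forall j, rational_curve (f j)).

Definition degs (c : 'I_r -> nat) := (\sum_j c j * d j)%N.
Definition mults (c : 'I_r -> nat) i := (\sum_j c j * k j i)%N.
Definition curves (c : 'I_r -> nat) : R := \prod_j f j ^+ c j.

Lemma degs0 : degs (fun=> 0%N) = 0%N. Proof. by apply: big1. Qed.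
Lemma mults0 : mults (fun=> 0%N) = fun=> 0%N.
Proof. by apply: functional_extensionality => i; apply: big1. Qed.

Lemma sum_bump_mul (c g : 'I_r -> nat) (j : 'I_r) :
  (\sum_l bump c j l * g l = \sum_l c l * g l + g j)%N.
Proof.
under eq_bigr => l _ do rewrite /bump mulnDl.
by rewrite big_split /=; congr (_ + _)%N; rewrite (bigD1 j) //= eqxx mul1n big1 ?addn0 // => l /negPf ->.
Qed.

Lemma degs_bump c j : degs (bump c j) = (degs c + d j)%N.
Proof. exact: sum_bump_mul. Qed.

Lemma mults_bump c j : mults (bump c j) = addm (mults c) (k j).
Proof. by apply: functional_extensionality => i; exact: (sum_bump_mul c (fun j => k j i)). Qed.

Lemma curves_homog c : curves c \is (degs c).-homog.
Proof. by apply: dhomog_prodE => j; rewrite mulnC; apply: dhomogMn. Qed.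

Lemma curves_mult c i : mult_at (P i) (curves c) (mults c i).
Proof. by apply: mult_prod => j; apply: mult_expr. Qed.

Lemma curves_neq0 c : curves c != 0.
Proof. by apply/prodf_neq0 => j _; apply: expf_neq0; case: (fi j). Qed.

Lemma bump_pred (c : 'I_r -> nat) j : (0 < c j)%N -> exists e, c = bump e j.
Proof.
move=> cj; exists (fun l => c l - (l == j))%N; apply: functional_extensionality => l.
by rewrite /bump subnK //; case: eqP => // ->.
Qed.

Lemma not_divides_other i j : i != j -> ~ divides (f i) (f j).
Proof.
move=> ij [x E]; apply: (nassoc ij).
have [_ _ /(_ _ _ E)[ux|ui]] := fi j; last by case: (fi i) => _ /negP[].
split; first by exists x.
by exists x^-1; rewrite E mulKr.
Qed.

Lemma other_inter i j : i != j -> 0 <= inter (d j) (k j) (d i) (k i).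
Proof.
move=> ij; apply: (inter_ge0_of_not_divides (fi i) (hf i) (fk i) (x := f j)).
  exact: fat_mult (hf j) (fk j).
exact: not_divides_other.
Qed.

Lemma inter_sym a (m : 'I_n -> nat) a' m' : inter a m a' m' = inter a' m' a m :> int.
Proof. by rewrite /inter mulrC; congr (_ - _); apply: eq_bigr => i _; rewrite mulrC. Qed.

(** * Fixed and moving part in one degree *)

Section Level.
Variables (m : 'I_n -> nat) (s : nat) (c : 'I_r -> nat).
Hypothesis Inz : exists2 x, fat_ideal_deg P m s x & x != 0.
Hypothesis Idiv : forall x, fat_ideal_deg P m s x -> divides (curves c) x.
Hypothesis Ineg : forall q, irreducible_elt q -> negative P q ->
  ~ (forall x, fat_ideal_deg P m s x -> divides (curves c * q) x).

Definition res i := (m i - mults c i)%N.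

Lemma degs_le : (degs c <= s)%N.
Proof.
have [x Ix x0] := Inz; have [y yE] := Idiv Ix.
by have [] := homog_quotient Ix.2 x0 (curves_homog c) yE.
Qed.

Lemma res_quotient x y : fat_ideal_deg P m s x -> x = y * curves c -> fat_ideal_deg P res (s - degs c) y.
Proof.
move=> Ix E; split=> [i|].
  apply: (vanish_div (curves_mult c i)); rewrite mulrC -E; exact: Ix.1.
exact: form_quotient Ix.2 (curves_neq0 c) (curves_homog c) E.
Qed.

Lemma fat_of_res y : fat_ideal_deg P res (s - degs c) y -> fat_ideal_deg P m s (curves c * y).
Proof.
move=> Iy; have := fatM (fat_mult (curves_homog c) (curves_mult c)) Iy.
rewrite subnKC ?degs_le //; apply: fatW => i; rewrite /res; clear; lia.
Qed.

Lemma h0_res : h0 P m s = h0 P res (s - degs c).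
Proof.
rewrite /h0 -(hdim_mul (curves_neq0 c) (subspace_fat P res (s - degs c)) (fin_dim_fat P _ _)).
apply: eq_hdim => x; split=> [Ix|[y Iy ->]]; last exact: fat_of_res.
by have [y E] := Idiv Ix; exists y; [exact: res_quotient E|rewrite mulrC].
Qed.

(** If the moving part were negative on q, then q would be a negative curve dividing every section
    of it by Bezout, and the fixed part would not contain all negative factors. *)
Lemma res_nef q e l : irreducible_elt q -> q \is e.-homog -> (forall i, mult_at (P i) q (l i)) ->
  0 <= inter (s - degs c) res e l.
Proof.
move=> qi hq lq; rewrite leNgt; apply/negP => neg.
have [x Ix x0] := Inz; have [y yE] := Idiv Ix.
have y0 : y != 0 by apply: contraNneq x0 => z; rewrite yE z mul0r.
have q0 : q != 0 by case: qi.
have qq := negative_of_inter qi hq lq (res_quotient Ix yE) y0 neg.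
apply: (Ineg qi).
  exists l => //; rewrite (mdegree_homog q0 hq).
  move: qq; rewrite /inter -PoszM.
  have -> : \sum_i (l i)%:Z * (l i)%:Z = (\sum_i l i ^ 2)%N%:Z.
    by rewrite sumZ; apply: eq_bigr => i _; rewrite -PoszM mulnn.
  by rewrite mulnn; clear; lia.
move=> x' Ix'; have [y' E'] := Idiv Ix'; rewrite E' (mulrC y').
rewrite (divides_mul2l _ _ (curves_neq0 c)); apply: NNPP => nd.
by have := inter_ge0_of_not_divides qi hq lq (res_quotient Ix' E') nd; rewrite leNgt neg.
Qed.

Hypothesis hres : (h0 P res (s - degs c))%:Z <= chi res (s - degs c).

(** Multiplication by G embeds the class (m', D') into I(Z)_s, whose dimension is that of the moving
    part, so that [chi] cannot increase. *)
Lemma chi_le_of_mul (G : R) dG mu m' D' : G \is dG.-homog -> (forall i, mult_at (P i) G (mu i)) -> G != 0 ->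
  (forall i, (m i <= mu i + m' i)%N) -> (dG + D' = s)%N -> chi m' D' <= chi res (s - degs c).
Proof.
move=> hG mG G0 le E; have := h0_mul D' hG mG G0 le; rewrite E h0_res => lh.
apply: le_trans (le_trans (chi_le_h0 P m' D') _) hres.
by rewrite lez_nat.
Qed.

Lemma res_inter0 j : (0 < c j)%N -> inter (s - degs c) res (d j) (k j) = 0.
Proof.
move=> cj; have [e ce] := bump_pred cj.
apply/eqP; rewrite eq_le (res_nef (fi j) (hf j) (fk j)) andbT.
have := @chi_le_of_mul _ _ _ (addm res (k j)) (s - degs c + d j)%N (curves_homog e) (curves_mult e) (curves_neq0 e).
rewrite chi_curve // gerDl; apply.
  by move=> i; rewrite /addm /res ce mults_bump /addm; clear; lia.
have := degs_le; rewrite ce degs_bump; clear; lia.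
Qed.

Lemma curves_disjoint i j : i != j -> (0 < c i)%N -> (0 < c j)%N ->
  inter (d i) (k i) (d j) (k j) = 0.
Proof.
move=> ij ci cj; have [e ce] := bump_pred cj.
have ei : (0 < e i)%N by move: ci; rewrite ce /bump (negPf ij) addn0.
have [e' ee] := bump_pred ei.
apply/eqP; rewrite eq_le inter_sym other_inter // andbT inter_sym.
have := @chi_le_of_mul _ _ _ (addm (addm res (k i)) (k j)) (s - degs c + d i + d j)%N
  (curves_homog e') (curves_mult e') (curves_neq0 e').
rewrite chi_curve // chi_curve // interD !res_inter0 // addr0 add0r gerDl; apply.
  by move=> l; rewrite /addm /res ce mults_bump ee mults_bump /addm; clear; lia.
have := degs_le; rewrite ce degs_bump ee degs_bump; clear; lia.
Qed.

(** If the fixed curves exceed the multiplicity m_i, some C_j among them passes through P_i. Add C_j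
    to the moving part and lower the multiplicity at P_i by one: the sections still embed into
    I(Z)_s thanks to the excess, yet [chi] has grown. *)
Lemma mults_le i : (mults c i <= m i)%N.
Proof.
rewrite leqNgt; apply/negP => lt.
have /existsP[j /andP[cj kj]] : [exists j, (0 < c j)%N && (0 < k j i)%N].
  apply: contraTT lt; rewrite negb_exists => /forallP nj; rewrite -leqNgt.
  by rewrite /mults big1 // => j _; move: (nj j); rewrite negb_and -!leqNgt !leqn0 => /orP[] /eqP ->; rewrite ?muln0.
have [e ce] := bump_pred cj.
(* The class of A + C_j + E_i; its multiplicity at P_i is still natural since C_j passes through
   P_i. *)
pose m' l := (addm res (k j) l - (l == i))%N.
have bm : bump m' i = addm res (k j).
  apply: functional_extensionality => l; rewrite /bump /m' subnK //.
  by case: eqP => // ->; rewrite /addm; move: kj; clear; lia.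
have := @chi_le_of_mul _ _ _ m' (s - degs c + d j)%N (curves_homog e) (curves_mult e) (curves_neq0 e).
have -> : chi m' (s - degs c + d j) = chi res (s - degs c) + (m' i).+1%:Z.
  have := chi_bump m' i (s - degs c + d j); rewrite bm chi_curve // (res_inter0 cj) addr0 => ->.
  by rewrite subrK.
rewrite gerDl => H; suff : (m' i).+1%:Z <= 0 by [].
apply: H => [l|].
  rewrite /m' /addm /res ce mults_bump /addm.
  case: eqP => [->|_]; last by clear; lia.
  by move: lt kj; rewrite ce mults_bump /addm; clear; lia.
have := degs_le; rewrite ce degs_bump; clear; lia.
Qed.

End Level.

Lemma bin2_succ_sub z y : ('C(z.+1 - y, 2) = 'C(z - y, 2) + (z - y))%N.
Proof.
case: (leqP y z) => [le|lt]; first by rewrite subSn // binS bin1.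
have -> : (z - y = 0)%N by move: lt; clear; lia.
have -> : (z.+1 - y = 0)%N by move: lt; clear; lia.
by [].
Qed.

Lemma degs_sub c x : (forall j, (x j <= c j)%N) -> degs c = (degs x + degs (fun j => c j - x j))%N.
Proof.
by move=> le; rewrite /degs -big_split; apply: eq_bigr => j _ /=; rewrite -mulnDl subnKC.
Qed.

Lemma mults_sub c x i : (forall j, (x j <= c j)%N) ->
  mults c i = (mults x i + mults (fun j => c j - x j) i)%N.
Proof.
by move=> le; rewrite /mults -big_split; apply: eq_bigr => j _ /=; rewrite -mulnDl subnKC.
Qed.

(** * Adding disjoint curves one copy at a time *)

Section Chain.
Variable act : pred 'I_r.
Hypothesis disj : forall i j, i != j -> act i -> act j -> inter (d i) (k i) (d j) (k j) = 0.

Lemma inter_curves x j : (forall l, (0 < x l)%N -> act l) -> act j ->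
  inter (degs x) (mults x) (d j) (k j) = - (x j)%:Z.
Proof.
move=> + aj; elim/mult_ind: x => [_|x l IH ax].
  by rewrite degs0 mults0 /inter mul0r big1 ?subr0 ?oppr0 // => i _; rewrite mul0r.
rewrite degs_bump mults_bump interD IH; last first.
  by move=> i xi; apply: ax; rewrite /bump addn_gt0 xi.
have al : act l by apply: ax; rewrite /bump eqxx addn1.
rewrite /bump PoszD opprD; congr (_ + _).
have [->|ne] := eqVneq j l; first exact: sq.
by rewrite disj // 1?eq_sym // oppr0.
Qed.

Variables (m0 : 'I_n -> nat) (D0 : nat) (X : 'I_r -> nat).
Hypothesis X_act : forall j, (0 < X j)%N -> act j.
Hypothesis X_le : forall j, (X j <= d j)%N.
Hypothesis inter0 : forall j, (0 < X j)%N -> inter D0 m0 (d j) (k j) = (d j)%:Z.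

Lemma inter_chain x j : (forall l, (x l <= X l)%N) -> (0 < X j)%N ->
  inter (D0 + degs x) (addm m0 (mults x)) (d j) (k j) = (d j)%:Z - (x j)%:Z.
Proof.
move=> le Xj; rewrite interD inter0 // inter_curves //; last exact: X_act.
by move=> l xl; apply: X_act; apply: leq_trans xl (le l).
Qed.

Lemma chain_bump x j : addm m0 (mults (bump x j)) = addm (addm m0 (mults x)) (k j) /\
  (D0 + degs (bump x j) = D0 + degs x + d j)%N.
Proof.
split; last by rewrite degs_bump addnA.
by rewrite mults_bump; apply: functional_extensionality => i; rewrite /addm addnA.
Qed.

(** Each copy of C_j lowers the degree on C_j by one, starting from d_j. The bound X_j <= d_j keeps
    the degree at least 0, so natural subtraction is exact. *)
Lemma inter_chain_bump x j : (forall l, (bump x j l <= X l)%N) ->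
  inter (D0 + degs x + d j) (addm (addm m0 (mults x)) (k j)) (d j) (k j) + 1 = (d j - x j)%N%:Z.
Proof.
move=> le; have lej := le j; have := chain_bump x j => -[<- <-].
have Xj : (0 < X j)%N by apply: leq_trans lej; rewrite /bump eqxx addn1.
rewrite inter_chain //; move: lej (X_le j); rewrite /bump eqxx; clear; lia.
Qed.

Lemma bump_le_X x j : (forall l, (bump x j l <= X l)%N) -> forall l, (x l <= X l)%N.
Proof. by move=> le l; apply: leq_trans (le l); rewrite /bump leq_addr. Qed.

Lemma sum_bump_other (F : 'I_r -> nat -> nat) x j :
  (\sum_l F l (bump x j l) + F j (x j) = \sum_l F l (x l) + F j (x j).+1)%N.
Proof.
rewrite (bigD1 j) //= [in RHS](bigD1 j) //= /bump eqxx addn1.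
rewrite (eq_bigr (fun l => F l (x l))) => [|l /negPf ->]; last by rewrite addn0.
by move: (\sum_(_ | _) _)%N => z; clear; lia.
Qed.

(** The copy of C_j added to x_j others contributes at most d_j - x_j sections; these sum to x_j d_j
    - binom(x_j, 2). *)
Lemma h0_chain x : (forall l, (x l <= X l)%N) ->
  (h0 P (addm m0 (mults x)) (D0 + degs x) + \sum_j 'C(x j, 2) <= h0 P m0 D0 + \sum_j x j * d j)%N.
Proof.
elim/mult_ind: x => [_|x j IH le].
  rewrite degs0 mults0 addn0 !big1 // leq_add2r.
  rewrite (_ : addm m0 (fun=> 0%N) = m0) //.
  by apply: functional_extensionality => i; rewrite /addm addn0.
have iE := inter_chain_bump le.
have [phi nphi] := rat j.
have := h0_add_curve distP (fi j) (hf j) (fk j) nphi (m := addm m0 (mults x)) (D := D0 + degs x) (e := d j - x j).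
rewrite iE lexx => /(_ isT); have [-> ->] := chain_bump x j.
move: (IH (bump_le_X le)) (le j) (X_le j) (sum_bump_mul x d j) (sum_bump_other (fun _ z => 'C(z, 2)) x j).
rewrite /bump eqxx binS bin1; clear.
move: (h0 _ _ _) (h0 _ _ _) (h0 _ _ _) (\sum_l _)%N (\sum_l _)%N (\sum_l _)%N (\sum_l _)%N ('C(x j, 2)).
move=> z1 z2 z3 z4 z5 z6 z7 z8; lia.
Qed.

Variables (a b : 'I_r -> nat).
Hypothesis spl : forall j, splitting_type (f j) (a j) (b j).

(** Here e = d_j - x_j, and a_j + b_j = d_j gives (a_j - e)^+ = (x_j - b_j)^+ and symmetrically;
    these are the increments of binom(x - b_j, 2) and binom(x - a_j, 2). *)
Lemma cok_chain x : (h0 P m0 D0)%:Z <= chi m0 D0 ->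
  (h0 P m0 D0.+1 <= hdim (im_mu P m0 D0))%N -> (forall l, (x l <= X l)%N) ->
  (h0 P (addm m0 (mults x)) (D0 + degs x))%:Z <= chi (addm m0 (mults x)) (D0 + degs x) /\
  (h0 P (addm m0 (mults x)) (D0 + degs x).+1 <=
    hdim (im_mu P (addm m0 (mults x)) (D0 + degs x)) + \sum_j ('C(x j - a j, 2) + 'C(x j - b j, 2)))%N.
Proof.
move=> h00 c00; elim/mult_ind: x => [_|x j IH le].
  rewrite degs0 mults0 addn0 (_ : addm m0 (fun=> 0%N) = m0).
    by split=> //; apply: leq_trans c00 (leq_addr _ _).
  by apply: functional_extensionality => i; rewrite /addm addn0.
have iE := inter_chain_bump le.
have [hx cx] := IH (bump_le_X le).
have [_ [phi [nphi [q1 [q2 [h1 h2 bas]]]]]] := spl j.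
have [-> ->] := chain_bump x j; split.
  by apply: (chi_step distP (fi j) (hf j) (fk j) nphi) => //; rewrite iE.
have := cok_step distP (fi j) (hf j) (fk j) nphi h1 h2 bas (sq j) (adj j) hx iE.
have ab := splitting_degree (fi j) (hf j) nphi h1 h2 bas.
move: cx (le j) (X_le j) ab (sum_bump_other (fun l z => 'C(z - a l, 2) + 'C(z - b l, 2))%N x j).
rewrite !bin2_succ_sub /bump eqxx; clear.
move: (h0 _ _ _) (h0 _ _ _) (hdim _) (hdim _) (\sum_l _)%N (\sum_l _)%N ('C(_, 2)) ('C(_, 2)).
move=> z1 z2 z3 z4 z5 z6 z7 z8 *; lia.
Qed.

End Chain.

Lemma im_mu_of_res m s c : (degs c <= s)%N ->
  (hdim (im_mu P (res m c) (s - degs c)) <= hdim (im_mu P m s))%N.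
Proof.
move=> le; rewrite -(hdim_mul (curves_neq0 c) (subspace_im_mu P _ _) (fin_dim_im_mu P _ _)).
apply: hdimS; [exact: subspace_im_mu| | |exact: fin_dim_im_mu].
  by apply: subspace_image; [exact: lin_mul|exact: subspace_im_mu].
move=> _ [_ [q [F [G [hF hG ->]]]] ->].
exists q, (fun i => curves c * F i), G; split=> // [i|].
  have := fatM (fat_mult (curves_homog c) (curves_mult c)) (hF i).
  rewrite subnKC //; apply: fatW => l; rewrite /res; clear; lia.
by rewrite mulr_sumr; apply: eq_bigr => i _; rewrite mulrA.
Qed.

Lemma binom2_sub x y : binom2 (x%:Z - y%:Z) = ('C(x - y, 2))%:Z.
Proof.
have [le|lt] := leqP y x; first by rewrite subzn.
rewrite (_ : x - y = 0)%N; last by move: lt; clear; lia.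
have -> : x%:Z - y%:Z = Negz (y - x).-1 by rewrite NegzE; move: lt; clear; lia.
by [].
Qed.

Definition base_locus m s c := [/\ exists2 x, fat_ideal_deg P m s x & x != 0,
    forall x, fat_ideal_deg P m s x -> divides (curves c) x
  & forall q, irreducible_elt q -> negative P q ->
      ~ (forall x, fat_ideal_deg P m s x -> divides (curves c * q) x)].

(** With A the moving part in degree t - 1, the moving part in degree t is A + L + sum X1_j C_j, and
    that in degree t + 1 is obtained from it by adding L + sum X2_j C_j. The first chain bounds the
    cokernel of multiplication on the moving part of degree t, the second bounds the sections in
    degree t + 1 that lie beyond the target of that multiplication. *)
Theorem numeric_bound m t (c c' c'' a b : 'I_r -> nat) : (0 < t)%N ->
  base_locus m t.-1 c -> base_locus m t c' -> base_locus m t.+1 c'' ->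
  good_nef t -> (forall j, 0 < c j)%N -> (forall j, c'' j <= c' j <= c j)%N ->
  (forall j, splitting_type (f j) (a j) (b j)) ->
  exists N : nat, dim_cok_mu P m t N /\
    N%:Z <= \sum_j (d j)%:Z * ((c' j)%:Z - (c'' j)%:Z) - \sum_j binom2 ((c' j)%:Z - (c'' j)%:Z)
       + \sum_j (binom2 ((c j)%:Z - (c' j)%:Z - (a j)%:Z) + binom2 ((c j)%:Z - (c' j)%:Z - (b j)%:Z)).
Proof.
move=> t0 [I0 d0 n0] [I1 d1 n1] [I2 d2 n2] nef c0 le spl.
have le1 j : (c' j <= c j)%N by case/andP: (le j).
have le2 j : (c'' j <= c' j)%N by case/andP: (le j).
set A := res m c; set D := (t.-1 - degs c)%N.
have D0le := degs_le I0 d0; have D1le := degs_le I1 d1; have D2le := degs_le I2 d2.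
have hA : (h0 P A D)%:Z <= chi A D.
  apply: nef; first by rewrite /D; clear; lia.
    have [x Ix x0] := I0; have [y E] := d0 _ Ix; exists y; first exact: res_quotient Ix E.
    by apply: contraNneq x0 => z; rewrite E z mul0r.
  by move=> g e l gi hg lg; apply: (res_nef I0 d0 n0 gi hg lg).
have A0 j : inter D A (d j) (k j) = 0 by apply: (res_inter0 I0 d0 n0 hA).
have disj i j : i != j -> true -> true -> inter (d i) (k i) (d j) (k j) = 0.
  by move=> ij _ _; apply: (curves_disjoint I0 d0 n0 hA).
have mle i : (mults c i <= m i)%N by apply: (mults_le I0 d0 n0 hA).
pose X1 j := (c j - c' j)%N; pose X2 j := (c' j - c'' j)%N.
(* The fixed multiplicities in degree t - 1 do not exceed m, so truncated subtraction is additive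
   here. *)
have resS x y (lexy : forall j, (y j <= x j)%N) : (forall j, (x j <= c j)%N) ->
    res m y = addm (res m x) (mults (fun j => x j - y j)%N).
  move=> lexc; apply: functional_extensionality => i; rewrite /res /addm.
  have := mle i; have := mults_sub i lexc; have := mults_sub i lexy; clear; lia.
have E1 : res m c' = addm A (mults X1) by apply: resS.
have F1 : (t - degs c' = D.+1 + degs X1)%N.
  have := degs_sub le1; rewrite -/X1 /D; move: D0le D1le t0; clear; lia.
have E2 : res m c'' = addm (res m c') (mults X2) by apply: resS.
have F2 : (t.+1 - degs c'' = (t - degs c').+1 + degs X2)%N.
  have := degs_sub le2; rewrite -/X2; move: D1le D2le; clear; lia.
have interL a0 (m0 : 'I_n -> nat) j : inter a0.+1 m0 (d j) (k j) = inter a0 m0 (d j) (k j) + (d j)%:Z.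
  by rewrite /inter -addn1 PoszD; ring.
have nn (x : 'I_r -> nat) j : (forall l, 0 < x l -> true)%N by [].
(* The moving part in degree t is nef, and its degree on C_j is d_j - X1_j. *)
have X1le j : (X1 j <= d j)%N.
  have := res_nef I1 d1 n1 (fi j) (hf j) (fk j); rewrite E1 F1 interD interL A0.
  by rewrite (inter_curves (act := predT)) // add0r subr_ge0 lez_nat.
have [hL surj] := line_step hA.
have cL : (h0 P A D.+2 <= hdim (im_mu P A D.+1))%N.
  by apply: hdimS; [exact: subspace_im_mu|exact: subspace_fat|exact: surj|exact: fin_dim_im_mu].
have intL j : (0 < X1 j)%N -> inter D.+1 A (d j) (k j) = (d j)%:Z.
  by move=> _; rewrite interL A0 add0r.
have := @cok_chain predT disj A D.+1 X1 (fun _ _ => isT) X1le intL a b spl X1 hL cL (fun _ => leqnn _).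
rewrite -E1 -F1 => -[hR cR].
(* A curve with X2_j > 0 is fixed in degree t, where H^1 of the moving part vanishes by the chain;
   so it is orthogonal to that moving part. *)
have R0 j : (0 < X2 j)%N -> inter (t - degs c') (res m c') (d j) (k j) = 0.
  by move=> X2j; apply: (res_inter0 I1 d1 n1 hR); move: X2j; rewrite /X2; clear; lia.
have X2le j : (X2 j <= d j)%N.
  case: (posnP (X2 j)) => [->//|X2j].
  have := res_nef I2 d2 n2 (fi j) (hf j) (fk j); rewrite E2 F2 interD interL R0 //.
  by rewrite (inter_curves (act := predT)) // add0r subr_ge0 lez_nat.
have intR j : (0 < X2 j)%N -> inter (t - degs c').+1 (res m c') (d j) (k j) = (d j)%:Z.
  by move=> X2j; rewrite interL R0 // add0r.
have := @h0_chain predT disj (res m c') (t - degs c').+1 X2 (fun _ _ => isT) X2le intR X2 (fun _ => leqnn _).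
rewrite -E2 -F2 -(h0_res I2 d2) => h2.
have imle := im_mu_of_res m D1le.
have imI : (hdim (im_mu P m t) <= h0 P m t.+1)%N.
  apply: hdimS; [exact: subspace_fat|exact: subspace_im_mu| |exact: fin_dim_fat].
  by move=> x; exact: im_mu_sub.
exists (h0 P m t.+1 - hdim (im_mu P m t))%N; split.
  apply: hdim_quot; [exact: subspace_fat|exact: subspace_im_mu| |exact: fin_dim_fat].
  by move=> x; exact: im_mu_sub.
have -> : \sum_j (d j)%:Z * ((c' j)%:Z - (c'' j)%:Z) = (\sum_j X2 j * d j)%N%:Z.
  by rewrite sumZ; apply: eq_bigr => j _; rewrite PoszM /X2 subzn // mulrC.
have -> : \sum_j binom2 ((c' j)%:Z - (c'' j)%:Z) = (\sum_j 'C(X2 j, 2))%N%:Z.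
  by rewrite sumZ; apply: eq_bigr => j _; rewrite binom2_sub.
have -> : \sum_j (binom2 ((c j)%:Z - (c' j)%:Z - (a j)%:Z) + binom2 ((c j)%:Z - (c' j)%:Z - (b j)%:Z))
   = (\sum_j ('C(X1 j - a j, 2) + 'C(X1 j - b j, 2)))%N%:Z.
  by rewrite sumZ; apply: eq_bigr => j _; rewrite PoszD subzn // !binom2_sub.
move: h2 imle imI cR; clear.
move: (h0 _ _ _) (h0 _ _ _) (hdim _) (hdim _) => z1 z2 z3 z4.
move: (\sum_j _)%N (\sum_j _)%N (\sum_j _)%N => z5 z6 z7; lia.
Qed.

End Curves.

Lemma fat_succ_neq0 m s s' : (s <= s')%N -> (exists2 x, fat_ideal_deg P m s x & x != 0) ->
  exists2 x, fat_ideal_deg P m s' x & x != 0.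
Proof.
move=> le [x [vx hx] x0]; exists (x * 'X_ord0 ^+ (s' - s)).
  split=> [i|]; first by rewrite mulrC; apply: vanish_mull.
  have := dhomogM hx (dhomogMn (s' - s) (dhomogX1 K (ord0 : 'I_3))).
  by rewrite mul1n subnKC.
by rewrite mulf_neq0 // expf_neq0 // var_neq0.
Qed.

(** As t exceeds alpha, I(Z)_(t-1) contains a nonzero form; the f_j divide it, hence are forms of
    degree at most t, and being negative they fall under [good_curves t]. *)
Theorem good_points_bound m t : good_curves t -> good_nef t ->
  forall alpha : nat, is_alpha P m alpha -> (alpha < t)%N ->
  forall (r : nat) (f : 'I_r -> {mpoly K[3]}) (c c' c'' : 'I_r -> nat),
    (forall j, irreducible_elt (f j)) ->
    (forall i j, i != j -> ~ associate (f i) (f j)) ->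
    (forall j, (0 < c j)%N) ->
    is_gamma P m t.-1 (\prod_j f j ^+ c j) ->
    is_gamma P m t (\prod_j f j ^+ c' j) ->
    is_gamma P m t.+1 (\prod_j f j ^+ c'' j) ->
    (forall j, (c'' j <= c' j <= c j)%N) ->
    (forall j, exists a b, splitting_type (f j) a b) /\
    (forall a b : 'I_r -> nat,
       (forall j, splitting_type (f j) (a j) (b j)) ->
       exists N : nat, dim_cok_mu P m t N /\
         N%:Z <= \sum_j (mdegree (f j))%:Z * ((c' j)%:Z - (c'' j)%:Z)
                 - \sum_j binom2 ((c' j)%:Z - (c'' j)%:Z)
                 + \sum_j (binom2 ((c j)%:Z - (c' j)%:Z - (a j)%:Z)
                         + binom2 ((c j)%:Z - (c' j)%:Z - (b j)%:Z))).
Proof.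
move=> gc gn alpha [[x0 [Ix0 nx0]] _] lt r f c c' c'' fi na c0 g0 g1 g2 le.
have t0 : (0 < t)%N by exact: leq_trans lt.
have I0 : exists2 x, fat_ideal_deg P m t.-1 x & x != 0.
  by apply: (fat_succ_neq0 (s := alpha)); [move: lt; clear; lia|exists x0].
have I1 := fat_succ_neq0 (leq_pred t) I0; have I2 := fat_succ_neq0 (leqnSn t) I1.
have [G0 d0 n0 b0] := gammaP g0 I0; have [_ d1 _ b1] := gammaP g1 I1; have [_ d2 _ b2] := gammaP g2 I2.
have fG j : divides (f j) (\prod_j f j ^+ c j).
  rewrite (bigD1 j) //=; apply: divides_mulr; case: (c j) (c0 j) => // e _.
  by rewrite exprS; apply: divides_mulr; exact: divides_refl.
have [x Ix nx] := I0; have [y yE] := d0 _ Ix.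
have fx j : divides (f j) x by rewrite yE; apply: divides_mull; exact: fG.
have hf j : f j \is (mdegree (f j)).-homog by exact: homog_divides Ix.2 nx (fx j).
have ft j : (mdegree (f j) <= t)%N.
  have [z zE] := fx j; have [le' _] := homog_quotient Ix.2 nx (hf j) zE.
  exact: leq_trans le' (leq_pred _).
have neg j : exists k, (forall i, mult_at (P i) (f j) (k i)) /\ (mdegree (f j) ^ 2 < \sum_i k i ^ 2)%N.
  by have [k mk lk] := n0 _ (fi j) (fG j); exists k.
pose k j := projT1 (constructive_indefinite_description _ (neg j)).
have kP j : (forall i, mult_at (P i) (f j) (k j i)) /\ (mdegree (f j) ^ 2 < \sum_i k j i ^ 2)%N.
  exact: projT2 (constructive_indefinite_description _ (neg j)).
have gcj j : [/\ inter (mdegree (f j)) (k j) (mdegree (f j)) (k j) = -1,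
    3 * (mdegree (f j))%:Z - \sum_i (k j i)%:Z = 1 & rational_curve (f j)].
  apply: gc => //; first by case: (kP j).
  have [_] := kP j; rewrite /inter -PoszM mulnn.
  have -> : \sum_i (k j i)%:Z * (k j i)%:Z = (\sum_i k j i ^ 2)%N%:Z.
    by rewrite sumZ; apply: eq_bigr => i _; rewrite -PoszM mulnn.
  by clear; lia.
split=> [j|a b spl]; first by apply: splitting_type_exists => //; case: (gcj j).
apply: (numeric_bound (k := k) fi hf _ na _ _ _ t0 _ _ _ gn) => //.
- by move=> j i; case: (kP j).
- by move=> j; case: (gcj j).
- by move=> j; case: (gcj j).
- by move=> j; case: (gcj j).
Qed.

End Numeric.

(** * Sections on the blow-up *)

Section CurvePoints.
Variable K : closedFieldType.
Local Notation R := {mpoly K[3]}.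

Lemma distinct_elements N : exists s : seq K, uniq s /\ size s = N.
Proof.
elim: N => [|N [s [us sN]]]; first by exists [::].
have q0 : \prod_(a <- s) ('X - a%:P) != 0 :> {poly K}.
  by rewrite monic_neq0 // monic_prod_XsubC.
have [x] := closed_nonrootP _ q0; rewrite root_prod_XsubC => xs.
by exists (x :: s); rewrite /= xs us sN.
Qed.

Definition frame_point (M : 'M[K]_3) (x : 'I_3 -> K) j := \sum_i M i j * x i.

Lemma frame_pointE M x j : frame_point M x j = (\row_i x i *m M) 0 j.
Proof. by rewrite mxE; apply: eq_bigr => l _; rewrite mxE mulrC. Qed.

Lemma frame_point_inj M x y : M \in unitmx -> (forall j, frame_point M x j = frame_point M y j) -> x =1 y.
Proof.
move=> uM E i; have : \row_j x j *m M = \row_j y j *m M.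
  by apply/rowP => j; rewrite -!frame_pointE.
by move/(congr1 (mulmx^~ (invmx M))); rewrite !mulmxK // => /rowP/(_ i); rewrite !mxE.
Qed.

Lemma frame_point_neq0 M x : M \in unitmx -> (exists i, x i != 0) -> exists j, frame_point M x j != 0.
Proof.
move=> uM [i xi]; apply: NNPP => no; move: xi; rewrite (@frame_point_inj M x (fun=> 0)) ?eqxx // => j.
rewrite [RHS]big1 => [|l _]; last by rewrite mulr0.
by apply/eqP/negPn/negP => h; apply: no; exists j.
Qed.

(** Every line through a point Q off the curve meets the curve, away from Q. Different lines of the
    pencil, indexed by c, give different points, and K is infinite. *)
Lemma curve_points (b : R) d N : b \is d.-homog -> b != 0 -> (0 < d)%N ->
  exists w : 'I_N -> proj 2 K, distinct_points w /\ forall i, b.@[w i] = 0.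
Proof.
move=> hb b0 d0; have [Q bQ] := mpoly_nonvanish b0.
have Qn : exists i, Q i != 0.
  apply: NNPP => no; move: bQ; rewrite (meval_eq (v2 := fun i => 0 * Q i)).
    by rewrite (homog_scale _ _ hb) expr0n (gtn_eqF d0) mul0r eqxx.
  by move=> i; rewrite mul0r; apply/eqP/negPn/negP => h; apply: no; exists i.
have [M uM MQ] := exists_frame Qn.
pose v3 (s t c : K) : 'I_3 -> K := fun i => if i == ord0 then s else if i == j1 then t else c * t.
have v3E s t c j : frame_point M (v3 s t c) j = M ord0 j * s + (M j1 j + c * M j2 j) * t.
  by rewrite /frame_point !big_ord_recl big_ord0 /v3 /= addr0 -/j1 -/j2; ring.
have root c : exists w : proj 1 K, b.@[frame_point M (v3 (w ord0) (w ord_max) c)] = 0 /\ w ord_max != 0.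
  pose psi j : {mpoly K[2]} := M ord0 j *: 'X_ord0 + (M j1 j + c * M j2 j) *: 'X_ord_max.
  have hpsi j : psi j \is 1.-homog by rewrite rpredD // rpredZ // dhomogX1.
  have [w wE] := binary_root d0 (msub_homog1 hpsi hb).
  have E : b.@[frame_point M (v3 (w ord0) (w ord_max) c)] = 0.
    rewrite -wE msub_eval; apply: meval_eq => j.
    by rewrite v3E /psi mevalD !mevalZ !mevalXU.
  exists w; split=> //; apply/eqP => w1; case: (proj1_neq0 w) => [w0|]; last by rewrite w1 eqxx.
  move: E; rewrite (meval_eq (v2 := fun j => w ord0 * Q j)) => [|j].
    rewrite (homog_scale _ _ hb) => /eqP; rewrite mulf_eq0 (negPf bQ) orbF.
    by rewrite expf_eq0 (negPf w0) andbF.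
  by rewrite v3E w1 mulr0 addr0 MQ mulrC.
pose w c := projT1 (constructive_indefinite_description _ (root c)).
have wP c : b.@[frame_point M (v3 (w c ord0) (w c ord_max) c)] = 0 /\ w c ord_max != 0.
  exact: projT2 (constructive_indefinite_description _ (root c)).
have nz c : exists j, frame_point M (v3 (w c ord0) (w c ord_max) c) j != 0.
  by apply: frame_point_neq0 => //; exists j1; case: (wP c).
have [s [us sN]] := distinct_elements N.
exists (fun i : 'I_N => Proj (nz s`_i)); split=> [i j ij [l lE]|i]; last by case: (wP s`_i).
have E := @frame_point_inj M (v3 (w s`_i ord0) (w s`_i ord_max) s`_i)
  (fun x => l * v3 (w s`_j ord0) (w s`_j ord_max) s`_j x) uM.
have {E lE} E x : v3 (w s`_i ord0) (w s`_i ord_max) s`_i x = l * v3 (w s`_j ord0) (w s`_j ord_max) s`_j x.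
  apply: E => y; have := lE y; rewrite /= => ->; rewrite /frame_point mulr_sumr.
  by apply: eq_bigr => z _; rewrite mulrCA.
have e1 := E j1; have e2 := E j2; move: e1 e2; rewrite /v3 /= => e1 e2.
have [_ ne] := wP s`_i; have e3 : s`_i = s`_j by apply: (mulIf ne); rewrite e2 e1; ring.
have li (l' : 'I_N) : (l' < size s)%N by rewrite sN.
case/negP: ij; rewrite -(inj_eq val_inj) -(nth_uniq 0 (li i) (li j) us).
by rewrite -e3.
Qed.

(** Multiply A by lines through the P_i that do not contain the curve. The product, of degree e + n,
    cannot vanish at d (e + n) + 1 points of the curve by Bezout; where it is nonzero the point also
    differs from all P_i. *)
Lemma curve_point_off n (P : 'I_n -> proj 2 K) (b A : R) d e : irreducible_elt b ->
  b \is d.-homog -> A \is e.-homog -> ~ divides b A ->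
  exists w : proj 2 K, [/\ b.@[w] = 0, A.@[w] != 0 & forall i, ~ proportional w (P i)].
Proof.
move=> bi hb hA nd; have [b0 bu _] := bi.
have d0 : (0 < d)%N.
  by rewrite lt0n; apply/eqP => z; case/negP: bu; apply: homog0_unit b0 _; have := hb; rewrite z.
have line i : exists l, [/\ l \is 1.-homog, l.@[P i] = 0 & ~ divides b l].
  have [w [dw bw]] := curve_points 2 hb b0 d0.
  have [j npj] : exists j, ~ proportional (w j) (P i).
    apply: NNPP => no; have pr j : proportional (w j) (P i).
      by apply: NNPP => h; apply: no; exists j.
    apply: (dw ord0 ord_max) => //; have [c cE] := pr ord0; have [c' c'E] := pr ord_max.
    have c'0 : c' != 0.
      have [l] := coords_neq0 (w ord_max); rewrite c'E; apply: contraNneq => ->.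
      by rewrite mul0r.
    exists (c / c') => l; rewrite cE c'E; by field.
  have [l [hl l0 l1]] := separating_line npj.
  by exists l; split=> // -[y yE]; case/negP: l1; rewrite yE mevalM bw mulr0.
pose l i := projT1 (constructive_indefinite_description _ (line i)).
have lP i : [/\ l i \is 1.-homog, (l i).@[P i] = 0 & ~ divides b (l i)].
  exact: projT2 (constructive_indefinite_description _ (line i)).
pose A' := A * \prod_i l i.
have hA' : A' \is (e + n)%N.-homog.
  apply: dhomogM => //; have := @dhomog_prodE K 3 _ (index_enum 'I_n) l (fun=> 1%N).
  by rewrite sum1_card card_ord; apply=> i; case: (lP i).
have nd' : ~ divides b A'.
  have pr := mpoly_irreducible_prime bi.
  move=> /pr[//|]; rewrite /A'; elim: (index_enum _) => [|i s IH].
    by rewrite big_nil => -[y yE]; case/negP: bu; apply/unitrPr; exists y; rewrite mulrC.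
  by rewrite big_cons => /pr[|//]; case: (lP i).
have [w [dw bw]] := curve_points (d * (e + n)).+1 hb b0 d0.
have [j Aj] : exists j, A'.@[w j] != 0.
  apply: NNPP => no.
  have v1 (f : R) k : f \is k.-homog -> (forall j, f.@[w j] = 0) -> forall j, vanish (w j) 1 f.
    by move=> hf f0 j; apply/(vanish1_eval _ hf).
  have := bezout_inequality dw bi hb hA' (v1 _ _ hb bw) (v1 _ _ hA' _) nd'.
  rewrite sum1_card card_ord ltnn => H; suff: false by [].
  by apply: H => j; apply/eqP/negPn/negP => h; apply: no; exists j.
exists (w j); move: Aj; rewrite mevalM mulf_eq0 negb_or => /andP[Aj lj]; split=> // i [c cE].
have [hl l0 _] := lP i; case/negP: lj; rewrite rmorph_prod (bigD1 i) //=.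
by rewrite (meval_eq (v2 := fun x => c * P i x)) // (homog_scale _ _ hl) l0 mulr0 mul0r.
Qed.

End CurvePoints.

Section Fractions.
Variable R : idomainType.
Local Notation F := {fraction R}.

Lemma frac_cross (a b c d : R) : b != 0 -> d != 0 ->
  tofrac a / tofrac b = tofrac c / tofrac d :> F <-> a * d = c * b.
Proof.
move=> b0 d0; split=> [/eqP|E].
  by rewrite GRing.eqr_div ?tofrac_eq0 // -!tofracM tofrac_eq => /eqP.
by apply/eqP; rewrite GRing.eqr_div ?tofrac_eq0 // -!tofracM E.
Qed.

Lemma frac_cross_pow (a b g h s : R) k : b != 0 -> h != 0 ->
  tofrac a / tofrac b = tofrac s ^ k%:Z * (tofrac g / tofrac h) :> F <-> a * h = s ^+ k * g * b.
Proof.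
move=> b0 h0; rewrite -exprnP -tofracXn mulrA -tofracM; exact: frac_cross.
Qed.

End Fractions.

Lemma mul_cross (R : comNzRingType) (a a' c c' h g : R) :
  a * c' = c * a' -> c * h = g * c' -> a * h * c' = g * a' * c'.
Proof. by move=> E E'; rewrite mulrAC E mulrAC E' mulrAC. Qed.

Lemma constant_coefE (K : fieldType) k (G : {mpoly K[k]}) : G@_0%MM = G.@[fun=> 0].
Proof.
have := @mpoly_rmorph_ext k K K (mcoeff 0%MM) (meval (fun=> 0)) _ _ G.
by apply=> [c|i] /=; rewrite ?mcoeffC ?eqxx ?mulr1 ?mevalC // mcoeffX mevalXU mnm1_eq0.
Qed.

Lemma constant_coefM (K : fieldType) k (G H : {mpoly K[k]}) : (G * H)@_0%MM = G@_0%MM * H@_0%MM.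
Proof. by rewrite !constant_coefE mevalM. Qed.

Lemma constant_coef_neq0 (K : fieldType) k (G : {mpoly K[k]}) : G@_0%MM != 0 -> G != 0.
Proof. by apply: contraNneq => ->; rewrite mcoeff0. Qed.

(** * Charts of the blow-up and regular sections *)

Section Pullback.
Variables (K : closedFieldType) (n : nat) (P : 'I_n -> proj 2 K).
Local Notation R := {mpoly K[3]}.
Local Notation B := {mpoly K[2]}.
Implicit Types (x : blowup_frame P).

(** After the linear change of coordinates by the frame, the chart is (1, s, u) off the exceptional
    curves and (1, s, s u) on them. *)
Definition chart (on : bool) (j : 'I_3) : B :=
  if j == ord0 then 1 else if j == j1 then 'X_ord0 else if on then 'X_ord0 * 'X_ord_max else 'X_ord_max.

Definition on_exceptional x := if frame_on x is Some _ then true else false.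

Lemma pullbackE x f : pullback x f = msub (chart (on_exceptional x)) (lsub (frame_mx x) f).
Proof.
rewrite /pullback msub_psubst lsubE msub_comp; apply: eq_msub => j.
rewrite msub_sum !big_ord_recl big_ord0 !msubZ !msubX addr0 addrA -/j1 -/j2 /chart /=.
have e1 : 1 = j1 :> 'I_3 by apply: val_inj.
have e2 : ord_max = j2 :> 'I_3 by apply: val_inj.
rewrite /frame_chart /on_exceptional e1 e2; move: (frame_mx x) => M.
by case: (frame_on x) => [i|]; rewrite -!mul_mpolyC mulr1.
Qed.

(** The image of a monomial under the chart. In a fixed degree it determines the monomial, so
    coefficients of a form can be read off its pullback. *)
Definition chart_mon (on : bool) (u : 'X_{1..3}) : 'X_{1..2} :=
  (U_(ord0) *+ (u j1 + on * u j2) + U_(ord_max) *+ u j2)%MM.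

Lemma chart_mon0 on u : chart_mon on u ord0 = (u j1 + on * u j2)%N.
Proof. by rewrite mnmDE !mulmnE !mnm1E /= mul1n mul0n addn0. Qed.

Lemma chart_mon1 on u : chart_mon on u ord_max = u j2.
Proof. by rewrite mnmDE !mulmnE !mnm1E /= mul1n mul0n add0n. Qed.

Lemma msub_chartE on f : msub (chart on) f = \sum_(u <- msupp f) f@_u *: 'X_[chart_mon on u].
Proof.
rewrite msubE; apply: eq_bigr => u _; congr (_ *: _).
rewrite !big_ord_recl big_ord0 /chart /= expr1n mul1r mulr1 -/j1 -/j2 mpolyXD -!mpolyXn.
case: on => /=; last by rewrite mul0n addn0.
by rewrite mul1n exprD exprMn; ring.
Qed.

Lemma mdeg3 (u : 'X_{1..3}) : mdeg u = (u ord0 + u j1 + u j2)%N.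
Proof. by rewrite mdegE !big_ord_recl big_ord0 addn0 addnA. Qed.

Lemma chart_mon_inj on u v : mdeg u = mdeg v -> chart_mon on u = chart_mon on v -> u = v.
Proof.
move=> duv E; have e0 := congr1 (fun w : 'X_{1..2} => w ord0) E.
have e1 := congr1 (fun w : 'X_{1..2} => w ord_max) E.
move: e0 e1 duv; rewrite /= !chart_mon0 !chart_mon1 !mdeg3 => e0 e1 duv.
apply/mnmP => j; move: e0 e1 duv; clear E; case: (ord3P j) => -> //; case: on => /=;
  by move: (u ord0) (u j1) (u j2) (v ord0) (v j1) (v j2) => *; lia.
Qed.

Lemma msub_chart_coef on d f u : f \is d.-homog -> u \in msupp f -> (msub (chart on) f)@_(chart_mon on u) = f@_u.
Proof.
move=> hf fu; rewrite msub_chartE raddf_sum (bigD1_seq u) //= ?msupp_uniq //.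
rewrite mcoeffZ mcoeffX eqxx mulr1 big1_seq ?addr0 // => v /andP[vu fv].
rewrite mcoeffZ mcoeffX; case: eqP => [E|]; last by rewrite mulr0.
case/negP: vu; apply/eqP; apply: (chart_mon_inj _ E).
by rewrite (dhomog_mf hf fu) (dhomog_mf hf fv).
Qed.

Lemma pullbackM x f g : pullback x (f * g) = pullback x f * pullback x g.
Proof. by rewrite /pullback !msub_psubst msubM. Qed.

Lemma pullback1 x : pullback x 1 = 1.
Proof. by rewrite /pullback msub_psubst msub1. Qed.

Lemma pullback_neq0 x f d : f \is d.-homog -> f != 0 -> pullback x f != 0.
Proof.
move=> hf f0; have uM := frame_unit x; have g0 := lsub_neq0 uM f0.
have := lsub_homog (frame_mx x) hf; move: g0; rewrite pullbackE.
move: (lsub _ _) => g g0 hg; have gs : mlead g \in msupp g by apply: mlead_supp.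
apply/eqP => E; have := msub_chart_coef (on_exceptional x) hg gs; rewrite E mcoeff0 => /esym/eqP.
by move: gs; rewrite mcoeff_msupp => /negPf ->.
Qed.

Lemma pullback_at0 x f : (pullback x f)@_0%MM = f.@[frame_mx x ord0].
Proof.
rewrite constant_coefE /pullback msub_psubst msub_eval; apply: meval_eq => j.
rewrite /frame_chart !mevalD !mevalZ mevalC mevalXU mulr0 addr0.
by case: (frame_on x) => [_|]; rewrite ?mevalM mevalXU ?mul0r mulr0 addr0.
Qed.

Lemma base_neq0 x : exists i, frame_mx x ord0 i != 0.
Proof.
apply: NNPP => no; have := frame_unit x; rewrite -row_free_unit.
move/row_freeP => [N MN]; have /matrixP/(_ ord0 ord0)/eqP := MN; rewrite !mxE big1 ?eqxx //=.
  by rewrite eq_sym oner_eq0.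
move=> j _; rewrite (_ : frame_mx x ord0 j = 0) ?mul0r //.
by apply/eqP/negPn/negP => h; apply: no; exists j.
Qed.

Lemma w01_3 (u : 'X_{1..3}) : mwt (@w01 3) u = (u j1 + u j2)%N.
Proof. by rewrite /mwt !big_ord_recl big_ord0 /w01 /= mul0n !mul1n add0n addn0. Qed.

Lemma frame_on_base x i : frame_on x = Some i -> forall j, frame_mx x ord0 j = P i j.
Proof. by case: x => M [i'|] uM b //= [<-]. Qed.

Lemma pullback_vanish x i k f : frame_on x = Some i -> vanish (P i) k f ->
  exists G, pullback x f = 'X_ord0 ^+ k * G.
Proof.
move=> xi; rewrite /vanish (ideal_powP _ _ (frame_unit x) (frame_on_base xi)) /ordM => o.
rewrite pullbackE /on_exceptional xi msub_chartE big_seq.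
have ex u : u \in msupp (lsub (frame_mx x) f) -> divides ('X_ord0 ^+ k) ('X_[chart_mon true u] : B).
  move=> /o; rewrite w01_3 /chart_mon mul1n => le; rewrite mpolyXD -!mpolyXn -(subnK le) exprD.
  by apply: divides_mulr; apply: divides_mull; exact: divides_refl.
have [G GE] : divides ('X_ord0 ^+ k) (\sum_(i0 <- msupp (lsub (frame_mx x) f) |
   i0 \in msupp (lsub (frame_mx x) f)) (lsub (frame_mx x) f)@_i0 *: 'X_[chart_mon true i0] : B).
  elim/big_rec: _ => [|u y /ex du dy]; first exact: divides0.
  apply: dividesD => //; rewrite -mul_mpolyC; exact: divides_mull.
by exists G; rewrite GE mulrC.
Qed.

(** Having a nonzero constant term, H is coprime to s, so s^k divides the pullback of f; the
    exponent of s in a pulled back monomial is its weight in the frame at P_i. *)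
Lemma vanish_pullback x i k f d (G H : B) : frame_on x = Some i -> f \is d.-homog ->
  H@_0%MM != 0 -> pullback x f * H = 'X_ord0 ^+ k * G -> vanish (P i) k f.
Proof.
move=> xi hf H0 E; rewrite /vanish (ideal_powP _ _ (frame_unit x) (frame_on_base xi)) /ordM.
have cop : coprime_elt ('X_ord0 ^+ k : B) H.
  have HN0 := constant_coef_neq0 H0.
  apply: coprime_sym => //.
  apply: coprime_expr; apply: coprime_of_no_common => // p pi [y yE] [z zE].
  have := congr1 (fun q : B => q@_0%MM) yE; rewrite /= constant_coefM => Ey.
  have := congr1 (fun q : B => q@_U_(ord0)%MM) zE; rewrite /= => Ez.
  have pu : p \is a GRing.unit; last by case: pi => _ /negP[].
  have p0 : p != 0 by case: pi.
  have z0 : z != 0 by apply/eqP => z0; have := var_neq0 K (ord0 : 'I_2); rewrite zE z0 mul0r eqxx.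
  have pc : p@_0%MM != 0 by apply: contraNneq H0 => c; rewrite Ey c mulr0.
  have hp : p \is (mdegree p).-homog by apply: (homog_divides (dhomogX1 K (ord0 : 'I_2)) (var_neq0 _ _)); exists z.
  have := dhomog_mf hp; move: pc; rewrite -mcoeff_msupp => p0s /(_ _ p0s).
  rewrite /= mdeg0 => e; apply: homog0_unit p0 _; by have := hp; rewrite -e.
have [G' GE] : divides ('X_ord0 ^+ k) (pullback x f).
  by apply: cop; exists G; rewrite mulrC E mulrC.
move=> u us; have hg := lsub_homog (frame_mx x) hf.
have := msub_chart_coef true hg us; have := us; rewrite mcoeff_msupp => nz cE.
have : (pullback x f)@_(chart_mon true u) != 0.
  by rewrite pullbackE /on_exceptional xi cE.
rewrite GE -mcoeff_msupp mpolyXn (perm_mem (msuppMX _ _)) => /mapP[v _ vE].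
have := congr1 (fun w : 'X_{1..2} => w ord0) vE.
rewrite /= chart_mon0 mnmDE mulmnE mnm1E /= w01_3 !mul1n => ->; exact: leq_addr.
Qed.

Lemma local_rep_cross (F : divisor n) x g G H (A A' : R) a b : local_rep F x g G H ->
  A \is (a).-homog -> A' \is b.-homog -> A' != 0 -> g = tofrac A / tofrac A' ->
  forall k : nat, order_at x F = k%:Z -> pullback x A * H = 'X_ord0 ^+ k * G * pullback x A'.
Proof.
move=> [H0 [a1 [b1 [C [C' [hC hC' C'0 _ [gE lE]]]]]]] hA hA' A'0 gE' k kE.
have p0 := pullback_neq0 x hA' A'0; have p0' := pullback_neq0 x hC' C'0.
have HN0 := constant_coef_neq0 H0.
have E1 : A * C' = C * A' by apply/(frac_cross _ _ A'0 C'0); rewrite -gE' gE.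
have E2 : pullback x C * H = 'X_ord0 ^+ k * G * pullback x C'.
  by apply/frac_cross_pow => //; rewrite -kE.
apply: (mulIf p0'); have := congr1 (pullback x) E1; rewrite !pullbackM => E3; exact: mul_cross E3 E2.
Qed.

Lemma off_frame (w : proj 2 K) : (forall i, ~ proportional w (P i)) ->
  exists x : blowup_frame P, frame_on x = None /\ forall j, frame_mx x ord0 j = w j.
Proof.
move=> nw; have [M uM Mw] := exists_frame (coords_neq0 w).
have nb : forall (i : 'I_n) (c : K), exists j, M ord0 j <> c * P i j.
  move=> i c; apply: NNPP => no; apply: (nw i); exists c => j; rewrite -Mw.
  by apply: NNPP => h; apply: no; exists j.
by exists (@BlowupFrame n K P M None uM nb).
Qed.

Lemma on_frame i : exists x : blowup_frame P, frame_on x = Some i.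
Proof.
have [M uM Mw] := exists_frame (coords_neq0 (P i)).
by exists (@BlowupFrame n K P M (Some i) uM Mw).
Qed.

Lemma exists_off_frame : exists x : blowup_frame P, frame_on x = None.
Proof.
have ix : irreducible_elt ('X_ord0 : R).
  split; [exact: var_neq0|by rewrite mpoly_unitE msizeX mdeg1|].
  move=> a b E; have nz := var_neq0 K (ord0 : 'I_3).
  have ha := homog_divides (dhomogX1 K (ord0 : 'I_3)) nz (ex_intro _ b (etrans E (mulrC a b))).
  have hb := homog_divides (dhomogX1 K (ord0 : 'I_3)) nz (ex_intro _ a E).
  have [le h] := homog_quotient (dhomogX1 K (ord0 : 'I_3)) nz hb E.
  have a0 : a != 0 by apply: contraNneq nz => z; rewrite E z mul0r.
  have b0 : b != 0 by apply: contraNneq nz => z; rewrite E z mulr0.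
  have := mdegree_homog a0 h; case E' : (mdegree b) le => [|[|//]] _.
    by right; apply: homog0_unit b0 _; have := hb; rewrite E'.
  by left; apply: homog0_unit a0 _; have := h; rewrite E'.
have [|w [_ _ wP]] := @curve_point_off K n P _ 1 1 0 ix (dhomogX1 K (ord0 : 'I_3)) (dhomog1 _ _).
  by move=> [y yE]; case: ix => _ /negP[]; apply/unitrPr; exists y; rewrite mulrC.
by have [x [x0 _]] := off_frame wP; exists x.
Qed.

(* Off the exceptional curves a section is regular on all of P^2 but finitely
   many points, hence a form. *)
Lemma regular_form (F : divisor n) g : (forall x, frame_on x = None -> regular_at F x g) ->
  g != 0 -> exists e S, [/\ S \is e.-homog, S != 0, e%:Z = F.1 & g = tofrac S].
Proof.
move=> reg g0; have [x0 x00] := exists_off_frame.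
have [_ [_ [_ [a [b [A [C [hA hC C0 ab [gE _]]]]]]]]] := reg _ x00.
have A0 : A != 0 by apply: contraNneq g0 => z; rewrite gE z tofrac0 mul0r.
(* Induction on the degree of the denominator. A prime factor of it that did not divide the
   numerator would vanish at a point off the P_i where the numerator does not, against regularity
   there; so it cancels. *)
elim: b {-2}b (leqnn b) a A C hA hC C0 ab gE A0 => [|N IH] b bN a A C hA hC C0 ab gE A0.
  have b0 : b = 0%N by move: bN; clear; lia.
  have uC : C \is a GRing.unit by apply: homog0_unit C0 _; have := hC; rewrite b0.
  have hC' : C^-1 \is 0.-homog.
    have [le h] := homog_quotient (dhomog1 _ _) (oner_neq0 R) hC (esym (mulVr uC)).
    by have := h; rewrite sub0n.
  exists a, (A * C^-1); split.
  - by have := dhomogM hA hC'; rewrite addn0.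
  - by rewrite mulf_neq0 // invr_eq0.
  - by rewrite -ab b0 subr0.
  rewrite gE -[RHS]divr1 -tofrac1; apply/frac_cross; rewrite ?oner_neq0 // mulr1.
  by rewrite -mulrA mulVr // mulr1.
have [uC|nuC] := boolP (C \is a GRing.unit).
  by apply: (IH b _ a A C) => //; rewrite (unit_homog hC uC).
have [p pi [C' C'E]] := exists_irreducible_factor C0 nuC.
have hp := homog_divides hC C0 (ex_intro _ C' C'E : divides p C).
have [p0 pu _] := pi.
have C'0 : C' != 0 by apply: contraNneq C0 => z; rewrite C'E z mul0r.
have [le1 hC'] := homog_quotient hC C0 hp C'E.
have d0 : (0 < mdegree p)%N.
  by rewrite lt0n; apply/eqP => z; case/negP: pu; apply: homog0_unit p0 _; have := hp; rewrite z.
have [[A' A'E]|nd] := classic (divides p A).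
  have A'0 : A' != 0 by apply: contraNneq A0 => z; rewrite A'E z mul0r.
  have [le2 hA'] := homog_quotient hA A0 hp A'E.
  apply: (IH (b - mdegree p)%N _ (a - mdegree p)%N A' C') => //.
  - by move: bN d0; clear; lia.
  - by rewrite -ab; move: le1 le2; clear; lia.
  rewrite gE; apply/frac_cross => //; by rewrite A'E C'E; ring.
have [w [wp wA wP]] := curve_point_off P pi hp hA nd.
have [x [xn xw]] := off_frame wP.
have [G [H lr]] := reg x xn; have [H0 _] := lr.
have := local_rep_cross lr hA hC C0 gE (k := 0); rewrite /order_at xn => /(_ erefl).
move/(congr1 (fun q : B => q@_0%MM)); rewrite /= !constant_coefM !pullback_at0.
have ev f : f.@[frame_mx x ord0] = f.@[w] by apply: meval_eq.
rewrite !ev C'E mevalM wp !mulr0 => /eqP.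
by rewrite mulf_eq0 (negPf wA) (negPf H0).
Qed.

Lemma regular_exceptional (F : divisor n) x i e S k : frame_on x = Some i -> S \is e.-homog ->
  F.2 i = k%:Z -> regular_at F x (tofrac S) -> vanish (P i) k S.
Proof.
move=> xi hS Fk [G [H lr]]; have [H0 _] := lr.
have := local_rep_cross lr hS (dhomog1 _ _) (oner_neq0 R); rewrite tofrac1 divr1 => /(_ erefl k).
rewrite /order_at xi pullback1 mulr1 => /(_ Fk); exact: vanish_pullback xi hS H0.
Qed.

Lemma form_regular (F : divisor n) x e S (m : 'I_n -> nat) : S \is e.-homog -> F.1 = e%:Z ->
  (forall i, F.2 i = (m i)%:Z) -> (forall i, frame_on x = Some i -> vanish (P i) (m i) S) ->
  exists G, local_rep F x (tofrac S) G 1 /\ (frame_on x = None -> G@_0%MM = S.@[frame_mx x ord0]).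
Proof.
move=> hS Fe Fm v.
have o1 : (1 : B)@_0%MM != 0 by rewrite mcoeff1 eqxx oner_neq0.
have rep G k : order_at x F = k%:Z -> pullback x S = 'X_ord0 ^+ k * G -> local_rep F x (tofrac S) G 1.
  move=> ok E; split=> //; exists e, 0%N, S, 1; split=> //; first exact: dhomog1.
  - exact: oner_neq0.
  - by rewrite Fe subr0.
  split; first by rewrite tofrac1 divr1.
  rewrite ok pullback1; apply/frac_cross_pow; rewrite ?oner_neq0 //.
  by rewrite !mulr1.
case xi : (frame_on x) => [i|].
  have [G GE] := pullback_vanish xi (v i xi).
  by exists G; split=> //; apply: (rep _ (m i)) => //; rewrite /order_at xi Fm.
exists (pullback x S); split; last by rewrite pullback_at0.
by apply: (rep _ 0%N); rewrite ?mul1r // /order_at xi.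
Qed.

End Pullback.

(** * From vanishing of the first cohomology to interpolation *)

Section Vanishing.
Import Order.TTheory Num.Theory.
Variables (K : closedFieldType) (n : nat) (P : 'I_n -> proj 2 K).
Hypothesis distP : distinct_points P.
Local Notation R := {mpoly K[3]}.
Implicit Types (x : blowup_frame P).

Definition fat_class a (m : 'I_n -> nat) : divisor n := (a%:Z, fun i => (m i)%:Z).

Section Nef.
Variables (m : 'I_n -> nat) (a : nat).
Hypothesis pos : forall (g : R) e k, irreducible_elt g -> g \is e.-homog ->
  (forall i, mult_at (P i) g (k i)) -> 0 <= inter a m e k.

Lemma inter_form_ge0 e S nu : S \is e.-homog -> S != 0 -> (forall i, mult_at (P i) S (nu i)) ->
  0 <= inter a m e nu.
Proof.
elim: e {-2}e (leqnn e) S nu => [|N IH] e eN S nu hS S0 mS.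
  have e0 : e = 0%N by move: eN; clear; lia.
  rewrite /inter e0 mulr0 sub0r big1 ?oppr0 // => i _.
  have := vanish_le_deg hS S0 (mS i).1; rewrite e0 leqn0 => /eqP ->; exact: mulr0.
have [uS|nuS] := boolP (S \is a GRing.unit).
  by apply: (IH e _ S) => //; rewrite (unit_homog hS uS).
have [p pi [T TE]] := exists_irreducible_factor S0 nuS.
have hp := homog_divides hS S0 (ex_intro _ T TE : divides p S).
have [p0 pu _] := pi.
have T0 : T != 0 by apply: contraNneq S0 => z; rewrite TE z mul0r.
have [le hT] := homog_quotient hS S0 hp TE.
have d0 : (0 < mdegree p)%N.
  by rewrite lt0n; apply/eqP => z; case/negP: pu; apply: homog0_unit p0 _; have := hp; rewrite z.
pose mu i := projT1 (constructive_indefinite_description _ (mult_exists (P i) p0)).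
have mp i : mult_at (P i) p (mu i) := projT2 (constructive_indefinite_description _ (mult_exists (P i) p0)).
pose la i := projT1 (constructive_indefinite_description _ (mult_exists (P i) T0)).
have mT i : mult_at (P i) T (la i) := projT2 (constructive_indefinite_description _ (mult_exists (P i) T0)).
have -> : inter a m e nu = inter a m (e - mdegree p) la + inter a m (mdegree p) mu.
  rewrite !(inter_sym a) -interD subnK //; congr inter; apply: functional_extensionality => i.
  by apply: (mult_uniq (mS i)); rewrite TE; apply: mult_mul.
apply: addr_ge0; last exact: pos mp.
by apply: (IH _ _ T) => //; move: eN d0 le; clear; lia.
Qed.

(** A section of D is a form S with D_i at most the multiplicity of S at P_i. Replacing D_i by that
    multiplicity only lowers the intersection number, as the m_i are natural, and for a form one
    factors it into irreducible curves. *)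
Lemma nef_of_curves : nef P (fat_class a m).
Proof.
move=> D [g g0 reg]; have [e [S [hS S0 eE gE]]] := regular_form (fun x _ => reg x) g0.
pose nu i := projT1 (constructive_indefinite_description _ (mult_exists (P i) S0)).
have mS i : mult_at (P i) S (nu i) := projT2 (constructive_indefinite_description _ (mult_exists (P i) S0)).
have le i : D.2 i <= (nu i)%:Z.
  case Di : (D.2 i) => [k|//]; rewrite lez_nat; apply: (mult_le (mS i)).
  have [x xi] := on_frame P i; apply: (regular_exceptional xi hS Di); rewrite -gE; exact: reg.
apply: le_trans (inter_form_ge0 hS S0 mS) _.
rewrite /inter /intersection /= eE lerD2l lerN2; apply: ler_sum => i _.
by apply: ler_wpM2l.
Qed.

End Nef.

(** Surjectivity of forms of degree a onto the jets of order m_i at the P_i, the jets being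
    prescribed by forms of the same degree; this is the concrete content of H^1 = 0. *)
Definition interpolates a (m : 'I_n -> nat) := forall h : 'I_n -> R, (forall i, h i \is (a).-homog) ->
  exists2 S, S \is (a).-homog & forall i, vanish (P i) (m i) (S - h i).

Lemma h0_not_vanishes m a S : fat_ideal_deg P m a S -> S != 0 -> ~ h0_vanishes P (fat_class a m).
Proof.
move=> [v hS] S0 /(_ (tofrac S)) H.
have /eqP : tofrac S = 0; last by rewrite tofrac_eq0 (negPf S0).
apply: H => x; have [G [lr _]] := @form_regular K n P (fat_class a m) x a S m hS erefl (fun=> erefl) (fun i _ => v i).
by exists G, 1.
Qed.

Definition off_exceptional (J : pred 'I_n) x : Prop := if frame_on x is Some j then ~~ J j else true.

(** Near x the complement of the E_j, j in J, contains the nonvanishing locus of a product of n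
    linear forms, those for j in J passing through P_j and none vanishing at the image of x. *)
Lemma off_exceptional_open (J : pred 'I_n) : blowup_open (off_exceptional J).
Proof.
rewrite /off_exceptional => x Ux.
have line j : exists l : R, [/\ l \is 1.-homog, J j -> l.@[P j] = 0 & l.@[frame_mx x ord0] != 0].
  pose w := Proj (base_neq0 x).
  have [Jj|nJ] := boolP (J j); last first.
    have [i xi] := base_neq0 x; exists 'X_i; split=> //; first exact: dhomogX1.
    by rewrite mevalXU.
  have [|l [hl l0 l1]] := @separating_line _ w (P j); last by exists l.
  move=> [c cE]; case xi : (frame_on x) Ux => [i|] Ux.
    have ij : i != j by apply: contraNneq Ux => ->.
    apply: (distP ij); exists c => y; rewrite -(frame_on_base xi) -cE.
    by [].
  move: cE xi; rewrite /w /=; case: (x) => M [i'|] uM b //= cE _.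
  by have [y []] := b j c; exact: cE.
pose l j := projT1 (constructive_indefinite_description _ (line j)).
have lP j : [/\ l j \is 1.-homog, J j -> (l j).@[P j] = 0 & (l j).@[frame_mx x ord0] != 0].
  exact: projT2 (constructive_indefinite_description _ (line j)).
pose A := \prod_j l j.
have hA : A \is n.-homog.
  have := @dhomog_prodE K 3 _ (index_enum 'I_n) l (fun=> 1%N).
  by rewrite sum1_card card_ord; apply=> i; case: (lP i).
pose D : divisor n := (n%:Z, fun=> 0).
have rep y := @form_regular K n P D y n A (fun=> 0%N) hA erefl (fun=> erefl) (fun _ _ => vanish0 _ _).
have rep0 (y : blowup_frame P) G H : local_rep D y (tofrac A) G H -> A.@[frame_mx y ord0] * H@_0%MM = G@_0%MM.
  move=> lr; have := local_rep_cross lr hA (dhomog1 _ _) (oner_neq0 R); rewrite tofrac1 divr1 => /(_ erefl 0%N).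
  have -> : order_at y D = 0%:Z by rewrite /order_at; case: (frame_on y).
  move=> /(_ erefl); rewrite pullback1 mulr1 mul1r.
  by move/(congr1 (fun q : {mpoly K[2]} => q@_0%MM)); rewrite /= constant_coefM pullback_at0.
exists D, (tofrac A); split=> [y||y [G [H [lr G0]]]].
- by have [G [lr _]] := rep y; exists G, 1.
- have [G [lr _]] := rep x; exists G, 1; split=> //.
  rewrite -(rep0 _ _ _ lr) mcoeff1 eqxx mulr1 rmorph_prod; apply/prodf_neq0 => j _.
  by case: (lP j).
case yi : (frame_on y) => [j|//]; apply: contraNN G0 => Jj.
rewrite -(rep0 _ _ _ lr) (meval_eq (v2 := P j)); last exact: frame_on_base.
rewrite rmorph_prod (bigD1 j) //=; case: (lP j) => _ -> // _.
by rewrite !mul0r.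
Qed.

(* The cocycle h_j - h_i on the cover of X by U_0, the complement of all E_i,
   and U_i, the complement of the E_j with j <> i, is a coboundary. *)
Lemma interpolates_of_h1 m a : h1_vanishes P (fat_class a m) -> interpolates a m.
Proof.
move=> h1 h hh; set F := fat_class a m.
pose J (o : option 'I_n) : pred 'I_n := fun j => o != Some j.
pose U (o : option 'I_n) := off_exceptional (J o).
pose ho (o : option 'I_n) : R := if o is Some i then h i else 0.
have hho o : ho o \is (a).-homog by case: o => [i|]; [exact: hh|exact: dhomog0].
have none_U o x : frame_on x = None -> U o x by rewrite /U /off_exceptional => ->.
have [|||||s [sreg sE]] := h1 (option 'I_n) U _ _ _ (fun i j => tofrac (ho j) - tofrac (ho i)).
- by move=> o; exact: off_exceptional_open.
- by move=> o; have [x x0] := exists_off_frame P; exists x; exact: none_U.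
- move=> x; exists (frame_on x); rewrite /U /off_exceptional; case: (frame_on x) => [j|//].
  by rewrite /J eqxx.
- move=> i j x Ui Uj; rewrite -tofracB.
  have [->|ij] := eqVneq i j.
    rewrite subrr.
    have [G [lr _]] := @form_regular K n P F x a 0 m (dhomog0 _ _ _) erefl (fun=> erefl) (fun _ _ => ideal_pow0 _ _).
    by exists G, 1.
  have x0 : frame_on x = None.
    move: Ui Uj; rewrite /U /off_exceptional /J; case: (frame_on x) => [l|//]; rewrite !negbK => /eqP E1 /eqP E2.
    by case/negP: ij; rewrite E1 E2.
  have hd : ho j - ho i \is (a).-homog by rewrite rpredB.
  have [|G [lr _]] := @form_regular K n P F x a _ m hd erefl (fun=> erefl); last by exists G, 1.
  by move=> l; rewrite x0.
- by move=> i j l; ring.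
have s0 o : s o = s None + tofrac (ho o).
  by have := sE None o; rewrite tofrac0 subr0 => ->; ring.
(* The component on the complement of all E_i is a form T; on E_i the section T + h_i is regular, so
   -T agrees with h_i up to order m_i. *)
have [T [hT TE]] : exists T, T \is (a).-homog /\ s None = tofrac T.
  have [->|nz] := eqVneq (s None) 0; first by exists 0; split; [exact: dhomog0|rewrite tofrac0].
  have [|e [T [hT _ eE TE]]] := @regular_form K n P F (s None) _ nz.
    by move=> x x0; apply: sreg; exact: none_U.
  by exists T; split=> //; case: eE => <-.
exists (- T) => [|i]; first by rewrite rpredN.
have [x xi] := on_frame P i.
have Ui : U (Some i) x by rewrite /U /off_exceptional xi /J eqxx.
have := sreg (Some i) x Ui; rewrite s0 TE -tofracD => reg.
have v := @regular_exceptional K n P F x i a (T + h i) (m i) xi (rpredD hT (hh i)) erefl reg.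
rewrite (_ : - T - h i = (-1) * (T + h i)); last by ring.
exact: vanish_mull.
Qed.

(** At the single point P_i the m_i + 1 conditions are independent in degree a. Interpolation
    replaces forms witnessing this by forms with the same leading parts at P_i and the required
    multiplicities elsewhere. *)
Lemma h0_bump_interpolates m i a : interpolates a (bump m i) -> (m i <= a)%N ->
  (h0 P (bump m i) a + (m i).+1 <= h0 P m a)%N.
Proof.
move=> js ma; pose m0 := fun j => if j == i then m i else 0%N.
have m0i : m0 i = m i by rewrite /m0 eqxx.
have s0 : (\sum_j m0 j <= a)%N.
  by rewrite (bigD1 i) //= m0i big1 ?addn0 // => j /negPf ji; rewrite /m0 ji.
have := h0_bump_ge distP i s0; rewrite m0i => ge.
have [e [Ie ie _]] := hdim_quot (subspace_fat P m0 a) (subspace_fat P (bump m0 i) a)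
  (@subspace_bump _ _ _ m0 i a) (fin_dim_fat P m0 a).
set N0 := (_ - _)%N in e Ie ie.
have N0ge : (m i < N0)%N by rewrite /N0 -/(h0 P m0 a) -/(h0 P (bump m0 i) a); move: ge; clear; lia.
have lift l : exists e', fat_ideal_deg P m a e' /\ fat_ideal_deg P (bump m0 i) a (e' - e l).
  have [|S hS v] := js (fun j => if j == i then e l else 0).
    by move=> j; case: ifP => _; [case: (Ie l)|exact: dhomog0].
  have vi : vanish (P i) (m i).+1 (S - e l).
    by have := v i; rewrite eqxx /bump eqxx addn1.
  have hd : S - e l \is (a).-homog by rewrite rpredB //; case: (Ie l).
  exists S; split; split=> //.
    move=> j; have [->|ji] := eqVneq j i.
      rewrite (_ : S = (S - e l) + e l); last by rewrite subrK.
      apply: ideal_powD; first exact: vanishW (leqnSn _) vi.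
      by have := (Ie l).1 i; rewrite m0i.
    by have := v j; rewrite (negPf ji) subr0 /bump (negPf ji) addn0.
  move=> j; rewrite /bump /m0; case: eqP => [->|_]; last by [].
  by rewrite addn1.
pose e' l := projT1 (constructive_indefinite_description _ (lift l)).
have eP l : fat_ideal_deg P m a (e' l) /\ fat_ideal_deg P (bump m0 i) a (e' l - e l).
  exact: projT2 (constructive_indefinite_description _ (lift l)).
have [N [g [Ig ig sg]]] := dim_quot_exists (subspace_fat P m a) (subspace_fat P (bump m i) a) (fin_dim_fat P m a).
rewrite {2}/h0 (dim_quot_hdim _ _ (@subspace_bump _ _ _ m i a) (fin_dim_fat P m a) (ex_intro _ g (And3 Ig ig sg)));
  try exact: subspace_fat.
rewrite addnC leq_add2r; apply: leq_trans N0ge _.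
apply: (indep_le_span (subspace_fat P (bump m i) a) sg (fun l => (eP l).1)) => c Ic.
apply: ie; have sub : forall z, fat_ideal_deg P (bump m i) a z -> fat_ideal_deg P (bump m0 i) a z.
  by move=> z; apply: fatW => j; rewrite /bump /m0; case: eqP => [->|_].
have -> : \sum_l c l *: e l = \sum_l c l *: e' l - \sum_l c l *: (e' l - e l).
  by rewrite -sumrB; apply: eq_bigr => l _; rewrite -scalerBr; congr (_ *: _); ring.
have sb := subspace_fat P (bump m0 i) a.
apply: (subspaceB sb); first exact: sub.
by apply: (subspace_sum sb) => l; apply: subspaceZ; [exact: sb|case: (eP l)].
Qed.

(** Interpolation for larger multiplicities implies it for smaller ones, so every increase of a
    multiplicity imposes its full number of conditions; before an increase the multiplicity is at
    most a. *)
Lemma h0_le_chi m a : interpolates a m -> (forall i, (m i <= a.+1)%N) -> (h0 P m a)%:Z <= chi m a.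
Proof.
elim/mult_ind: m => [|m i IH] js le; first by rewrite chi0 h0_0.
have js' : interpolates a m.
  move=> h hh; have [S hS v] := js h hh; exists S => // j; apply: vanishW (v j).
  by rewrite /bump leq_addr.
have le' j : (m j <= a.+1)%N by apply: leq_trans (le j); rewrite /bump leq_addr.
have mi : (m i <= a)%N by have := le i; rewrite /bump eqxx addn1.
have := h0_bump_interpolates js mi; have := IH js' le'; rewrite chi_bump; clear.
by move: (h0 _ _ _) (h0 _ _ _) (chi _ _) => *; lia.
Qed.

End Vanishing.

(** * Adjunction *)

Section BinarySystems.
Variable K : closedFieldType.
Local Notation B := {mpoly K[2]}.
Implicit Types (w v : proj 1 K).

Lemma root_line_sym w v : (root_line w).@[v] = 0 -> (root_line v).@[w] = 0.
Proof.
rewrite !root_line_eval => E; transitivity (- (w ord_max * v ord0 - w ord0 * v ord_max)); first by ring.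
by rewrite E oppr0.
Qed.

Lemma root_line_self w : (root_line w).@[w] = 0.
Proof. by rewrite root_line_eval mulrC subrr. Qed.

Lemma root_line_other w : exists v, (root_line v).@[w] != 0 /\ (root_line w).@[v] != 0.
Proof.
have [w0|w1] := proj1_neq0 w.
  have [v [v0 v1]] := @proj1_exists K 0 1 (or_intror (oner_neq0 K)).
  by exists v; rewrite !root_line_eval v0 v1 mul1r mul0r mulr0 mulr1 subr0 sub0r oppr_eq0.
have [v [v0 v1]] := @proj1_exists K 1 0 (or_introl (oner_neq0 K)).
by exists v; rewrite !root_line_eval v0 v1 mul1r mul0r mulr0 mulr1 subr0 sub0r oppr_eq0.
Qed.

Lemma binary_roots d (a : B) : a \is d.-homog -> a != 0 -> exists s : seq (proj 1 K),
  forall e b, b \is e.-homog -> (forall u, List.In u s -> b.@[u] != 0) ->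
  forall w, a.@[w] = 0 -> b.@[w] = 0 -> False.
Proof.
elim: d a => [|d IH] a ha a0.
  exists [::] => e b _ _ w aw _; have := homog0_const ha => aE.
  by case/eqP: a0; move: aw; rewrite aE mevalC => ->; rewrite mpolyC0.
have [w aw] := binary_root (ltn0Sn d) ha.
have [a' a'E] := root_line_divides ha aw.
have a'0 : a' != 0 by apply: contraNneq a0 => z; rewrite a'E z mul0r.
have ha' : a' \is d.-homog.
  have := form_quotient ha (root_line_neq0 w) (root_line_homog w) a'E; by rewrite subn1.
have [s sP] := IH a' ha' a'0; exists (w :: s) => e b hb bs v av bv.
move: av; rewrite a'E mevalM => /eqP; rewrite mulf_eq0 => /orP[/eqP a'v|/eqP lv].
  by apply: (sP e b hb _ v) => // u us; apply: bs; right.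
have [x xE] := root_line_divides hb bv.
have := bs w (or_introl erefl); rewrite xE mevalM (root_line_sym lv) mulr0.
by rewrite eqxx.
Qed.

(** Given b nonzero on the old points and c nonzero at a new base point u of b, take b + x c with x
    off finitely many values; the factor X in q excludes x = 0. *)
Lemma system_avoid (Q : B -> Prop) : subspace Q -> (forall w, exists2 r, Q r & r.@[w] != 0) ->
  forall s : seq (proj 1 K), exists2 b, Q b & forall u, List.In u s -> b.@[u] != 0.
Proof.
move=> sQ nz; elim=> [|u s [b Qb bs]]; first by exists 0 => //; exact: subspace0.
have [bu|bu] := eqVneq b.@[u] 0; last by exists b => // v [<-|/bs].
have [c Qc cu] := nz u.
pose q := 'X * \prod_(v <- s) ((b.@[v])%:P + (c.@[v])%:P * 'X) : {poly K}.
have q0 : q != 0.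
  rewrite mulf_neq0 ?polyX_eq0 // /q {q}; elim: s bs => [|v s IH] bs; first by rewrite big_nil oner_neq0.
  rewrite big_cons mulf_neq0 //; last by apply: IH => v' v's; apply: bs; right.
  apply/eqP => /(congr1 (horner^~ 0)); rewrite hornerD hornerM hornerX !hornerC mulr0 addr0.
  by apply/eqP; apply: bs; left.
have [x] := closed_nonrootP _ q0; rewrite /root /q hornerM hornerX mulf_eq0 negb_or => /andP[x0 xs].
exists (b + x *: c) => [|v [<-|vs]]; first by apply: subspaceD => //; exact: subspaceZ.
  by rewrite mevalD mevalZ bu add0r mulf_neq0.
rewrite mevalD mevalZ; move: xs vs {q q0 bs}; elim: s => [//|v' s IH].
rewrite big_cons hornerM mulf_eq0 negb_or => /andP[xv xs] [<-|/(IH xs)//].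
by move: xv; rewrite hornerD hornerM hornerX !hornerC mulrC.
Qed.

(** A base point free system on P^1 contains two members without common zero, and these generate all
    forms of degree at least 2e. *)
Lemma system_span (Q : B -> Prop) e N : subspace Q -> (forall r, Q r -> r \is e.-homog) ->
  (forall w, exists2 r, Q r & r.@[w] != 0) -> (e <= N)%N ->
  exists a b, [/\ Q a, Q b & forall h, h \is (e + N).-homog ->
    exists x y, [/\ x \is N.-homog, y \is N.-homog & h = a * x + b * y]].
Proof.
move=> sQ hQ nz eN.
have [w0 _] := @proj1_exists K 1 0 (or_introl (oner_neq0 K)).
have [a Qa aw] := nz w0.
have a0 : a != 0 by apply: contraNneq aw => ->; rewrite meval0.
have [s sP] := binary_roots (hQ a Qa) a0.
have [b Qb bs] := system_avoid sQ nz s.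
exists a, b; split=> // h hh.
exact: span_no_common_zero (hQ a Qa) (hQ b Qb) (sP e b (hQ b Qb) bs) eN h hh.
Qed.

End BinarySystems.

(** * A smooth point of a plane curve carries a single unramified branch *)

Section LocalBranch.
Variable K : closedFieldType.
Local Notation B := {mpoly K[2]}.
Local Notation R := {mpoly K[3]}.

Definition e0 : 'I_3 -> K := fun i => (i == ord0)%:R.

Lemma split_at_e0 d (A : R) : A \is d.-homog -> A.@[e0] = 0 -> exists A1 A2,
  [/\ A1 \is d.-1.-homog, A2 \is d.-1.-homog & A = 'X_j1 * A1 + 'X_j2 * A2].
Proof.
move=> hA Ae; have A0 : A@_(U_(ord0) *+ d)%MM = 0 by rewrite -(eval_base hA).
rewrite (mpolyE A) big_seq.
apply: (big_ind (fun A => exists A1 A2, [/\ A1 \is d.-1.-homog, A2 \is d.-1.-homog & A = 'X_j1 * A1 + 'X_j2 * A2])).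
- by exists 0, 0; split; rewrite ?dhomog0 // !mulr0 addr0.
- move=> x y [x1 [x2 [h1 h2 ->]]] [y1 [y2 [h3 h4 ->]]].
  by exists (x1 + y1), (x2 + y2); split; rewrite ?rpredD //; ring.
move=> u us; have du : mdeg u = d := dhomog_mf hA us.
have piece j : (0 < u j)%N -> exists2 C : R, C \is d.-1.-homog & A@_u *: 'X_[u] = 'X_j * C.
  move=> uj; exists (A@_u *: 'X_[u - U_(j)]).
    rewrite rpredZ // dhomogX; apply/eqP; rewrite -du.
    by rewrite -[in RHS](submK (m := U_(j)%MM) (m' := u)) ?mdegD ?mdeg1 ?addn1 ?lep1mP -?lt0n.
  by rewrite -scalerAr -mpolyXD addmC submK // lep1mP -lt0n.
have [u1|u1] := posnP (u j1); last first.
  by have [C hC ->] := piece j1 u1; exists C, 0; split; rewrite ?dhomog0 // mulr0 addr0.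
have [u2|u2] := posnP (u j2); last first.
  by have [C hC ->] := piece j2 u2; exists 0, C; split; rewrite ?dhomog0 // mulr0 add0r.
have uE : u = (U_(ord0) *+ d)%MM.
  apply/mnmP => j; have := mdeg3 u; rewrite du u1 u2 !addn0 => ->.
  by case: (ord3P j) => ->; rewrite mulmnE mnm1E /= ?mul1n ?mul0n.
by exists 0, 0; split; rewrite ?dhomog0 // !mulr0 addr0 uE A0 scale0r.
Qed.

Variables (D : nat) (psi : 'I_3 -> B) (w w' : proj 1 K).
Hypothesis hpsi : forall j, psi j \is D.-homog.
Hypotheses (qw : (psi ord0).@[w] != 0) (qw' : (psi ord0).@[w'] != 0).
Local Notation lw := (root_line w).
Local Notation lw' := (root_line w').
Hypotheses (d1 : divides (lw * lw') (psi j1)) (d2 : divides (lw * lw') (psi j2)).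

Let at0 (v : proj 1 K) e (A : R) : (psi ord0).@[v] != 0 -> (psi j1).@[v] = 0 -> (psi j2).@[v] = 0 ->
  A \is e.-homog -> (msub psi A).@[v] = (psi ord0).@[v] ^+ e * A.@[e0].
Proof.
move=> q0 s0 u0 hA; rewrite -(homog_scale _ _ hA) msub_eval; apply: meval_eq => j.
by rewrite /e0; case: (ord3P j) => ->; rewrite /= ?mulr1 ?mulr0 ?s0 ?u0.
Qed.

Let j10 : j1 != ord0. Proof. by []. Qed.
Let j20 : j2 != ord0. Proof. by []. Qed.

Let zero_w j : j != ord0 -> (psi j).@[w] = 0 /\ (psi j).@[w'] = 0.
Proof.
have z : divides (lw * lw') (psi j) -> (psi j).@[w] = 0 /\ (psi j).@[w'] = 0.
  by move=> [x ->]; rewrite !mevalM !root_line_self mulr0 mul0r !mulr0.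
by case: (ord3P j) z => -> z // _; exact: z.
Qed.

(* Modulo the curve, the local ring at e0 is a discrete valuation ring with
   uniformizer X_i / X_0. *)
Let power_of_uniformizer (i j : 'I_3) g S1 U1 : i != ord0 -> j != ord0 ->
  (forall e (A : R), A \is e.-homog -> A.@[e0] = 0 ->
    exists A1 A2, [/\ A1 \is e.-1.-homog, A2 \is e.-1.-homog & A = 'X_i * A1 + 'X_j * A2]) ->
  S1 \is g.-homog -> U1 \is g.-homog -> U1.@[e0] != 0 -> msub psi ('X_i * S1 + 'X_j * U1) = 0 ->
  psi i != 0 -> forall e (A : R), A \is e.-homog -> msub psi A != 0 ->
  exists r e' A', [/\ A' \is e'.-homog, A'.@[e0] != 0 &
    msub psi U1 ^+ r * msub psi A = psi i ^+ r * msub psi A'].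
Proof.
move=> i0 j0 dec hS hU U0 G0 pi0 e A hA nA.
have [zi zi'] := zero_w i0.
have Uw : (msub psi U1).@[w] != 0.
  have [z1 _] := zero_w j10; have [z2 _] := zero_w j20.
  by rewrite (at0 qw z1 z2 hU) mulf_neq0 // expf_neq0.
have iter N : (exists r e' A', [/\ A' \is e'.-homog, A'.@[e0] != 0 &
    msub psi U1 ^+ r * msub psi A = psi i ^+ r * msub psi A']) \/
  exists e' A', A' \is e'.-homog /\ msub psi U1 ^+ N * msub psi A = psi i ^+ N * msub psi A'.
  elim: N => [|N [IH|[e' [A' [hA' E]]]]]; first by right; exists e, A; rewrite !expr0 !mul1r.
    by left.
  have [z|nz] := eqVneq A'.@[e0] 0; last by left; exists N, e', A'.
  right; have [A1 [A2 [h1 h2 AE]]] := dec _ _ hA' z.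
  exists (g + e'.-1)%N, (U1 * A1 - S1 * A2); split; first by rewrite rpredB // dhomogM.
  have E' : msub psi U1 * msub psi A' = psi i * msub psi (U1 * A1 - S1 * A2).
    move: G0; rewrite AE msubB !msubD !msubM !msubX => G0.
    have -> : psi i * (msub psi U1 * msub psi A1 - msub psi S1 * msub psi A2) =
      msub psi U1 * (psi i * msub psi A1 + psi j * msub psi A2)
       - (psi i * msub psi S1 + psi j * msub psi U1) * msub psi A2 by ring.
    by rewrite G0 mul0r subr0.
  by rewrite !exprS -mulrA E mulrCA E' mulrCA mulrA.
have [//|[e' [A' [hA' E]]]] := iter (e * D).+1.
have hm := msub_homog hpsi hA.
have cop : coprime_elt (lw ^+ (e * D).+1) (msub psi U1 ^+ (e * D).+1).
  apply: coprime_expr; apply: coprime_sym; first by apply: contraNneq Uw => ->; rewrite meval0.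
  apply: coprime_expr; apply: coprime_sym; first exact: root_line_neq0.
  apply: (no_common_zero_coprime (root_line_neq0 w) (root_line_homog w) (msub_homog hpsi hU)) => v lv uv.
  have [x xE] := root_line_divides (msub_homog hpsi hU) uv.
  by case/negP: Uw; rewrite xE mevalM (root_line_sym lv) mulr0.
have [y yE] : divides (lw ^+ (e * D).+1) (msub psi A).
  apply: cop; rewrite E; apply: divides_mulr.
  have [x ->] := root_line_divides (hpsi i) zi.
  by rewrite exprMn; apply: divides_mull; exact: divides_refl.
have hl := dhomogMn (e * D).+1 (root_line_homog w).
have [] := homog_quotient hm nA hl yE.
by rewrite mul1n ltnn.
Qed.

(** Both w and w', possibly equal, are mapped to e0, where G has a linear term, so a coordinate
    X_i/X_0 is a uniformizer; its pullback vanishes on w + w'. The quotient of A by A', which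
    birationality provides, vanishes only once at w and cannot be a unit times a power of it. *)
Lemma smooth_branch_contradiction g (G : R) e (A A' : R) (ka : B) (v : proj 1 K) :
  G \is g.-homog -> msub psi G = 0 -> (exists2 l, l \in msupp G & mwt (@w01 3) l = 1%N) ->
  A \is e.-homog -> A' \is e.-homog -> ka != 0 -> (root_line v).@[w] != 0 ->
  msub psi A = lw * ka -> msub psi A' = root_line v * ka -> False.
Proof.
move=> hG G0 [l lG l1] hA hA' ka0 vw AE A'E.
have [z1 z1'] := zero_w j10; have [z2 z2'] := zero_w j20.
have Ge : G.@[e0] = 0.
  have := at0 qw z1 z2 hG; rewrite G0 meval0 => /esym/eqP.
  by rewrite mulf_eq0 expf_eq0 (negPf qw) andbF => /eqP.
have [S1 [U1 [hS hU GE]]] := split_at_e0 hG Ge.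
have lin : S1.@[e0] != 0 \/ U1.@[e0] != 0.
  apply: NNPP => no; have zS : S1.@[e0] = 0 by apply/eqP/negPn/negP => h; apply: no; left.
  have zU : U1.@[e0] = 0 by apply/eqP/negPn/negP => h; apply: no; right.
  have o1 h (x : R) : x \is h.-homog -> x.@[e0] = 0 -> ordw (@w01 3) 1 x.
    move=> hx x0 u us; rewrite lt0n; apply/eqP => u0; have := us; rewrite mcoeff_msupp => /eqP[].
    rewrite -x0 (eval_base hx); congr (_@_ _); apply/mnmP => j.
    move: u0; rewrite w01_3 => /eqP; rewrite addn_eq0 => /andP[/eqP u1 /eqP u2].
    have := mdeg3 u; rewrite u1 u2 !addn0 (dhomog_mf hx us : mdeg u = h) => dE.
    by case: (ord3P j) => ->; rewrite mulmnE mnm1E /= ?mul1n ?mul0n.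
  have X1 j : j != ord0 -> ordw (@w01 3) 1 ('X_j : R).
    by move=> j0; apply: (o1 1%N) => //; rewrite ?dhomogX1 // mevalXU /e0 (negPf j0).
  have : ordw (@w01 3) 2 G.
    by rewrite GE; apply: ordwD; [exact: ordwM (X1 _ j10) (o1 _ _ hS zS)|exact: ordwM (X1 _ j20) (o1 _ _ hU zU)].
  by move=> /(_ _ lG); rewrite l1.
have nA : msub psi A != 0 by rewrite AE mulf_neq0 // root_line_neq0.
have vl0 : root_line v != 0 := root_line_neq0 v.
have nA' : msub psi A' != 0 by rewrite A'E mulf_neq0.
(* Both lw and root_line v would be S^a times a unit at w and w', although lw
   vanishes simply at w and S vanishes to order two on {w, w'}. *)
have core (i j : 'I_3) (S U : R) : i != ord0 -> j != ord0 -> divides (lw * lw') (psi i) ->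
  (forall e (A : R), A \is e.-homog -> A.@[e0] = 0 ->
    exists A1 A2, [/\ A1 \is e.-1.-homog, A2 \is e.-1.-homog & A = 'X_i * A1 + 'X_j * A2]) ->
  S \is g.-1.-homog -> U \is g.-1.-homog -> U.@[e0] != 0 -> msub psi ('X_i * S + 'X_j * U) = 0 ->
  psi i != 0 -> False.
  move=> i0 j0 [x xE] dec hS' hU' U0 GG pi0.
  have P0 := power_of_uniformizer i0 j0 dec hS' hU' U0 GG pi0.
  have [r [a [C [hC C0 EC]]]] := P0 _ _ hA nA.
  have [r' [a' [C' [hC' C'0 EC']]]] := P0 _ _ hA' nA'.
  have nz (u : proj 1 K) (t : R) h : (psi ord0).@[u] != 0 -> (psi j1).@[u] = 0 -> (psi j2).@[u] = 0 ->
      t \is h.-homog -> t.@[e0] != 0 -> (msub psi t).@[u] != 0.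
    by move=> q0 s0 u0 ht t0; rewrite (at0 q0 s0 u0 ht) mulf_neq0 // expf_neq0.
  have Cw := nz w _ _ qw z1 z2 hC C0; have C'w := nz w _ _ qw z1 z2 hC' C'0.
  have C'w' := nz w' _ _ qw' z1' z2' hC' C'0.
  have Uw := nz w _ _ qw z1 z2 hU' U0; have Uw' := nz w' _ _ qw' z1' z2' hU' U0.
  have lw0 := root_line_self w.
  move: EC EC'; rewrite AE A'E; move: (msub psi U) (msub psi C) (msub psi C') Uw Uw' Cw C'w C'w' => u c c' uw uw' cw c'w c'w' EC EC'.
  have E : u ^+ r * lw * (psi i ^+ r' * c') = psi i ^+ r * c * (u ^+ r' * root_line v).
    apply: (mulIf ka0); transitivity (u ^+ r * (lw * ka) * (psi i ^+ r' * c')); first by ring.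
    rewrite EC -EC'; by ring.
  have [le|lt] := leqP r r'.
    have E2 : u ^+ r * lw * (psi i ^+ (r' - r) * c') = c * (u ^+ r' * root_line v).
      apply: (mulfI (expf_neq0 r pi0)); transitivity (u ^+ r * lw * (psi i ^+ r' * c')).
        by rewrite -[in RHS](subnK le) exprD; ring.
      by rewrite E; ring.
    have := congr1 (fun q : B => q.@[w]) E2; rewrite /= !mevalM lw0 mulr0 !mul0r => /esym/eqP.
    by rewrite !mulf_eq0 (negPf cw) (negPf vw) rmorphXn expf_eq0 (negPf uw) andbF.
  have E2 : u ^+ r * lw * c' = psi i ^+ (r - r') * c * (u ^+ r' * root_line v).
    apply: (mulfI (expf_neq0 r' pi0)); transitivity (u ^+ r * lw * (psi i ^+ r' * c')); first by ring.
    by rewrite E -[in LHS](subnK (ltnW lt)) exprD; ring.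
  have [y yE] : exists y, psi i ^+ (r - r') = y * (lw * lw').
    move: lt; rewrite -subn_gt0; case: (r - r')%N => // k _; exists (psi i ^+ k * x).
    by rewrite exprSr -mulrA -xE.
  have E3 : u ^+ r * c' = lw' * (y * c * (u ^+ r' * root_line v)).
    apply: (mulfI (root_line_neq0 w)); transitivity (u ^+ r * lw * c'); first by ring.
    rewrite E2 yE; ring.
  have := congr1 (fun q : B => q.@[w']) E3; rewrite /= !mevalM root_line_self !mul0r => /eqP.
  by rewrite !mulf_eq0 (negPf c'w') rmorphXn expf_eq0 (negPf uw') andbF.
have nconst : psi j1 != 0 \/ psi j2 != 0.
  apply: NNPP => no; have p1 : psi j1 = 0 by apply/eqP/negPn/negP => h; apply: no; left.
  have p2 : psi j2 = 0 by apply/eqP/negPn/negP => h; apply: no; right.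
  have [Az Az'] : A.@[e0] = 0 /\ A.@[e0] = 0.
    have := at0 qw z1 z2 hA; rewrite AE mevalM root_line_self mul0r => /esym/eqP.
    by rewrite mulf_eq0 expf_eq0 (negPf qw) andbF => /eqP ->.
  have [A1 [A2 [_ _ E]]] := split_at_e0 hA Az.
  by case/eqP: nA; rewrite E msubD !msubM !msubX p1 p2 !mul0r addr0.
have dec12 := split_at_e0.
have dec21 : forall e (A : R), A \is e.-homog -> A.@[e0] = 0 ->
    exists A1 A2, [/\ A1 \is e.-1.-homog, A2 \is e.-1.-homog & A = 'X_j2 * A1 + 'X_j1 * A2].
  by move=> e' X hX X0; have [A1 [A2 [h1 h2 ->]]] := split_at_e0 hX X0; exists A2, A1; split=> //; rewrite addrC.
have G12 : msub psi ('X_j1 * S1 + 'X_j2 * U1) = 0 by rewrite -GE.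
have G21 : msub psi ('X_j2 * U1 + 'X_j1 * S1) = 0 by rewrite addrC -GE.
have vanishing (u : R) h (i j : 'I_3) (t : R) k : (i = j1 /\ j = j2) \/ (i = j2 /\ j = j1) ->
  u \is h.-homog -> u.@[e0] != 0 -> t \is k.-homog ->
  msub psi ('X_i * t + 'X_j * u) = 0 -> psi i != 0.
  move=> ij hu u0 ht; rewrite msubD !msubM !msubX; apply: contra_eqN => /eqP pi0.
  have nu : msub psi u != 0.
    by apply/eqP => z; have := at0 qw z1 z2 hu; rewrite z meval0 => /esym/eqP; rewrite mulf_eq0 expf_eq0 (negPf qw) andbF (negPf u0).
  rewrite pi0 mul0r add0r mulf_neq0 //; apply/eqP => pj0.
  by case: nconst => /eqP[]; case: ij => -[ei ej]; rewrite -?ei -?ej.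
case: lin => [S0|U0].
  apply: (core j2 j1 U1 S1) => //; apply: (vanishing S1 _ j2 j1 U1) hS S0 hU G21; by right.
apply: (core j1 j2 S1 U1) => //; apply: (vanishing U1 _ j1 j2 S1) hU U0 hS G12; by left.
Qed.

End LocalBranch.

(** * Computation of K . C *)

Section Adjunction.
Import Order.TTheory Num.Theory.
Variables (K : closedFieldType) (n : nat) (P : 'I_n -> proj 2 K).
Hypothesis distP : distinct_points P.
Local Notation B := {mpoly K[2]}.
Local Notation R := {mpoly K[3]}.
Variables (f : R) (d : nat) (k : 'I_n -> nat) (phi : 'I_3 -> B).
Hypotheses (fi : irreducible_elt f) (hf : f \is d.-homog) (fk : forall i, mult_at (P i) f (k i)).
Hypothesis nphi : normalization_P1 f phi.
Hypothesis c2 : inter d k d k = -1.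

Local Notation same c := (fun _ : 'I_n => c).

Let f0 : f != 0. Proof. by case: fi. Qed.

Lemma irreducible_degree_gt0 : (0 < d)%N.
Proof.
rewrite lt0n; apply/eqP => z; case: fi => _ /negP[]; apply: homog0_unit f0 _.
by have := hf; rewrite z.
Qed.
Let d0 := irreducible_degree_gt0.

Let kd i : (k i <= d)%N. Proof. exact: vanish_le_deg hf f0 (fk i).1. Qed.

Lemma sum_mult_le : (\sum_i k i <= n * d)%N.
Proof. by apply: leq_trans (leq_sum _ (fun i _ => kd i)) _; rewrite sum_nat_const card_ord. Qed.

(* H = (n + 1) L - E_1 - ... - E_n; N0 = H . C *)
Let N0 := (n.+1 * d - \sum_i k i)%N.

Let N0_gt0 : (d <= N0)%N.
Proof. by rewrite /N0; have := sum_mult_le; rewrite mulSn; move: d0; move: (\sum_i _)%N (n * d)%N => a b; clear; lia. Qed.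

Let interH c : inter (c * n.+1) (same c) d k = (c * N0)%N%:Z.
Proof.
rewrite /inter -mulr_sumr -sumZ -!PoszM /N0.
have -> : (c * n.+1 * d = c * (n.+1 * d))%N by rewrite mulnA.
have := sum_mult_le; rewrite mulnBr; have : (n * d <= n.+1 * d)%N by rewrite leq_mul2r leqnSn orbT.
move=> h1 h2; have := leq_trans h2 h1; move: (\sum_i k i)%N (n.+1 * d)%N => a b ab.
rewrite subzn ?leq_mul2l ?ab ?orbT //.
Qed.

Let chiH c : (h0 P (same c) (c * n.+1))%:Z = chi (same c) (c * n.+1).
Proof.
apply: (h0_eq_chi distP); rewrite sum_nat_const card_ord mulnC mulnS; lia.
Qed.

Let G (c : nat) : 'I_n -> nat := fun i => (c - k i)%N.

Let addG c : (d <= c)%N -> addm (G c) k = same c.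
Proof.
move=> dc; apply: functional_extensionality => i; rewrite /addm /G subnK //.
exact: leq_trans (kd i) dc.
Qed.

Let degG c : (d <= c)%N -> (c * n.+1 - d + d = c * n.+1)%N.
Proof. by move=> dc; rewrite subnK // mulnS; lia. Qed.

Let chiG c : (d <= c)%N -> (h0 P (G c) (c * n.+1 - d))%:Z = chi (G c) (c * n.+1 - d).
Proof.
move=> dc; apply: (h0_eq_chi distP).
have : (\sum_i G c i <= \sum_(i < n) c)%N by apply: leq_sum => i _; apply: leq_subr.
rewrite sum_nat_const card_ord mulnS (mulnC n); move: (c * n)%N (\sum_i _)%N => a b; lia.
Qed.

Let kappa : int := 3 * d%:Z - \sum_i (k i)%:Z.

(** Riemann-Roch for c H and c H - C. It also shows that [kappa], which is -K . C, is odd. *)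
Let chi_diff c : (d <= c)%N ->
  2 * chi (same c) (c * n.+1) = 2 * chi (G c) (c * n.+1 - d) + 2 * (c * N0)%N%:Z + 1 + kappa.
Proof.
move=> dc; have := chi_addm (G c) k (c * n.+1 - d) d; rewrite addG // degG // c2 -/kappa.
have := interD (c * n.+1 - d) d (G c) k d k; rewrite addG // degG // interH c2.
by move: (chi _ _) (chi _ _) (inter _ _ _ _) kappa => x1 x2 x3 x4; clear; lia.
Qed.

(** Take c = d. Both classes have h^0 = chi, and the sections of c H modulo those of c H - C inject
    into forms of degree c N0 on P^1, of dimension c N0 + 1. *)
Lemma kappa_le1 : kappa <= 1.
Proof.
have := chi_diff (leqnn d); rewrite -chiH -chiG //.
have := @h0_add_curve K n P distP f d k phi fi hf fk nphi (G d) (d * n.+1 - d) (d * N0 + 1).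
rewrite addG // degG // interH => /(_ (lexx _)).
by move: (h0 _ _ _) (h0 _ _ _) kappa (d * N0)%N => x1 x2 x3 x4; clear; lia.
Qed.

Hypothesis gn : forall t, good_nef P t.

(* The class F = H + N0 C is nef and F . C = 0, so h^0(F) = chi(F) >= chi(F - C). *)
Lemma kappa_geN1 : -1 <= kappa.
Proof.
(* The classes H + c C, whose intersection with C is N0 - c; the last nef one is reached at c =
   N0. *)
pose m c i := (1 + c * k i)%N; pose D c := (n.+1 + c * d)%N.
have mS c : m c.+1 = addm (m c) k.
  by apply: functional_extensionality => i; rewrite /m /addm mulSn; clear; lia.
have DS c : D c.+1 = (D c + d)%N by rewrite /D mulSn; clear; lia.
have mono c : (h0 P (m c) (D c) <= h0 P (m c.+1) (D c.+1))%N.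
  rewrite DS addnC; apply: (h0_mul (D c) hf fk f0) => i; rewrite mS /addm addnC; exact: leqnn.
have iF c : inter (D c) (m c) d k = N0%:Z - c%:Z.
  elim: c => [|c IH].
    have := interH 1; rewrite !mul1n => <-; rewrite subr0 /inter /D /m mul0n addn0.
    by congr (_ - _); apply: eq_bigr => i _; rewrite mul0n addn0.
  rewrite mS DS interD IH c2; clear; lia.
have nz c : (0 < h0 P (m c) (D c))%N.
  elim: c => [|c IH]; last exact: leq_trans IH (mono c).
  have -> : h0 P (m 0%N) (D 0%N) = h0 P (same 1%N) (1 * n.+1).
    rewrite mul1n /D mul0n addn0; congr h0; apply: functional_extensionality => i; by rewrite /m mul0n addn0.
  rewrite -ltz_nat chiH /chi mul1n sumr_const card_ord.
  rewrite (_ : 'C(1 + 1, 2) = 1%N) // addn2 !binS bin1 bin0; lia.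
have [x Ix x0] := fat_neq0 (nz N0).
have nefF : (h0 P (m N0) (D N0))%:Z <= chi (m N0) (D N0).
  apply: (gn (leqnn _)); first by exists x.
  move=> g e l gi hg lg; have [[y yE]|nd] := classic (divides f g).
    have g0 : g != 0 by case: gi.
    have [le hy] := homog_quotient hg g0 hf yE.
    have uy : y \is a GRing.unit.
      have [_ _ /(_ _ _ yE)[//|uf]] := gi; by case: fi => _ /negP[].
    have ed := unit_homog hy uy.
    have y0 : y != 0 by apply: contraNneq g0 => z; rewrite yE z mul0r.
    have lE : l = k.
      apply: functional_extensionality => i; have [z zP] := mult_exists (P i) y0.
      have z0 : z = 0%N by have := vanish_le_deg hy y0 zP.1; rewrite ed leqn0 => /eqP.
      by apply: (mult_uniq (lg i)); have := mult_mul zP (fk i); rewrite -yE {1}z0.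
    have -> : e = d by move: ed le; clear; lia.
    by rewrite lE iF subrr.
  have Cg : 0 <= inter d k e l.
    rewrite inter_sym; apply: (inter_ge0_of_not_divides distP fi hf fk _ nd).
    exact: fat_mult hg lg.
  have Hg : 0 <= inter n.+1 (same 1%N) e l.
    have le : (\sum_i l i <= n * e)%N.
      have li i : (l i <= e)%N by apply: vanish_le_deg hg _ (lg i).1; case: gi.
      by apply: leq_trans (leq_sum _ (fun i _ => li i)) _; rewrite sum_nat_const card_ord.
    rewrite /inter -PoszM; under eq_bigr => i _ do rewrite mul1r.
    by rewrite -sumZ mulSn; move: le; clear; lia.
  have iG c : inter (D c) (m c) e l = inter n.+1 (same 1%N) e l + c%:Z * inter d k e l.
    elim: c => [|c IH]; last by rewrite mS DS interD IH intS; ring.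
    rewrite mul0r addr0 /D mul0n addn0; rewrite (_ : m 0%N = same 1%N) //.
  by rewrite iG addr_ge0 // mulr_ge0.
have : exists N, N0 = N.+1 by exists N0.-1; rewrite prednK //; exact: leq_trans d0 N0_gt0.
move=> [N NE]; have := mono N; rewrite -NE.
have := chi_addm (m N) k (D N) d; rewrite -mS -DS -NE c2 iF NE -NE -/kappa.
have := chi_le_h0 P (m N) (D N); move: nefF; rewrite NE; clear.
by move: (chi _ _) (chi _ _) (h0 _ _ _) (h0 _ _ _) kappa => *; lia.
Qed.

Let hphi j : phi j \is d.-homog. Proof. by case: (normalization_curve fi hf nphi). Qed.
Let nzphi : no_common_zero phi. Proof. by case: (normalization_curve fi hf nphi). Qed.
Let phif : msub phi f = 0. Proof. by case: (normalization_curve fi hf nphi). Qed.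
Let lphi : lin (msub phi). Proof. exact: lin_msub. Qed.

Let theta_ex i : exists t : 'M[K]_3 * (B * B * B), let: (M, (th, a, b)) := t in
  [/\ M \in unitmx /\ (forall j, M ord0 j = P i j), [/\ th \is (k i).-homog, th != 0,
      a \is (d - k i).-homog & b \is (d - k i).-homog],
      forall w : proj 1 K, a.@[w] = 0 -> b.@[w] = 0 -> False
    & [/\ msub phi (coord M j1) = a * th, msub phi (coord M j2) = b * th
        & forall m x, vanish (P i) m x -> divides (th ^+ m) (msub phi x)]].
Proof.
have [M uM pM] := frameP (P i); have [_ _ _ _ atp] := normalization_curve fi hf nphi.
have [th [a [b [[h1 h2] [h3 h4] h5 h6]]]] := atp _ _ _ uM pM (fk i).
by exists (M, (th, a, b)); split.
Qed.

Let T i := projT1 (constructive_indefinite_description _ (theta_ex i)).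
Let Mx i := (T i).1.
Let th i := (T i).2.1.1.
Let aa i := (T i).2.1.2.
Let bb i := (T i).2.2.

Let TP i : [/\ Mx i \in unitmx /\ (forall j, Mx i ord0 j = P i j), [/\ th i \is (k i).-homog, th i != 0,
      aa i \is (d - k i).-homog & bb i \is (d - k i).-homog],
      forall w : proj 1 K, (aa i).@[w] = 0 -> (bb i).@[w] = 0 -> False
    & [/\ msub phi (coord (Mx i) j1) = aa i * th i, msub phi (coord (Mx i) j2) = bb i * th i
        & forall m x, vanish (P i) m x -> divides (th i ^+ m) (msub phi x)]].
Proof.
have := projT2 (constructive_indefinite_description _ (theta_ex i)).
by rewrite /Mx /th /aa /bb /T; case: constructive_indefinite_description => -[M [[t a] b]].
Qed.

Let th_root i (w : proj 1 K) : (th i).@[w] = 0 -> exists2 c, c != 0 & forall j, (phi j).@[w] = c * P i j.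
Proof.
have [[uM pM] _ _ [E1 E2 _]] := TP i => tw; pose x j := (phi j).@[w].
have z j : j != ord0 -> (coord (Mx i) j).@[x] = 0.
  by case: (ord3P j) => -> // _; rewrite -msub_eval ?E1 ?E2 mevalM tw mulr0.
have xE := on_point uM pM (z j1 isT) (z j2 isT).
exists ((coord (Mx i) ord0).@[x]) => //; apply/eqP => c0; have [j /eqP[]] := nzphi w.
by rewrite -/(x j) xE c0 mul0r.
Qed.

Let Th (m : 'I_n -> nat) : B := \prod_i th i ^+ m i.

Let Th_homog m : Th m \is (\sum_i m i * k i)%N.-homog.
Proof. by apply: dhomog_prodE => i; rewrite mulnC; apply: dhomogMn; case: (TP i) => _ []. Qed.

Let Th_neq0 m : Th m != 0.
Proof. by apply/prodf_neq0 => i _; apply: expf_neq0; case: (TP i) => _ []. Qed.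

Let Th_divides m x : (forall i, vanish (P i) (m i) x) -> divides (Th m) (msub phi x).
Proof.
apply: (prod_theta_divides distP (k := k)) => i.
have [_ [h1 h2 _ _] _ [_ _ h3]] := TP i; split=> // w; exact: th_root.
Qed.

Let ThD m m' : Th (addm m m') = Th m * Th m'.
Proof. by rewrite /Th -big_split; apply: eq_bigr => i _; rewrite exprD. Qed.

(* Forms of degree c N0 on P^1 cut out on the curve by sections of c H. *)
Let V c (r : B) := r \is (c * N0)%N.-homog /\
  exists2 h, fat_ideal_deg P (same c) (c * n.+1) h & msub phi h = Th (same c) * r.

Let subspace_V c : subspace (V c).
Proof.
split=> [|s x y [hx [h Ih hE]] [hy [h' Ih' hE']]].
  split; first exact: dhomog0.
  by exists 0; rewrite ?msub0 ?mulr0 //; exact: subspace0 (subspace_fat _ _ _).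
split; first by rewrite rpredD // rpredZ.
exists (s *: h + h').
  by apply: subspaceD; [exact: subspace_fat|apply: subspaceZ => //; exact: subspace_fat|].
by rewrite msubD msubZ hE hE' mulrDr -scalerAr.
Qed.

Let fin_dim_V c : fin_dim (V c).
Proof. by apply: fin_dimS (fin_dim_form K 1 (c * N0)) => r []. Qed.

Let Th_same c : Th (same c) \is (c * \sum_i k i)%N.-homog.
Proof. by have := Th_homog (same c); rewrite big_distrr. Qed.

Let V_of c h r : fat_ideal_deg P (same c) (c * n.+1) h -> msub phi h = Th (same c) * r -> V c r.
Proof.
move=> Ih E; split; last by exists h.
rewrite /N0 mulnBr mulnA.
by apply: (form_quotient (msub_homog hphi Ih.2) (Th_neq0 (same c)) (Th_same c)); rewrite E mulrC.
Qed.

Let VM c c' r r' : V c r -> V c' r' -> V (c + c') (r * r').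
Proof.
move=> [hr [h Ih hE]] [hr' [h' Ih' hE']]; apply: (@V_of _ (h * h')).
  by rewrite mulnDl; exact: fatM Ih Ih'.
by rewrite msubM hE hE' (ThD (same c) (same c')); ring.
Qed.

(** The value kappa = -1 corresponds to arithmetic genus one: the sections of c H cut a hyperplane
    in the forms of degree c N0, as for a nodal or cuspidal cubic. *)
Let hdim_V c : (d <= c)%N -> kappa = -1 -> hdim (V c) = (c * N0)%N.
Proof.
move=> dc kap; have rn := hdim_image lphi (subspace_fat P (same c) (c * n.+1)) (fin_dim_fat P _ _).
have imE : hdim (image (msub phi) (fat_ideal_deg P (same c) (c * n.+1))) = hdim (V c).
  rewrite -(hdim_mul (Th_neq0 (same c)) (subspace_V c) (fin_dim_V c)); apply: eq_hdim => y.
  split=> [[h Ih ->]|[r [hr [h Ih hE]] ->]]; last by exists h.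
  have [r rE] := Th_divides Ih.1; exists r; last by rewrite mulrC.
  by apply: (V_of Ih); rewrite rE mulrC.
have := hdim_ker fi hf fk nphi (G c) (c * n.+1 - d); rewrite addG // degG // => le.
have ge : (h0 P (G c) (c * n.+1 - d) <= hdim (fun x => fat_ideal_deg P (same c) (c * n.+1) x /\ msub phi x = 0%R))%N.
  rewrite /h0 -(hdim_mul f0 (subspace_fat P _ _) (fin_dim_fat P _ _)); apply: hdimS.
  - apply: subspaceI; first exact: subspace_fat.
    exact: (subspace_preim lphi (W := zero_sub) (@subspace_zero _ _)).
  - by apply: subspace_image; [exact: lin_mul|exact: subspace_fat].
  - move=> _ [y Iy ->]; split; last by rewrite msubM phif mul0r.
    have := fatM Iy (fat_mult hf fk); rewrite degG // mulrC -(addG dc); exact.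
  - by apply: fin_dimS (fin_dim_fat P (same c) (c * n.+1)) => x [].
have := chi_diff dc; rewrite -chiH -chiG // kap; move: rn le ge; rewrite imE -/(h0 P (same c) (c * n.+1)).
move: (h0 _ _ _) (h0 _ _ _) (hdim _) (hdim _) (c * N0)%N => x1 x2 x3 x4 x5; clear; lia.
Qed.

(** A product of lines through the P_i, each chosen in its pencil so that the residual part on P^1
    is nonzero at w and w', padded by a line missing the images of both. *)
Let base_point_free m D (w w' : proj 1 K) : (\sum_i m i <= D)%N -> exists h r,
  [/\ fat_ideal_deg P m D h, msub phi h = Th m * r, r.@[w] != 0 & r.@[w'] != 0].
Proof.
move=> le.
have two (Q : B -> Prop) : subspace Q -> (forall u : proj 1 K, exists2 r, Q r & r.@[u] != 0) ->
    exists r, [/\ Q r, r.@[w] != 0 & r.@[w'] != 0].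
  move=> sQ nz; have [r Qr rs] := system_avoid sQ nz [:: w; w'].
  by exists r; split=> //; apply: rs => /=; [left|right; left].
have [|u|_ [[l hl ->] lw lw']] := two (image (msub phi) (@form K 3 1)).
- by apply: subspace_image => //; exact: subspace_form.
- have [j pj] := nzphi u; exists (phi j) => //; exists 'X_j; last by rewrite msubX.
  exact: dhomogX1.
have line i : exists l r, [/\ l \is 1.-homog, vanish (P i) 1 l, msub phi l = th i * r,
    r.@[w] != 0 & r.@[w'] != 0].
  have [[uM pM] _ ncz [E1 E2 _]] := TP i.
  pose Q r := exists s t : K, r = s *: aa i + t *: bb i.
  have [||_ [[s [t ->]] rw rw']] := two Q.
  - split=> [|c x y [s [t ->]] [s' [t' ->]]]; first by exists 0, 0; rewrite !scale0r addr0.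
    by exists (c * s + s'), (c * t + t'); rewrite -!mul_mpolyC !mpolyCD !mpolyCM; ring.
  - move=> u; have [au|au] := eqVneq (aa i).@[u] 0.
      exists (bb i); first by exists 0, 1; rewrite scale0r add0r scale1r.
      by apply/eqP => bu; exact: ncz au bu.
    by exists (aa i) => //; exists 1, 0; rewrite scale0r addr0 scale1r.
  exists (s *: coord (Mx i) j1 + t *: coord (Mx i) j2), (s *: aa i + t *: bb i); split=> //.
  - by rewrite rpredD // rpredZ // coord_homog.
  - have vz (c : K) j : j != ord0 -> vanish (P i) 1 (c *: coord (Mx i) j).
      by move=> j0; rewrite -mul_mpolyC; apply: vanish_mull; exact: coord_vanish uM pM j0.
    by apply: ideal_powD; apply: vz.
  - by rewrite msubD !msubZ E1 E2 -!mul_mpolyC; ring.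
pose L i := projT1 (constructive_indefinite_description _ (line i)).
have LP i := projT2 (constructive_indefinite_description _ (line i)).
pose r i := projT1 (constructive_indefinite_description _ (LP i)).
have rP i : [/\ L i \is 1.-homog, vanish (P i) 1 (L i), msub phi (L i) = th i * r i,
    (r i).@[w] != 0 & (r i).@[w'] != 0] := projT2 (constructive_indefinite_description _ (LP i)).
exists (l ^+ (D - \sum_i m i) * \prod_i L i ^+ m i), (msub phi l ^+ (D - \sum_i m i) * \prod_i r i ^+ m i).
have ev (u : proj 1 K) : (msub phi l).@[u] != 0 -> (forall i, (r i).@[u] != 0) ->
    (msub phi l ^+ (D - \sum_i m i) * \prod_i r i ^+ m i).@[u] != 0.
  move=> lu ru; rewrite mevalM rmorphXn rmorph_prod /= mulf_neq0 ?expf_neq0 //.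
  by apply/prodf_neq0 => i _; rewrite rmorphXn; apply: expf_neq0; exact: ru.
split; [split| |apply: ev => // i; by case: (rP i)|apply: ev => // i; by case: (rP i)].
- move=> i; apply: vanish_mull; rewrite (bigD1 i) //= mulrC; apply: vanish_mull.
  have [_ v _ _ _] := rP i; exact: vanish_exp.
- rewrite -{2}(subnK le); apply: dhomogM; first by have := dhomogMn (D - \sum_i m i) hl; rewrite mul1n.
  apply: dhomog_prodE => i; have [hL _ _ _ _] := rP i; have := dhomogMn (m i) hL; by rewrite mul1n.
- rewrite msubM msubXn msub_prod mulrCA; congr (_ * _); rewrite /Th -big_split; apply: eq_bigr => i _.
  by case: (rP i) => _ _ E _ _; rewrite msubXn E exprMn.
Qed.

Lemma codim1 (W S : B -> Prop) : subspace S -> subspace W -> (forall x, W x -> S x) -> fin_dim S ->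
  hdim S = (hdim W).+1 -> exists2 y, S y & forall s, S s -> exists c, W (s - c *: y).
Proof.
move=> sS sW WS fS E; have := hdim_quot sS sW WS fS; rewrite E subSnn => -[e [Se _ sp]].
exists (e ord0) => // s /sp[c]; rewrite big_ord1 => h; by exists (c ord0).
Qed.

(** * Arithmetic genus one contradicts smoothness *)

Section Singular.
Hypothesis kap : kappa = -1.
Hypothesis sm : smooth_transform P f k.

Let S c := @form K 2 (c * N0).

Let V_proper c : (d <= c)%N -> ~ (forall h, S c h -> V c h).
Proof.
move=> dc all; have : (hdim (S c) <= hdim (V c))%N.
  by apply: hdimS; [exact: subspace_V|exact: subspace_form|exact: all|exact: fin_dim_V].
by rewrite hdim_V // hdim_binary ltnn.
Qed.

Let V_codim c : (d <= c)%N -> exists2 y, S c y & forall s, S c s -> exists z, V c (s - z *: y).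
Proof.
move=> dc; apply: codim1; [exact: subspace_form|exact: subspace_V|by move=> x []|exact: fin_dim_form|].
by rewrite hdim_V // hdim_binary.
Qed.

Let V_nonzero c (w w' : proj 1 K) : exists r, [/\ V c r, r.@[w] != 0 & r.@[w'] != 0].
Proof.
have [|h [r [Ih E rw rw']]] := @base_point_free (same c) (c * n.+1) w w'.
  by rewrite sum_nat_const card_ord mulnC mulnS leq_addl.
by exists r; split=> //; exact: V_of Ih E.
Qed.

(** The conductor in degree d: the members of V_d that multiply all forms of degree d N0 into
    V_(2d). *)
Let Q r := V d r /\ forall y, S d y -> V (d + d) (r * y).

Let subspace_Q : subspace Q.
Proof.
split=> [|s x y [Vx hx] [Vy hy]].
  by split=> [|y _]; rewrite ?mul0r; exact: subspace0 (subspace_V _).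
have sV c := subspace_V c.
split; first by apply: subspaceD => //; exact: subspaceZ.
move=> z hz; rewrite mulrDl -scalerAl; apply: subspaceD => //; first by apply: subspaceZ => //; exact: hx.
exact: hy.
Qed.

(** As V_d and V_(2d) are hyperplanes, membership of r in the conductor depends on the class of r y0
    modulo V_(2d) for a single y0 outside V_d; this is one linear condition on r. *)
Let Q_codim r1 r2 : V d r1 -> V d r2 -> ~ Q r1 -> exists c, Q (r2 - c *: r1).
Proof.
move=> V1 V2 nQ; have [y0 hy0 yP] := V_codim (leqnn d).
have [z0 hz0 zP] := V_codim (leq_addr d d).
have sV c := subspace_V c.
have S2 r : V d r -> S (d + d) (r * y0).
  by move=> [hr _]; rewrite /S /form mulnDl; exact: dhomogM.
have QP r : V d r -> V (d + d) (r * y0) -> Q r.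
  move=> Vr Vry; split=> // y /yP[c hc]; rewrite (_ : r * y = r * (y - c *: y0) + c *: (r * y0)).
    by apply: subspaceD => //; [exact: VM|exact: subspaceZ].
  by rewrite -!mul_mpolyC; ring.
have [c1 h1] := zP _ (S2 _ V1); have [c2' h2] := zP _ (S2 _ V2).
have c10 : c1 != 0.
  by apply/eqP => z; apply: nQ; apply: QP => //; move: h1; rewrite z scale0r subr0.
exists (c2' / c1); apply: QP; first by apply: subspaceB => //; exact: subspaceZ.
rewrite (_ : _ * y0 = (r2 * y0 - c2' *: z0) - (c2' / c1) *: (r1 * y0 - c1 *: z0)).
  by apply: subspaceB => //; exact: subspaceZ.
rewrite scalerBr scalerA divfK //.
by rewrite -!mul_mpolyC; ring.
Qed.

(* The conductor of V has codimension one in V: it is the ideal of a point w. *)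
Let conductor_root : exists w : proj 1 K, forall r, V d r -> r.@[w] = 0 -> Q r.
Proof.
have [w wP] : exists w : proj 1 K, forall r, Q r -> r.@[w] = 0.
  apply: NNPP => no; have nz (w : proj 1 K) : exists2 r, Q r & r.@[w] != 0.
    apply: NNPP => no'; apply: no; exists w => r Qr; apply/eqP/negPn/negP => h.
    by apply: no'; exists r.
  have [a [b [Qa Qb ab]]] := system_span subspace_Q (fun r Qr => (proj1 (proj1 Qr))) nz (leqnn _).
  apply: (V_proper (leq_addr d d)) => h; rewrite /S /form mulnDl => /ab[x [y [hx hy ->]]].
  by apply: subspaceD; [exact: subspace_V|exact: Qa.2|exact: Qb.2].
have [r0 [V0 r0w _]] := V_nonzero d w w.
have nQ : ~ Q r0 by move=> /wP z; rewrite z eqxx in r0w.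
exists w => r Vr rw; have [c Qc] := Q_codim V0 Vr nQ.
have := wP _ Qc; rewrite mevalB mevalZ rw sub0r => /eqP; rewrite oppr_eq0 mulf_eq0 (negPf r0w) orbF.
by move=> /eqP z; move: Qc; rewrite z scale0r subr0.
Qed.

(** Suppose the conductor divided by the equation of w had no base point. Then two members would
    generate, so V_(2d) would contain all multiples of the equation of w; both have dimension 2d N0,
    so w would be a base point of V_(2d), which has none. The second root w' may equal w, the
    cuspidal case. *)
Lemma double_root : exists w w' : proj 1 K, forall r, V d r -> r.@[w] = 0 ->
  divides (root_line w * root_line w') r.
Proof.
have [w wP] := conductor_root; exists w.
pose Q' x := x \is (d * N0).-1.-homog /\ Q (x * root_line w).
have e0 : (0 < d * N0)%N by rewrite muln_gt0 d0 (leq_trans d0 N0_gt0).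
have dividesQ r : V d r -> r.@[w] = 0 -> exists2 x, Q' x & r = x * root_line w.
  move=> Vr rw; have [hr _] := Vr; have [x xE] := root_line_divides hr rw; exists x => //.
  split; last by rewrite -xE; exact: wP.
  by have := form_quotient hr (root_line_neq0 w) (root_line_homog w) xE; rewrite subn1.
have sQ' : subspace Q'.
  split=> [|s x y [hx Qx] [hy Qy]]; first by split; rewrite ?mul0r ?dhomog0 //; exact: subspace0 subspace_Q.
  split; first by rewrite rpredD // rpredZ.
  by rewrite mulrDl -scalerAl; case: subspace_Q => _; apply.
have [w' w'P] : exists w' : proj 1 K, forall x, Q' x -> x.@[w'] = 0.
  apply: NNPP => no; have nz (w' : proj 1 K) : exists2 r, Q' r & r.@[w'] != 0.
    apply: NNPP => no'; apply: no; exists w' => r Qr; apply/eqP/negPn/negP => h.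
    by apply: no'; exists r.
  have [a [b [[_ Qa] [_ Qb] ab]]] := system_span sQ' (fun r Qr => (proj1 Qr)) nz (leq_pred _).
  pose W := image (fun y => root_line w * y) (@form K 2 ((d * N0).-1 + d * N0)).
  have sW : subspace W by apply: subspace_image; [exact: lin_mul|exact: subspace_form].
  have WV x : W x -> V (d + d) x.
    move=> [_ /ab[x1 [x2 [h1 h2 ->]]] ->].
    rewrite (_ : _ * _ = a * root_line w * x1 + b * root_line w * x2); last by ring.
    by apply: subspaceD; [exact: subspace_V|exact: Qa.2|exact: Qb.2].
  have hW : hdim W = ((d + d) * N0)%N.
    rewrite (hdim_mul (root_line_neq0 w) (subspace_form _ _ _) (fin_dim_form _ _ _)) hdim_binary.
    by rewrite mulnDl -{3}(prednK e0) addSn.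
  have [r [Vr rw _]] := V_nonzero (d + d) w w.
  have [y _ yE] : W r.
    apply: (hdim_eq (subspace_V (d + d)) sW WV (fin_dim_V _)) => //.
    by rewrite hW hdim_V // leq_addr.
  by case/negP: rw; rewrite yE mevalM root_line_self mul0r.
exists w' => r Vr rw; have [x Qx ->] := dividesQ _ Vr rw.
have [y ->] := root_line_divides Qx.1 (w'P _ Qx).
by exists y; ring.
Qed.

Variables (w w' : proj 1 K).
Hypothesis dbl : forall r, V d r -> r.@[w] = 0 -> divides (root_line w * root_line w') r.

(** The property of w and w' extends to sections of smaller classes: multiply by a section of the
    complementary class that is nonzero at both points, then cancel it. *)
Let small_section h mu de m D r : fat_ideal_deg P mu de h -> (\sum_i m i <= D)%N ->
  (de + D = d * n.+1)%N -> (forall i, d <= mu i + m i)%N ->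
  msub phi h * Th m = Th (same d) * r -> r.@[w] = 0 -> divides (root_line w * root_line w') r.
Proof.
move=> Ih le deD dm E rw; have [h1 [r1 [I1 E1 r1w r1w']]] := base_point_free w w' le.
have Vr : V d (r * r1).
  apply: (@V_of d (h * h1)); last first.
    transitivity (msub phi h * Th m * r1); first by rewrite msubM E1; ring.
    by rewrite E; ring.
  by have := fatM Ih I1; rewrite deD; apply: fatW.
have := dbl Vr; rewrite mevalM rw mul0r => /(_ erefl).
have r10 : r1 != 0 by apply: contraNneq r1w => ->; rewrite meval0.
have cop u : r1.@[coords u] != 0 -> coprime_elt (root_line u) r1.
  move=> r1u; have [hr1] : exists e, r1 \is e.-homog.
    exists (D * d - \sum_i m i * k i)%N.
    by apply: (form_quotient (msub_homog hphi I1.2) (Th_neq0 m) (Th_homog m)); rewrite E1 mulrC.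
  move=> hr; apply: (no_common_zero_coprime (root_line_neq0 u) (root_line_homog u) hr) => v lv r1v.
  have [x xE] := root_line_divides hr r1v.
  by case/negP: r1u; rewrite xE mevalM (root_line_sym lv) mulr0.
move=> [x xE]; have [y yE] : divides r1 x.
  have c1 := coprime_sym (root_line_neq0 w) (cop w r1w).
  have c2' := coprime_sym (root_line_neq0 w') (cop w' r1w').
  apply: (c2' x); apply: (c1 (root_line w' * x)); exists r.
  by rewrite xE; ring.
exists y; apply: (mulIf r10); rewrite xE yE; ring.
Qed.

Let sum_same c : (\sum_(i < n) same c i = n * c)%N.
Proof. by rewrite sum_nat_const card_ord. Qed.

Let linear_section l : l \is 1.-homog -> (msub phi l).@[w] = 0 ->
  divides (root_line w * root_line w') (msub phi l).
Proof.
move=> hl; apply: (@small_section l (same 0) 1 (same d) (d * n.+1).-1); try by [].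
- rewrite sum_same mulnS; move: d0; rewrite mulnC; move: (d * n)%N; clear; lia.
- by rewrite add1n prednK // muln_gt0 d0.
- by rewrite mulrC.
Qed.

Let theta_section i : (th i).@[w] = 0 -> divides (root_line w * root_line w') (th i).
Proof.
apply: (@small_section 1 (same 0) 0 (bump (same d) i) (d * n.+1)).
- by split; [|exact: dhomog1].
- by rewrite sum_bump sum_same mulnS mulnC; move: d0; move: (d * n)%N; clear; lia.
- by [].
- by move=> j; rewrite /bump add0n leq_addr.
rewrite msub1 mul1r /Th (bigD1 i) //= [in RHS](bigD1 i) //= /bump eqxx addn1 exprSr.
rewrite (eq_bigr (fun j => th j ^+ d)) => [|j /negPf ->]; last by rewrite addn0.
ring.
Qed.

Let direction_section i s t : (s *: aa i + t *: bb i).@[w] = 0 ->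
  divides (root_line w * root_line w') (s *: aa i + t *: bb i).
Proof.
have [[uM pM] _ _ [E1 E2 _]] := TP i.
pose l := s *: coord (Mx i) j1 + t *: coord (Mx i) j2.
pose mu j := (j == i : nat).
apply: (@small_section l mu 1 (fun j => d - (j == i))%N (d * n.+1).-1).
- split; last by rewrite rpredD // rpredZ // coord_homog.
  have vz (c : K) j : j != ord0 -> vanish (P i) 1 (c *: coord (Mx i) j).
    by move=> j0; rewrite -mul_mpolyC; apply: vanish_mull; exact: coord_vanish uM pM j0.
  move=> j; rewrite /mu; case: eqP => [->|_]; last by [].
  by apply: ideal_powD; apply: vz.
- apply: leq_trans (leq_sum _ (fun j _ => leq_subr _ _)) _.
  rewrite sum_same mulnS; move: d0; rewrite mulnC; move: (d * n)%N; clear; lia.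
- by rewrite add1n prednK // muln_gt0 d0.
- by move=> j; rewrite /mu subnKC //; case: eqP.
rewrite /l msubD !msubZ E1 E2 /Th (bigD1 i) //= [in RHS](bigD1 i) //= eqxx.
have -> : th i ^+ d = th i ^+ (d - true) * th i by rewrite -exprSr /= subn1 prednK.
rewrite (eq_bigr (fun j => th j ^+ d)) => [|j /negPf ->]; last by rewrite subn0.
by rewrite -!mul_mpolyC; ring.
Qed.

Let phi_coord (M : 'M[K]_3) j : M \in unitmx -> phi j = \sum_i M i j *: msub phi (coord M i).
Proof.
move=> uM; have E : 'X_j = \sum_i M i j *: coord M i.
  rewrite -[LHS](lsubK uM) (lsubE M) msubX lsub_sum; apply: eq_bigr => i _.
  by rewrite lsubZ.
by rewrite -[LHS](msubX phi j) E msub_sum; apply: eq_bigr => i _; rewrite msubZ.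
Qed.

Let msub_coords (M : 'M[K]_3) (y : 'I_3 -> B) : (forall j, phi j = \sum_i M i j *: y i) ->
  forall A, msub phi A = msub y (lsub M A).
Proof.
move=> E A; rewrite lsubE msub_comp; apply: eq_msub => j.
by rewrite E msub_sum; apply: eq_bigr => i _; rewrite msubZ msubX.
Qed.

(** From the rational inverse (A0 : A1): up to one fixed factor [ka], every linear form on P^1 is
    the pullback of a form. *)
Let birational : exists e (ka : B), ka != 0 /\ forall u : proj 1 K, exists2 A, A \is (e).-homog &
  msub phi A = root_line u * ka.
Proof.
have [_ _ _ [e [A0 [A1 []]]]] := nphi; rewrite !msub_psubst => h0 h1 nz E.
have [u [u0 u1]] := @proj1_exists K 0 1 (or_intror (oner_neq0 K)).
have uE : root_line u = 'X_ord0 by rewrite /root_line u0 u1 scale1r scale0r subr0.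
have A0u : (msub phi A0).@[u] = 0.
  have := congr1 (fun q : B => q.@[u]) E; rewrite /= !mevalM !mevalXU u0 u1 mulr1 mulr0; exact.
have [ka kaE] := root_line_divides (msub_homog hphi h0) A0u; rewrite uE in kaE.
have A1E : msub phi A1 = 'X_ord_max * ka.
  by apply: (mulIf (var_neq0 K (ord0 : 'I_2))); rewrite -E kaE; ring.
exists e, ka; split.
  by apply/eqP => z; case: nz => /eqP[]; rewrite ?A1E ?kaE z ?mulr0 ?mul0r.
move=> v; exists (v ord_max *: A0 - v ord0 *: A1); first by rewrite rpredB // rpredZ.
by rewrite msubB !msubZ kaE A1E /root_line -!mul_mpolyC; ring.
Qed.

(** Feeds the local argument: G' is the equation of the proper transform in the chart, completed to
    a plane curve, and psi its parametrization. Smoothness supplies a linear term of G', and [lift]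
    carries the forms of the rational inverse over to psi. *)
Let branch_contradiction (x : blowup_frame P) g (G' : R) (D : nat) (psi : 'I_3 -> B) :
  G' \is g.-homog -> msub psi G' = 0 ->
  pullback x f = 'X_ord0 ^+ (if frame_on x is Some i then k i else 0%N) * msub (chart K false) G' ->
  (forall j, psi j \is D.-homog) -> (psi ord0).@[w] != 0 -> (psi ord0).@[w'] != 0 ->
  divides (root_line w * root_line w') (psi j1) -> divides (root_line w * root_line w') (psi j2) ->
  (exists2 la : B, la != 0 & exists q : nat -> nat, forall e (A : R), A \is (e).-homog ->
    exists2 A', A' \is (q e).-homog & msub psi A' = la ^+ e * msub phi A) -> False.
Proof.
move=> hG G0 pE hpsi qw qw' s1 s2 [la la0 [q lift]].
have Ge : G'.@[e0 K] = 0.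
  have z j : divides (root_line w * root_line w') (psi j) -> (psi j).@[w] = 0.
    by move=> [y ->]; rewrite !mevalM root_line_self mul0r mulr0.
  have : (msub psi G').@[w] = (psi ord0).@[w] ^+ g * G'.@[e0 K].
    rewrite -(homog_scale _ _ hG) msub_eval; apply: meval_eq => j; rewrite /e0.
    by case: (ord3P j) => ->; rewrite /= ?mulr1 ?mulr0 ?(z _ s1) ?(z _ s2).
  rewrite G0 meval0 => /esym/eqP; rewrite mulf_eq0 expf_eq0 (negPf qw) andbF.
  by move/eqP.
have lin : exists2 l, l \in msupp G' & mwt (@w01 3) l = 1%N.
  have [|v] := sm pE.
    rewrite constant_coefE msub_eval -[RHS]Ge; apply: meval_eq => j; rewrite /e0 /chart.
    by case: (ord3P j) => -> /=; rewrite ?meval1 ?mevalXU.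
  rewrite msub_chartE raddf_sum /= => nz.
  have [l ls le] : exists2 l, l \in msupp G' & chart_mon false l = U_(v)%MM.
    apply: NNPP => no; case/eqP: nz; rewrite big1_seq // => l /andP[_ ls].
    rewrite mcoeffZ mcoeffX; case: eqP => [E|]; last by rewrite mulr0.
    by case: no; exists l.
  exists l => //; have := congr1 (fun z : 'X_{1..2} => z ord0) le.
  have := congr1 (fun z : 'X_{1..2} => z ord_max) le.
  rewrite /= chart_mon0 chart_mon1 !mnm1E mul0n addn0 w01_3 => -> ->.
  by case: (ord2P v) => ->.
have [e [ka [ka0 bir]]] := birational; have [v [vw _]] := root_line_other w.
have [A hA AE] := bir w; have [A' hA' A'E] := bir v.
have [C hC CE] := lift _ _ hA; have [C' hC' C'E] := lift _ _ hA'.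
apply: (smooth_branch_contradiction hpsi qw qw' s1 s2 hG G0 lin hC hC' (ka := la ^+ e * ka) _ vw).
- by rewrite mulf_neq0 // expf_neq0.
- by rewrite CE AE; ring.
- by rewrite C'E A'E; ring.
Qed.

Let not_off : ~ (forall i, ~ proportional (Proj (nzphi w)) (P i)).
Proof.
move=> off; have [x [xn xw]] := off_frame off.
pose M := frame_mx x; have uM : M \in unitmx := frame_unit x.
pose y j := msub phi (coord M j).
have yw j : (y j).@[w] = (ord0 == j)%:R.
  by rewrite msub_eval -(coord_eval _ _ uM); apply: meval_eq => l; rewrite xw.
have dy j : j != ord0 -> divides (root_line w * root_line w') (y j).
  by move=> j0; apply: linear_section; [exact: coord_homog|rewrite -/(y j) yw eq_sym (negPf j0)].
have yw' j : j != ord0 -> (y j).@[w'] = 0.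
  by move=> /dy[z ->]; rewrite !mevalM root_line_self !mulr0.
have yE A := msub_coords (fun j => phi_coord j uM) A.
have hy j : y j \is d.-homog by have := msub_homog hphi (coord_homog M j); rewrite mul1n.
apply: (@branch_contradiction x d (lsub M f) d y) => //.
- exact: lsub_homog.
- by rewrite -yE phif.
- by rewrite pullbackE /on_exceptional xn expr0 mul1r.
- by rewrite yw eqxx oner_neq0.
- apply/eqP => z; have [j] := nzphi w'; rewrite (phi_coord j uM) rmorph_sum big1 ?eqxx // => l _.
  rewrite /= mevalZ -/(y l); case: (ord3P l) => ->; rewrite ?z ?yw' ?mulr0 //.
- exact: dy.
- exact: dy.
exists 1; first exact: oner_neq0.
exists id => e A hA; exists (lsub M A); first exact: lsub_homog.
by rewrite expr1n mul1r yE.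
Qed.

(** When w is mapped to some P_i the point in question lies on E_i, so coordinates are set up at the
    tangent direction of the branch at w; w' is shown to give the same direction. *)
Lemma no_singular_pair : False.
Proof.
have [i [c cE]] : exists i, proportional (Proj (nzphi w)) (P i).
  by apply: NNPP => no; apply: not_off => i pr; apply: no; exists i.
have {}cE j : (phi j).@[w] = c * P i j := cE j.
have [[uM pM] [hth th0 ha hb] ncz [E1 E2 _]] := TP i.
set M := Mx i in uM pM E1 E2; set a := aa i in ha ncz E1; set b := bb i in hb ncz E2.
set t := th i in hth th0 E1 E2.
pose y0 := msub phi (coord M ord0).
have hy0 : y0 \is d.-homog by have := msub_homog hphi (coord_homog M ord0); rewrite mul1n.
have phiE j : phi j = M ord0 j *: y0 + M j1 j *: (a * t) + M j2 j *: (b * t).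
  by rewrite (phi_coord j uM) !big_ord_recl big_ord0 addr0 -/j1 -/j2 E1 E2 addrA.
have cz j : j != ord0 -> (msub phi (coord M j)).@[w] = 0.
  move=> j0; rewrite msub_eval (meval_eq (v2 := fun l => c * M ord0 l)) => [|l]; last by rewrite cE pM.
  by rewrite (homog_scale _ _ (coord_homog M j)) coord_eval // eq_sym (negPf j0) mulr0.
have tw : t.@[w] = 0.
  apply/eqP/negPn/negP => tn; apply: (ncz w).
    by have /eqP := cz j1 isT; rewrite E1 mevalM mulf_eq0 (negPf tn) orbF => /eqP.
  by have /eqP := cz j2 isT; rewrite E2 mevalM mulf_eq0 (negPf tn) orbF => /eqP.
have dt : divides (root_line w * root_line w') t by apply: theta_section.
have tw' : t.@[w'] = 0 by have [z ->] := dt; rewrite !mevalM root_line_self !mulr0.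
have y0n (u : proj 1 K) : t.@[u] = 0 -> y0.@[u] != 0.
  move=> tu; apply/eqP => yu; have [j] := nzphi u.
  by rewrite phiE !mevalD !mevalZ !mevalM tu yu !mulr0 !addr0 eqxx.
pose a0 := a.@[w]; pose b0 := b.@[w].
have [c0 [d0' det]] : exists c0 d0', a0 * d0' - b0 * c0 = 1.
  have [az|an] := eqVneq a0 0.
    have bn : b0 != 0 by apply/eqP => bz; exact: ncz az bz.
    by exists (- b0^-1), 0; rewrite mulr0 sub0r mulrN opprK mulfV.
  by exists 0, a0^-1; rewrite mulr0 subr0 mulfV.
pose a' := d0' *: a - c0 *: b; pose b' := a0 *: b - b0 *: a.
have aE : a = a0 *: a' + c0 *: b'.
  rewrite -[LHS]scale1r -det /a' /b' -!mul_mpolyC !mpolyCB !mpolyCM; ring.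
have bE : b = b0 *: a' + d0' *: b'.
  rewrite -[LHS]scale1r -det /a' /b' -!mul_mpolyC !mpolyCB !mpolyCM; ring.
have ha' : a' \is (d - k i).-homog by rewrite rpredB // rpredZ.
have hb' : b' \is (d - k i).-homog by rewrite rpredB // rpredZ.
have a'w : a'.@[w] = 1 by rewrite /a' mevalB !mevalZ -/a0 -/b0 -det; ring.
have b'w : b'.@[w] = 0 by rewrite /b' mevalB !mevalZ -/a0 -/b0; ring.
have db' : divides (root_line w * root_line w') b'.
  have -> : b' = (- b0) *: a + a0 *: b by rewrite scaleNr addrC.
  apply: direction_section; rewrite mevalD !mevalZ -/a0 -/b0; ring.
have b'w' : b'.@[w'] = 0 by have [z ->] := db'; rewrite !mevalM root_line_self !mulr0.
have a'w' : a'.@[w'] != 0.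
  apply/eqP => z; apply: (ncz w'); first by rewrite aE mevalD !mevalZ z b'w' !mulr0 addr0.
  by rewrite bE mevalD !mevalZ z b'w' !mulr0 addr0.
have a'n : a' != 0 by apply: contraNneq a'w' => ->; rewrite meval0.
(* The last two rows of the frame are recombined so that the direction of the branch at w becomes
   the origin u = 0 of E_i; the determinant 1 condition keeps it invertible. *)
pose M' : 'M[K]_3 := \matrix_(l, j) (if l == ord0 then M ord0 j else
   if l == j1 then a0 * M j1 j + b0 * M j2 j else c0 * M j1 j + d0' * M j2 j).
have uM' : M' \in unitmx.
  rewrite -row_free_unit; apply: inj_row_free => v vM.
  pose v3 (l : 'I_3) : K := if l == ord0 then v 0 ord0 else
     if l == j1 then v 0 j1 * a0 + v 0 j2 * c0 else v 0 j1 * b0 + v 0 j2 * d0'.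
  have z : v3 =1 (fun=> 0).
    apply: (frame_point_inj uM) => j; have /rowP/(_ j) := vM; rewrite !mxE => h.
    rewrite /frame_point [RHS]big1 => [|l _]; last by rewrite mulr0.
    rewrite -[RHS]h !big_ord_recl !big_ord0 /v3 /= !mxE /= -/j1 -/j2; ring.
  have := z ord0; have := z j1; have := z j2; rewrite /v3 /= => z2 z1 z0.
  have s1 : v 0 j1 = d0' * (v 0 j1 * a0 + v 0 j2 * c0) - c0 * (v 0 j1 * b0 + v 0 j2 * d0').
    by rewrite -[LHS]mulr1 -det; ring.
  have s2 : v 0 j2 = a0 * (v 0 j1 * b0 + v 0 j2 * d0') - b0 * (v 0 j1 * a0 + v 0 j2 * c0).
    by rewrite -[LHS]mulr1 -det; ring.
  by apply/rowP => l; rewrite mxE; case: (ord3P l) => -> //; [rewrite s1|rewrite s2]; rewrite z1 z2 !mulr0 subr0.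
have pM' j : M' ord0 j = P i j by rewrite mxE /= pM.
pose x := @BlowupFrame n K P M' (Some i) uM' pM'.
pose y (j : 'I_3) : B := if j == ord0 then y0 else if j == j1 then a' * t else b' * t.
have yE A : msub phi A = msub y (lsub M' A).
  apply: msub_coords => j; rewrite phiE !big_ord_recl big_ord0 /y /= !mxE /= -/j1 -/j2 aE bE.
  by rewrite -!mul_mpolyC !mpolyCD !mpolyCM; ring.
pose la := y0 * a' ^+ 2.
(* In affine coordinates psi is s = a' t / y0, u = b' / a', the parametrization lifted to the chart.
   Below, [tau] homogenizes the chart map (s, u) -> (1 : s : s u), so that [tau] after psi is y up
   to the factor [la]. *)
pose psi (j : 'I_3) : B := if j == ord0 then y0 * a' else if j == j1 then a' ^+ 2 * t else b' * y0.
pose tau (j : 'I_3) : R := if j == ord0 then 'X_ord0 * 'X_ord0 else if j == j1 then 'X_ord0 * 'X_j1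
  else 'X_j1 * 'X_j2.
have htau j : tau j \is 2.-homog.
  have h2 (l l' : 'I_3) : 'X_l * 'X_l' \is 2.-homog := dhomogM (dhomogX1 K l) (dhomogX1 K l').
  by rewrite /tau; case: ifP => _; [|case: ifP => _]; exact: h2.
have psitau e A : A \is (e).-homog -> msub psi (msub tau A) = la ^+ e * msub y A.
  move=> hA; rewrite -(msub_scale _ _ hA) msub_comp; apply: eq_msub => j; rewrite /tau /y /la.
  by case: (ord3P j) => -> /=; rewrite msubM !msubX /psi /=; ring.
have kid := kd i.
have la0 : la != 0.
  rewrite mulf_neq0 ?expf_neq0 //.
  by have := y0n w tw; apply: contraNneq => ->; rewrite meval0.
have hl := lsub_homog M' hf.
(* The total transform contains E_i, here X_j1 = 0, with multiplicity k_i; the quotient is the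
   proper transform. *)
have [G' GE] : divides ('X_j1 ^+ k i) (msub tau (lsub M' f)).
  have /(ideal_powP _ _ uM' pM') o := (fk i).1; rewrite msubE big_seq.
  elim/big_rec: _ => [|u z us dz]; first exact: divides0.
  apply: dividesD => //; rewrite -mul_mpolyC; apply: divides_mull.
  have := o u us; rewrite w01_3 => le; rewrite !big_ord_recl big_ord0 mulr1 -/j1 -/j2 /tau /=.
  exists ('X_j1 ^+ (u j1 + u j2 - k i) * (('X_ord0 * 'X_ord0) ^+ u ord0 * 'X_ord0 ^+ u j1 * 'X_j2 ^+ u j2)).
  transitivity ('X_j1 ^+ (u j1 + u j2) * (('X_ord0 * 'X_ord0) ^+ u ord0 * 'X_ord0 ^+ u j1 * 'X_j2 ^+ u j2) : R).
    by rewrite !exprMn exprD; ring.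
  by rewrite -{1}(subnK le) exprD; ring.
have f0' : lsub M' f != 0 by exact: lsub_neq0.
have hX : ('X_j1 ^+ k i : R) \is (k i).-homog by have := dhomogMn (k i) (dhomogX1 K j1); rewrite mul1n.
have Xn : ('X_j1 ^+ k i : R) != 0 by rewrite expf_neq0 // var_neq0.
have hG' := form_quotient (msub_homog htau hl) Xn hX GE.
have psi1n : psi j1 != 0 by rewrite /psi /= mulf_neq0 // expf_neq0.
apply: (@branch_contradiction x _ G' (d + (d - k i)) psi hG').
- have := psitau _ _ hl; rewrite -yE phif mulr0 GE msubM msubXn msubX => /eqP.
  by rewrite mulf_eq0 (negPf (expf_neq0 _ psi1n)) orbF => /eqP.
- rewrite pullbackE /on_exceptional /=.
  transitivity (msub (chart K false) (msub tau (lsub M' f))).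
    rewrite msub_comp; apply: eq_msub => j; rewrite /tau /chart.
    by case: (ord3P j) => -> /=; rewrite msubM !msubX /= ?mul1r.
  by rewrite GE msubM msubXn msubX /= mulrC.
- move=> j; rewrite /psi; case: ifP => _; first exact: dhomogM.
  case: ifP => _; last by rewrite addnC; exact: dhomogM.
  have -> : (d + (d - k i) = (d - k i) * 2 + k i)%N by move: kid; clear; lia.
  by apply: dhomogM => //; apply: dhomogMn.
- by rewrite /psi /= mevalM a'w mulr1 y0n.
- by rewrite /psi /= mevalM mulf_neq0 // y0n.
- by rewrite /psi /=; apply: divides_mull.
- by rewrite /psi /=; apply: divides_mulr.
exists la => //; exists (fun e => (e * 2)%N) => e A hA.
exists (msub tau (lsub M' A)); first exact: msub_homog htau (lsub_homog M' hA).
by rewrite (psitau _ _ (lsub_homog M' hA)) -yE.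
Qed.

End Singular.

(** [kappa] is odd and lies between -1 and 1, and the value -1 was excluded by smoothness. *)
Theorem adjunction : smooth_transform P f k -> 3 * d%:Z - \sum_i (k i)%:Z = 1.
Proof.
move=> sm; rewrite -/kappa; have := kappa_le1; have := kappa_geN1.
have odd := chi_diff (leqnn d).
have : kappa != -1.
  apply/eqP => kap; have [w [w' dbl]] := double_root kap.
  exact: (no_singular_pair sm dbl).
by move: odd; move: (chi _ _) (chi _ _) kappa (d * N0)%N => *; lia.
Qed.

End Adjunction.

(** * Ultraproducts *)

Record ultrafilter (I : Type) := Ultrafilter {
  large :> (I -> Prop) -> Prop;
  large_and : forall Q Q', large Q -> large Q' -> large (fun i => Q i /\ Q' i);
  large_sub : forall Q Q' : I -> Prop, (forall i, Q i -> Q' i) -> large Q -> large Q';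
  not_large_false : ~ large (fun=> False);
  large_or_not : forall Q, large Q \/ large (fun i => ~ Q i) }.

Lemma ultrafilter_exists (I : Type) (F : (I -> Prop) -> Prop) : F (fun=> True) ->
  (forall Q Q', F Q -> F Q' -> F (fun i => Q i /\ Q' i)) ->
  (forall Q Q' : I -> Prop, (forall i, Q i -> Q' i) -> F Q -> F Q') -> ~ F (fun=> False) ->
  exists U : ultrafilter I, forall Q, F Q -> U Q.
Proof.
move=> FT FI FS F0.
have pF : filter.ProperFilter (F : classical_sets.set (classical_sets.set I)).
  split; first exact: F0.
  split; [exact: FT|exact: FI|exact: FS].
have [G [uG FG]] := filter.ultraFilterLemma pF.
have [[G0 [GT GI GS]] _] := uG.
have GN Q : G Q \/ G (fun i => ~ Q i) by have := @filter.in_ultra_setVsetC I G Q uG.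
by exists (@Ultrafilter I G GI GS G0 GN) => Q /FG.
Qed.

Section Large.
Variables (I : Type) (U : ultrafilter I).

Lemma large_true Q : (forall i, Q i) -> U Q.
Proof.
move=> h; case: (large_or_not U Q) => // nQ; case: (not_large_false (large_sub _ nQ)).
by move=> i; apply.
Qed.

Lemma large_not Q : U (fun i => ~ Q i) <-> ~ U Q.
Proof.
split=> [nQ UQ|nQ]; last by case: (large_or_not U Q).
by apply: (not_large_false (large_sub _ (large_and nQ UQ))) => i [].
Qed.

Lemma large_or Q Q' : U (fun i => Q i \/ Q' i) -> U Q \/ U Q'.
Proof.
move=> h; case: (large_or_not U Q) => [|nQ]; first by left.
by right; apply: large_sub (large_and h nQ) => i [[]].
Qed.

(** An ultrafilter decides a finite case distinction: one case holds on a large set. *)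
Lemma large_bounded N (Q : nat -> I -> Prop) :
  U (fun i => exists2 j, (j < N)%N & Q j i) -> exists2 j, (j < N)%N & U (Q j).
Proof.
elim: N => [|N IH] h; first by case: (not_large_false (large_sub _ h)) => i [].
have [] : U (fun i => exists2 j, (j < N)%N & Q j i) \/ U (Q N).
- apply: large_or; apply: large_sub h => i [j]; rewrite ltnS leq_eqVlt => /orP[/eqP ->|lt q]; first by right.
  by left; exists j.
- by move=> /IH[j lt q]; exists j => //; exact: ltnW.
by exists N.
Qed.

Lemma large_finite (T : finType) (Q : T -> I -> Prop) :
  U (fun i => exists j, Q j i) -> exists j, U (Q j).
Proof.
move=> h; apply: NNPP => no; have [j lt q] : exists2 j, (j < #|T|)%N &
    U (fun i => exists2 x, j = enum_rank x & Q x i).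
  apply: large_bounded; apply: large_sub h => i [x q].
  by exists (enum_rank x) => //; exists x.
apply: no; exists (enum_val (Ordinal lt)); apply: large_sub q => i [x jx].
suff -> : enum_val (Ordinal lt) = x by [].
by rewrite -(enum_rankK x); congr enum_val; apply: val_inj.
Qed.

Lemma large_all (T : finType) (Q : T -> I -> Prop) : (forall j, U (Q j)) -> U (fun i => forall j, Q j i).
Proof.
move=> h; case: (large_or_not U (fun i => forall j, Q j i)) => // nh.
have [j q] : exists j, U (fun i => ~ Q j i).
  apply: large_finite; apply: large_sub nh => i /not_all_ex_not[j q]; by exists j.
by case/large_not: q.
Qed.

End Large.

(** * The ultraproduct of a field *)

Section Families.
Variables (I : Type) (i0 : I) (K : fieldType).

(* The index i0 witnesses that I is inhabited, so that 1 != 0. *)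
Definition family of I : Type := I -> K.
Local Notation A := (family i0).

HB.instance Definition _ := boolp.gen_eqMixin A.
HB.instance Definition _ := boolp.gen_choiceMixin A.

Let zero : A := fun=> 0.
Let one : A := fun=> 1.
Let add (x y : A) : A := fun i => x i + y i.
Let opp (x : A) : A := fun i => - x i.
Let mul (x y : A) : A := fun i => x i * y i.
Let ext (x y : A) : (forall i, x i = y i) -> x = y. Proof. exact: functional_extensionality. Qed.

Let addA : associative add. Proof. by move=> x y z; apply: ext => i; rewrite /add addrA. Qed.
Let addC : commutative add. Proof. by move=> x y; apply: ext => i; rewrite /add addrC. Qed.
Let add0 : left_id zero add. Proof. by move=> x; apply: ext => i; rewrite /add add0r. Qed.
Let addN : left_inverse zero opp add. Proof. by move=> x; apply: ext => i; rewrite /add addNr. Qed.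
HB.instance Definition _ := GRing.isZmodule.Build A addA addC add0 addN.

Let mulA : associative mul. Proof. by move=> x y z; apply: ext => i; rewrite /mul mulrA. Qed.
Let mulC : commutative mul. Proof. by move=> x y; apply: ext => i; rewrite /mul mulrC. Qed.
Let mul1 : left_id one mul. Proof. by move=> x; apply: ext => i; rewrite /mul mul1r. Qed.
Let mulD : left_distributive mul add. Proof. by move=> x y z; apply: ext => i; rewrite /mul mulrDl. Qed.
Let one0 : one != 0.
Proof. by apply/eqP => /(congr1 (fun x : A => x i0)) /eqP; rewrite oner_eq0. Qed.
HB.instance Definition _ := GRing.Zmodule_isComNzRing.Build A mulA mulC mul1 mulD one0.

Definition member (i : I) (x : A) : K := x i.

Lemma member_is_zmod i : zmod_morphism (member i). Proof. by []. Qed.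
Lemma member_is_monoid i : monoid_morphism (member i). Proof. by []. Qed.
HB.instance Definition _ i := GRing.isZmodMorphism.Build A K (member i) (member_is_zmod i).
HB.instance Definition _ i := GRing.isMonoidMorphism.Build A K (member i) (member_is_monoid i).

Lemma member_ext (x y : A) : (forall i, member i x = member i y) -> x = y.
Proof. exact: ext. Qed.

Definition const (c : K) : A := fun=> c.

Lemma const_is_zmod : zmod_morphism const. Proof. by []. Qed.
Lemma const_is_monoid : monoid_morphism const. Proof. by []. Qed.
HB.instance Definition _ := GRing.isZmodMorphism.Build K A const const_is_zmod.
HB.instance Definition _ := GRing.isMonoidMorphism.Build K A const const_is_monoid.

Variable U : ultrafilter I.

Definition null (V : ultrafilter I) (x : A) : bool := boolp.asbool (V (fun i => member i x = 0)).
Local Notation N := (null U).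

Lemma nullP (x : A) : reflect (U (fun i => member i x = 0)) (N x).
Proof. exact: boolp.asboolP. Qed.

Lemma null_ideal : idealr_closed N.
Proof.
split.
- by apply/nullP; apply: large_true => i; rewrite rmorph0.
- apply/nullP => h; apply: (not_large_false (large_sub _ h)) => i; rewrite rmorph1 => /eqP.
  by rewrite oner_eq0.
- move=> a x y /nullP hx /nullP hy; apply/nullP; apply: large_sub (large_and hx hy) => i [ex ey].
  by rewrite rmorphD rmorphM /= ex ey mulr0 addr0.
Qed.

HB.instance Definition _ := isIdealr.Build A N null_ideal.

Definition null_idealr : idealr A := N.

Definition ultraproduct : Type := {ideal_quot null_idealr}.
Local Notation L := ultraproduct.
HB.instance Definition _ := GRing.ComNzRing.on L.

Local Open Scope quotient_scope.

Definition germ (x : A) : L := \pi_{ideal_quot null_idealr} x.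

Lemma germ_is_zmod : zmod_morphism germ.
Proof. by move=> x y; rewrite /germ; exact: (rmorphB \pi_{ideal_quot null_idealr}). Qed.

Lemma germ_is_monoid : monoid_morphism germ.
Proof.
split; first by rewrite /germ; exact: (rmorph1 \pi_{ideal_quot null_idealr}).
by move=> x y; rewrite /germ; exact: (rmorphM \pi_{ideal_quot null_idealr}).
Qed.
HB.instance Definition _ := GRing.isZmodMorphism.Build A L germ germ_is_zmod.
HB.instance Definition _ := GRing.isMonoidMorphism.Build A L germ germ_is_monoid.

Lemma germ_eq0 (x : A) : germ x = 0 <-> U (fun i => member i x = 0).
Proof.
have -> : germ x = 0 <-> N (x - 0).
  have -> : 0 = germ 0 by rewrite rmorph0.
  have -> : N (x - 0) = (germ x == germ 0) by exact: (Quotient.idealrBE null_idealr x 0).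
  by split=> [->|/eqP].
by rewrite subr0; split=> [/nullP|h]; last exact/nullP.
Qed.

Definition lift (x : L) : A := repr x.

Lemma liftK x : germ (lift x) = x. Proof. exact: reprK. Qed.

Definition ultrainv (x : L) : L := germ (fun i => (member i (lift x))^-1).

Lemma ultra_mulVf x : x != 0 -> ultrainv x * x = 1.
Proof.
move=> x0; rewrite -{2}(liftK x) /ultrainv -rmorphM; apply/eqP; rewrite -subr_eq0; apply/eqP.
rewrite -[1](rmorph1 germ) -rmorphB; apply/germ_eq0.
have : U (fun i => ~ member i (lift x) = 0).
  by apply/large_not => /germ_eq0; rewrite liftK => /eqP; rewrite (negPf x0).
apply: large_sub => i /eqP h; rewrite rmorphB rmorphM rmorph1.
by rewrite {1}/member mulVf ?subrr.
Qed.

Lemma ultra_inv0 : ultrainv 0 = 0.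
Proof.
apply/germ_eq0; have /germ_eq0 : germ (lift 0) = 0 by rewrite liftK.
by apply: large_sub => i; rewrite /member => ->; rewrite invr0.
Qed.

HB.instance Definition _ := GRing.ComNzRing_isField.Build L ultra_mulVf ultra_inv0.

Definition ultra_sat (e : seq L) (f : GRing.formula L) : bool := boolp.asbool (GRing.holds e f).

Lemma ultra_satP : GRing.decidable_field_axiom ultra_sat.
Proof. by move=> e f; exact: boolp.asboolP. Qed.

HB.instance Definition _ := GRing.Field_isDecField.Build L ultra_satP.

End Families.

Section Closed.
Variables (I : Type) (i0 : I) (K : closedFieldType) (U : ultrafilter I).
Local Notation L := (ultraproduct i0 K U).

Lemma ultra_closed : GRing.closed_field_axiom L.
Proof.
move=> n p n0.
have root i : exists x : K, x ^+ n = \sum_(j < n) member i (lift (p j)) * x ^+ j.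
  exact: (@solve_monicpoly K n (fun j => member i (lift (p j)))).
pose x : family K i0 := fun i => projT1 (constructive_indefinite_description _ (root i)).
have xP i : member i x ^+ n = \sum_(j < n) member i (lift (p j)) * member i x ^+ j.
  exact: projT2 (constructive_indefinite_description _ (root i)).
exists (germ U x); rewrite -rmorphXn.
have -> : \sum_(j < n) p j * germ U x ^+ j = germ U (\sum_(j < n) lift (p j) * x ^+ j).
  by rewrite rmorph_sum; apply: eq_bigr => j _; rewrite rmorphM rmorphXn /= liftK.
congr (germ U _); apply: member_ext => i; rewrite rmorphXn /= xP rmorph_sum; apply: eq_bigr => j _.
by rewrite rmorphM rmorphXn.
Qed.

HB.instance Definition _ := GRing.DecField_isAlgClosed.Build L ultra_closed.

End Closed.

Section BaseChange.
Variables (R S : comNzRingType) (h : {rmorphism R -> S}).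

Lemma meval_map n (f : {mpoly R[n]}) (x : 'I_n -> R) :
  (map_mpoly h f).@[fun j => h (x j)] = h f.@[x].
Proof.
pose F : {rmorphism {mpoly R[n]} -> S} := meval (fun j => h (x j)) \o map_mpoly h.
pose G : {rmorphism {mpoly R[n]} -> S} := h \o meval x.
apply: (mpoly_rmorph_ext (F := F) (G := G)) => [c|i]; rewrite /F /G /=.
  by rewrite map_mpolyC !mevalC.
by rewrite map_mpolyX !mevalXU.
Qed.

Lemma map_lsub n (M : 'M[R]_n) f : map_mpoly h (lsub M f) = lsub (map_mx h M) (map_mpoly h f).
Proof.
rewrite !lsubE map_msub; apply: eq_msub => j; rewrite rmorph_sum; apply: eq_bigr => i _.
by rewrite /= map_mpolyZ map_mpolyX mxE.
Qed.

Lemma map_low n (w : 'I_n -> nat) f j : map_mpoly h ((grw w f)`_j) = (grw w (map_mpoly h f))`_j.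
Proof.
apply/mpolyP => u; rewrite mcoeff_map_mpoly !coef_grw mcoeff_map_mpoly.
by case: eqP => _ //; exact: (rmorph0 h).
Qed.

Lemma map_homog n d (f : {mpoly R[n]}) : f \is d.-homog -> map_mpoly h f \is d.-homog.
Proof.
move=> hf; apply/dhomogP => u; rewrite mcoeff_msupp mcoeff_map_mpoly => nz.
by apply: (dhomog_mf hf); rewrite mcoeff_msupp; apply: contraNneq nz => ->; apply/eqP; exact: (rmorph0 h).
Qed.

End BaseChange.

(** For forms, reducibility is the existence of factors of degrees bounded in terms of d, a shape
    that passes through the ultraproduct. *)
Lemma irreducible_form (K : fieldType) n d (f : {mpoly K[n]}) : f \is d.-homog ->
  irreducible_elt f <-> [/\ f != 0, (0 < d)%N & ~ exists2 e, (e < d)%N & exists g h : {mpoly K[n]},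
    [/\ (0 < e)%N, g \is e.-homog, h \is (d - e).-homog & f = g * h]].
Proof.
move=> hf; split=> [[f0 fu fi]|[f0 d0 no]].
  split=> //.
    rewrite lt0n; apply/eqP => z; case/negP: fu; apply: homog0_unit f0 _; by have := hf; rewrite z.
  move=> [e ed [g [h [e0 hg hh E]]]]; case: (fi _ _ E) => u.
    by move: e0; rewrite (unit_homog hg u).
  by have := unit_homog hh u; move: ed; clear; lia.
split=> //; first by apply/negP => u; move: d0; rewrite (unit_homog hf u).
move=> g h E.
have g0 : g != 0 by apply: contraNneq f0 => z; rewrite E z mul0r.
have h0 : h != 0 by apply: contraNneq f0 => z; rewrite E z mulr0.
have hg := homog_divides hf f0 (ex_intro _ h (etrans E (mulrC g h))).
have [le hh] := homog_quotient hf f0 hg (etrans E (mulrC g h)).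
have [z|e0] := posnP (mdegree g).
  by left; apply: homog0_unit g0 _; have := hg; rewrite z.
have [lt|ge] := ltnP (mdegree g) d; first by case: no; exists (mdegree g) => //; exists g, h.
have z : (d - mdegree g = 0)%N by move: ge; clear; lia.
by right; apply: homog0_unit h0 _; have := hh; rewrite z.
Qed.

(** * Los's theorem for forms, multiplicities and rational curves *)

Section Transfer.
Variables (I : Type) (i0 : I) (K : closedFieldType) (U : ultrafilter I).
Local Notation A := (family K i0).
Local Notation L := (ultraproduct i0 K U).

(** A polynomial over the ring of families specializes to a polynomial over K at each index and, as
    its limit, to one over the ultraproduct. Each statement below compares the limit with almost all
    fibres. *)
Definition fiber n (i : I) (F : {mpoly A[n]}) : {mpoly K[n]} := map_mpoly (member i) F.
Definition limit n (F : {mpoly A[n]}) : {mpoly L[n]} := map_mpoly (germ U) F.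

Lemma limitB n (F G : {mpoly A[n]}) : limit (F - G) = limit F - limit G. Proof. exact: rmorphB. Qed.
Lemma limitM n (F G : {mpoly A[n]}) : limit (F * G) = limit F * limit G. Proof. exact: rmorphM. Qed.
Lemma fiberB n i (F G : {mpoly A[n]}) : fiber i (F - G) = fiber i F - fiber i G. Proof. exact: rmorphB. Qed.
Lemma fiberM n i (F G : {mpoly A[n]}) : fiber i (F * G) = fiber i F * fiber i G. Proof. exact: rmorphM. Qed.

Lemma limit_eq0 n (F : {mpoly A[n]}) : limit F = 0 <-> U (fun i => fiber i F = 0).
Proof.
split=> [z|h].
  have : U (fun i => forall j : 'I_(size (msupp F)), member i F@_(nth 0%MM (msupp F) j) = 0).
    apply: large_all => j; apply/germ_eq0.
    by have := congr1 (mcoeff (nth 0%MM (msupp F) j)) z; rewrite mcoeff_map_mpoly mcoeff0.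
  apply: large_sub => i zi; apply/mpolyP => u; rewrite mcoeff_map_mpoly mcoeff0.
  have [us|us] := boolP (u \in msupp F); last by rewrite memN_msupp_eq0 // rmorph0.
  have lt : (index u (msupp F) < size (msupp F))%N by rewrite index_mem.
  by have := zi (Ordinal lt); rewrite /= nth_index.
apply/mpolyP => u; rewrite mcoeff_map_mpoly mcoeff0; apply/germ_eq0.
apply: large_sub h => i zi; have := congr1 (mcoeff u) zi; by rewrite mcoeff_map_mpoly mcoeff0.
Qed.

Lemma limit_eq n (F G : {mpoly A[n]}) : limit F = limit G <-> U (fun i => fiber i F = fiber i G).
Proof.
have -> : limit F = limit G <-> limit (F - G) = 0.
  rewrite limitB; split=> [->|/eqP]; first by rewrite subrr.
  by rewrite subr_eq0 => /eqP.
rewrite limit_eq0; split; apply: large_sub => i; rewrite fiberB.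
  by move/eqP; rewrite subr_eq0 => /eqP.
by move=> ->; rewrite subrr.
Qed.

Definition lift_poly n (p : {mpoly L[n]}) : {mpoly A[n]} := \sum_(u <- msupp p) lift p@_u *: 'X_[u].

Lemma lift_polyK n (p : {mpoly L[n]}) : limit (lift_poly p) = p.
Proof.
rewrite /limit rmorph_sum [RHS]mpolyE; apply: eq_bigr => u _.
rewrite /= map_mpolyZ map_mpolyX; congr (_ *: _); exact: liftK.
Qed.

Lemma lift_poly_homog n d (p : {mpoly L[n]}) : p \is d.-homog -> lift_poly p \is d.-homog.
Proof.
move=> hp; rewrite /lift_poly big_seq; apply: rpred_sum => u us; apply: rpredZ.
by rewrite dhomogX; apply/eqP; exact: (dhomog_mf hp us : mdeg u = d).
Qed.

(** The common degree is essential: only finitely many monomials occur, so that the forms are the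
    fibres of one polynomial. *)
Lemma family_form n d (f : I -> {mpoly K[n]}) : (forall i, f i \is d.-homog) ->
  exists2 F : {mpoly A[n]}, F \is d.-homog & forall i, fiber i F = f i.
Proof.
move=> hf; pose c (u : 'X_{1..n}) : A := fun i => (f i)@_u.
exists (\sum_(u : 'X_{1..n < d.+1} | mdeg u == d) c u *: 'X_[u]).
  by apply: rpred_sum => u du; apply: rpredZ; rewrite dhomogX.
move=> i; apply/mpolyP => v; rewrite /fiber rmorph_sum raddf_sum /=.
under eq_bigr => u _ do rewrite map_mpolyZ map_mpolyX mcoeffZ mcoeffX.
have [dv|dv] := eqVneq (mdeg v) d; last first.
  rewrite big1 => [|u du]; last first.
    by case: eqP => [E|]; [move: dv; rewrite -E du|rewrite mulr0].
  apply/esym/memN_msupp_eq0; apply: contra_neqN dv => vs; exact: (dhomog_mf (hf i) vs : mdeg v = d).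
have lt : (mdeg v < d.+1)%N by rewrite dv.
rewrite (bigD1 (BMultinom lt)) /= ?dv // eqxx mulr1 big1 ?addr0 // => u /andP[_ ne].
case: eqP => [E|]; last by rewrite mulr0.
by case/eqP: ne; apply: val_inj.
Qed.

Lemma limit_neq0 n (F : {mpoly A[n]}) : limit F != 0 <-> U (fun i => fiber i F != 0).
Proof.
split=> [/eqP n0|h].
  have : U (fun i => ~ fiber i F = 0) by apply/large_not => /limit_eq0.
  by apply: large_sub => i /eqP.
by apply/eqP => /limit_eq0; apply/large_not; apply: large_sub h => i /eqP; exact.
Qed.

Lemma limit_irreducible n d (F : {mpoly A[n]}) : F \is d.-homog ->
  irreducible_elt (limit F) <-> U (fun i => irreducible_elt (fiber i F)).
Proof.
move=> hF; have hL : limit F \is d.-homog by exact: map_homog.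
have hK i : fiber i F \is d.-homog by exact: map_homog.
rewrite (irreducible_form hL).
have red : (exists2 e, (e < d)%N & exists g h : {mpoly L[n]},
    [/\ (0 < e)%N, g \is e.-homog, h \is (d - e).-homog & limit F = g * h]) <->
    U (fun i => exists2 e, (e < d)%N & exists g h : {mpoly K[n]},
    [/\ (0 < e)%N, g \is e.-homog, h \is (d - e).-homog & fiber i F = g * h]).
  split=> [[e ed [g [h [e0 hg hh E]]]]|/large_bounded[e ed he]].
    have : limit F = limit (lift_poly g * lift_poly h) by rewrite E limitM !lift_polyK.
    move/limit_eq; apply: large_sub => i Ei; exists e => //.
    exists (fiber i (lift_poly g)), (fiber i (lift_poly h)).
    by split=> //; [exact: map_homog (lift_poly_homog hg)|exact: map_homog (lift_poly_homog hh)|rewrite Ei fiberM].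
  exists e => //.
  have ch i : exists gh : {mpoly K[n]} * {mpoly K[n]}, [/\ gh.1 \is e.-homog, gh.2 \is (d - e).-homog
     & (exists g h : {mpoly K[n]}, [/\ (0 < e)%N, g \is e.-homog, h \is (d - e).-homog & fiber i F = g * h]) ->
       (0 < e)%N /\ fiber i F = gh.1 * gh.2].
    have [[g [h [e0 hg hh E]]]|no] := classic (exists g h : {mpoly K[n]},
       [/\ (0 < e)%N, g \is e.-homog, h \is (d - e).-homog & fiber i F = g * h]).
      by exists (g, h); split.
    by exists (0, 0); split; rewrite ?dhomog0.
  pose gh i := projT1 (constructive_indefinite_description _ (ch i)).
  have ghP i : [/\ (gh i).1 \is e.-homog, (gh i).2 \is (d - e).-homog
     & (exists g h : {mpoly K[n]}, [/\ (0 < e)%N, g \is e.-homog, h \is (d - e).-homog & fiber i F = g * h]) ->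
       (0 < e)%N /\ fiber i F = (gh i).1 * (gh i).2] := projT2 (constructive_indefinite_description _ (ch i)).
  have h1 i : (gh i).1 \is e.-homog by case: (ghP i).
  have h2 i : (gh i).2 \is (d - e).-homog by case: (ghP i).
  have [G hG GE] := family_form h1; have [H hH HE] := family_form h2.
  have e0 : (0 < e)%N.
    rewrite lt0n; apply/eqP => z; apply: (not_large_false (large_sub _ he)) => i [g [h [e0 _ _ _]]].
    by move: e0; rewrite z.
  exists (limit G), (limit H); split=> //; [exact: map_homog|exact: map_homog|].
  rewrite -limitM; apply/limit_eq; apply: large_sub he => i ex.
  have [_ _ /(_ ex)[_ E]] := ghP i.
  by rewrite E -(GE i) -(HE i) fiberM.
have nz := limit_neq0 F.
split=> [[n0 d0 nr]|h].
  have nr' := proj2 (large_not U _) (fun x => nr (proj2 red x)).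
  apply: large_sub (large_and (proj1 nz n0) nr') => i [ni ri].
  by apply/(irreducible_form (hK i)).
split.
- by apply/nz; apply: large_sub h => i [].
- rewrite lt0n; apply/eqP => z; apply: (not_large_false (large_sub _ h)) => i.
  by move/(irreducible_form (hK i)) => [_]; rewrite z.
move=> /red hr; apply: (not_large_false (large_sub _ (large_and h hr))) => i [].
by move/(irreducible_form (hK i)) => [].
Qed.

Section Points.
Variables (k : nat) (p : 'I_k.+1 -> A).
Hypothesis pn : forall i, exists j, member i (p j) != 0.

Definition fiber_point i : proj k K := Proj (pn i).

Lemma germ_point_neq0 : exists j, germ U (p j) != 0.
Proof.
have [j h] : exists j, U (fun i => member i (p j) != 0).
  by apply: large_finite; exact: large_true.
exists j; apply/eqP => /germ_eq0; apply/large_not; apply: large_sub h => i /eqP; exact.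
Qed.

Definition limit_point : proj k L := Proj germ_point_neq0.

Lemma limit_eval (F : {mpoly A[k.+1]}) : (limit F).@[limit_point] = 0 <->
  U (fun i => (fiber i F).@[fiber_point i] = 0).
Proof.
rewrite /limit /limit_point /= meval_map germ_eq0.
by split; apply: large_sub => i; rewrite /fiber /fiber_point /= meval_map.
Qed.

End Points.

Lemma family_point k (w : I -> proj k K) : exists2 p : 'I_k.+1 -> A,
  (forall i, exists j, member i (p j) != 0) & forall i j, member i (p j) = w i j.
Proof.
exists (fun j i => w i j) => // i; exact: coords_neq0 (w i).
Qed.

(** Frames chosen at every index assemble to a matrix that is invertible in the limit; by
    [ideal_powP] vanishing then means that finitely many polynomials in the coefficients are
    zero. *)
Lemma limit_vanish (p : 'I_3 -> A) (pn : forall i, exists j, member i (p j) != 0) e (F : {mpoly A[3]}) :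
  vanish (limit_point pn) e (limit F) <-> U (fun i => vanish (fiber_point pn i) e (fiber i F)).
Proof.
have fr i : exists M : 'M[K]_3, M \in unitmx /\ forall j, M ord0 j = fiber_point pn i j.
  by have [M uM ME] := exists_frame (pn i); exists M.
pose Mi i := projT1 (constructive_indefinite_description _ (fr i)).
have MP i : Mi i \in unitmx /\ forall j, Mi i ord0 j = fiber_point pn i j :=
  projT2 (constructive_indefinite_description _ (fr i)).
pose M : 'M[A]_3 := \matrix_(a, b) (fun i => Mi i a b).
have ME i : map_mx (member i) M = Mi i by apply/matrixP => a b; rewrite !mxE.
have uM : map_mx (germ U) M \in unitmx.
  rewrite unitmxE det_map_mx unitfE; apply/eqP => /germ_eq0 h.
  apply: (not_large_false (large_sub _ h)) => i; rewrite -det_map_mx ME => /eqP.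
  by have [u _] := MP i; move: u; rewrite unitmxE unitfE => /negPf ->.
rewrite /vanish (ideal_powP (M := map_mx (germ U) M)) //; last first.
  move=> j; rewrite !mxE /limit_point /=; congr (germ U _); apply: member_ext => i.
  by have [_ E] := MP i; exact: E.
rewrite /ordM ordwP.
have -> : (forall j, (j < e)%N -> (grw (@w01 3) (lsub (map_mx (germ U) M) (limit F)))`_j = 0) <->
   forall j : 'I_e, U (fun i => fiber i ((grw (@w01 3) (lsub M F))`_j) = 0).
  split=> [h j|h j lt].
    by apply/limit_eq0; rewrite /limit map_low map_lsub; exact: h.
  by rewrite /limit -map_lsub -map_low; apply/limit_eq0; exact: (h (Ordinal lt)).
split=> [h|h j].
  apply: large_sub (large_all h) => i hi; have [u E] := MP i.
  rewrite (ideal_powP _ _ u E) /ordM ordwP => j lt; have := hi (Ordinal lt).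
  by rewrite /fiber map_low map_lsub ME.
apply: large_sub h => i; have [u E] := MP i.
rewrite (ideal_powP _ _ u E) /ordM ordwP /fiber map_low map_lsub ME; apply; exact: ltn_ord.
Qed.

Lemma limit_mult (p : 'I_3 -> A) (pn : forall i, exists j, member i (p j) != 0) e (F : {mpoly A[3]}) :
  mult_at (limit_point pn) (limit F) e <-> U (fun i => mult_at (fiber_point pn i) (fiber i F) e).
Proof.
split=> [[h nh]|h].
  have nh' := proj2 (large_not U _) (fun x => nh (proj2 (limit_vanish pn e.+1 F) x)).
  exact: large_and (proj1 (limit_vanish pn e F) h) nh'.
split; first by apply/limit_vanish; apply: large_sub h => i [].
move/limit_vanish; apply/large_not; apply: large_sub h => i [_]; exact.
Qed.


Lemma limit_msub n l (phi : 'I_n -> {mpoly A[l]}) F :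
  limit (msub phi F) = msub (fun j => limit (phi j)) (limit F).
Proof. exact: map_msub. Qed.

Lemma fiber_msub n l i (phi : 'I_n -> {mpoly A[l]}) F :
  fiber i (msub phi F) = msub (fun j => fiber i (phi j)) (fiber i F).
Proof. exact: map_msub. Qed.

Lemma limit_rational (F : {mpoly A[3]}) : rational_curve (limit F) ->
  U (fun i => rational_curve (fiber i F)).
Proof.
move=> [phi [[e he] nz phi0 [e' [A0 [A1 [h0 h1 n01 E]]]]]].
pose Phi j := lift_poly (phi j).
have phiE A : psubst phi (limit A) = limit (msub Phi A).
  by rewrite msub_psubst limit_msub; apply: eq_msub => j; rewrite lift_polyK.
have u1 : U (fun i => msub (fun j => fiber i (Phi j)) (fiber i F) = 0).
  move: phi0; rewrite phiE => /limit_eq0; apply: large_sub => i; by rewrite fiber_msub.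
have u2 : U (fun i => forall w : proj 1 K, exists j, (fiber i (Phi j)).@[w] != 0).
  (* If common zeros existed at almost all indices, chosen ones would form a family of points whose
     limit is a common zero of phi. *)
  case: (large_or_not U (fun i => forall w : proj 1 K, exists j, (fiber i (Phi j)).@[w] != 0)) => // no.
  have ch i : exists w : proj 1 K, ~ (forall w : proj 1 K, exists j, (fiber i (Phi j)).@[w] != 0) ->
      forall j, (fiber i (Phi j)).@[w] = 0.
    have [h|h] := classic (forall w : proj 1 K, exists j, (fiber i (Phi j)).@[w] != 0).
      by have [w _] := @proj1_exists K 1 0 (or_introl (oner_neq0 K)); exists w.
    have [w nw] := not_all_ex_not _ _ h; exists w => _ j; apply/eqP/negPn/negP => z.
    by apply: nw; exists j.
  pose w i := projT1 (constructive_indefinite_description _ (ch i)).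
  have wP i := projT2 (constructive_indefinite_description _ (ch i)).
  have [p pn pE] := family_point w.
  have [j] := nz (limit_point pn); rewrite -(lift_polyK (phi j)) => /eqP[].
  apply/limit_eval; apply: large_sub no => i /(wP i) /(_ j) <-.
  by apply: meval_eq => l; rewrite /= pE.
have u3 : U (fun i => msub (fun j => fiber i (Phi j)) (fiber i (lift_poly A0)) != 0 \/
    msub (fun j => fiber i (Phi j)) (fiber i (lift_poly A1)) != 0).
  by case: n01; rewrite -[X in psubst _ X]lift_polyK phiE => /limit_neq0; apply: large_sub => i;
    rewrite fiber_msub => z; [left|right].
have u4 : U (fun i => msub (fun j => fiber i (Phi j)) (fiber i (lift_poly A0)) * 'X_ord_max =
    msub (fun j => fiber i (Phi j)) (fiber i (lift_poly A1)) * 'X_ord0).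
  have lX l : limit 'X_l = 'X_l :> {mpoly L[2]} by rewrite /limit map_mpolyX.
  have fX i l : fiber i 'X_l = 'X_l :> {mpoly K[2]} by rewrite /fiber map_mpolyX.
  have phiE' A : psubst phi A = limit (msub Phi (lift_poly A)) by rewrite -phiE lift_polyK.
  have : limit (msub Phi (lift_poly A0) * 'X_ord_max) = limit (msub Phi (lift_poly A1) * 'X_ord0).
    by rewrite !limitM !lX -!phiE'.
  move/limit_eq; apply: large_sub => i.
  by rewrite !fiberM !fiber_msub !fX.
apply: large_sub (large_and (large_and u1 u2) (large_and u3 u4)) => i [[p1 p2] [p3 p4]].
exists (fun j => fiber i (Phi j)); split.
- by exists e => j; apply: map_homog; apply: lift_poly_homog.
- exact: p2.
- by rewrite msub_psubst.
exists e', (fiber i (lift_poly A0)), (fiber i (lift_poly A1)); split.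
- by apply: map_homog; apply: lift_poly_homog.
- by apply: map_homog; apply: lift_poly_homog.
- by rewrite !msub_psubst.
- by rewrite !msub_psubst.
Qed.

Section Configurations.
Variables (n : nat) (p : 'I_n -> 'I_3 -> A).
Hypothesis pn : forall l i, exists j, member i (p l j) != 0.

Definition fiber_points i l : proj 2 K := fiber_point (pn l) i.
Definition limit_points l : proj 2 L := limit_point (pn l).

Lemma limit_fat m d (F : {mpoly A[3]}) : F \is d.-homog ->
  fat_ideal_deg limit_points m d (limit F) <-> U (fun i => fat_ideal_deg (fiber_points i) m d (fiber i F)).
Proof.
move=> hF; split=> [[v _]|h].
  have : U (fun i => forall l, vanish (fiber_points i l) (m l) (fiber i F)).
    by apply: large_all => l; apply/limit_vanish; exact: v.
  by apply: large_sub => i vi; split=> //; exact: map_homog.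
split=> [l|]; last exact: map_homog.
by apply/limit_vanish; apply: large_sub h => i [v _]; exact: v.
Qed.

(** The dimension in the fibres is bounded by that of all forms, so it is constant on a large set;
    bases chosen there form families whose limits remain independent. *)
Lemma limit_h0 m d N : U (fun i => (N <= h0 (fiber_points i) m d)%N) -> (N <= h0 limit_points m d)%N.
Proof.
move=> h; have [M ltM hM] : exists2 M, (M < 'C(d + 2, 2).+1)%N &
    U (fun i => (N <= M)%N /\ h0 (fiber_points i) m d = M).
  apply: large_bounded; apply: large_sub h => i Ni; exists (h0 (fiber_points i) m d) => //.
  rewrite ltnS -(hdim_form K 2 d); apply: hdimS.
  - exact: subspace_form.
  - exact: subspace_fat.
  - by move=> x [].
  - exact: fin_dim_form.
have NM : (N <= M)%N.
  by rewrite leqNgt; apply/negP => lt; apply: (not_large_false (large_sub _ hM)) => i []; rewrite leqNgt lt.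
apply: leq_trans NM _.
have ch i : exists e : 'I_M -> {mpoly K[3]}, (forall a, e a \is d.-homog) /\
  (h0 (fiber_points i) m d = M -> (forall a, fat_ideal_deg (fiber_points i) m d (e a)) /\
    forall c : 'I_M -> K, \sum_a c a *: e a = 0 -> forall a, c a = 0).
  have [E|ne] := classic (h0 (fiber_points i) m d = M); last first.
    by exists (fun=> 0); split=> // a; exact: dhomog0.
  have := hdimP (subspace_fat (fiber_points i) m d) (fin_dim_fat (fiber_points i) m d).
  rewrite -/(h0 (fiber_points i) m d) E => -[e [Ie ie _]].
  by exists e; split=> [a|_]; [case: (Ie a)|].
pose e i := projT1 (constructive_indefinite_description _ (ch i)).
have eP i : (forall a, e i a \is d.-homog) /\
  (h0 (fiber_points i) m d = M -> (forall a, fat_ideal_deg (fiber_points i) m d (e i a)) /\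
    forall c : 'I_M -> K, \sum_a c a *: e i a = 0 -> forall a, c a = 0) :=
  projT2 (constructive_indefinite_description _ (ch i)).
have fam a : exists F : {mpoly A[3]}, F \is d.-homog /\ forall i, fiber i F = e i a.
  by have [F hF FE] := @family_form 3 d (fun i => e i a) (fun i => (eP i).1 a); exists F.
pose F a := projT1 (constructive_indefinite_description _ (fam a)).
have FP a : F a \is d.-homog /\ forall i, fiber i (F a) = e i a :=
  projT2 (constructive_indefinite_description _ (fam a)).
apply: (hdim_ge (g := fun a => limit (F a)) (subspace_fat limit_points m d) (fin_dim_fat limit_points m d)).
  move=> a; apply/(limit_fat m (FP a).1); apply: large_sub hM => i [_ E].
  rewrite (FP a).2; exact: ((eP i).2 E).1.
move=> c cz a.
have : limit (\sum_a lift (c a) *: F a) = 0.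
  rewrite -[RHS]cz /limit rmorph_sum; apply: eq_bigr => b _.
  by rewrite /= map_mpolyZ; congr (_ *: _); exact: liftK.
move/limit_eq0 => hz; rewrite -(liftK (c a)); apply/germ_eq0.
apply: large_sub (large_and hM hz) => i [[_ E] z].
apply: (((eP i).2 E).2 (fun a => member i (lift (c a)))).
rewrite -[RHS]z /fiber rmorph_sum; apply: eq_bigr => b _.
by rewrite /= map_mpolyZ -/(fiber i (F b)) (FP b).2.
Qed.

End Configurations.

End Transfer.

(** * From generic to general points *)

Lemma map_mpoly_comp (R S T : comNzRingType) (h : {rmorphism R -> S}) (g : {rmorphism S -> T}) n
  (f : {mpoly R[n]}) : map_mpoly g (map_mpoly h f) = map_mpoly (g \o h) f.
Proof. by apply/mpolyP => u; rewrite !mcoeff_map_mpoly. Qed.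

Lemma meval_map_comp (R S T : comNzRingType) (h : {rmorphism R -> S}) (g : {rmorphism S -> T}) n
  (f : {mpoly R[n]}) (x : 'I_n -> S) :
  (map_mpoly (g \o h : {rmorphism R -> T}) f).@[fun j => g (x j)] = g (map_mpoly h f).@[x].
Proof. by rewrite -meval_map map_mpoly_comp. Qed.

Lemma meval_map_id (R S : comNzRingType) (h : {rmorphism R -> S}) (g : {rmorphism S -> R}) n
  (f : {mpoly R[n]}) (x : 'I_n -> S) : cancel h g -> g (map_mpoly h f).@[x] = f.@[fun j => g (x j)].
Proof.
move=> hg; rewrite -meval_map map_mpoly_comp; congr (_.@[_]).
by apply/mpolyP => u; rewrite mcoeff_map_mpoly /= hg.
Qed.

(** For an effective nef class the given section excludes vanishing of h^0, so H^1 vanishes and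
    interpolation gives [h0 <= chi]; adjunction then completes the numerical data of a negative
    curve. *)
Lemma good_of_SHGH (K : closedFieldType) (n : nat) (P : 'I_n -> proj 2 K) : distinct_points P ->
  (forall (f : {mpoly K[3]}) (k : 'I_n -> nat),
     irreducible_elt f -> f \is (mdegree f).-homog -> (forall i, mult_at (P i) f (k i)) ->
     let C := proper_transform f k in
     intersection C C < 0 ->
     [/\ smooth_transform P f k, rational_curve f & intersection C C = -1]) ->
  (forall F : divisor n, nef P F -> h0_vanishes P F \/ h1_vanishes P F) ->
  forall t, good_curves P t /\ good_nef P t.
Proof.
move=> dP H1 H2; have gn t : good_nef P t.
  move=> m a _ [x Ix x0] pos; have [h0|h1] := H2 _ (nef_of_curves pos).
    by case: (h0_not_vanishes Ix x0 h0).
  apply: (h0_le_chi dP (interpolates_of_h1 dP h1)) => i.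
  exact: leq_trans (vanish_le_deg Ix.2 x0 (Ix.1 i)) (leqnSn a).
move=> t; split; last exact: gn.
move=> f d k fi hf _ fk neg; have f0 : f != 0 by case: fi.
have dE := mdegree_homog f0 hf; have hf' : f \is (mdegree f).-homog by rewrite dE.
have := H1 f k fi hf' fk; rewrite /proper_transform /intersection /= dE.
move=> /(_ neg)[sm rat sq]; split=> //; have [phi nphi] := rat.
exact: (adjunction dP fi hf fk nphi sq gn sm).
Qed.

(** * Nonempty open sets of configurations *)

Section ZariskiOpen.
Variables (n : nat) (K : closedFieldType).
Local Notation config := ('I_n -> proj 2 K).
Local Notation R := {mpoly K[n * 3]}.

Lemma eval_points_var (P : config) i j : eval_points 'X_(mxvec_index i j) P = P i j.
Proof. by rewrite /eval_points mevalXU mxvecE mxE. Qed.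

Lemma eval_pointsM (G H : R) (P : config) : eval_points (G * H) P = eval_points G P * eval_points H P.
Proof. exact: mevalM. Qed.

Lemma eval_pointsB (G H : R) (P : config) : eval_points (G - H) P = eval_points G P - eval_points H P.
Proof. exact: mevalB. Qed.

Lemma eval_points1 (P : config) : eval_points 1 P = 1.
Proof. exact: meval1. Qed.

Lemma multihomogM (G H : R) : multihomog G -> multihomog H -> multihomog (G * H).
Proof.
move=> [e he] [e' he']; exists (fun i => e i + e' i)%N => u /msuppM_le/allpairsP[[u1 u2] /= [s1 s2 ->]] i.
by under eq_bigr => j _ do rewrite mnmDE; rewrite big_split /= he // he'.
Qed.

Lemma multihomog1 : multihomog (1 : R).
Proof.
exists (fun=> 0%N) => u; rewrite msupp1 inE => /eqP -> i.
by apply: big1 => j _; rewrite mnm0E.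
Qed.

Definition nonempty_open (G : R) := multihomog G /\ exists Q : config, eval_points G Q != 0.

Lemma config_of_nonvanishing (v : 'I_(n * 3) -> K) : (forall i, v (mxvec_index i ord0) != 0) ->
  exists P : config, forall G : R, eval_points G P = G.@[v].
Proof.
move=> h; have nz i : exists j, v (mxvec_index i j) != 0 by exists ord0.
exists (fun i => Proj (nz i)) => G; apply: meval_eq => l.
by case/mxvec_indexP: l => i j; rewrite mxvecE mxE.
Qed.

(** Irreducibility of the space of configurations. The extra factors X_(i,0) ensure that a point
    where the product is nonzero defines points of the plane. *)
Lemma nonempty_openM G H : nonempty_open G -> nonempty_open H -> nonempty_open (G * H).
Proof.
move=> [hG [Q GQ]] [hH [Q' HQ']]; split; first exact: multihomogM.
have nzp (F : R) (P : config) : eval_points F P != 0 -> F != 0.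
  by apply: contraNneq => ->; rewrite /eval_points meval0.
have [|v] := @mpoly_nonvanish K _ (G * H * \prod_i 'X_(mxvec_index i ord0)).
  rewrite !mulf_neq0 ?(nzp _ _ GQ) ?(nzp _ _ HQ') //; apply/prodf_neq0 => i _.
  by rewrite -msize_poly_eq0 msizeX.
rewrite mevalM mulf_eq0 negb_or rmorph_prod => /andP[GHv /prodf_neq0 vn].
have [P PE] : exists P : config, forall G : R, eval_points G P = G.@[v].
  by apply: config_of_nonvanishing => i; have := vn i isT; rewrite /= mevalXU.
by exists P; rewrite PE.
Qed.

Lemma nonempty_open1 : nonempty_open 1.
Proof.
split; first exact: multihomog1.
have [P _] := @config_of_nonvanishing (fun=> 1) (fun=> oner_neq0 K).
by exists P; rewrite eval_points1 oner_neq0.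
Qed.

Lemma mxvec_index_eq m l (i i' : 'I_m) (j j' : 'I_l) :
  (mxvec_index i j == mxvec_index i' j') = (i == i') && (j == j').
Proof.
apply/eqP/andP => [E|[/eqP -> /eqP ->] //].
by have [-> ->] : (i, j) = (i', j') by apply/enum_rank_inj/(@cast_ord_inj _ _ (mxvec_cast m l)).
Qed.

(** One 2 by 2 minor of the coordinates is enough: where it is nonzero the two points differ. *)
Lemma nonempty_open_minor (i j : 'I_n) : i != j -> nonempty_open
  ('X_(mxvec_index i ord0) * 'X_(mxvec_index j j1) - 'X_(mxvec_index i j1) * 'X_(mxvec_index j ord0)).
Proof.
move=> ij; split.
  have one (s : 'I_n) (a : 'I_3) l :
      (\sum_(c < 3) (U_(mxvec_index s a) : 'X_{1..(n * 3)})%MM (mxvec_index l c) = (s == l))%N.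
    under eq_bigr => c _ do rewrite mnm1E mxvec_index_eq.
    rewrite (bigD1 a) //= eqxx andbT big1 ?addn0 // => c /negPf ca.
    by rewrite (eq_sym a) ca andbF.
  have mono (a b : 'I_3) u : u \in msupp ('X_(mxvec_index i a) * 'X_(mxvec_index j b) : R) -> forall l,
      (\sum_(c < 3) u (mxvec_index l c))%N = ((i == l) + (j == l))%N.
    rewrite -mpolyXD msuppX inE => /eqP -> l.
    by under eq_bigr => c _ do rewrite mnmDE; rewrite big_split /= !one.
  exists (fun l => (i == l) + (j == l))%N => u /msuppB_le; rewrite mem_cat => /orP[]; exact: mono.
have std (a : 'I_3) : exists q : proj 2 K, forall l, q l = (l == a)%:R.
  have ex : exists l : 'I_3, (l == a)%:R != 0 :> K by exists a; rewrite eqxx oner_neq0.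
  by exists (Proj ex).
have [q0 q0E] := std ord0; have [q1 q1E] := std j1.
exists (fun l => if l == i then q0 else q1).
rewrite eval_pointsB !eval_pointsM !eval_points_var eqxx (eq_sym j i) (negPf ij) !q0E !q1E /=.
by rewrite mulr1 mul0r subr0 oner_neq0.
Qed.

End ZariskiOpen.

(** * From the tautological configuration to almost all configurations *)

Section Spreading.
Variables (K : closedFieldType) (n t : nat).
Local Notation config := ('I_n -> proj 2 K).

Definition good (P : config) := [/\ distinct_points P, good_curves P t & good_nef P t].

Lemma nonvanishing_config : exists P : config, True.
Proof. by have [_ [P _]] := nonempty_open1 n K; exists P. Qed.

Let P0 := projT1 (constructive_indefinite_description _ nonvanishing_config).
Variable U : ultrafilter config.
Hypothesis open_large : forall G : {mpoly K[n * 3]}, nonempty_open G -> U (fun P => eval_points G P != 0).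
Local Notation A := (family K P0).
Local Notation L := (ultraproduct P0 K U).

Let p (l : 'I_n) (j : 'I_3) : A := fun P => P l j.
Let pn l (P : config) : exists j, member P (p l j) != 0.
Proof. exact: coords_neq0 (P l). Qed.

Let fiber_pointsE (P : config) : fiber_points pn P = P.
Proof.
apply: functional_extensionality => l; rewrite /fiber_points /fiber_point.
move: (pn l P); rewrite /member /p; case: (P l) => c h h'.
by rewrite (proof_irrelevance _ h h').
Qed.

Let Q := limit_points U pn.

(** The value of a polynomial with constant coefficients at the tautological configuration is the
    germ of its values at all configurations, nonzero on a large set. *)
Lemma generic_config : generic_points (germ U \o @const _ P0 K : {rmorphism K -> L}) Q.
Proof.
move=> G hG nG; have GU := open_large (conj hG nG).
pose a (l : 'I_(n * 3)) : A := fun P => mxvec (\matrix_(i < n, j < 3) P i j) 0 l.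
have E := meval_map_comp (@const _ P0 K) (germ U) G a.
have aE l : germ U (a l) = mxvec (\matrix_(i < n, j < 3) Q i j) 0 l.
  case/mxvec_indexP: l => i j; rewrite mxvecE mxE /Q /limit_points /=.
  by congr (germ U _); apply: member_ext => P; rewrite /member /a mxvecE mxE.
apply/eqP => z.
have /germ_eq0 : germ U (map_mpoly (@const _ P0 K) G).@[a] = 0.
  by rewrite -E -[RHS]z; apply: meval_eq => l; exact: aE.
apply/large_not; apply: large_sub GU => P.
rewrite (@meval_map_id _ _ (@const _ P0 K) (member P)) //.
by move=> /eqP.
Qed.

Lemma distinct_large : U (fun P => distinct_points P).
Proof.
have h : forall ij : 'I_n * 'I_n, U (fun P => ij.1 != ij.2 -> ~ proportional (P ij.1) (P ij.2)).
  move=> [i j] /=; have [->|ij] := eqVneq i j; first by apply: large_true.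
  apply: large_sub (open_large (nonempty_open_minor K ij)) => P; rewrite eval_pointsB !eval_pointsM !eval_points_var.
  by move=> /eqP nz _ [c cE]; apply: nz; rewrite !cE; ring.
by apply: large_sub (large_all h) => P hP i j; exact: (hP (i, j)).
Qed.

Lemma distinct_limit : distinct_points Q.
Proof.
move=> i j ij [c cE].
have h : U (fun P => forall l, member P (p i l - lift c * p j l) = 0).
  apply: large_all => l; apply/germ_eq0; rewrite rmorphB rmorphM /= liftK.
  by have := cE l; rewrite /Q /limit_points /= => ->; rewrite subrr.
apply: (not_large_false (large_sub _ (large_and distinct_large h))) => P [dP hP].
apply: (dP i j ij); exists (member P (lift c)) => l.
by have /eqP := hP l; rewrite rmorphB rmorphM subr_eq0 => /eqP.
Qed.

Hypothesis good_limit : forall s, good_curves Q s /\ good_nef Q s.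

(** Otherwise almost every configuration carries a bad curve, on a large set with the same degree
    and multiplicities. The equations form a family whose limit is a negative curve on Q, rational
    by hypothesis; rationality then descends to the fibres. *)
Lemma good_curves_large : U (fun P => good_curves P t).
Proof.
case: (large_or_not U (fun P => good_curves P t)) => // no.
pose bad d (k : 'I_n -> nat) (f : {mpoly K[3]}) (P : config) := [/\ irreducible_elt f, f \is d.-homog,
  forall i, mult_at (P i) f (k i), inter d k d k < 0
  & ~ [/\ inter d k d k = -1, 3 * d%:Z - \sum_i (k i)%:Z = 1 & rational_curve f]].
(* Multiplicities are at most the degree, hence at most t, so the numerical types form a finite
   set. *)
have [d dt hd] : exists2 d, (d < t.+1)%N & U (fun P => exists ka : {ffun 'I_n -> 'I_t.+1}, exists f,
    bad d (fun i => ka i : nat) f P).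
  apply: large_bounded; apply: large_sub no => P nP; apply: NNPP => nb; apply: nP.
  move=> f d k fi hf dt fk neg; apply: NNPP => nc; apply: nb; exists d => //.
  have kt i : (k i < t.+1)%N.
    by rewrite ltnS; apply: leq_trans dt; apply: vanish_le_deg hf _ (fk i).1; case: fi.
  exists [ffun i => Ordinal (kt i)], f.
  rewrite (_ : (fun i => _) = k) //; apply: functional_extensionality => i; by rewrite ffunE.
have [ka {}hd] := large_finite hd; set k := fun i => ka i : nat in hd.
have ch P : exists f, f \is d.-homog /\ ((exists f, bad d k f P) -> bad d k f P).
  have [[f fb]|nb] := classic (exists f, bad d k f P); first by exists f; split=> //; case: fb.
  by exists 0; split; [exact: dhomog0|].
pose f P := projT1 (constructive_indefinite_description _ (ch P)).
have fP P : f P \is d.-homog /\ ((exists f, bad d k f P) -> bad d k (f P) P) :=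
  projT2 (constructive_indefinite_description _ (ch P)).
have [F hF FE] := @family_form config P0 K 3 d f (fun P => (fP P).1).
have {}hd : U (fun P => bad d k (fiber P F) P).
  by apply: large_sub hd => P ex; rewrite FE; exact: (fP P).2.
have Fi : irreducible_elt (limit U F).
  by apply/limit_irreducible; [exact: hF|apply: large_sub hd => P []].
have Fk i : mult_at (Q i) (limit U F) (k i).
  by apply/limit_mult; apply: large_sub hd => P [_ _ h _ _]; have := h i; rewrite -{1}(fiber_pointsE P).
have neg : inter d k d k < 0.
  by apply/negPn/negP => nn; apply: (not_large_false (large_sub _ hd)) => P [_ _ _ h _]; case/negP: nn.
have [h1 h2 h3] := (good_limit d).1 _ _ _ Fi (map_homog (germ U) hF) (leqnn d) Fk neg.
case: (not_large_false (large_sub _ (large_and hd (limit_rational h3)))) => P [[_ _ _ _ nb] rat].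
by apply: nb.
Qed.

(** A bad class of constant type on a large set stays effective and nef in the limit, so there
    [h0 <= chi]; but h^0 of the limit is at least that of almost all fibres. *)
Lemma good_nef_large : U (fun P => good_nef P t).
Proof.
case: (large_or_not U (fun P => good_nef P t)) => // no.
pose bad a (m : 'I_n -> nat) (x : {mpoly K[3]}) (P : config) := [/\ fat_ideal_deg P m a x, x != 0,
  forall (g : {mpoly K[3]}) e k, irreducible_elt g -> g \is e.-homog -> (forall i, mult_at (P i) g (k i)) ->
     0 <= inter a m e k
  & ~ ((h0 P m a)%:Z <= chi m a)].
have [a at' ha] : exists2 a, (a < t.+1)%N & U (fun P => exists mu : {ffun 'I_n -> 'I_t.+1}, exists x,
    bad a (fun i => mu i : nat) x P).
  apply: large_bounded; apply: large_sub no => P nP; apply: NNPP => nb; apply: nP.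
  move=> m a at' [x Ix x0] pos; apply: NNPP => nc; apply: nb; exists a => //.
  have mt i : (m i < t.+1)%N.
    by rewrite ltnS; apply: leq_trans at'; exact: vanish_le_deg Ix.2 x0 (Ix.1 i).
  exists [ffun i => Ordinal (mt i)], x.
  rewrite (_ : (fun i => _) = m) //; apply: functional_extensionality => i; by rewrite ffunE.
have [mu {}ha] := large_finite ha; set m := fun i => mu i : nat in ha.
have ch P : exists f, f \is (a).-homog /\ ((exists f, bad a m f P) -> bad a m f P).
  have [[f fb]|nb] := classic (exists f, bad a m f P); first by exists f; split=> //; case: fb => -[].
  by exists 0; split; [exact: dhomog0|].
pose f P := projT1 (constructive_indefinite_description _ (ch P)).
have fP P : f P \is (a).-homog /\ ((exists f, bad a m f P) -> bad a m (f P) P) :=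
  projT2 (constructive_indefinite_description _ (ch P)).
have [F hF FE] := @family_form config P0 K 3 a f (fun P => (fP P).1).
have {}ha : U (fun P => bad a m (fiber P F) P).
  by apply: large_sub ha => P ex; rewrite FE; exact: (fP P).2.
have hQ : (h0 Q m a)%:Z <= chi m a.
  apply: ((good_limit a).2 _ _ (leqnn a)).
    exists (limit U F); last by apply/limit_neq0; apply: large_sub ha => P [_ h _ _]; exact: h.
    apply/(limit_fat U pn m hF); apply: large_sub ha => P [Ix _ _ _]; rewrite fiber_pointsE.
    exact: Ix.
  (* Nefness in the limit: a curve on Q spreads to irreducible curves with the same degree and
     multiplicities in almost all fibres, where the class is nonnegative. *)
  move=> g e k gi hg gk; pose G : {mpoly A[3]} := lift_poly g.
  have GE : limit U G = g := lift_polyK g.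
  have hG : G \is e.-homog := lift_poly_homog hg.
  have u1 : U (fun P => irreducible_elt (fiber P G)) by apply/(limit_irreducible U hG); rewrite GE.
  have u2 : U (fun P => forall i, mult_at (P i) (fiber P G) (k i)).
    apply: large_all => i; have := gk i; rewrite -GE => /limit_mult.
    apply: large_sub => P h; have E : fiber_point (pn i) P = P i := congr1 (fun q => q i) (fiber_pointsE P).
    by rewrite -E.
  apply/negPn/negP => nn; apply: (not_large_false (large_sub _ (large_and ha (large_and u1 u2)))).
  move=> P [[_ _ pos _] [i1 i2]]; case/negP: nn; apply: pos i1 _ i2; exact: map_homog.
have := @limit_h0 config P0 K U n p pn m a (h0 Q m a).+1.
rewrite ltnn => H; suff: false by []; apply: H; apply: large_sub ha => P [_ _ _ /negP nle].
rewrite fiber_pointsE -ltz_nat; apply: Order.POrderTheory.le_lt_trans hQ _.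
by rewrite Order.TotalTheory.ltNge.
Qed.

End Spreading.

Lemma good_open (K : closedFieldType) (n t : nat) : SHGH K ->
  exists2 G : {mpoly K[n * 3]}, nonempty_open G & forall P, eval_points G P != 0 -> good t P.
Proof.
move=> hS; apply: NNPP => no.
have bad (G : {mpoly K[n * 3]}) : nonempty_open G -> exists P, eval_points G P != 0 /\ ~ good t P.
  move=> hG; apply: NNPP => nb; apply: no; exists G => // P GP; apply: NNPP => ng.
  by apply: nb; exists P.
(* The sets containing all bad configurations of some nonempty open set; the filter is proper
   exactly because no open set is free of them. *)
pose F (Q : ('I_n -> proj 2 K) -> Prop) := exists2 G : {mpoly K[n * 3]}, nonempty_open G &
  forall P, eval_points G P != 0 -> ~ good t P -> Q P.
have [||||U FU] := @ultrafilter_exists _ F.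
- by exists 1 => //; exact: nonempty_open1.
- move=> Q Q' [G hG GQ] [G' hG' GQ']; exists (G * G'); first exact: nonempty_openM.
  by move=> P; rewrite eval_pointsM mulf_eq0 negb_or => /andP[h h'] ng; split; [exact: GQ|exact: GQ'].
- by move=> Q Q' QQ' [G hG GQ]; exists G => // P h ng; apply: QQ'; exact: GQ.
- by move=> [G /bad[P [GP ng]] h]; exact: h P GP ng.
have open_large (G : {mpoly K[n * 3]}) : nonempty_open G -> U (fun P => eval_points G P != 0).
  by move=> hG; apply: FU; exists G.
have [H1 H2] := hS _ _ _ _ (generic_config open_large).
have gl := good_of_SHGH (distinct_limit open_large) H1 H2.
have ng : U (fun P => ~ good t P) by apply: FU; exists 1 => //; exact: nonempty_open1.
have g1 := distinct_large open_large; have g2 := good_curves_large t gl; have g3 := good_nef_large t gl.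
case: (not_large_false (large_sub _ (large_and (large_and g1 g2) (large_and g3 ng)))) => P [[d c] [e]].
by apply.
Qed.

Theorem theorem1p2p1 (K : closedFieldType) (n : nat) (m : 'I_n -> nat) (t : nat)
    (hSHGH : SHGH K) :
  exists U : ('I_n -> proj 2 K) -> Prop,
    [/\ zariski_open U,
        exists P, U P &
        forall P : 'I_n -> proj 2 K, U P ->
        forall alpha : nat, is_alpha P m alpha -> (alpha < t)%N ->
        forall (r : nat) (f : 'I_r -> {mpoly K[3]}) (c c' c'' : 'I_r -> nat),
          (forall j, irreducible_elt (f j)) ->
          (forall i j, i != j -> ~ associate (f i) (f j)) ->
          (forall j, (0 < c j)%N) ->
          is_gamma P m t.-1 (\prod_j f j ^+ c j) ->
          is_gamma P m t (\prod_j f j ^+ c' j) ->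
          is_gamma P m t.+1 (\prod_j f j ^+ c'' j) ->
          (forall j, (c'' j <= c' j <= c j)%N) ->
          (forall j, exists a b, splitting_type (f j) a b) /\
          (forall a b : 'I_r -> nat,
             (forall j, splitting_type (f j) (a j) (b j)) ->
             exists N : nat, dim_cok_mu P m t N /\
               N%:Z <= \sum_j (mdegree (f j))%:Z * ((c' j)%:Z - (c'' j)%:Z)
                       - \sum_j binom2 ((c' j)%:Z - (c'' j)%:Z)
                       + \sum_j (binom2 ((c j)%:Z - (c' j)%:Z - (a j)%:Z)
                               + binom2 ((c j)%:Z - (c' j)%:Z - (b j)%:Z)))].
Proof.
have [G [hG nG] gG] := good_open n t hSHGH.
exists (fun P => eval_points G P != 0); split=> // [|P /gG[dP gc gn]]; last exact: good_points_bound.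
exists (fun H => H = G); split=> [_ ->//|P]; split=> [h|[_ -> //]]; by exists G.
Qed.
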